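(* Consider the multi-scale ensemble Kalman sampler model on $\mathbb R^n\times\mathbb R^n$ $$dX^\varepsilon_t=\big(-\mathrm{Cov}(\mathscr L_{Y^\varepsilon_t})X^\varepsilon_t+Y^\varepsilon_t\big)dt+\sqrt\varepsilon\Big(\sqrt{\mathrm{Cov}(\mathscr L_{X^\varepsilon_t})}+\sqrt{\mathrm{Cov}(\mathscr L_{Y^\varepsilon_t})}\Big)dW^1_t,$$ $$dY^\varepsilon_t=\tfrac1\delta\big(-2Y^\varepsilon_t-|Y^\varepsilon_t|^2Y^\varepsilon_t-\mathrm{Cov}(\mathscr L_{X^\varepsilon_t})Y^\varepsilon_t\big)dt+\tfrac1{\sqrt\delta}\sqrt{\mathrm{Cov}(\mathscr L_{Y^\varepsilon_t})}\,dW^2_t.$$ There exists $\kappa\ge2$ such that the following hold. (1) For all $\mathscr F_0$-measurable initial values $X_0^\varepsilon=\xi$, $Y^\varepsilon_0=\zeta$ in $L^p$ with $p>\kappa$ and every $T>0$ there is a constant $C_T$ independent of $\varepsilon,\delta\in(0,1)$ with $$\mathbb E\Big[\sup_{t\in[0,T]}|X^\varepsilon_t-\bar X_t|^2\Big]\le C_T(\varepsilon+\delta^{1/3}),$$ where $\bar X$ is the solution of the corresponding averaged equation with $\bar X_0=\xi$. (2) If moreover $\delta=\delta(\varepsilon)=o(\varepsilon)$ as $\varepsilon\to0$, then for deterministic initial values $X^\varepsilon_0=x$, $Y^\varepsilon_0=y$, the family $\{X^\varepsilon\}_{\varepsilon\in(0,1)}$ satisfies the large deviation principle on $C([0,T];\mathbb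 R^n)$.
   Context: $W^1,W^2$ are independent $n$-dimensional Brownian motions; $\mathscr L_X$ is the law of $X$; $\varepsilon,\delta\in(0,1)$. For a probability measure $\mu$ on $\mathbb R^n$, $m(\mu)=\int x\,\mu(dx)$ and $\mathrm{Cov}(\mu)=\int(x-m(\mu))\otimes(x-m(\mu))\,\mu(dx)$; $\sqrt{\cdot}$ is the positive semidefinite square root. Averaged equation: for a probability measure $\mu$ on $\mathbb R^n$ with sufficiently many finite moments, $\nu^\mu$ denotes the unique invariant probability measure of the frozen McKean--Vlasov equation $dY_t=(-2Y_t-|Y_t|^2Y_t-\mathrm{Cov}(\mu)Y_t)dt+\sqrt{\mathrm{Cov}(\mathscr L_{Y_t})}\,dB_t$ ($B$ an $n$-dimensional Brownian motion). With $\bar b(x,\mu)=-\mathrm{Cov}(\nu^\mu)x+\int z\,\nu^\mu(dz)$, the averaged equation is $\frac{d\bar X_t}{dt}=\bar b(\bar X_t,\mathscr L_{\bar X_t})$. LDP: $\{X^\varepsilon\}$ satisfies the LDP on a Polish space $\mathcal E$ if there is a lower semicontinuous $I:\mathcal E\to[0,\infty]$ (rate function) with $\liminf_{\varepsilon\to0}\varepsilon\log\mathbb P(X^\varepsilon\in G)\ge-\inf_GI$ for open $G$ and $\limsup_{\varepsilon\to0}\varepsilon\log\mathbb P(X^\varepsilon\in F)\le-\inf_FI$ for closed $F$. *)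

(* Defs.v *)
From HB Require Import structures.
From mathcomp Require Import all_boot all_order all_algebra.
From mathcomp Require Import all_classical all_reals all_analysis.

Set Implicit Arguments.
Unset Strict Implicit.
Unset Printing Implicit Defensive.

Import Order.TTheory GRing.Theory Num.Theory.
Import numFieldNormedType.Exports.

Local Open Scope classical_set_scope.
Local Open Scope ring_scope.

Section matrices.
Context {R : realType}.

(* Squared Euclidean norm of a vector, squared Hilbert-Schmidt norm of a
   matrix (the library norm on matrices is the sup norm). *)
Definition sqnorm m k (A : 'M[R]_(m, k)) : R := \sum_i \sum_j A i j ^+ 2.

Definition psdmx n (A : 'M[R]_n) : Prop :=
  A^T = A /\ forall x : 'cV[R]_n, 0 <= (x^T *m A *m x) 0 0.

(* The positive semidefinite square root; the default value 0 is only taken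
   when A is not positive semidefinite. *)
Definition sqrtmx n (A : 'M[R]_n) : 'M[R]_n :=
  xget 0 [set B | psdmx B /\ B *m B = A].

(* Matrices with the sigma-algebra generated by the entries, which is the
   Borel one. *)
Definition mx_cylinders m k : set (set 'M[R]_(m, k)) :=
  [set A | exists i j (B : set R),
     measurable B /\ A = [set M : 'M[R]_(m, k) | B (M i j)]].

Definition Mx m k : measurableType _ :=
  g_sigma_algebraType (@mx_cylinders m k).

End matrices.

Notation Rn R n := (@Mx R n 1).

Section laws.
Context {R : realType} {n : nat}.
Local Open Scope ereal_scope.

(* Measures are taken as bare set functions so that these apply directly to
   the law pushforward P X of a random vector. *)
Definition mean (mu : set (Rn R n) -> \bar R) : 'cV[R]_n :=
  \col_i fine (\int[mu]_x ((x : 'cV[R]_n) i 0%R)%:E).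

Definition Cov (mu : set (Rn R n) -> \bar R) : 'M[R]_n :=
  \matrix_(i, j) fine (\int[mu]_x
    (((x : 'cV[R]_n) i 0%R - mean mu i 0%R) *
     ((x : 'cV[R]_n) j 0%R - mean mu j 0%R))%R%:E).

Definition law {d} {Om : measurableType d} (P : probability Om R)
    (X : Om -> 'cV[R]_n) : set (Rn R n) -> \bar R :=
  pushforward P (X : Om -> Rn R n).

Definition eq_law (mu nu : set (Rn R n) -> \bar R) : Prop :=
  forall A : set (Rn R n), measurable A -> mu A = nu A.

End laws.

Section processes.
Context {R : realType} {d : measure_display} {Om : measurableType d}.
Variables (P : probability Om R) (F : R -> set (set Om)).

(* Processes are indexed by R; only times t >= 0 are meaningful. *)

Definition filtration : Prop :=
  [/\ forall t, 0 <= t -> sigma_algebra [set: Om] (F t),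
      forall t, 0 <= t -> F t `<=` measurable
    & forall s t, 0 <= s -> s <= t -> F s `<=` F t].

Definition mx_measurable m k (G : set (set Om)) (X : Om -> 'M[R]_(m, k)) :=
  forall A : set (Mx m k), measurable A -> G (X @^-1` A).

Definition adapted m k (X : R -> Om -> 'M[R]_(m, k)) : Prop :=
  forall t, 0 <= t -> mx_measurable (F t) (X t).

Definition continuous_paths n (X : R -> Om -> 'cV[R]_n) : Prop :=
  forall w, {within `[0, +oo[, continuous (fun t => X t w)}.

(* F-Brownian motion: the increments over [s, t] are independent of F_s with
   law N(0, (t - s) Id). *)
Definition brownian n (W : R -> Om -> 'cV[R]_n) : Prop :=
  [/\ adapted W, continuous_paths W, {ae P, forall w, W 0 w = 0}
    & forall s t, 0 <= s -> s < t ->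
      forall (A : set Om) (B : 'I_n -> set R),
      F s A -> (forall i, measurable (B i)) ->
      (P (A `&` [set w | forall i, B i ((W t w - W s w) i 0)%R]) =
       P A * \prod_(i < n) normal_prob 0%R (Num.sqrt (t - s)) (B i))%E].

Definition generated n (W : R -> Om -> 'cV[R]_n) : set (set Om) :=
  <<s [set A | exists t (B : set (Rn R n)),
         [/\ 0 <= t, measurable B & A = W t @^-1` B]] >>.

Definition independent_processes n (V W : R -> Om -> 'cV[R]_n) : Prop :=
  forall A B, generated V A -> generated W B -> P (A `&` B) = (P A * P B)%E.

Definition locally_L2 n (X : R -> Om -> 'cV[R]_n) : Prop :=
  forall T : R, exists M : R, forall t, 0 <= t <= T ->
    (\int[P]_w (sqnorm (X t w))%:E <= M%:E)%E.

(* Simple process: sum over k < sp_size of sp_val k times the indicator of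
   ]sp_time k, sp_time k.+1]. *)
Record simple_process n := SimpleProcess {
  sp_size : nat;
  sp_time : nat -> R;
  sp_val : nat -> Om -> 'M[R]_n }.

Definition is_simple n (S : simple_process n) : Prop :=
  [/\ 0 <= sp_time S 0,
      {homo sp_time S : i j / (i <= j)%N >-> i <= j},
      forall k, mx_measurable (F (sp_time S k)) (sp_val S k)
    & exists M : R, forall k w, sqnorm (sp_val S k w) <= M].

Definition sp_eval n (S : simple_process n) (s : R) (w : Om) : 'M[R]_n :=
  \sum_(k < sp_size S)
    (if sp_time S k < s <= sp_time S k.+1 then sp_val S k w else 0).

Definition sp_integral n (S : simple_process n) (W : R -> Om -> 'cV[R]_n)
    (t : R) (w : Om) : 'cV[R]_n :=
  \sum_(k < sp_size S) sp_val S k w *m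
    (W (Num.min (sp_time S k.+1) t) w - W (Num.min (sp_time S k) t) w).

(* I_t is the Ito integral of H over [0, t] with respect to W, for every t:
   the L^2 limit of integrals of simple processes converging to H in
   L^2([0, t] x Om). *)
Definition ito_integral n (W : R -> Om -> 'cV[R]_n) (H : R -> Om -> 'M[R]_n)
    (I : R -> Om -> 'cV[R]_n) : Prop :=
  [/\ forall i j, measurable_fun [set p : measurableTypeR R * Om | 0 <= p.1]
        (fun p => H p.1 p.2 i j),
      forall t, 0 <= t -> mx_measurable measurable (I t)
    & exists2 S : nat -> simple_process n, forall k, is_simple (S k) &
      forall t, 0 <= t ->
        ((\int[lebesgue_measure]_(s in `[0%R, t])
            \int[P]_w (sqnorm (sp_eval (S k) s w - H s w))%:E)%E
           @[k --> \oo] --> 0%E) /\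
        ((\int[P]_w (sqnorm (sp_integral (S k) W t w - I t w))%:E)%E
           @[k --> \oo] --> 0%E)].

Definition time_integral n (b : R -> Om -> 'cV[R]_n) (t : R) (w : Om) :
    'cV[R]_n :=
  \col_i \int[lebesgue_measure]_(s in `[0%R, t]) b s w i 0.

Definition drift_integrable n (b : R -> Om -> 'cV[R]_n) : Prop :=
  {ae P, forall w, forall (t : R) i, 0 <= t ->
    lebesgue_measure.-integrable `[0%R, t] (fun s => (b s w i 0)%:E)}.

(* X is a continuous adapted process with dX = b dt + H dW. *)
Definition ito_process n (W X b : R -> Om -> 'cV[R]_n)
    (H : R -> Om -> 'M[R]_n) : Prop :=
  [/\ adapted X, continuous_paths X, drift_integrable b
    & exists2 I, ito_integral W H I &
      forall t, 0 <= t ->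
        {ae P, forall w, X t w = X 0 w + time_integral b t w + I t w}].

Definition slow_fast_solution n (W1 W2 : R -> Om -> 'cV[R]_n) (eps delta : R)
    (xi zeta : Om -> 'cV[R]_n) (X Y : R -> Om -> 'cV[R]_n) : Prop :=
  let CX t := Cov (law P (X t)) in
  let CY t := Cov (law P (Y t)) in
  [/\ locally_L2 X /\ locally_L2 Y,
      {ae P, forall w, X 0 w = xi w} /\ {ae P, forall w, Y 0 w = zeta w},
      ito_process W1 X
        (fun t w => - (CY t *m X t w) + Y t w)
        (fun t _ => Num.sqrt eps *: (sqrtmx (CX t) + sqrtmx (CY t)))
    & ito_process W2 Y
        (fun t w => delta^-1 *:
           (- 2 *: Y t w - sqnorm (Y t w) *: Y t w - CX t *m Y t w))
        (fun t _ => (Num.sqrt delta)^-1 *: sqrtmx (CY t))].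

Definition frozen_solution n (mu : set (Rn R n) -> \bar R)
    (B Y : R -> Om -> 'cV[R]_n) : Prop :=
  [/\ filtration, brownian B, locally_L2 Y
    & ito_process B Y
        (fun t w => - 2 *: Y t w - sqnorm (Y t w) *: Y t w - Cov mu *m Y t w)
        (fun t _ => sqrtmx (Cov (law P (Y t))))].

End processes.

(* Solutions of the frozen equation started from the law nu exist, and each of
   them has law nu at all times. *)
Definition invariant_measure (R : realType) n (mu : set (Rn R n) -> \bar R)
    (nu : probability (Rn R n) R) : Prop :=
  (exists (d : measure_display) (Om : measurableType d) (P : probability Om R)
      (F : R -> set (set Om)) (B Y : R -> Om -> 'cV[R]_n),
    frozen_solution P F mu B Y /\ eq_law (law P (Y 0)) nu) /\
  (forall (d : measure_display) (Om : measurableType d) (P : probability Om R)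
      (F : R -> set (set Om)) (B Y : R -> Om -> 'cV[R]_n),
    frozen_solution P F mu B Y -> eq_law (law P (Y 0)) nu ->
    forall t, 0 <= t -> eq_law (law P (Y t)) nu).

Definition unique_invariant_measure (R : realType) n
    (mu : set (Rn R n) -> \bar R) (nu : probability (Rn R n) R) : Prop :=
  invariant_measure mu nu /\
  forall nu' : probability (Rn R n) R,
    invariant_measure mu nu' -> eq_law nu' nu.

Section averaged_and_ldp.
Context {R : realType} {d : measure_display} {Om : measurableType d}.
Variable P : probability Om R.

(* nu t plays the part of the measure denoted nu^mu for mu the law of X t. *)
Definition averaged_solution (F : R -> set (set Om)) n (xi : Om -> 'cV[R]_n)
    (X : R -> Om -> 'cV[R]_n) : Prop :=
  [/\ adapted F X, continuous_paths X, locally_L2 P X,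
      {ae P, forall w, X 0 w = xi w}
    & exists nu : R -> probability (Rn R n) R,
      let b t w := - (Cov (nu t) *m X t w) + mean (nu t) in
      [/\ forall t, 0 <= t -> unique_invariant_measure (law P (X t)) (nu t),
          drift_integrable P b
        & forall t, 0 <= t ->
            {ae P, forall w, X t w = X 0 w + time_integral b t w}]].

Definition Lp_vector n (p : R) (xi : Om -> 'cV[R]_n) : Prop :=
  (\int[P]_w (Num.sqrt (sqnorm (xi w)) `^ p)%:E < +oo)%E.

Definition LDP (E : topologicalType) (X : R -> Om -> E) : Prop :=
  exists I : E -> \bar R,
    [/\ forall f, (0 <= I f)%E,
        lower_semicontinuous I,
        forall G : set E, open G ->
          (- ereal_inf (I @` G) <=
           limf_einf (fun e : R => e%:E * lne (P (X e @^-1` G))) 0^'+)%E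
      & forall G : set E, closed G ->
          (limf_esup (fun e : R => e%:E * lne (P (X e @^-1` G))) 0^'+ <=
           - ereal_inf (I @` G))%E].

End averaged_and_ldp.

Section path_space.
Import ArrowAsUniformType.

(* C([0, T]; R^n) with the topology of uniform convergence. *)
Definition path_space (R : realType) (n : nat) (T : R) : topologicalType :=
  continuousType (set_type `[0%R, T]) 'cV[R]_n.

Definition path_at (R : realType) (n : nat) (T : R) (f : path_space n T)
    (t : set_type `[0%R, T]) : 'cV[R]_n :=
  (f : continuousType (set_type `[0%R, T]) 'cV[R]_n) t.

End path_space.

(* Main.v *)
(* The diffusion coefficient of the fast equation vanishes at Dirac masses. With
   f(t) = E|Y_t|^2, the inequality |sqrt(Cov)|^2 = tr Cov <= f gives
   f' <= (-4 + 1) f / delta. So delta_0 is the only invariant measure of the frozen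
   equation, the averaged drift is 0 and Xbar = xi for all times.

   (1) Integrating, the time integral of f over [0, T] is at most delta * f(0), hence
   the drift of X contributes O(delta) to the mean square displacement and the noise
   O(eps) (Gronwall and Doob). Since delta <= delta^(1/3), kappa = 2 will do.

   (2) If X starts at x, then tr Cov(X_u) <= E|X_u - x|^2 = O(eps + delta), so the
   noise is subgaussian with variance eps * O(eps + delta), while the time integral of
   |Y| exceeds a fixed level with probability exp(-const / delta). As delta = o(eps),
   the path stays near the constant path x up to probabilities exp(-M / eps) for every
   M: the rate function is 0 at this path and +oo elsewhere.

   Ito's formula and the quadratic variation are avoided as follows. The Ito integral
   of a deterministic integrand is subgaussian conditionally on the past, as one sees
   by passing to the limit in simple processes. For a convex psi, this bounds
   E[U psi(Y_s + M_t - M_s)], where M = Y - Y_0 - (integral of b); convexity turns it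
   into a bound for psi(Y_t) weighted by exp(- integral of <grad log psi(Y), b>), first
   along a partition and then in the limit by Fatou's lemma. Taking
   psi = 1 + al |y|^2 with al -> 0 gives the energy inequality, and
   psi = 1 + sum_j cosh(la y_j) exponential moments of the time integral of |Y|. *)

Require Import Defs.
From HB Require Import structures.
From mathcomp Require Import all_boot all_order all_algebra.
From mathcomp Require Import all_classical all_reals all_analysis.
From mathcomp Require Import measurable_realfun.
From mathcomp Require Import ring lra.

Set Implicit Arguments.
Unset Strict Implicit.
Unset Printing Implicit Defensive.

Import Order.TTheory GRing.Theory Num.Theory.
Import numFieldNormedType.Exports HBSimple HBNNSimple.

Local Open Scope classical_set_scope.
Local Open Scope ring_scope.

(** * Integrals of real functions *)

(** The noise coefficients depend on the laws alone, which is why the stochastic integrals have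
    deterministic integrands. An Ito integral is known only at each fixed time, up to a null set, as
    an L^2 limit; adaptedness and path regularity of the noise are therefore read off from the
    process minus the time integral of its drift.

    Upper bounds on conditional exponential moments are what survives the L^2 limit. They hold for
    both signs of theta, and letting theta tend to 0 forces conditional mean zero: this yields
    second moment bounds without loss in the constant and the submartingale property behind Doob's
    inequality.

    The cubic drift is the other obstacle, since no fourth moment of Y is at hand. The drift is
    handled path by path, where continuity makes it bounded, and expectations are taken of
    nonnegative quantities only. The 1 in psi permits division by psi, and it drops out when the
    inequality is divided by al.

    Exponential moments of Y demand a small Cov(X) in the drift; a deterministic start provides
    this, Cov(X_u) being of the order of the squared deviation of X_u from x. *)

Ltac mf := first [ assumption | match goal with H : _ |- _ => exact (H _) end | exact: measurable_cst | exact: measurable_id |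
  lazymatch goal with
  | |- measurable_fun _ (fun x => EFin (@?f x)) => apply/measurable_EFinP; mf
  | |- measurable_fun _ (fun x => GRing.add (@?f x) (@?g x)) =>
      apply: (@measurable_funD _ _ _ _ f g); mf
  | |- measurable_fun _ (fun x => GRing.mul (@?f x) (@?g x)) =>
      apply: (@measurable_funM _ _ _ _ f g); mf
  | |- measurable_fun _ (fun x => GRing.opp (@?f x)) =>
      apply: (@measurable_funN _ _ _ _ f); mf
  | |- measurable_fun _ (fun x => GRing.exp (@?f x) ?n) =>
      apply: (@measurable_funX _ _ _ _ f n); mf
  | |- measurable_fun _ (fun x => expR (@?f x)) =>
      apply: (measurableT_comp (@measurable_expR _) (g := f)); mf
  | |- measurable_fun _ (fun x => Num.norm (@?f x)) =>
      apply: (measurableT_comp (@normr_measurable _ setT) (g := f)); mf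
  | |- measurable_fun _ (fun x => \sum_(i <- _) (@?f i x)) =>
      apply: measurable_sum => ?; mf
  | |- measurable_fun _ (fun x => \1_ _ _) => apply: measurable_indic => //
  | |- measurable_fun _ (\1_ _) => apply: measurable_indic => //
  | |- _ => idtac
  end ].

Ltac pos := first [ done | assumption | apply: sqr_ge0 | apply: expR_ge0 |
  lazymatch goal with
  | |- forall _, _ => move=> ?; pos
  | |- is_true (Order.le _ (GRing.mul _ _)) => apply: mulr_ge0; pos
  | |- is_true (Order.le _ (GRing.add _ _)) => apply: addr_ge0; pos
  | |- is_true (Order.le _ (GRing.inv _)) => rewrite invr_ge0; pos
  | |- is_true (Order.le _ (GRing.exp _ _)) => apply: exprn_ge0; pos
  | |- is_true (Order.le _ (bigop _ _ _)) => apply: sumr_ge0 => ? _; pos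
  | |- is_true (Order.le _ (fine _)) => apply: fine_ge0 => //
  | |- is_true (Order.le _ (Num.norm _)) => apply: normr_ge0
  | |- is_true (Order.le _ (Num.sqrt _)) => apply: sqrtr_ge0
  | |- is_true (Order.le _ (\1_ _ _)) => rewrite indicE; apply: ler0n
  | |- is_true (Order.le _ _) => first [ apply: ltW; assumption |
      match goal with H : _ |- _ => solve [apply: H] end ]
  | |- _ => idtac
  end ].

Lemma cvg_sumr (R : realType) (T : Type) (F : set_system T) {FF : Filter F}
    (I : Type) (r : seq I) (f : I -> T -> R) (l : I -> R) :
  (forall i, f i x @[x --> F] --> l i) ->
  \sum_(i <- r) f i x @[x --> F] --> \sum_(i <- r) l i.
Proof.
move=> h; elim: r => [|i r IH].
  by rewrite big_nil; under eq_cvg do rewrite big_nil; exact: cvg_cst.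
by rewrite big_cons; under eq_cvg do rewrite big_cons; apply: cvgD.
Qed.

Lemma cvge0_le (R : realType) (u : nat -> \bar R) (e : R) :
  u k @[k --> \oo] --> 0%E -> 0 < e -> \forall k \near \oo, (u k <= e%:E)%E.
Proof.
move=> /fine_cvgP[fin /cvgrPdist_le cv] e0.
apply: filterS2 fin (cv e e0) => k /fineK <- /=.
by rewrite sub0r normrN lee_fin; exact: le_trans (ler_norm _).
Qed.

Lemma ge0_cvge0 (R : realType) (u : nat -> \bar R) :
  (forall k, (0 <= u k)%E) ->
  (forall e : R, 0 < e -> \forall k \near \oo, (u k <= e%:E)%E) ->
  u k @[k --> \oo] --> 0%E.
Proof.
move=> u0 h; have fin (e : R) : 0 < e -> \forall k \near \oo, u k \is a fin_num.
  by move=> e0; apply: filterS (h e e0) => k /le_lt_trans/(_ (ltry _)) ?; rewrite ge0_fin_numE.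
apply/fine_cvgP; split; first exact: (fin 1 ltr01).
apply/cvgrPdist_le => e e0; apply: filterS2 (fin e e0) (h e e0) => k fk.
by rewrite sub0r normrN ger0_norm ?fine_ge0// -{1}(fineK fk) lee_fin.
Qed.

Section nonneg_integrals.
Context {d : measure_display} {T : measurableType d} {R : realType}.
Variable mu : {measure set T -> \bar R}.
Implicit Types f g : T -> R.

Lemma integral_EFin_ge0 f : (forall x, 0 <= f x) -> (0 <= \int[mu]_x (f x)%:E)%E.
Proof. by move=> f0; apply: integral_ge0 => x _; rewrite lee_fin. Qed.

Lemma integral_EFin_le f g : measurable_fun setT f -> measurable_fun setT g ->
  (forall x, 0 <= f x) -> (forall x, f x <= g x) ->
  (\int[mu]_x (f x)%:E <= \int[mu]_x (g x)%:E)%E.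
Proof.
move=> mfn mg f0 fg; apply: ge0_le_integral => //; try by mf.
- by move=> x _; rewrite lee_fin.
- by move=> x _; rewrite lee_fin.
Qed.

Lemma integral_EFin_ae_le f g : measurable_fun setT f -> measurable_fun setT g ->
  (forall x, 0 <= f x) -> (forall x, 0 <= g x) ->
  {ae mu, forall x, f x <= g x} ->
  (\int[mu]_x (f x)%:E <= \int[mu]_x (g x)%:E)%E.
Proof.
move=> mfn mg f0 g0 fg; apply: ae_ge0_le_integral => //; try by mf.
- by move=> x _; rewrite lee_fin.
- by move=> x _; rewrite lee_fin.
- by apply: filterS fg => x h _; rewrite lee_fin.
Qed.

Lemma integral_EFinD f g : measurable_fun setT f -> measurable_fun setT g ->
  (forall x, 0 <= f x) -> (forall x, 0 <= g x) ->
  (\int[mu]_x (f x + g x)%:E = \int[mu]_x (f x)%:E + \int[mu]_x (g x)%:E)%E.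
Proof.
move=> mfn mg f0 g0.
under eq_integral do rewrite EFinD.
by apply: ge0_integralD => //; try (by mf); move=> x _; rewrite lee_fin.
Qed.

Lemma integral_EFinZ (c : R) f : measurable_fun setT f -> 0 <= c ->
  (forall x, 0 <= f x) ->
  (\int[mu]_x (c * f x)%:E = c%:E * \int[mu]_x (f x)%:E)%E.
Proof.
move=> mfn c0 f0.
under eq_integral do rewrite EFinM.
by apply: ge0_integralZl_EFin => //; try (by mf); move=> x _; rewrite lee_fin.
Qed.

Lemma integral_EFin_sum (I : Type) (s : seq I) (f : I -> T -> R) :
  (forall i, measurable_fun setT (f i)) -> (forall i x, 0 <= f i x) ->
  (\int[mu]_x (\sum_(i <- s) f i x)%:E = \sum_(i <- s) \int[mu]_x (f i x)%:E)%E.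
Proof.
move=> mfn f0; rewrite -ge0_integral_sum//.
- by apply: eq_integral => x _; rewrite sumEFin.
- by move=> i; mf.
- by move=> i x _; rewrite lee_fin.
Qed.

(** The eventual bound [f x - e <= fk k x] says that f is at most the lower limit of [fk], which is
    what Fatou's lemma uses; the e in the integral bound lets asymptotic estimates be inserted
    directly. *)
Lemma fatou_EFin (fk : nat -> T -> R) f (C : \bar R) :
  (forall k, measurable_fun setT (fk k)) -> measurable_fun setT f ->
  (forall k x, 0 <= fk k x) -> (forall x, 0 <= f x) ->
  (forall x e, 0 < e -> \forall k \near \oo, f x - e <= fk k x) ->
  (forall e, 0 < e ->
     \forall k \near \oo, (\int[mu]_x (fk k x)%:E <= C + e%:E)%E) ->
  (\int[mu]_x (f x)%:E <= C)%E.
Proof.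
move=> mfk mfn fk0 f0 lim bnd; apply/lee_addgt0Pr => e e0.
have le_einf (u : (\bar R)^nat) (l : \bar R) :
    (\forall k \near \oo, (l <= u k)%E) -> (l <= limn_einf u)%E.
  move=> [N _ hN]; rewrite limn_einf_lim.
  apply: (@le_trans _ _ (einfs u N)).
    by apply: le_ereal_inf_tmp => _ [k /= Nk <-]; exact: hN.
  apply: lime_ge; first exact: is_cvg_einfs.
  by exists N => // k Nk; exact: nondecreasing_einfs.
have einf_le (u : (\bar R)^nat) (l : \bar R) :
    (\forall k \near \oo, (u k <= l)%E) -> (limn_einf u <= l)%E.
  move=> [N _ hN]; rewrite limn_einf_lim; apply: lime_le.
    exact: is_cvg_einfs.
  exists N => // k Nk; apply: (@le_trans _ _ (u k)); last exact: hN.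
  by apply: ereal_inf_lbound; exists k => //=.
apply: (@le_trans _ _ (\int[mu]_x limn_einf (fun k => (fk k x)%:E)))%E; last first.
  apply: le_trans (fatou _ _ _ _) _ => //.
  - by move=> k; mf.
  - by move=> k x _; rewrite lee_fin.
  - by apply: einf_le; exact: bnd.
apply: ge0_le_integral => //.
- by move=> x _; rewrite lee_fin.
- by mf.
(* The lower limit is measurable as minus the upper limit of the negatives. *)
- have -> : (fun x => limn_einf (fun k => (fk k x)%:E)) =
      (fun x => - limn_esup (fun k => - (fk k x)%:E))%E.
    apply/funext => x; rewrite -limn_einfN; congr limn_einf.
    by apply/funext => k; rewrite /comp oppeK.
  apply: (measurableT_comp (@oppe_measurable _ setT)).
  apply: measurable_fun_limn_esup => k.
  by apply: (measurableT_comp (@oppe_measurable _ setT)); mf.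
- move=> x _; apply/lee_addgt0Pr => r r0; rewrite -leeBlDr//; apply: le_einf.
  by apply: filterS (lim x _ r0) => k; rewrite -EFinB lee_fin.
Qed.

Lemma fatou_EFin_le (fk : nat -> T -> R) f (C : \bar R) :
  (forall k, measurable_fun setT (fk k)) -> measurable_fun setT f ->
  (forall k x, 0 <= fk k x) -> (forall x, 0 <= f x) ->
  (forall x e, 0 < e -> \forall k \near \oo, f x - e <= fk k x) ->
  (forall k, (\int[mu]_x (fk k x)%:E <= C)%E) ->
  (\int[mu]_x (f x)%:E <= C)%E.
Proof.
move=> mfk mfn fk0 f0 lim bnd; apply: (fatou_EFin mfk) => // e e0.
by apply: nearW => k; apply: le_trans (bnd k) _; rewrite leeDl// lee_fin ltW.
Qed.

End nonneg_integrals.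

(** * Comparison of weighted image measures *)

Section image_measure_bound.
Context {d d' : measure_display} {T : measurableType d} {T' : measurableType d'}.
Context {R : realType}.
Variables (mu : {measure set T -> \bar R}) (nu : {measure set T' -> \bar R}).

(** The hypothesis says that the image under V of the measure g mu is dominated by h nu on sets;
    linearity extends this to simple functions and approximation from below to nonnegative f. It
    serves with h constant, to pass from events to conditional weights, and with h a multiple of a
    normal density. *)
Lemma image_measure_le (V : T -> T') (g : T -> R) (h : T' -> R) :
  measurable_fun setT V -> measurable_fun setT g -> (forall w, 0 <= g w) ->
  measurable_fun setT h -> (forall x, 0 <= h x) ->
  (forall B, measurable B ->
     (\int[mu]_w (g w * \1_B (V w))%:E <= \int[nu]_x (h x * \1_B x)%:E)%E) ->
  forall f : T' -> R, measurable_fun setT f -> (forall w, 0 <= f w) ->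
  (\int[mu]_w (g w * f (V w))%:E <= \int[nu]_x (h x * f x)%:E)%E.
Proof.
move=> mV mg g0 mh h0 H f mfn f0.
have mEf : measurable_fun [set: T'] (fun w => (f w)%:E) by mf.
pose phi (k : nat) : T' -> R := nnsfun_approx measurableT mEf k.
have phi0 k x : 0 <= phi k x by exact: fun_ge0.
have phi_le k w : phi k w <= f w.
  have nd : nondecreasing_seq (fun k => (phi k w)%:E).
    move=> a b ab; rewrite lee_fin.
    exact/lefP/nd_nnsfun_approx.
  have cv : ((phi k w)%:E @[k --> \oo] --> (f w)%:E)%E.
    by apply: (@cvg_nnsfun_approx _ _ _ _ measurableT) => // x _; rewrite lee_fin.
  rewrite -lee_fin -(cvg_lim _ cv)//.
  apply: lime_ge; first by apply/cvg_ex; exists (f w)%:E.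
  by exists k => // j kj; exact: nd.
have mphi k : measurable_fun setT (phi k) by exact: measurable_funPT.
have mphiV k : measurable_fun setT (fun w => phi k (V w)).
  exact: (measurableT_comp (mphi k) mV).
apply: (fatou_EFin_le (fk := fun k w => g w * phi k (V w))).
- by move=> k; mf.
- by mf; exact: (measurableT_comp mfn mV).
- by pos.
- by pos.
- move=> w e e0.
  have cv : phi k (V w) @[k --> \oo] --> f (V w).
    have /fine_cvgP[_] : (phi k (V w))%:E @[k --> \oo] --> (f (V w))%:E.
      by apply: (@cvg_nnsfun_approx _ _ _ _ measurableT) => // x _; rewrite lee_fin.
    by [].
  have : g w * phi k (V w) @[k --> \oo] --> g w * f (V w) by apply: cvgMr.
  by move=> /cvgrPdist_le /(_ e e0); apply: filterS => k /ler_normlP[_]; lra.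
- move=> k.
  (* Level sets of [phi k]. Writing |y| for the value y changes nothing on the range and makes every
     term of the sum nonnegative. *)
  pose A y : set T' := phi k @^-1` [set y].
  have phiE x : phi k x =
      \sum_(y <- finmap.enum_fset (fset_set (range (phi k)))) `|y| * \1_(A y) x.
    rewrite {1}/phi fimfunE fsbig_finite//; apply: eq_bigr => y _.
    rewrite !indicE; case: (boolP (x \in _)); rewrite ?mulr0// => /set_mem /= <-.
    by rewrite ger0_norm.
  apply: (@le_trans _ _ (\int[nu]_x (h x * phi k x)%:E)%E); last first.
    by apply: integral_EFin_le => //; [mf|mf|pos|move=> x; rewrite ler_wpM2l].
  have mA y : measurable (A y) by exact: measurable_sfunP.
  have mAV y : measurable_fun setT (fun w => \1_(A y) (V w) : R).
    exact: (measurableT_comp (@measurable_indic _ _ _ setT _ (mA y)) mV).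
  under eq_integral do rewrite phiE mulr_sumr.
  under [leRHS]eq_integral do rewrite phiE mulr_sumr.
  rewrite integral_EFin_sum; [|by move=> y; mf|by pos].
  rewrite integral_EFin_sum; [|by move=> y; mf|by pos].
  apply: lee_sum => y _.
  under eq_integral do rewrite mulrCA.
  under [leRHS]eq_integral do rewrite mulrCA.
  rewrite integral_EFinZ//; [|by mf|by pos].
  rewrite integral_EFinZ//; [|by mf|by pos].
  by apply: lee_pmul => //; [apply: integral_EFin_ge0; pos|exact: H].
Qed.

End image_measure_bound.

Notation SA G := (g_sigma_algebraType G).
Notation gfun G U := (measurable_fun [set: SA G] (U : SA G -> _)).

(** * Inequalities conditional on a sub-sigma-algebra *)

Section sub_sigma_algebras.
Context {d : measure_display} {Om : measurableType d} {R : realType}.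
Variables (P : probability Om R) (G : set (set Om)).
Hypothesis Gm : G `<=` measurable.
Implicit Types (U g m : Om -> R).

Lemma SA_measurable (A : set Om) : measurable (A : set (SA G)) -> measurable A.
Proof.
apply: (@smallest_sub _ (sigma_algebra [set: Om])) => //.
exact: sigma_algebra_measurable.
Qed.

Lemma gfun_measurable U : gfun G U -> measurable_fun setT U.
Proof.
by move=> mU _ B mB; apply: SA_measurable; exact: mU.
Qed.

(** The identity, viewed as a map into Om with the sigma-algebra generated by G, pushes P forward to
    its restriction; [image_measure_le] then extends the inequality from events to nonnegative
    weights. *)
Lemma cond_le g (c : R) : measurable_fun setT g -> (forall w, 0 <= g w) ->
  0 <= c ->
  (forall A, measurable (A : set (SA G)) ->
     (\int[P]_w (\1_A w * g w)%:E <= c%:E * P A)%E) ->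
  forall U, gfun G U -> (forall w, 0 <= U w) ->
  (\int[P]_w (U w * g w)%:E <= c%:E * \int[P]_w (U w)%:E)%E.
Proof.
move=> mg g0 c0 H U mU U0.
pose J (w : Om) : SA G := w.
have mJ : measurable_fun [set: Om] J.
  by move=> _ B mB; rewrite setTI; exact: SA_measurable.
have := @image_measure_le _ _ _ _ _ P (pushforward P J) J g (cst c) mJ mg g0.
move=> /(_ mJ (measurable_cst _) (fun=> c0) _ _ mU U0).
rewrite (integral_EFinZ _ mU)// ge0_integral_pushforward//; last 2 first.
- by mf.
- by move=> y _; rewrite lee_fin.
under eq_integral do rewrite mulrC.
apply => B mB.
rewrite (integral_EFinZ _ (f := \1_B))// integral_indic//.
by under eq_integral do rewrite mulrC; rewrite setIT; exact: H.
Qed.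

End sub_sigma_algebras.

Section exponential_bounds.
Context {R : realType}.
Implicit Types x y : R.

Lemma expR_ge_quadratic x : 0 <= x -> 1 + x + x ^+ 2 / 2 <= expR x.
Proof.
move=> x0; have -> : 1 + x + x ^+ 2 / 2 = series (exp_coeff x) 3.
  rewrite /series /= !big_nat_recr//= big_nil /exp_coeff /=.
  by rewrite expr0 expr1 !fact0 factS /= add0r divr1 divr1.
apply: nondecreasing_cvgn_le; last exact: is_cvg_series_exp_coeff.
apply/nondecreasing_seqP => n; rewrite /series /= big_nat_recr//= lerDl.
by rewrite /exp_coeff /= divr_ge0// exprn_ge0.
Qed.

(** With y = x/2 the left side is 2 + (2 y)^2 and the right side is 2 + (e^y - e^(-y))^2. So it
    suffices that 2 y <= e^y - e^(-y) for y >= 0, which follows from the quadratic lower bound of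
    e^y. *)
Lemma expRD_expRN_ge x : 2 + x ^+ 2 <= expR x + expR (- x).
Proof.
wlog x0 : x / 0 <= x.
  move=> H; case: (leP 0 x) => [/H//|x0].
  by have := H (- x); rewrite oppr_ge0 sqrrN opprK [expR _ + _]addrC => /(_ (ltW x0)).
pose y := x / 2; have y0 : 0 <= y by rewrite divr_ge0.
have ey := expR_ge_quadratic y0.
have -> : expR x = expR y ^+ 2 by rewrite -expRM_natl; congr expR; rewrite /y; field.
have -> : expR (- x) = (expR y)^-1 ^+ 2.
  by rewrite -expRN -expRM_natl; congr expR; rewrite /y; field.
set E := expR y in ey *.
have E0 : 0 < E by exact: expR_gt0.
have xE : x = 2 * y by rewrite /y; field.
have EE : E * E^-1 = 1 by rewrite divff// gt_eqF.
have key : 2 * y <= E - E^-1.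
  have : 2 * y * E + 1 <= E ^+ 2 by nra.
  by move=> h; rewrite -(ler_pM2r E0) mulrBl mulVf ?gt_eqF//; nra.
have -> : 2 + x ^+ 2 = 2 + (2 * y) ^+ 2 by rewrite xE.
have -> : E ^+ 2 + E^-1 ^+ 2 = (E - E^-1) ^+ 2 + 2 by nra.
have : (2 * y) ^+ 2 <= (E - E^-1) ^+ 2 by rewrite ler_sqr ?nnegrE//; lra.
lra.
Qed.

Lemma expR_le_inv x : x < 1 -> expR x <= (1 - x)^-1.
Proof.
move=> x1; rewrite -[x in expR x]opprK expRN lef_pV2 ?posrE ?expR_gt0//; last lra.
by have := expR_ge1Dx (- x).
Qed.

Lemma expR_le_1D2x x : 0 <= x -> x <= 2^-1 -> expR x <= 1 + 2 * x.
Proof.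
move=> x0 x1; apply: le_trans (expR_le_inv _) _; first lra.
by rewrite -[leLHS]mul1r ler_pdivrMr; nra.
Qed.

End exponential_bounds.

(** * Conditional subgaussianity and Ito integrals *)

Section subgaussian.
Context {d : measure_display} {Om : measurableType d} {R : realType}.
Variables (P : probability Om R) (G : set (set Om)).
Implicit Types (U m : Om -> R) (v : R).

(* Testing on the events of [G] makes this a bound on the conditional exponential
   moments given [G], without conditional expectations. *)
Definition subgaussian m v := forall theta A, measurable (A : set (SA G)) ->
  (\int[P]_w (\1_A w * expR (theta * m w))%:E
     <= (expR (theta ^+ 2 * v / 2))%:E * P A)%E.

Hypothesis Gm : G `<=` measurable.
Variables (m : Om -> R) (v : R).
Hypotheses (mm : measurable_fun setT m) (v0 : 0 <= v) (sg : subgaussian m v).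

Lemma subgaussian_exp U theta : gfun G U -> (forall w, 0 <= U w) ->
  (\int[P]_w (U w * expR (theta * m w))%:E
     <= (expR (theta ^+ 2 * v / 2))%:E * \int[P]_w (U w)%:E)%E.
Proof.
move=> mU U0; apply: (cond_le Gm) => //; first by mf.
by move=> A mA; exact: sg.
Qed.

(** Plays the part of Jensen's inequality given G. From e^z >= 1 + z at two points, s e^y + e^(-s y)
    >= 1 + s with y = theta m. Subgaussianity bounds the second exponential by 1 + O(s^2) in mean,
    so dividing by s and letting s tend to 0 leaves E[U] <= E[U e^y]. *)
Lemma subgaussian_exp_ge U theta (a : R) : gfun G U -> (forall w, 0 <= U w) ->
  (\int[P]_w (U w)%:E = a%:E)%E ->
  (a%:E <= \int[P]_w (U w * expR (theta * m w))%:E)%E.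
Proof.
move=> mU U0 Ua; have mU' := gfun_measurable Gm mU.
have a0 : 0 <= a by rewrite -lee_fin -Ua; exact: integral_EFin_ge0.
set I := (\int[P]_w _)%E.
have I0 : (0 <= I)%E by apply: integral_EFin_ge0 => w; rewrite mulr_ge0// expR_ge0.
move: I0; case IE : I => [r| |] I0; rewrite ?leey//.
rewrite lee_fin; pose c := theta ^+ 2 * v / 2.
have c0 : 0 <= c by rewrite /c; pos.
have key (s : R) : 0 < s -> (1 + s) * a <= s * r + expR (s ^+ 2 * c) * a.
  move=> s0; rewrite -lee_fin.
  have h := subgaussian_exp (- s * theta) mU U0.
  have e1 : (\int[P]_w ((1 + s) * U w)%:E = ((1 + s) * a)%:E)%E.
    by rewrite integral_EFinZ// ?Ua//; lra.
  rewrite -e1.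
  apply: (@le_trans _ _ (\int[P]_w (s * (U w * expR (theta * m w)) + U w * expR (- s * theta * m w))%:E)%E).
    apply: integral_EFin_le => //; try by mf.
      by move=> w; rewrite mulr_ge0//; lra.
    move=> w; have := expR_ge1Dx (theta * m w).
    have := expR_ge1Dx (- s * theta * m w); have := U0 w.
    rewrite -[- s * theta * m w]mulrA; move: (theta * m w) => y.
    move=> u0 h2 h3; rewrite [leLHS]mulrC.
    have -> : s * (U w * expR y) + U w * expR (- s * y) =
        U w * (s * expR y + expR (- s * y)) by ring.
    by rewrite ler_wpM2l//; nra.
  rewrite integral_EFinD//; try (by mf); last 2 first.
  - by pos.
  - by pos.
  rewrite integral_EFinZ//; [|by mf|exact: ltW|by pos].
  rewrite -/I IE -EFinM [leRHS]EFinD leeD// (le_trans h)// Ua -EFinM lee_fin.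
  by apply: ler_wpM2r => //; rewrite ler_expR /c; lra.
apply/ler_addgt0Pr => e e0.
(* The choice s <= e / D makes the error 2 s c a at most e, and s <= 1 / (2 D) gives s^2 c <= 1/2,
   as [expR_le_1D2x] requires. *)
pose D := 2 * c * a + 2 * c + 1.
have D0 : 0 < D by rewrite /D; nra.
pose s := Num.min 1 (Num.min (e / D) ((2 * D)^-1)).
have s0 : 0 < s by rewrite /s !lt_min ltr01 divr_gt0//= invr_gt0; nra.
have s1 : s <= 1 by rewrite /s ge_min lexx.
have s2 : s * D <= e.
  by rewrite -ler_pdivlMr// /s !ge_min lexx orbT.
have s3 : s * (2 * D) <= 1.
  by rewrite -ler_pdivlMr ?div1r ?/s ?ge_min ?lexx ?orbT//; nra.
have ss : s ^+ 2 * c <= 2^-1.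
  have : s ^+ 2 <= s by rewrite expr2; nra.
  have : s * c <= 2^-1 by rewrite /D in s3; nra.
  move=> ? ?; nra.
have := key s s0; have := expR_le_1D2x (mulr_ge0 (sqr_ge0 s) c0) ss.
move: (expR _) => E hE hk.
have : s * a <= s * (r + s * (2 * c * a)) by nra.
rewrite ler_pM2l// => h; apply: le_trans h _; rewrite lerD2l.
by apply: le_trans s2; apply: ler_wpM2l; [exact: ltW|rewrite /D; lra].
Qed.

(** Adding the bounds at s and -s and comparing with 2 + (s m)^2 <= e^(s m) + e^(-s m), the terms 2
    a of order zero cancel as s tends to 0; the order s^2 gives the variance v with constant 1. *)
Lemma subgaussian_sqr U (a : R) : gfun G U -> (forall w, 0 <= U w) ->
  (\int[P]_w (U w)%:E = a%:E)%E ->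
  (\int[P]_w (U w * m w ^+ 2)%:E <= (v * a)%:E)%E.
Proof.
move=> mU U0 Ua; have mU' := gfun_measurable Gm mU.
have a0 : 0 <= a by rewrite -lee_fin -Ua; exact: integral_EFin_ge0.
set I := (\int[P]_w _)%E.
have I0 : (0 <= I)%E by apply: integral_EFin_ge0 => w; rewrite mulr_ge0// sqr_ge0.
have key (s : R) : 0 < s -> ((s ^+ 2)%:E * I + (2 * a)%:E <=
    (2 * expR (s ^+ 2 * v / 2) * a)%:E)%E.
  move=> s0; have h1 := subgaussian_exp s mU U0.
  have h2 := subgaussian_exp (- s) mU U0.
  have e1 : (\int[P]_w (s ^+ 2 * (U w * m w ^+ 2) + 2 * U w)%:E =
      (s ^+ 2)%:E * I + (2 * a)%:E)%E.
    rewrite integral_EFinD//; try (by mf); last 2 first.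
    - by pos.
    - by pos.
    rewrite integral_EFinZ ?sqr_ge0//; [|by mf|by pos].
    by rewrite integral_EFinZ// Ua.
  rewrite -e1.
  apply: (@le_trans _ _ (\int[P]_w (U w * expR (s * m w) + U w * expR (- s * m w))%:E)%E).
    apply: integral_EFin_le => //; try by mf.
      by pos.
    move=> w; have := expRD_expRN_ge (s * m w); rewrite -mulNr exprMn.
    have := U0 w; move: (expR _) (expR _) => E1 E2 ? ?; nra.
  rewrite integral_EFinD//; try (by mf); last 2 first.
  - by pos.
  - by pos.
  apply: le_trans (leeD h1 h2) _.
  by rewrite sqrrN Ua -!EFinM -EFinD lee_fin; lra.
(* The value s = 1 shows that the integral is finite. *)
have := key 1 ltr01.
case: I I0 key => [r| |] I0 key; last 2 first.
- by rewrite mulry gtr0_sg ?mul1e//= ?expr1n.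
- by [].
move=> _; rewrite lee_fin; apply/ler_addgt0Pr => e e0.
have {}key (s : R) : 0 < s -> s ^+ 2 * r + 2 * a <= 2 * expR (s ^+ 2 * v / 2) * a.
  by move=> s0; rewrite -lee_fin EFinD EFinM; exact: key.
(* Here t = s^2 and x = t v / 2; the bound e^x <= 1 / (1 - x) turns the comparison into a polynomial
   one. *)
have key' (t : R) : 0 < t -> t * v / 2 < 1 -> r * (1 - t * v / 2) <= v * a.
  move=> t0 t1; have st : Num.sqrt t ^+ 2 = t by rewrite sqr_sqrtr// ltW.
  have := key (Num.sqrt t); rewrite sqrtr_gt0 st => /(_ t0).
  have := expR_le_inv t1.
  set x := t * v / 2 in t1 *; have x1 : 0 < 1 - x by rewrite subr_gt0.
  rewrite -(ler_pM2r x1) mulVf ?gt_eqF//; move: (expR x) => E hE hk.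
  rewrite -(ler_pM2l t0).
  have : (t * r + 2 * a) * (1 - x) <= 2 * a.
    apply: (@le_trans _ _ (2 * E * a * (1 - x))); first by rewrite ler_pM2r.
    nra.
  move=> hh; have xE : t * v = 2 * x by rewrite /x; field.
  rewrite [X in _ <= X]mulrA xE; nra.
rewrite lee_fin in I0.
pose t := Num.min (e / (v * r + 1)) ((v + 1)^-1).
have vr : 0 < v * r + 1 by rewrite ltr_wpDl ?mulr_ge0.
have v1 : 0 < v + 1 by rewrite ltr_wpDl.
have t0 : 0 < t by rewrite /t lt_min divr_gt0//= invr_gt0.
have t1 : t * (v * r + 1) <= e by rewrite -ler_pdivlMr// /t ge_min lexx.
have t2 : t * (v + 1) <= 1 by rewrite -ler_pdivlMr// div1r /t ge_min lexx orbT.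
have := key' t t0; rewrite ltr_pdivrMr// mul1r => /(_ ltac:(nra)) h.
have e1 : r * (1 - t * v / 2) = r - t * (v * r) / 2 by field.
rewrite e1 in h; have : 0 <= v * r by rewrite mulr_ge0.
nra.
Qed.

(** The cross term 2 E[U z m] has to be reached from exponentials of m against nonnegative weights.
    So z is split into [zp] and [zn]: one has 2 zp m <= (2/s) zp (e^(s m) - 1), and likewise -2 zn m
    <= (2/s) zn (e^(-s m) - 1). In mean both are O(s). *)
Lemma subgaussian_sqrD U (z : Om -> R) (a b : R) :
  gfun G U -> gfun G z -> (forall w, 0 <= U w) ->
  (\int[P]_w (U w)%:E = a%:E)%E -> (\int[P]_w (U w * z w ^+ 2)%:E = b%:E)%E ->
  (\int[P]_w (U w * (z w + m w) ^+ 2)%:E <= (b + v * a)%:E)%E.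
Proof.
move=> mU mz U0 Ua Uz; have mU' := gfun_measurable Gm mU.
have mz' := gfun_measurable Gm mz.
have a0 : 0 <= a by rewrite -lee_fin -Ua; exact: integral_EFin_ge0.
have b0 : 0 <= b by rewrite -lee_fin -Uz; apply: integral_EFin_ge0 => w; rewrite mulr_ge0// sqr_ge0.
pose zp w := Num.max (z w) 0; pose zn w := Num.max (- z w) 0.
have gzp : gfun G zp by apply: measurable_maxr => //; exact: measurable_cst.
have gzn : gfun G zn.
  by apply: measurable_maxr; [exact: (@measurable_funN _ (SA G))|exact: measurable_cst].
have mzp := gfun_measurable Gm gzp; have mzn := gfun_measurable Gm gzn.
have zp0 w : 0 <= zp w by rewrite /zp le_max lexx orbT.
have zn0 w : 0 <= zn w by rewrite /zn le_max lexx orbT.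
have zE w : z w = zp w - zn w.
  by rewrite /zp /zn; case: (leP (z w) 0); case: (leP (- z w) 0); lra.
have znorm w : zp w + zn w <= 1 + z w ^+ 2.
  by rewrite /zp /zn; case: (leP (z w) 0); case: (leP (- z w) 0); nra.
(* The weighted means of [zp] and [zn] are finite because |z| <= 1 + z^2; this permits the
   subtractions that follow. *)
have fin (y : Om -> R) : gfun G y -> (forall w, 0 <= y w) ->
    (forall w, y w <= 1 + z w ^+ 2) ->
    exists2 r, 0 <= r & (\int[P]_w (U w * y w)%:E = r%:E)%E.
  move=> gy y0 yz; have my := gfun_measurable Gm gy.
  have I0 : (0 <= \int[P]_w (U w * y w)%:E)%E by apply: integral_EFin_ge0 => w; rewrite mulr_ge0.
  have : (\int[P]_w (U w * y w)%:E <= (a + b)%:E)%E.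
    rewrite EFinD -Ua -Uz -integral_EFinD//; [|by mf|by pos].
    apply: integral_EFin_le; try by mf.
      by pos.
    by move=> w; have := U0 w; have := yz w; nra.
  case: (\int[P]_w _)%E I0 => [r r0 _| |//]; first by exists r.
  by move=> _; rewrite leye_eq.
have [p p0 pE] := fin zp gzp zp0 (fun w => le_trans (ler_wpDr (zn0 w) (lexx _)) (znorm w)).
have [q q0 qE] := fin zn gzn zn0 (fun w => le_trans (ler_wpDl (zp0 w) (lexx _)) (znorm w)).
have hsq := subgaussian_sqr mU U0 Ua.
set I := (\int[P]_w _)%E.
have I0 : (0 <= I)%E by apply: integral_EFin_ge0 => w; rewrite mulr_ge0// sqr_ge0.
have gUp : gfun G (fun w => U w * zp w) by apply: (@measurable_funM _ (SA G)).
have gUn : gfun G (fun w => U w * zn w) by apply: (@measurable_funM _ (SA G)).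
have Up0 w : 0 <= U w * zp w by rewrite mulr_ge0.
have Un0 w : 0 <= U w * zn w by rewrite mulr_ge0.
have key (s : R) : 0 < s -> (I + (2 / s * (p + q))%:E <=
    (b + v * a + 2 / s * (expR (s ^+ 2 * v / 2) * (p + q)))%:E)%E.
  move=> s0; have s20 : 0 <= 2 / s by rewrite divr_ge0// ltW.
  have h1 := subgaussian_exp s gUp Up0; have h2 := subgaussian_exp (- s) gUn Un0.
  have e1 : (\int[P]_w (U w * (z w + m w) ^+ 2 + 2 / s * (U w * zp w + U w * zn w))%:E =
      I + (2 / s * (p + q))%:E)%E.
    rewrite integral_EFinD//; try (by mf); last 2 first.
    - by pos.
    - by pos.
    rewrite integral_EFinZ//; [|by mf|by pos].
    by rewrite integral_EFinD//; [rewrite pE qE|mf|mf].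
  rewrite -e1.
  apply: (@le_trans _ _ (\int[P]_w ((U w * z w ^+ 2 + U w * m w ^+ 2) +
      2 / s * (U w * zp w * expR (s * m w) + U w * zn w * expR (- s * m w)))%:E)%E).
    apply: integral_EFin_le => //; try by mf.
      by pos.
    move=> w; rewrite zE.
    have := expR_ge1Dx (s * m w); have := expR_ge1Dx (- s * m w).
    have := U0 w; have := zp0 w; have := zn0 w.
    move: (U w) (zp w) (zn w) (m w) => u p' q' y q0' p0' u0 h3 h4.
    set E1 := expR (- s * y) in h3 *; set E2 := expR (s * y) in h4 *.
    have hp : 2 / s * (u * p') + 2 * (u * p' * y) <= 2 / s * (u * p' * E2).
      have -> : 2 / s * (u * p') + 2 * (u * p' * y) = 2 / s * (u * p' * (1 + s * y)).
        by field; rewrite gt_eqF.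
      by rewrite ler_wpM2l// ler_wpM2l// mulr_ge0.
    have hq : 2 / s * (u * q') - 2 * (u * q' * y) <= 2 / s * (u * q' * E1).
      have -> : 2 / s * (u * q') - 2 * (u * q' * y) = 2 / s * (u * q' * (1 + - s * y)).
        by field; rewrite gt_eqF.
      by rewrite ler_wpM2l// ler_wpM2l// mulr_ge0.
    rewrite [2 / s * (_ * _ + _)]mulrDr [2 / s * (_ * E2 + _)]mulrDr; nra.
  rewrite integral_EFinD//; try (by mf); last 2 first.
  - by pos.
  - by pos.
  rewrite integral_EFinD//; try (by mf); last 2 first.
  - by pos.
  - by pos.
  rewrite integral_EFinZ//; try (by mf); last first.
    by pos.
  rewrite integral_EFinD//; try (by mf); last 2 first.
  - by pos.
  - by pos.
  rewrite Uz EFinD leeD//; first by rewrite EFinD leeD.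
  rewrite [leRHS]EFinM lee_wpmul2l ?lee_fin//.
  apply: le_trans (leeD h1 h2) _.
  by rewrite sqrrN pE qE -!EFinM -EFinD lee_fin; lra.
have := key 1 ltr01.
case: I I0 key => [r| |] I0 key; last 2 first.
- by [].
- by [].
move=> _; rewrite lee_fin; apply/ler_addgt0Pr => e e0.
pose k := p + q; have k0 : 0 <= k by rewrite addr_ge0.
pose s := Num.min (e / (2 * v * k + 1)) ((v + 1)^-1).
have vk : 0 < 2 * v * k + 1 by rewrite ltr_wpDl ?mulr_ge0.
have v1 : 0 < v + 1 by rewrite ltr_wpDl.
have s0 : 0 < s by rewrite /s lt_min divr_gt0//= invr_gt0.
have s1 : s * (2 * v * k + 1) <= e by rewrite -ler_pdivlMr// /s ge_min lexx.
have s2 : s * (v + 1) <= 1 by rewrite -ler_pdivlMr// div1r /s ge_min lexx orbT.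
have sv := mulr_ge0 (ltW s0) v0.
have s3 : s <= 1 by rewrite mulrDr mulr1 in s2; lra.
have x0 : 0 <= s ^+ 2 * v / 2 by rewrite divr_ge0// mulr_ge0// sqr_ge0.
have x1 : s ^+ 2 * v / 2 <= 2^-1.
  have : s * (s * v) <= s by rewrite mulrDr mulr1 in s2; nra.
  by rewrite expr2 mulrA; lra.
have := key s s0; rewrite -EFinD lee_fin -/k => h.
have hE := expR_le_1D2x x0 x1; move: (expR _) hE h => E hE h.
have : 2 / s * (E * k) <= 2 / s * k + 2 * s * v * k.
  have -> : 2 / s * k + 2 * s * v * k = 2 / s * ((1 + 2 * (s ^+ 2 * v / 2)) * k).
    by field; rewrite gt_eqF.
  by apply: ler_wpM2l; [pos|apply: ler_wpM2r].
move=> h'; have : r <= b + v * a + 2 * s * v * k by lra.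
move=> h''; apply: le_trans h'' _; rewrite lerD2l; nra.
Qed.

End subgaussian.

(** * Exponential moments of Brownian increments *)

Section brownian_increments.
Context {R : realType}.

(** Completing the square moves the mean of the density to theta sigma^2 and factors out the
    constant. *)
Lemma normal_mgf (sigma theta : R) : sigma != 0 ->
  (\int[lebesgue_measure]_x (normal_pdf 0 sigma x * expR (theta * x))%:E =
   (expR (theta ^+ 2 * sigma ^+ 2 / 2))%:E)%E.
Proof.
move=> s0; set c := expR (theta ^+ 2 * _ / 2).
transitivity (\int[lebesgue_measure]_x
    (c * normal_pdf (theta * sigma ^+ 2) sigma x)%:E)%E.
  apply: eq_integral => x _; congr EFin.
  rewrite !normal_pdfE// mulrCA -mulrA; congr (_ * _).
  rewrite /normal_fun /c -!expRD; congr expR; field.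
  by rewrite s0.
rewrite (@integral_EFinZ _ _ _ lebesgue_measure).
- by rewrite integral_normal_pdf mule1.
- exact: measurable_normal_pdf.
- exact: expR_ge0.
- by move=> x; exact: normal_pdf_ge0.
Qed.

Context {d : measure_display} {Om : measurableType d}.
Variables (P : probability Om R) (F : R -> set (set Om)).
Hypothesis (filF : filtration F).
Context {n : nat}.

Lemma filtration_measurable t : 0 <= t -> F t `<=` measurable.
Proof. by case: filF => _ h _; exact: h. Qed.

Lemma filtration_SA t (A : set Om) : 0 <= t ->
  measurable (A : set (SA (F t))) <-> F t A.
Proof.
by case: filF => h _ _ t0; rewrite -[in F t A](sigma_algebra_id (h t t0)).
Qed.

Lemma gfun_filtration_le s t (U : Om -> R) : 0 <= s -> s <= t ->
  gfun (F s) U -> gfun (F t) U.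
Proof.
move=> s0 st mU _ B mB; have t0 := le_trans s0 st.
apply/filtration_SA => //; case: filF => _ _; apply; first exact: s0.
  exact: st.
by apply/filtration_SA => //; exact: mU.
Qed.

Lemma mx_measurable_gfun m k (G : set (set Om)) (X : Om -> 'M[R]_(m, k)) i j :
  mx_measurable G X -> gfun G (fun w => X w i j).
Proof.
move=> mX _ B mB; rewrite setTI; apply: sub_sigma_algebra.
have := mX [set M : 'M[R]_(m, k) | B (M i j)]; apply.
by apply: sub_sigma_algebra; exists i, j, B.
Qed.

Variable (W : R -> Om -> 'cV[R]_n).
Hypothesis bW : brownian P F W.

Lemma brownian_gfun t i : 0 <= t -> gfun (F t) (fun w => W t w i 0).
Proof. by move=> t0; case: bW => aW _ _ _; exact: mx_measurable_gfun (aW t t0). Qed.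

Variables (s t : R).
Hypotheses (s0 : 0 <= s) (st : s < t).
Let Gm : F s `<=` measurable := filtration_measurable s0.
Let D i w : R := W t w i 0 - W s w i 0.

Let mD i : measurable_fun setT (D i).
Proof.
apply: measurable_funB.
  by apply: (gfun_measurable (G := F t)); [apply: filtration_measurable|
    apply: brownian_gfun]; exact: le_trans (ltW st).
by apply: (gfun_measurable Gm); exact: brownian_gfun.
Qed.

Let h := t - s.
Let h0 : 0 < h. Proof. by rewrite subr_gt0. Qed.

(** Independence and normality are given on product sets only. Indicators are traded for
    exponentials one coordinate at a time: with the other factors put in the weight, the law of that
    coordinate is bounded on sets by a multiple of the normal density, and [image_measure_le]
    integrates the exponential. *)
Lemma brownian_exp (theta : 'I_n -> R) A : F s A ->
  (\int[P]_w (\1_A w * expR (\sum_i theta i * D i w))%:E <=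
   P A * (expR (\sum_i theta i ^+ 2 * h / 2))%:E)%E.
Proof.
move=> FA; have mA : measurable A by exact: Gm.
pose N := normal_prob 0 (Num.sqrt h).
have NE (B : set R) : measurable B -> N B = (fine (N B))%:E.
  by move=> mB; rewrite fineK//; apply: (@fin_num_measure _ _ _ (normal_prob 0 (Num.sqrt h))).
have shh : Num.sqrt h ^+ 2 = h by rewrite sqr_sqrtr// ltW.
have sh0 : Num.sqrt h != 0 by rewrite gt_eqF// sqrtr_gt0.
(* Coordinates below k carry exponentials, the others indicators: k = 0 is the hypothesis on
   Brownian motion, k = n the claim. *)
pose f (k : nat) (B : 'I_n -> set R) (i : 'I_n) (x : R) :=
  if (i < k)%N then expR (theta i * x) else \1_(B i) x.
pose m (k : nat) (B : 'I_n -> set R) (i : 'I_n) : R :=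
  if (i < k)%N then expR (theta i ^+ 2 * h / 2) else fine (N (B i)).
have f0 k B i x : 0 <= f k B i x by rewrite /f; case: ifP => _; pos.
have m0 k B i : 0 <= m k B i by rewrite /m; case: ifP => _; [pos|exact: fine_ge0].
have mfk k B i : (forall j, measurable (B j)) -> measurable_fun setT (fun w => f k B i (D i w)).
  move=> mB; rewrite /f; case ik : (i < k)%N.
    by mf.
  exact: (measurableT_comp (@measurable_indic _ _ _ setT _ (mB i)) (mD i)).
have PA : (P A)%E = (fine (P A))%:E by rewrite fineK// fin_num_measure.
have main k : (k <= n)%N -> forall B, (forall j, measurable (B j)) ->
   (\int[P]_w (\1_A w * \prod_i f k B i (D i w))%:E <=
     (fine (P A) * \prod_i m k B i)%:E)%E.
  elim: k => [|k IH] kn B mB.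
    have -> : (\int[P]_w (\1_A w * \prod_i f 0%N B i (D i w))%:E =
        P (A `&` [set w | forall i, B i (D i w)]))%E.
      rewrite -[X in P X]setIT -integral_indic//; last first.
        apply: measurableI => //.
        have -> : [set w | forall i, B i (D i w)] = \bigcap_(i in [set: 'I_n]) (D i @^-1` B i).
          by apply/seteqP; split => w /= H i; [move=> _|]; exact: H.
        by apply: fin_bigcap_measurable => // i _; rewrite -[_ @^-1` _]setTI; exact: mD.
      apply: eq_integral => w _; congr EFin; rewrite indicI; congr (_ * _).
      rewrite /f /= [RHS]indicE; case: (boolP (w \in _)) => [/set_mem/= H|].
        by rewrite big1// => i _; rewrite indicE mem_set.
      move=> /negP H; have /existsNP[i Bi] : ~ (forall i, B i (D i w)).
        by move=> Bw; apply: H; rewrite inE.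
      by rewrite (bigD1 i)//= indicE memNset// mul0r.
    case: bW => _ _ _ /(_ _ _ s0 st _ B FA mB); rewrite /D => H.
    have -> : [set w | forall i, B i (W t w i 0 - W s w i 0)] =
        [set w | forall i, B i ((W t w - W s w) i 0)].
      by apply/seteqP; split => w /= Hw i; have := Hw i; rewrite !mxE.
    rewrite H PA EFinM -prodEFin.
    rewrite (eq_bigr (fun i => (m 0%N B i)%:E))// => i _.
    by rewrite /m/= -NE.
  pose i0 := Ordinal kn.
  have ltS (i : 'I_n) : i != i0 -> (i < k.+1)%N = (i < k)%N.
    move=> ii0; rewrite ltnS leq_eqVlt.
    by have /negbTE -> : (i : nat) != k by apply: contra ii0 => /eqP ik; apply/eqP/val_inj.
  pose g w := \1_A w * \prod_(i < n | i != i0) f k.+1 B i (D i w).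
  have mg : measurable_fun setT g.
    apply: measurable_funM; first exact: measurable_indic.
    rewrite (_ : (fun _ => _) = fun w => \prod_(i <- index_enum 'I_n)
        (if i != i0 then f k.+1 B i (D i w) else 1)).
      by apply: measurable_prod => i _; case: (i != i0); [exact: mfk|exact: measurable_cst].
    by apply/funext => w; rewrite -big_mkcond.
  pose c := fine (P A) * \prod_(i < n | i != i0) m k.+1 B i.
  have c0 : 0 <= c by rewrite mulr_ge0 ?fine_ge0// prodr_ge0.
  have := @image_measure_le _ _ _ _ _ P lebesgue_measure (D i0) g
    (fun x => c * normal_pdf 0 (Num.sqrt h) x) (mD i0) mg.
  move=> /(_ _ _ _ _ (fun x => expR (theta i0 * x))) key.
  have e1 w : \1_A w * \prod_i f k.+1 B i (D i w) = g w * expR (theta i0 * D i0 w).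
    rewrite (bigD1 i0)//= /g mulrA mulrAC; congr (_ * _).
    by rewrite /f /= ltnSn.
  under eq_integral do rewrite e1.
  apply: le_trans (key _ _ _ _ _ _) _.
  - by move=> w; rewrite mulr_ge0 ?indicE// prodr_ge0.
  - by mf; exact: measurable_normal_pdf.
  - by move=> x; rewrite mulr_ge0// normal_pdf_ge0.
  - move=> C mC; pose B' (i : 'I_n) : set R := if i == i0 then C else B i.
    have mB' j : measurable (B' j) by rewrite /B'; case: (j == i0).
    have := IH (ltnW kn) B' mB'.
    have e2 w : \1_A w * \prod_i f k B' i (D i w) = g w * \1_C (D i0 w).
      rewrite (bigD1 i0)//= /g mulrA mulrAC [f k B' i0 _]/f /= ltnn /B' eqxx.
      congr (_ * _ * _); apply: eq_bigr => i ii0.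
      by rewrite /f ltS// (negbTE ii0).
    under [X in _ -> (X <= _)%E]eq_integral do rewrite -e2.
    move=> /le_trans; apply.
    under eq_integral do rewrite -mulrA.
    rewrite integral_EFinZ//; last 2 first.
    + by mf; exact: measurable_normal_pdf.
    + by move=> x; rewrite mulr_ge0 ?normal_pdf_ge0// indicE.
    rewrite (bigD1 i0)//= [m k B' i0]/m /= ltnn /B' eqxx mulrCA EFinM muleC.
    rewrite -NE//.
    apply: lee_pmul => //.
    + by rewrite lee_fin mulr_ge0 ?fine_ge0// prodr_ge0.
    + rewrite lee_fin /c ler_wpM2l ?fine_ge0//.
      apply: ler_prod => i ii0; by rewrite m0 /= /m ltS// (negbTE ii0).
    + rewrite /N /normal_prob integral_mkcond.
      apply: ge0_le_integral => //.
      * by move=> x _; rewrite patchE; case: ifP => // _; rewrite lee_fin normal_pdf_ge0.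
      * apply/(measurable_restrictT _ mC)/measurable_funTS/measurable_EFinP.
        exact: measurable_normal_pdf.
      * by mf; exact: measurable_normal_pdf.
      * move=> x _; rewrite patchE indicE; case: ifP => _; rewrite ?mulr1// mulr0.
        by rewrite lexx.
  - by mf.
  - by pos.
  - under eq_integral do rewrite -mulrA.
    rewrite integral_EFinZ//; last 2 first.
    + by mf; exact: measurable_normal_pdf.
    + by move=> x; rewrite mulr_ge0 ?normal_pdf_ge0// expR_ge0.
    rewrite normal_mgf// -EFinM lee_fin (bigD1 i0)//= /c.
    rewrite [m k.+1 B i0]/m ltnSn shh -[leLHS]mulrA.
    by apply: ler_wpM2l; [exact: fine_ge0|rewrite mulrC].
have := main n (leqnn _) (fun=> setT) (fun=> measurableT).
under eq_integral do under eq_bigr do rewrite /f ltn_ord.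
under eq_bigr do rewrite /m ltn_ord.
under [X in _ -> (X <= _)%E]eq_integral do rewrite expR_sum.
move=> H; apply: le_trans H _.
by rewrite [X in (_ <= X * _)%E]PA -EFinM expR_sum.
Qed.

Let E (theta : 'I_n -> R) w :=
  expR (\sum_i (theta i * D i w - theta i ^+ 2 * h / 2)).

Let mE (theta : 'I_n -> Om -> R) : (forall i, gfun (F s) (theta i)) ->
  measurable_fun setT (fun w => E (theta ^~ w) w).
Proof.
move=> mth; rewrite /E.
by mf; exact: gfun_measurable (mth _).
Qed.

(** The exponential [E] is normalized so that its bound does not depend on theta. Coordinates are
    made random one at a time: for a simple function theta_i the weight is split over the level
    sets, on which theta_i is constant, and Fatou's lemma handles the general case. *)
Lemma brownian_exp_random (theta : 'I_n -> Om -> R) (U : Om -> R) :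
  (forall i, gfun (F s) (theta i)) -> gfun (F s) U -> (forall w, 0 <= U w) ->
  (\int[P]_w (U w * E (theta ^~ w) w)%:E <= \int[P]_w (U w)%:E)%E.
Proof.
move=> mth mU U0.
pose tau (k : nat) (c : 'I_n -> R) (w : Om) (i : 'I_n) :=
  if (i < k)%N then theta i w else c i.
have mtau k c i : gfun (F s) (fun w => tau k c w i).
  by rewrite /tau; case: (i < k)%N => //; exact: measurable_cst.
have main k : (k <= n)%N -> forall c (V : Om -> R), gfun (F s) V -> (forall w, 0 <= V w) ->
    (\int[P]_w (V w * E (tau k c w) w)%:E <= \int[P]_w (V w)%:E)%E.
  elim: k => [_|k IH kn] c V mV V0.
    rewrite -[leRHS]mul1e; apply: (cond_le Gm) => //.
    - by apply: (mE (theta := fun i _ => c i)) => i; exact: measurable_cst.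
    - by move=> w; exact: expR_ge0.
    move=> A mA; have FA : F s A by apply/filtration_SA.
    rewrite mul1e.
    pose K := expR (- \sum_i c i ^+ 2 * h / 2).
    have -> : (\int[P]_w (\1_A w * E (tau 0%N c w) w)%:E =
        K%:E * \int[P]_w (\1_A w * expR (\sum_i c i * D i w))%:E)%E.
      rewrite -integral_EFinZ; last 3 first.
      + by mf; exact: Gm.
      + exact: expR_ge0.
      + by pos.
      apply: eq_integral => w _; congr EFin.
      rewrite /E /K /tau /= sumrB expRD [RHS]mulrCA; congr (_ * _).
      by rewrite mulrC.
    apply: le_trans (lee_wpmul2l _ (brownian_exp c FA)) _; first by rewrite lee_fin expR_ge0.
    rewrite muleCA -EFinM -expRD addNr expR0 mule1.
    by [].
  pose i0 := Ordinal kn.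
  have ltS (i : 'I_n) : i != i0 -> (i < k.+1)%N = (i < k)%N.
    move=> ii0; rewrite ltnS leq_eqVlt.
    by have /negbTE -> : (i : nat) != k by apply: contra ii0 => /eqP ik; apply/eqP/val_inj.
  have mEth : measurable_fun [set: SA (F s)] (fun w : SA (F s) => (theta i0 w)%:E).
    by apply/measurable_EFinP; exact: mth.
  have [phi cphi] := approximation_sfun measurableT mEth.
  have mphi j : gfun (F s) (phi j : Om -> R) by exact: measurable_funPT.
  pose sigma j w (i : 'I_n) : R := if i == i0 then phi j w else tau k c w i.
  have msigma j i : gfun (F s) (fun w => sigma j w i).
    by rewrite /sigma; case: (i == i0).
  apply: (fatou_EFin_le (fk := fun j w => V w * E (sigma j w) w)).
  - move=> j; apply: measurable_funM; first exact: gfun_measurable mV.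
    exact: (mE (theta := fun i w => sigma j w i)).
  - apply: measurable_funM; first exact: gfun_measurable mV.
    exact: (mE (theta := fun i w => tau k.+1 c w i)).
  - by move=> j w; rewrite mulr_ge0// expR_ge0.
  - by move=> w; rewrite mulr_ge0// expR_ge0.
  - move=> w e e0.
    have cv : phi j w @[j --> \oo] --> theta i0 w.
      by have /fine_cvgP[_] : (phi j w)%:E @[j --> \oo] --> (theta i0 w)%:E by exact: cphi.
    have : V w * E (sigma j w) w @[j --> \oo] --> V w * E (tau k.+1 c w) w.
      apply: cvgMr; apply: continuous_cvg; first exact: continuous_expR.
      apply: cvg_sumr => i.
      rewrite /sigma /tau; case: eqP => [->|/eqP ii0] /=; last first.
        by rewrite ltS//; exact: cvg_cst.
      rewrite ltnSn; apply: cvgB; first by apply: cvgMl.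
      by apply: cvgMl; apply: cvgMl; exact: (cvgM cv cv).
    by move=> /cvgrPdist_le /(_ e e0); apply: filterS => j /ler_normlP[_]; lra.
  - move=> j.
    pose B y : set Om := phi j @^-1` [set y].
    have gB y : gfun (F s) (\1_(B y) : Om -> R).
      by apply: measurable_indic; exact: measurable_sfunP.
    pose r := finmap.enum_fset (fset_set (range (phi j))).
    have ind1 w : \sum_(y <- r) \1_(B y) w = 1 :> R.
      have : phi j w \in r.
        by rewrite /r in_fset_set// inE; exists w.
      have : uniq r by exact: finmap.fset_uniq.
      move=> ur wr; rewrite (bigD1_seq (phi j w))//= indicE mem_set//= big1 ?addr0// => y yw.
      rewrite indicE memNset// /B /= => yE; by rewrite yE eqxx in yw.
    pose cc (y : R) (i : 'I_n) : R := if i == i0 then y else c i.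
    have e1 w : V w * E (sigma j w) w = \sum_(y <- r) (\1_(B y) w * V w) * E (tau k (cc y) w) w.
      rewrite -[LHS]mul1r -(ind1 w) mulr_suml; apply: eq_bigr => y _.
      rewrite mulrA !indicE; case: (boolP (w \in B y)); rewrite ?mul0r// => /set_mem/= yw.
      have -> : sigma j w = tau k (cc y) w; last by [].
      apply/funext => i; rewrite /sigma /tau /cc.
      by case: eqP => [->/=|//]; rewrite ltnn.
    under eq_integral do rewrite e1.
    rewrite integral_EFin_sum; last 2 first.
    + move=> y; apply: measurable_funM.
        by apply: (gfun_measurable Gm); apply: (@measurable_funM _ (SA (F s))).
      exact: (mE (theta := fun i w => tau k (cc y) w i)).
    + by move=> y w; rewrite !mulr_ge0// ?expR_ge0// indicE.
    have -> : (\int[P]_w (V w)%:E = \sum_(y <- r) \int[P]_w (\1_(B y) w * V w)%:E)%E.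
      rewrite -integral_EFin_sum; last 2 first.
      + by move=> y; apply: (gfun_measurable Gm); apply: (@measurable_funM _ (SA (F s))).
      + by move=> y w; rewrite !mulr_ge0// indicE.
      by apply: eq_integral => w _; rewrite -mulr_suml ind1 mul1r.
    apply: lee_sum => y _; apply: IH (ltnW kn) _ _ _ _.
    + by apply: (@measurable_funM _ (SA (F s))).
    + by move=> w; rewrite mulr_ge0// indicE.
have := main n (leqnn _) (fun=> 0) U mU U0.
have tauE w : tau n (fun=> 0) w = theta ^~ w.
  by apply/funext => i; rewrite /tau ltn_ord.
by under eq_integral do rewrite tauE.
Qed.

End brownian_increments.

Section exponential_limit.
Context {R : realType} {d : measure_display} {Om : measurableType d}.
Variables (P : probability Om R).

(* On {m <= L}, the tangent inequality e^b >= e^a (1 + b - a) bounds e^m by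
   e^(mk - Qk) plus e^L (|mk - m| + Qk), which is small in mean; then let L -> oo. *)
Lemma integral_exp_limit (A : set Om) (m : Om -> R) (mk Qk : nat -> Om -> R) (C : R) :
  measurable A -> measurable_fun setT m ->
  (forall k, measurable_fun setT (mk k)) ->
  (forall k, measurable_fun setT (Qk k)) -> (forall k w, 0 <= Qk k w) ->
  (forall k, (\int[P]_w (\1_A w * expR (mk k w - Qk k w))%:E <= C%:E)%E) ->
  (\int[P]_w ((mk k w - m w) ^+ 2)%:E)%E @[k --> \oo] --> 0%E ->
  (\int[P]_w (Qk k w)%:E)%E @[k --> \oo] --> 0%E ->
  (\int[P]_w (\1_A w * expR (m w))%:E <= C%:E)%E.
Proof.
move=> mA mm mmk mQk Q0 bnd mkm Qk0.
pose B (L : nat) := [set w | m w <= L%:R].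
have mB L : measurable (B L).
  have -> : B L = m @^-1` `]-oo, L%:R].
    by apply/seteqP; split => w /=; rewrite in_itv.
  by rewrite -[_ @^-1` _]setTI; exact: mm.
apply: (fatou_EFin_le (fk := fun L w => \1_A w * (\1_(B L) w * expR (m w)))).
- by move=> L; mf.
- by mf.
- by pos.
- by pos.
- move=> w e e0; exists (Num.truncn `|m w|).+1 => // L /= mL.
  rewrite [\1_(B L) w]indicE mem_set ?mul1r /B /=; first by rewrite lerBlDr lerDl ltW.
  apply: le_trans (ler_norm _) _; apply: le_trans (ltW (truncnS_gt _)) _.
  by rewrite ler_nat.
move=> L; apply/lee_addgt0Pr => e e0.
pose K : R := expR L%:R; have K0 : 0 < K by exact: expR_gt0.
(* Three error terms of mean at most e1 each, before the factor K: the constant e1, the square of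
   [mk - m] divided by e1, and [Qk]. The first two arise from |z| <= e1 + z^2 / e1, the control on
   [mk - m] being in L^2. *)
pose e1 := e / (3 * K); have e10 : 0 < e1 by rewrite divr_gt0// mulr_gt0.
have e2E : 0 < e1 * e1 by rewrite mulr_gt0.
have h1 : \forall k \near \oo, (\int[P]_w ((mk k w - m w) ^+ 2)%:E <= (e1 * e1)%:E)%E.
  exact: cvge0_le.
have h2 : \forall k \near \oo, (\int[P]_w (Qk k w)%:E <= e1%:E)%E.
  exact: cvge0_le.
have [k [h1k h2k]] : exists k, (\int[P]_w ((mk k w - m w) ^+ 2)%:E <= (e1 * e1)%:E)%E /\
    (\int[P]_w (Qk k w)%:E <= e1%:E)%E.
  near \oo => k; exists k; split; near: k; [exact: h1|exact: h2].
pose rest w := e1 + e1^-1 * (mk k w - m w) ^+ 2 + Qk k w.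
have rest0 w : 0 <= rest w.
  by rewrite /rest; pos.
have mrest : measurable_fun setT rest by rewrite /rest; mf.
apply: (@le_trans _ _ (\int[P]_w (\1_A w * expR (mk k w - Qk k w) + K * rest w)%:E)%E).
  apply: integral_EFin_le; [by mf|by mf|by pos|].
  move=> w; have Kr : 0 <= K * rest w by rewrite mulr_ge0// ltW.
  rewrite [\1_A w]indicE; case: (w \in A); rewrite ?mul0r ?mul1r ?add0r//.
  rewrite [\1_(B L) w]indicE; case: (boolP (w \in B L)); last first.
    by rewrite mul0r addr_ge0// expR_ge0.
  rewrite mul1r => /set_mem; rewrite /B /= => mL.
  have eK : expR (m w) <= K by rewrite ler_expR.
  pose z := mk k w - Qk k w - m w; have := expR_ge1Dx z.
  have -> : mk k w - Qk k w = z + m w by rewrite /z subrK.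
  rewrite expRD; move: (expR (m w)) eK (expR_gt0 (m w)) => E eK E0.
  move: (expR _) => E2; rewrite /z => hE2.
  have : `|mk k w - m w| <= e1 + e1^-1 * (mk k w - m w) ^+ 2.
    have := normr_ge0 (mk k w - m w); rewrite -[(_ - _) ^+ 2]real_normK ?num_real//.
    move: `|_| => y y0.
    have iv0 : 0 <= e1^-1 by pos.
    have iv1 : e1^-1 * e1 = 1 by rewrite mulVf// gt_eqF.
    move: e1^-1 iv0 iv1 => iv iv0 iv1.
    have iv2 : iv * e1 * y = y by rewrite iv1 mul1r.
    have iv3 : iv * e1 * e1 = e1 by rewrite iv1 mul1r.
    by have := mulr_ge0 iv0 (sqr_ge0 (y - e1)); nra.
  have := lerNnormlW (lexx `|mk k w - m w|); have := Q0 k w.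
  rewrite /rest; move: (rest0 w); rewrite /rest.
  move: (`|_|) (e1 + _) (Qk k w) hE2 => y x q hE2 r0 q0 hy hy'.
  have h1' : E * (1 - (y + q)) <= E2 * E by nra.
  have h2' : E * (x + q) <= K * (x + q) by rewrite ler_wpM2r.
  have h3' : E * (y + q) <= E * (x + q) by rewrite ler_wpM2l ?lerD2r// ltW.
  lra.
rewrite integral_EFinD//; try solve [mf | pos].
apply: leeD; first exact: bnd.
rewrite integral_EFinZ//; last exact: ltW.
apply: (@le_trans _ _ (K%:E * (3 * e1)%:E)%E); last first.
  by rewrite -EFinM lee_fin /e1; have -> : K * (3 * (e / (3 * K))) = e by field; rewrite gt_eqF.
apply: lee_wpmul2l; first by rewrite lee_fin ltW.
rewrite integral_EFinD//; try solve [mf | pos].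
have -> : 3 * e1 = (e1 + e1) + e1 by ring.
rewrite EFinD leeD// integral_EFinD//; try solve [mf | pos].
rewrite integral_cst//= probability_setT mule1 EFinD leeD//.
rewrite integral_EFinZ//; try solve [mf | pos].
apply: le_trans (lee_wpmul2l _ h1k) _; first by rewrite lee_fin; pos.
by rewrite -EFinM lee_fin mulrA mulVf ?gt_eqF// mul1r.
Unshelve. all: by end_near. Qed.

End exponential_limit.

(** * Exponential supermartingales of simple integrands *)

Section ito_simple.
Context {R : realType} {d : measure_display} {Om : measurableType d}.
Variables (P : probability Om R) (F : R -> set (set Om)).
Hypothesis filF : filtration F.
Context {n : nat}.
Variable (W : R -> Om -> 'cV[R]_n).
Hypothesis bW : brownian P F W.
Variables (s t : R).
Hypotheses (s0 : 0 <= s) (st : s <= t).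
Variable (S : @simple_process R d Om n).
Hypothesis simS : is_simple F S.
Variables (theta : R) (j : 'I_n).

(** Clamping the partition times to [s, t] keeps the index set of the simple process; cells outside
    [s, t] collapse to a point and contribute nothing. *)
Let clamp u : R := Num.max s (Num.min u t).
Let c k := clamp (sp_time S k).

Let sc k : s <= c k. Proof. by rewrite /c /clamp le_max lexx. Qed.
Let c0 k : 0 <= c k. Proof. exact: le_trans (sc k). Qed.
Let cS k : c k <= c k.+1.
Proof.
case: simS => _ h _ _; have := h k k.+1 (leqnSn k).
by move=> tk; rewrite /c /clamp; apply: le_max2 => //; apply: le_min2.
Qed.
(** A cell that does not collapse begins, once clamped, no earlier than [sp_time S k], so its value
    is measurable at the clamped time, as conditioning there requires. *)
Let ct k : c k < c k.+1 -> sp_time S k <= c k.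
Proof.
rewrite /c /clamp => ck; rewrite le_max le_min lexx /=.
case: (leP (sp_time S k) t) => tk; first by rewrite orbT.
case: simS => _ h _ _; have tk' := lt_le_trans tk (h k k.+1 (leqnSn k)).
by move: ck; rewrite (min_idPr (ltW tk)) (min_idPr (ltW tk')) ltxx.
Qed.

Let sp_time_ge0 k : 0 <= sp_time S k.
Proof. by case: simS => h0 h _ _; apply: le_trans h0 (h _ _ _). Qed.

(** Exponent of the stochastic exponential over one cell, for row j of the integrand; the partial
    sums [Z] are the logarithm of an exponential supermartingale. *)
Let term k w : R := \sum_l (theta * sp_val S k w j l * (W (c k.+1) w l 0 - W (c k) w l 0)
  - (theta * sp_val S k w j l) ^+ 2 * (c k.+1 - c k) / 2).
Let Z k w : R := \sum_(i < k) term i w.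

Let term0 k w : c k = c k.+1 -> term k w = 0.
Proof. by move=> e; rewrite /term e big1// => l _; rewrite !subrr mulr0 mulr0 mul0r subr0. Qed.

Let gval k l : c k < c k.+1 -> gfun (F (c k)) (fun w => theta * sp_val S k w j l).
Proof.
move=> ck; apply: (@measurable_funM _ (SA (F (c k)))); first exact: measurable_cst.
apply: (gfun_filtration_le filF (sp_time_ge0 k) (ct ck)).
by case: simS => _ _ h _; exact: mx_measurable_gfun (h k).
Qed.

Let gterm k : gfun (F (c k.+1)) (term k).
Proof.
have := cS k; rewrite le_eqVlt => /predU1P[e|ck].
  by rewrite (_ : term k = fun=> 0) ?(funext (fun w => term0 w e))//; exact: measurable_cst.
apply: (@measurable_sum _ (SA (F (c k.+1)))) => l.
have gv := gfun_filtration_le filF (c0 k) (cS k) (gval l ck).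
apply: (@measurable_funB _ (SA (F (c k.+1)))).
  apply: (@measurable_funM _ (SA (F (c k.+1)))) => //.
  apply: (@measurable_funB _ (SA (F (c k.+1)))).
    exact: (brownian_gfun bW).
  by apply: (gfun_filtration_le filF (c0 k) (cS k)); exact: (brownian_gfun bW).
do 2 (apply: (@measurable_funM _ (SA (F (c k.+1)))); last exact: measurable_cst).
exact: (@measurable_funX _ (SA (F (c k.+1)))).
Qed.

Let gZ k : gfun (F (c k)) (Z k).
Proof.
elim: k => [|k IH].
  by rewrite (_ : Z 0%N = fun=> 0); [exact: measurable_cst|apply/funext => w; rewrite /Z big_ord0].
rewrite (_ : Z k.+1 = fun w => Z k w + term k w); last first.
  by apply/funext => w; rewrite /Z big_ord_recr.
apply: (@measurable_funD _ (SA (F (c k.+1)))) => //.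
exact: (gfun_filtration_le filF (c0 k) (cS k)).
Qed.

Let Z_exp (A : set Om) k : measurable (A : set (SA (F s))) ->
  (\int[P]_w (\1_A w * expR (Z k w))%:E <= P A)%E.
Proof.
move=> mA; have mA' : measurable A := SA_measurable (filtration_measurable filF s0) mA.
elim: k => [|k IH].
  under eq_integral do rewrite /Z big_ord0 expR0 mulr1.
  by rewrite integral_indic// setIT.
have := cS k; rewrite le_eqVlt => /predU1P[e|ck].
  by under eq_integral do rewrite /Z big_ord_recr/= term0// addr0.
apply: le_trans IH.
under eq_integral do rewrite /Z big_ord_recr/= expRD mulrA.
apply: (brownian_exp_random filF bW (c0 k) ck
  (theta := fun l w => theta * sp_val S k w j l) (U := fun w => \1_A w * expR (Z k w))).
- by move=> l; exact: gval.
- apply: (@measurable_funM _ (SA (F (c k)))).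
    apply: (gfun_filtration_le filF s0 (sc k)); exact: measurable_indic.
  by apply: (measurableT_comp (@measurable_expR R)); exact: gZ.
- by pos.
Qed.

Let W_clamp u w l : W (clamp u) w l 0 - W s w l 0 =
  W (Num.min u t) w l 0 - W (Num.min u s) w l 0.
Proof.
rewrite /clamp; case: (leP u s) => us.
  by rewrite (min_idPl (le_trans us st)) (max_idPl us) !subrr.
by rewrite max_r// le_min st ltW.
Qed.

Lemma sp_integral_exp (A : set Om) : measurable (A : set (SA (F s))) ->
  (\int[P]_w (\1_A w * expR (theta * (sp_integral S W t w j 0 - sp_integral S W s w j 0)
     - theta ^+ 2 / 2 * \sum_(k < sp_size S) (\sum_l sp_val S k w j l ^+ 2) * (c k.+1 - c k)))%:E
   <= P A)%E.
Proof.
move=> mA; apply: le_trans (Z_exp (sp_size S) mA).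
rewrite le_eqVlt; apply/orP; left; apply/eqP.
apply: eq_integral => w _; congr (_ * expR _)%:E.
rewrite /Z /sp_integral !summxE -sumrB !mulr_sumr -sumrB.
apply: eq_bigr => k _; rewrite /term !mxE -sumrB mulr_suml !mulr_sumr -sumrB.
apply: eq_bigr => l _; rewrite !mxE.
have -> : W (c k.+1) w l 0 - W (c k) w l 0 =
  (W (c k.+1) w l 0 - W s w l 0) - (W (c k) w l 0 - W s w l 0) by ring.
rewrite !W_clamp; ring.
Qed.

Lemma measurable_sp_integral (u : R) i : 0 <= u ->
  measurable_fun setT (fun w => sp_integral S W u w i 0).
Proof.
move=> u0; rewrite /sp_integral; under eq_fun do rewrite summxE.
apply: measurable_sum => k; under eq_fun do rewrite mxE.
apply: measurable_sum => l; under eq_fun do rewrite !mxE.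
have mW (v : R) : 0 <= v -> measurable_fun setT (fun w => W v w l 0).
  by move=> v0; apply: (gfun_measurable (filtration_measurable filF v0)); exact: (brownian_gfun bW).
apply: measurable_funM; last first.
  by apply: measurable_funB; apply: mW; rewrite le_min u0 sp_time_ge0.
apply: (gfun_measurable (filtration_measurable filF (sp_time_ge0 k))).
by case: simS => _ _ h _; exact: mx_measurable_gfun (h k).
Qed.

Lemma measurable_sp_eval i l :
  measurable_fun setT (fun p : measurableTypeR R * Om => sp_eval S p.1 p.2 i l).
Proof.
rewrite /sp_eval; under eq_fun do rewrite summxE.
apply: measurable_sum => k.
have -> : (fun p : measurableTypeR R * Om => (if sp_time S k < p.1 <= sp_time S k.+1
   then sp_val S k p.2 else 0) i l) =
   (fun p => \1_(`]sp_time S k, sp_time S k.+1]%classic) p.1 * sp_val S k p.2 i l).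
  apply/funext => p; rewrite indicE mem_setE in_itv/=.
  by case: ifP; rewrite ?mxE ?mul1r// mul0r.
apply: measurable_funM.
  have mi : measurable_fun [set: measurableTypeR R]
      (\1_(`]sp_time S k, sp_time S k.+1]%classic) : R -> R).
    exact: measurable_indic.
  exact: (measurableT_comp mi (@measurable_fst _ _ _ _)).
have mv : measurable_fun setT (fun w => sp_val S k w i l).
  apply: (gfun_measurable (filtration_measurable filF (sp_time_ge0 k))).
  by case: simS => _ _ h _; exact: mx_measurable_gfun (h k).
exact: (measurableT_comp mv (@measurable_snd _ _ _ _)).
Qed.

(** The sum is the integral of a step function that equals the squared row of [sp_eval] on each
    clamped cell. The half-open cells of a monotone partition are disjoint, so at most one term is
    active at any time. *)
Lemma sum_clamp_le (w : Om) (B : R) :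
  (\int[lebesgue_measure]_(u in `[s, t]) (\sum_l sp_eval S u w j l ^+ 2)%:E <= B%:E)%E ->
  \sum_(k < sp_size S) (\sum_l sp_val S k w j l ^+ 2) * (c k.+1 - c k) <= B.
Proof.
rewrite -lee_fin; apply: le_trans.
pose a (k : nat) : R := \sum_l sp_val S k w j l ^+ 2.
have a0 k : 0 <= a k by rewrite /a; pos.
have -> : (\sum_(k < sp_size S) a k * (c k.+1 - c k))%:E =
   (\int[lebesgue_measure]_u (\sum_(k < sp_size S) a k * \1_(`]c k, c k.+1]%classic) u)%:E)%E.
  rewrite integral_EFin_sum; last 2 first.
  - by move=> k; mf.
  - by pos.
  rewrite -sumEFin; apply: eq_bigr => k _.
  rewrite (@integral_EFinZ _ _ _ lebesgue_measure)//; try solve [mf | pos].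
  rewrite integral_indic// setIT.
  rewrite [X in (_ * X)%E](lebesgue_measure_itv `]c k, c k.+1])/= lte_fin.
  case: ltP => ck; first by rewrite EFinM.
  have -> : c k.+1 = c k by apply/eqP; rewrite eq_le ck cS.
  by rewrite subrr mulr0 mule0.
have sp_evalE k u : (k < sp_size S)%N -> c k < u <= c k.+1 ->
    sp_time S k < u <= sp_time S k.+1 /\ s <= u <= t.
  move=> _ /andP[h1 h2].
  have su : s < u by exact: le_lt_trans (sc k) h1.
  move: h1; rewrite {1}/c /clamp gt_max => /andP[_].
  move: h2; rewrite {1}/c /clamp le_max leNgt su /= le_min => /andP[ut' ut].
  have nut : (t < u) = false by rewrite ltNge ut.
  by rewrite gt_min nut orbF => ->; rewrite ut' (ltW su).
have uniq_k (k i : nat) u : sp_time S k < u <= sp_time S k.+1 ->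
    sp_time S i < u <= sp_time S i.+1 -> i = k.
  move=> /andP[k1 k2] /andP[i1 i2]; case: simS => _ mono _ _.
  apply/eqP; rewrite eqn_leq; apply/andP; split; rewrite leqNgt; apply/negP => ik.
    by have := lt_le_trans i1 (le_trans k2 (mono _ _ ik)); rewrite ltxx.
  by have := lt_le_trans k1 (le_trans i2 (mono _ _ ik)); rewrite ltxx.
have evalE (k : 'I_(sp_size S)) u : sp_time S k < u <= sp_time S k.+1 ->
    sp_eval S u w = sp_val S k w.
  move=> uk; rewrite /sp_eval (bigD1 k)//= uk big1 ?addr0// => i ik.
  case: ifP => // ui; have := uniq_k _ _ _ uk ui => /val_inj e.
  by rewrite e eqxx in ik.
rewrite [X in (_ <= X)%E]integral_mkcond; apply: ge0_le_integral => //.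
- by move=> u _; rewrite lee_fin; pos.
- by mf.
- apply/(measurable_restrictT _ (measurable_itv `[s, t]))/measurable_funTS/measurable_EFinP.
  apply: measurable_sum => l; apply: measurable_funX.
  exact: (measurableT_comp (measurable_sp_eval j l) (pair2_measurable w)).
move=> u _; rewrite patchE.
case: (pselect (exists k : 'I_(sp_size S), c k < u <= c k.+1)) => [[k uk]|nk].
  have [uk1 uk2] := sp_evalE k u (ltn_ord k) uk.
  rewrite mem_set//= lee_fin (evalE _ _ uk1) (bigD1 k)//= indicE mem_set/= ?in_itv//= mulr1.
  rewrite big1 ?addr0// => i ik; rewrite indicE memNset ?mulr0//= in_itv/= => ui.
  have [ui1 _] := sp_evalE i u (ltn_ord i) ui.
  by have /val_inj e := uniq_k _ _ _ uk1 ui1; rewrite e eqxx in ik.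
rewrite big1; last first.
  move=> k _; rewrite indicE memNset ?mulr0//= in_itv/= => uk; apply: nk; by exists k.
by case: ifP => // _; rewrite lee_fin; pos.
Qed.

End ito_simple.

Section sqnorm_facts.
Context {R : realType}.

Lemma sqnorm_ge0 m k (A : 'M[R]_(m, k)) : 0 <= sqnorm A.
Proof. by rewrite /sqnorm; pos. Qed.

Lemma sqr_le_sqnorm m k (A : 'M[R]_(m, k)) i j : A i j ^+ 2 <= sqnorm A.
Proof.
rewrite /sqnorm (bigD1 i)//= (bigD1 j)//= -addrA lerDl addr_ge0//.
  by apply: sumr_ge0 => l _; pos.
by apply: sumr_ge0 => l _; pos.
Qed.

Lemma row_le_sqnorm m k (A : 'M[R]_(m, k)) i : \sum_j A i j ^+ 2 <= sqnorm A.
Proof. by rewrite /sqnorm (bigD1 i)//= lerDl; apply: sumr_ge0 => l _; pos. Qed.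

Lemma sqnormN m k (A : 'M[R]_(m, k)) : sqnorm (- A) = sqnorm A.
Proof. by apply: eq_bigr => i _; apply: eq_bigr => j _; rewrite !mxE sqrrN. Qed.

Lemma sqnormZ m k (a : R) (A : 'M[R]_(m, k)) : sqnorm (a *: A) = a ^+ 2 * sqnorm A.
Proof.
rewrite /sqnorm mulr_sumr; apply: eq_bigr => i _.
by rewrite mulr_sumr; apply: eq_bigr => j _; rewrite !mxE exprMn.
Qed.

Lemma sqnormD_le m k (A B : 'M[R]_(m, k)) : sqnorm (A + B) <= 2 * sqnorm A + 2 * sqnorm B.
Proof.
rewrite /sqnorm !mulr_sumr -big_split/=; apply: ler_sum => i _.
rewrite !mulr_sumr -big_split/=; apply: ler_sum => j _; rewrite !mxE.
by have := sqr_ge0 (A i j - B i j); nra.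
Qed.

Lemma sqnormB_le m k (A B : 'M[R]_(m, k)) : sqnorm (A - B) <= 2 * sqnorm A + 2 * sqnorm B.
Proof. by rewrite -(sqnormN B); exact: sqnormD_le. Qed.

Lemma measurable_sqnorm {d : measure_display} {T : measurableType d} m k
    (D : set T) (X : T -> 'M[R]_(m, k)) :
  (forall i j, measurable_fun D (fun w => X w i j)) ->
  measurable_fun D (fun w => sqnorm (X w)).
Proof.
move=> mX; apply: measurable_sum => i; apply: measurable_sum => j.
exact: measurable_funX.
Qed.

Lemma sqnorm_sp_eval_bounded {d : measure_display} {Om : measurableType d}
    (F : R -> set (set Om)) n (S : @simple_process R d Om n) :
  is_simple F S -> exists M : R, forall u w, sqnorm (sp_eval S u w) <= M.
Proof.
case=> _ _ _ [M hM].
(* An entry z with z^2 <= M satisfies |z| <= 1 + M. *)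
pose K : R := \sum_(k < sp_size S) (1 + M).
exists (\sum_(i < n) \sum_(j < n) K ^+ 2) => u w.
apply: ler_sum => i _; apply: ler_sum => j _.
rewrite -[sp_eval _ _ _ _ _ ^+ 2]real_normK ?num_real//.
have M0 : 0 <= M by apply: le_trans (hM 0%N w); exact: sqnorm_ge0.
rewrite ler_sqr ?nnegrE//; last by rewrite /K; apply: sumr_ge0 => k _; lra.
rewrite /sp_eval summxE; apply: le_trans (ler_norm_sum _ _ _) _.
apply: ler_sum => k _; case: ifP => _; rewrite ?mxE ?normr0; last by lra.
have := le_trans (sqr_le_sqnorm (sp_val S k w) i j) (hM k w).
rewrite -[_ ^+ 2]real_normK ?num_real//; move: `|_| (normr_ge0 (sp_val S k w i j)) => y y0 h.
nra.
Qed.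

End sqnorm_facts.

(** * Subgaussianity of Ito integrals with deterministic integrand *)

Section ito_integral_subgaussian.
Context {R : realType} {d : measure_display} {Om : measurableType d}.
Variables (P : probability Om R) (F : R -> set (set Om)).
Hypothesis filF : filtration F.
Context {n : nat}.
Variable (W : R -> Om -> 'cV[R]_n).
Hypothesis bW : brownian P F W.
Variables (h : R -> 'M[R]_n) (I : R -> Om -> 'cV[R]_n).
Hypothesis itoI : ito_integral P F W (fun t _ => h t) I.

(** Supplies a sample point at which joint measurability of the integrand is specialized to
    measurability in time. *)
Lemma probability_inhabited : exists w : Om, True.
Proof.
apply: contrapT => H; have := @probability_setT _ _ _ P.
have -> : [set: Om] = set0 by apply/seteqP; split => // w _; apply: H; exists w.
by rewrite measure0 => /esym/eqP; rewrite onee_eq0.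
Qed.

(** Times are meaningful from 0 on; composing with [Num.max 0] produces a function measurable on all
    of R, a device used for every process in the sequel. *)
Lemma ito_integrand_measurable i l : measurable_fun [set: measurableTypeR R] (fun u => h (Num.max 0 u) i l).
Proof.
have [w0 _] := probability_inhabited.
case: itoI => mh _ _.
pose f (u : measurableTypeR R) : measurableTypeR R * Om := (Num.max 0 u, w0).
apply: (@measurable_comp _ _ _ _ _ _ [set p : measurableTypeR R * Om | 0 <= p.1]
  (fun p => h p.1 i l) setT f).
- have -> : [set p : measurableTypeR R * Om | 0 <= p.1] = fst @^-1` `[0, +oo[%classic.
    by apply/seteqP; split => p /=; rewrite in_itv/= andbT.
  rewrite -[_ @^-1` _]setTI.
  exact: (@measurable_fst _ _ (measurableTypeR R) Om measurableT _ (measurable_itv `[0, +oo[)).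
- by move=> _ [u _ <-] /=; rewrite le_max lexx.
- exact: mh.
- apply/measurable_fun_pairP; split => /=; last exact: measurable_cst.
  by apply: measurable_maxr; [exact: measurable_cst|exact: measurable_id].
Qed.

Lemma ito_integral_measurable t i : 0 <= t -> measurable_fun setT (fun w => I t w i 0).
Proof.
move=> t0; case: itoI => _ mI _.
have sub : @measurable d Om `<=` @measurable d Om by [].
by apply: (gfun_measurable sub); exact: mx_measurable_gfun (mI t t0).
Qed.

Variables (s t : R) (j : 'I_n) (v : R).
Hypotheses (s0 : 0 <= s) (st : s <= t) (v0 : 0 <= v).
Hypothesis hM : exists M, forall u, 0 <= u <= t -> sqnorm (h u) <= M.
Hypothesis hv : (\int[lebesgue_measure]_(u in `[s, t]) (\sum_l h u j l ^+ 2)%:E <= v%:E)%E.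

Let t0 : 0 <= t := le_trans s0 st.
Let hp u := h (Num.max 0 u).

(** The compensator of an approximating simple process exceeds that of h by an error controlled by
    the squared L^2([0, t]) distance to h, a random variable of vanishing mean. Taken as [Qk] in
    [integral_exp_limit], this error disappears in the limit. *)
Lemma ito_subgaussian : subgaussian P (F s) (fun w => I t w j 0 - I s w j 0) v.
Proof.
move=> theta A mA; have mA' : measurable (A : set Om) := SA_measurable (filtration_measurable filF s0) mA.
have PA : (P A)%E = (fine (P A))%:E by rewrite fineK// fin_num_measure.
pose a := theta ^+ 2 * v / 2; have a0 : 0 <= a by rewrite /a; pos.
(* The slack eta stems from (a + b)^2 <= (1 + eta) a^2 + (1 + 1/eta) b^2, with a the integrand and b
   the approximation error; here it is removed by taking eta small. *)
suff main eta : 0 < eta -> (\int[P]_w (\1_A w * expR (theta * (I t w j 0 - I s w j 0)))%:E <=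
    (expR (a * (1 + eta)) * fine (P A))%:E)%E.
  rewrite PA -EFinM; apply/lee_addgt0Pr => e e0.
  pose K := expR a * (2 * a) * fine (P A); have K0 : 0 <= K by rewrite /K; pos; exact: fine_ge0.
  pose eta := Num.min (e / (K + 1)) ((2 * (a + 1))^-1).
  have eta0 : 0 < eta.
    by rewrite lt_min divr_gt0 ?ltr_wpDl//= invr_gt0 mulr_gt0// ltr_wpDl.
  have eta1 : eta * (K + 1) <= e by rewrite -ler_pdivlMr ?ltr_wpDl// ge_min lexx.
  have eta2 : eta * (2 * (a + 1)) <= 1.
    by rewrite -ler_pdivlMr ?div1r ?ge_min ?lexx ?orbT// mulr_gt0// ltr_wpDl.
  apply: le_trans (main _ eta0) _; rewrite -EFinD lee_fin.
  have ae : 0 <= a * eta by pos.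
  rewrite mulrDr mulr1 expRD.
  have := expR_le_1D2x ae; move=> /(_ ltac:(nra)).
  move: (expR (a * eta)) => E hE.
  have p0 : 0 <= fine (P A) by exact: fine_ge0.
  have E0 : 0 <= expR a * fine (P A) by pos.
  have : expR a * fine (P A) * E <= expR a * fine (P A) * (1 + 2 * (a * eta)) by rewrite ler_wpM2l.
  have -> : expR a * fine (P A) * (1 + 2 * (a * eta)) = expR a * fine (P A) + eta * K by rewrite /K; ring.
  have : eta * K <= e by nra.
  rewrite mulrAC; lra.
move=> eta0.
have [M hMM] := hM.
case: itoI => _ mI [S simS cvS].
pose f k (p : measurableTypeR R * Om) : R :=
  \1_(`[0, t]%classic) p.1 * sqnorm (sp_eval (S k) p.1 p.2 - hp p.1).
have f0 k p : 0 <= f k p by rewrite /f mulr_ge0 ?sqnorm_ge0// indicE.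
have mf1 k : measurable_fun setT (f k).
  have mi : measurable_fun [set: measurableTypeR R] (\1_(`[0, t]%classic) : R -> R).
    exact: measurable_indic.
  apply: measurable_funM; first exact: (measurableT_comp mi (@measurable_fst _ _ _ _)).
  apply: measurable_sqnorm => i l; under eq_fun do rewrite !mxE.
  apply: measurable_funB; first exact: (measurable_sp_eval filF (simS k)).
  exact: (measurableT_comp (ito_integrand_measurable i l) (@measurable_fst _ _ _ _)).
have mEf k : measurable_fun setT (fun p => (f k p)%:E) by mf.
pose De k w := (\int[lebesgue_measure]_u (f k (u, w))%:E)%E.
have De0 k w : (0 <= De k w)%E by exact: integral_EFin_ge0.
have mDe k : measurable_fun setT (De k).
  apply: (@measurable_fun_fubini_tonelli_G _ _ _ _ _ lebesgue_measure (fun p => (f k p)%:E)) => //.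
  by move=> p; rewrite lee_fin.
have hpE u : 0 <= u -> hp u = h u by move=> u0; rewrite /hp max_r.
(* Finite at every sample point, since simple processes and h are bounded on [0, t]; the error is
   thus a real random variable. *)
have De_fin k w : (De k w < +oo)%E.
  have [M' hM'] := sqnorm_sp_eval_bounded (simS k).
  pose B := 2 * M' + 2 * M.
  apply: (@le_lt_trans _ _ (\int[lebesgue_measure]_u (`|B| * \1_(`[0, t]%classic) u)%:E)%E).
    apply: integral_EFin_le => //.
    - exact: (measurableT_comp (mf1 k) (pair2_measurable w)).
    - by mf.
    move=> u; rewrite /f [\1_ _ _]indicE mulrC mem_setE/= in_itv/=.
    case: (boolP (0 <= u <= t)) => ut; rewrite ?mulr0// !mulr1.
    have u0 : 0 <= u by case/andP: ut.
    apply: le_trans (ler_norm _); apply: le_trans (sqnormB_le _ _) _.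
    by rewrite hpE// lerD// ler_wpM2l// hMM.
  rewrite (@integral_EFinZ _ _ _ lebesgue_measure); try solve [mf | pos].
  rewrite integral_indic// setIT [X in (_ * X)%E](lebesgue_measure_itv `[0, t])/=.
  by case: ifP => _; rewrite ?mule0 ?ltry// -EFinM ltry.
pose D k w := fine (De k w).
have DE k w : De k w = (D k w)%:E by rewrite fineK// ge0_fin_numE.
have D0 k w : 0 <= D k w by exact: fine_ge0.
have mD k : measurable_fun setT (D k).
  by apply: (measurableT_comp (@fine_measurable _ setT _)).
have ED k : (\int[P]_w (D k w)%:E =
    \int[lebesgue_measure]_(u in `[0%R, t]) \int[P]_w (sqnorm (sp_eval (S k) u w - h u))%:E)%E.
  under eq_integral do rewrite -DE /De.
  rewrite -(@fubini_tonelli _ _ _ _ _ lebesgue_measure P (fun p => (f k p)%:E))//; last first.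
    by move=> p; rewrite lee_fin.
  rewrite [RHS]integral_mkcond; apply: eq_integral => u _; rewrite patchE mem_setE/= in_itv/=.
  case: (boolP (0 <= u <= t)) => ut.
    apply: eq_integral => w _; rewrite /f indicE mem_set/= ?in_itv//= mul1r hpE//.
    by case/andP: ut.
  rewrite integral0_eq// => w _; rewrite /f indicE memNset ?mul0r//= in_itv/=.
  by apply/negP.
pose q := theta ^+ 2 / 2 * (1 + eta^-1).
have q0 : 0 <= q by rewrite /q; pos.
pose mk k w := theta * (sp_integral (S k) W t w j 0 - sp_integral (S k) W s w j 0).
have mmk k : measurable_fun setT (mk k).
  rewrite /mk; mf; first exact: (measurable_sp_integral filF bW (simS k)).
  exact: (measurable_sp_integral filF bW (simS k)).
have mIt := ito_integral_measurable j t0; have mIs := ito_integral_measurable j s0.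
apply: (integral_exp_limit (mk := mk) (Qk := fun k w => q * D k w)) => //.
- by mf.
- by move=> k; mf.
- by pos.
- move=> k.
  have bnd w : \sum_(k0 < sp_size (S k)) (\sum_l sp_val (S k) k0 w j l ^+ 2) *
        (Num.max s (Num.min (sp_time (S k) k0.+1) t) -
         Num.max s (Num.min (sp_time (S k) k0) t)) <= (1 + eta) * v + (1 + eta^-1) * D k w.
    apply: (sum_clamp_le filF (simS k)).
    have hE : {in `[s, t]%classic, forall u, \sum_l hp u j l ^+ 2 = \sum_l h u j l ^+ 2}.
      by move=> u; rewrite mem_setE in_itv/= => /andP[su _]; rewrite hpE// (le_trans s0).
    have mh2 : measurable_fun setT (fun u => \sum_l hp u j l ^+ 2).
      by apply: measurable_sum => l; apply: measurable_funX; exact: ito_integrand_measurable.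
    have mfw : measurable_fun setT (fun u => f k (u, w)).
      exact: (measurableT_comp (mf1 k) (pair2_measurable w)).
    have msp : measurable_fun setT (fun u => \sum_l sp_eval (S k) u w j l ^+ 2).
      apply: measurable_sum => l; apply: measurable_funX.
      exact: (measurableT_comp (measurable_sp_eval filF (simS k) j l) (pair2_measurable w)).
    have eta10 : 0 <= 1 + eta by pos.
    have eta20 : 0 <= 1 + eta^-1 by pos.
    apply: (@le_trans _ _ (\int[lebesgue_measure]_(u in `[s, t])
        ((1 + eta)%:E * (\sum_l hp u j l ^+ 2)%:E + (1 + eta^-1)%:E * (f k (u, w))%:E))%E).
      apply: ge0_le_integral => //.
      - by move=> u _; rewrite lee_fin; pos.
      - by apply: measurable_funTS; mf.
      - by apply: measurable_funTS; apply: emeasurable_funD; apply/measurable_EFinP; mf.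
      move=> u; rewrite /= in_itv/= => /andP[su ut]; have u0 := le_trans s0 su.
      rewrite -!EFinM -EFinD lee_fin /f indicE mem_set/= ?in_itv/= ?u0// mul1r.
      set B := sp_eval (S k) u w; set H := hp u.
      apply: (@le_trans _ _ ((1 + eta) * (\sum_l H j l ^+ 2) + (1 + eta^-1) * (\sum_l (B - H) j l ^+ 2))).
        rewrite !mulr_sumr -big_split/=; apply: ler_sum => l _; rewrite !mxE.
        have ie : eta^-1 * eta = 1 by rewrite mulVf// gt_eqF.
        have i0 : 0 <= eta^-1 by pos.
        move: eta^-1 ie i0 => ie ie1 ie0; move: (B j l) (H j l) => x y.
        have := mulr_ge0 ie0 (sqr_ge0 ((x - y) - eta * y)).
        have -> : ie * (x - y - eta * y) ^+ 2 = ie * (x - y) ^+ 2 - 2 * (ie * eta) * ((x - y) * y) + (ie * eta) * eta * y ^+ 2 by ring.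
        rewrite ie1; nra.
      by rewrite lerD2l ler_wpM2l// row_le_sqnorm.
    rewrite ge0_integralD//; last 4 first.
    - by move=> u _; rewrite -EFinM lee_fin; pos.
    - by apply: measurable_funTS; apply/measurable_EFinP; mf.
    - by move=> u _; rewrite -EFinM lee_fin; pos.
    - by apply: measurable_funTS; apply/measurable_EFinP; mf.
    rewrite ge0_integralZl_EFin//; last 2 first.
    - by move=> u _; rewrite lee_fin; pos.
    - by apply: measurable_funTS; mf.
    rewrite ge0_integralZl_EFin//; last 2 first.
    - by move=> u _; rewrite lee_fin; pos.
    - by apply: measurable_funTS; mf.
    rewrite [leRHS]EFinD; apply: leeD; rewrite [leRHS]EFinM;
      apply: lee_wpmul2l; rewrite ?lee_fin//.
      apply: le_trans hv; rewrite le_eqVlt; apply/orP; left; apply/eqP.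
      by apply: eq_integral => u us; rewrite hE.
    rewrite -DE /De; apply: ge0_subset_integral => //.
    - by mf.
    - by move=> u _; rewrite lee_fin.
  have msum : measurable_fun setT (fun w => \sum_(k0 < sp_size (S k)) (\sum_l sp_val (S k) k0 w j l ^+ 2) *
      (Num.max s (Num.min (sp_time (S k) k0.+1) t) -
       Num.max s (Num.min (sp_time (S k) k0) t))).
    apply: measurable_sum => k0; apply: measurable_funM; last exact: measurable_cst.
    apply: measurable_sum => l; apply: measurable_funX.
    have [st0 mono gv _] := simS k.
    have tk0 : 0 <= sp_time (S k) k0 by apply: le_trans st0 (mono _ _ _).
    by apply: (gfun_measurable (filtration_measurable filF tk0)); exact: mx_measurable_gfun (gv k0).
  apply: (@le_trans _ _ (\int[P]_w (expR (a * (1 + eta)) * (\1_A w * expR (mk k w -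
     theta ^+ 2 / 2 * \sum_(k0 < sp_size (S k)) (\sum_l sp_val (S k) k0 w j l ^+ 2) *
        (Num.max s (Num.min (sp_time (S k) k0.+1) t) -
         Num.max s (Num.min (sp_time (S k) k0) t)))))%:E)%E).
    apply: integral_EFin_le; [by mf|by mf|by pos|].
    move=> w; rewrite mulrCA ler_wpM2l ?indicE// -expRD ler_expR.
    have := ler_wpM2l (divr_ge0 (sqr_ge0 theta) (ler0n R 2)) (bnd w).
    rewrite /q /a; move: (\sum_(_ < _) _) => X; lra.
  rewrite integral_EFinZ; [|by mf|exact: expR_ge0|by pos].
  rewrite EFinM -PA; apply: lee_wpmul2l; first by rewrite lee_fin expR_ge0.
  exact: (sp_integral_exp filF bW s0 st (simS k)).
- apply: ge0_cvge0 => [k|e e0]; first by apply: integral_EFin_ge0; pos.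
  pose c := 2 * theta ^+ 2; have c0 : 0 <= c by rewrite /c; pos.
  have e1 : 0 < e / (2 * (c + 1)) by rewrite divr_gt0// mulr_gt0// ltr_wpDl.
  have := cvge0_le (cvS t t0).2 e1; have := cvge0_le (cvS s s0).2 e1.
  apply: filterS2 => k hs ht.
  have msp u : 0 <= u -> measurable_fun setT (fun w => sqnorm (sp_integral (S k) W u w - I u w)).
    move=> u0; apply: measurable_sqnorm => i i'; under eq_fun do rewrite !mxE.
    apply: measurable_funB; rewrite (ord1 i'); first exact: (measurable_sp_integral filF bW (simS k)).
    exact: ito_integral_measurable.
  apply: (@le_trans _ _ (\int[P]_w (c * (sqnorm (sp_integral (S k) W t w - I t w) +
       sqnorm (sp_integral (S k) W s w - I s w)))%:E)%E).
    have mt := msp t t0; have ms := msp s s0.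
    apply: integral_EFin_le; [by mf|by mf|by pos|].
    move=> w; have := sqr_le_sqnorm (sp_integral (S k) W t w - I t w) j 0.
    have := sqr_le_sqnorm (sp_integral (S k) W s w - I s w) j 0.
    rewrite !mxE /mk.
    move: (sqnorm _) (sqnorm _) => X Y.
    move: (sp_integral (S k) W t w j 0) (sp_integral (S k) W s w j 0) (I t w j 0) (I s w j 0) => x y x' y' hX hY.
    have -> : theta * (x - y) - theta * (x' - y') = theta * ((x - x') - (y - y')) by ring.
    rewrite exprMn /c [2 * _]mulrC -[leRHS]mulrA; apply: ler_wpM2l; first exact: sqr_ge0.
    have := sqr_ge0 ((x - x') + (y - y')); nra.
  rewrite integral_EFinZ//; last 2 first.
  - by apply: measurable_funD; apply: msp.
  - by move=> w; rewrite addr_ge0// sqnorm_ge0.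
  rewrite integral_EFinD; try by [apply: msp|move=> w; exact: sqnorm_ge0].
  apply: le_trans (lee_wpmul2l _ (leeD ht hs)) _; first by rewrite lee_fin.
  rewrite -EFinD -EFinM lee_fin.
  have -> : c * (e / (2 * (c + 1)) + e / (2 * (c + 1))) = (c / (c + 1)) * e.
    by field; rewrite gt_eqF// ltr_wpDl.
  apply: ler_piMl; first exact: ltW.
  by rewrite ler_pdivrMr ?ltr_wpDl// mul1r lerDl.
- apply: ge0_cvge0 => [k|e e0]; first by apply: integral_EFin_ge0; pos.
  have e1 : 0 < e / (q + 1) by rewrite divr_gt0// ltr_wpDl.
  have := cvge0_le (cvS t t0).1 e1; apply: filterS => k hk.
  rewrite integral_EFinZ// ED; apply: le_trans (lee_wpmul2l _ hk) _; first by rewrite lee_fin.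
  rewrite -EFinM lee_fin mulrCA; apply: ler_piMr; first exact: ltW.
  by rewrite ler_pdivrMr ?ltr_wpDl// mul1r lerDl.
Qed.

End ito_integral_subgaussian.

(** * Continuous adapted processes *)

Section continuous_real_functions.
Context {R : realType}.
Implicit Types (f g : R -> R) (a b : R).

Lemma continuous_dist f (x e : R) : {for x, continuous f} -> 0 < e ->
  exists2 r : R, 0 < r & forall u, `|u - x| < r -> `|f u - f x| <= e.
Proof.
move=> cf e0; have /cvgrPdist_le /(_ e e0) := cf.
rewrite -nbhs_nbhs_norm => -[r /= r0 h]; exists r => // u ux.
by rewrite distrC; apply: h => /=; rewrite distrC.
Qed.

(** Only x is confined to the compact interval while u may leave it, so grid points near the ends
    need no separate treatment. *)
Lemma heine f a b (e : R) : continuous f -> 0 < e ->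
  exists2 dl : R, 0 < dl &
    forall x u, a <= x <= b -> `|u - x| <= dl -> `|f u - f x| <= e.
Proof.
move=> cf e0; have e2 : 0 < e / 2 by rewrite divr_gt0.
pose Q (dl x : R) := forall u, `|u - x| <= dl -> `|f u - f x| <= e.
have := @segment_compact R a b; rewrite compact_near_coveringP => /(_ R (0^'+) Q _).
case=> [x _|r /= r0 h]; last first.
  exists (r / 2); first by rewrite divr_gt0.
  move=> x u xab ux; have := h (r / 2); apply => //=.
  - by rewrite sub0r normrN gtr0_norm ?divr_gt0// ltr_pdivrMr// ltr_pMr// ltr1n.
  - by rewrite divr_gt0.
have [r r0 hr] := continuous_dist (cf x) e2.
have r2 : 0 < r / 2 by rewrite divr_gt0.
near=> x' dl => u /= ux.
have x'x : `|x' - x| < r / 2.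
  rewrite distrC; near: x'; exact: cvgr_dist_lt.
have dlr : dl < r / 2 by near: dl; exact: nbhs_right_lt.
have h1 : `|f x' - f x| <= e / 2 by apply: hr; lra.
have h2 : `|f u - f x| <= e / 2.
  apply: hr; rewrite (_ : u - x = (u - x') + (x' - x)); last by ring.
  by apply: le_lt_trans (ler_normD _ _) _; lra.
rewrite (_ : f u - f x' = (f u - f x) - (f x' - f x)); last by ring.
by apply: le_trans (ler_normB _ _) _; lra.
Unshelve. all: by end_near. Qed.

Lemma continuous_bounded f a b : continuous f ->
  exists B : R, forall x, a <= x <= b -> `|f x| <= B.
Proof.
move=> cf; case: (leP a b) => ab; last first.
  by exists 0 => x /andP[h1 h2]; have := le_trans h1 h2; rewrite leNgt ab.
have [c _ hc] := @EVT_max R (fun x => `|f x|) a b ab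
  (continuous_subspaceT (fun x => continuous_comp (cf x) (@norm_continuous _ _ _))).
by exists `|f c| => x xab; apply: hc; rewrite in_itv.
Qed.

Lemma continuous_maxl a : continuous (fun x : R => Num.max a x).
Proof.
move=> x; apply: (@continuous_max _ _ (fun=> a) id x); first exact: cst_continuous.
exact: cvg_id.
Qed.

Lemma continuous_minr a : continuous (fun x : R => Num.min x a).
Proof.
move=> x; apply: (@continuous_min _ _ id (fun=> a) x); first exact: cvg_id.
exact: cst_continuous.
Qed.

Lemma continuous_measurable_funR f : continuous f -> measurable_fun [set: measurableTypeR R] (f : measurableTypeR R -> R).
Proof. exact: continuous_measurable_fun. Qed.

End continuous_real_functions.

(** * Measurability jointly in time and sample point *)

Section joint_measurability.
Context {R : realType} {d : measure_display} {T : measurableType d}.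

(** Rounding time down to multiples of 1/(k+1) gives countably many measurable maps glued along time
    strips; continuity in time makes the process their pointwise limit. *)
Lemma continuous_joint_measurable (x : R -> T -> R) :
  (forall w, continuous (x ^~ w)) -> (forall t, measurable_fun setT (x t)) ->
  measurable_fun setT (fun p : measurableTypeR R * T => x p.1 p.2).
Proof.
move=> cx mx.
pose fl (k : nat) (u : R) : R := (Num.floor (k.+1%:R * u))%:~R / k.+1%:R.
pose xk k (p : measurableTypeR R * T) := x (fl k p.1) p.2.
apply: (@measurable_fun_cvg _ _ _ setT xk) => //.
- move=> k _ B mB; rewrite setTI.
  have -> : xk k @^-1` B = \bigcup_(z in [set: int])
      ((fst @^-1` `[z%:~R / k.+1%:R, (z%:~R + 1) / k.+1%:R[%classic) `&`
       (snd @^-1` (x (z%:~R / k.+1%:R) @^-1` B))).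
    apply/seteqP; split=> -[u w] /=.
      move=> Bx; exists (Num.floor (k.+1%:R * u)) => //; split => //=.
      rewrite in_itv/= ler_pdivrMr// ltr_pdivlMr// [u * _]mulrC floor_le//.
      by rewrite -intrD1 floorD1_gt.
    move=> [z _ [/=]]; rewrite in_itv/= ler_pdivrMr// ltr_pdivlMr// [u * _]mulrC => zu.
    have -> : xk k (u, w) = x (z%:~R / k.+1%:R) w; last by [].
    rewrite /xk /fl /=; congr (x (_%:~R / _) w).
    by apply: floor_def; rewrite intrD1.
  apply: countable_bigcupT_measurable => [|z]; first exact: countableP.
  apply: measurableI.
    rewrite -[_ @^-1` _]setTI.
    exact: (@measurable_fst _ _ (measurableTypeR R) T measurableT _ (measurable_itv _)).
  rewrite -[_ @^-1` _]setTI; apply: (@measurable_snd _ _ (measurableTypeR R) T measurableT).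
  by rewrite -[_ @^-1` _]setTI; exact: mx.
- move=> [u w] _; rewrite /xk /=.
  have : fl k u @[k --> \oo] --> u.
    apply/cvgrPdist_le => e e0; near=> k.
    have k0 : 0 < k.+1%:R :> R by [].
    have : k.+1%:R^-1 <= e.
      by apply: ltW; near: k; exact: near_infty_natSinv_lt (PosNum e0).
    rewrite /fl; have := @floor_le R (k.+1%:R * u); have := @floorD1_gt R (k.+1%:R * u).
    rewrite intrD1; move: (Num.floor _)%:~R => z h1 h2 h3.
    have -> : u - z / k.+1%:R = (k.+1%:R * u - z) / k.+1%:R by field; rewrite gt_eqF.
    apply: le_trans h3; rewrite normrM [X in _ * X]gtr0_norm ?invr_gt0//.
    rewrite ler_piMl ?invr_ge0// ger0_norm; lra.
  by move=> /(cvg_comp _ _)/(_ (cx w u)).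
Unshelve. all: by end_near. Qed.

End joint_measurability.

Section parametrized_integrals.
Context {R : realType} {d : measure_display} {T : measurableType d}.

(** The integral is [fine] of a difference of two Tonelli integrals, each measurable in w, and
    [fine] is measurable; sample points with a non-integrable section are covered as well. *)
Lemma measurable_Rintegral_fst (D : set R) (g : measurableTypeR R * T -> R) :
  measurable (D : set (measurableTypeR R)) -> measurable_fun setT g ->
  measurable_fun setT (fun w => \int[lebesgue_measure]_(u in D) g (u, w)).
Proof.
move=> mD mg.
pose gD (p : measurableTypeR R * T) : R := \1_D p.1 * g p.
have mgD : measurable_fun setT gD.
  have mi : measurable_fun [set: measurableTypeR R] (\1_D : measurableTypeR R -> R).
    exact: measurable_indic.
  apply: measurable_funM => //.
  exact: (measurableT_comp mi (@measurable_fst _ _ _ _)).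
have pos_part (f : measurableTypeR R * T -> R) : measurable_fun setT f -> (forall p, 0 <= f p) ->
    measurable_fun setT (fun w => \int[lebesgue_measure]_u (f (u, w))%:E)%E.
  move=> mfn f0.
  apply: (@measurable_fun_fubini_tonelli_G _ _ _ _ _ lebesgue_measure (fun p => (f p)%:E)).
    by mf.
  by move=> p; rewrite lee_fin.
have m1 := pos_part _ (measurable_funrpos mgD) (funrpos_ge0 gD).
have m2 := pos_part _ (measurable_funrneg mgD) (funrneg_ge0 gD).
have E w : \int[lebesgue_measure]_(u in D) g (u, w) =
   fine (\int[lebesgue_measure]_u ((gD^\+)%R (u, w))%:E - \int[lebesgue_measure]_u ((gD^\-)%R (u, w))%:E)%E.
  rewrite /Rintegral integral_mkcond integralE; congr (fine (_ - _))%E.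
    apply: eq_integral => u _; rewrite funeposE /gD /funrpos patchE indicE.
    by case: (u \in D); rewrite ?mul1r ?mul0r EFin_max.
  apply: eq_integral => u _; rewrite funenegE /gD /funrneg patchE indicE.
  by case: (u \in D); rewrite ?mul1r ?mul0r ?oppr0 ?oppe0 EFin_max.
under eq_fun do rewrite E.
apply: (measurableT_comp (@fine_measurable _ setT _)) => //.
exact: emeasurable_funB.
Qed.

Lemma measurable_Rintegral_snd (P : probability T R) (g : measurableTypeR R * T -> R) :
  measurable_fun setT g ->
  measurable_fun [set: measurableTypeR R] (fun u => \int[P]_w g (u, w)).
Proof.
move=> mg.
have pos_part (f : measurableTypeR R * T -> R) : measurable_fun setT f -> (forall p, 0 <= f p) ->
    measurable_fun setT (fun u => \int[P]_w (f (u, w))%:E)%E.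
  move=> mfn f0.
  apply: (@measurable_fun_fubini_tonelli_F _ _ _ _ _ P (fun p => (f p)%:E)).
    by mf.
  by move=> p; rewrite lee_fin.
have m1 := pos_part _ (measurable_funrpos mg) (funrpos_ge0 g).
have m2 := pos_part _ (measurable_funrneg mg) (funrneg_ge0 g).
have E u : \int[P]_w g (u, w) =
   fine (\int[P]_w ((g^\+)%R (u, w))%:E - \int[P]_w ((g^\-)%R (u, w))%:E)%E.
  rewrite /Rintegral integralE; congr (fine (_ - _))%E.
    by apply: eq_integral => w _; rewrite funeposE /funrpos EFin_max.
  by apply: eq_integral => w _; rewrite funenegE /funrneg EFin_max.
under eq_fun do rewrite E.
apply: (measurableT_comp (@fine_measurable _ setT _)) => //.
exact: emeasurable_funB.
Qed.

End parametrized_integrals.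

Section progressive.
Context {R : realType} {d : measure_display} {Om : measurableType d}.
Variables (F : R -> set (set Om)).
Hypothesis filF : filtration F.

(** Progressive measurability; clamping time to [0, t] allows the condition to be stated on the
    whole product with R. *)
Definition progressive (y : R -> Om -> R) := forall t, 0 <= t ->
  measurable_fun [set: measurableTypeR R * SA (F t)]
    (fun p => y (Num.max 0 (Num.min p.1 t)) p.2).

Lemma progressive_continuous (y : R -> Om -> R) :
  (forall w, continuous (fun t : R => y (Num.max 0 t) w)) ->
  (forall t, 0 <= t -> gfun (F t) (y t)) -> progressive y.
Proof.
move=> cy gy t t0.
apply: (@continuous_joint_measurable R _ (SA (F t)) (fun u w => y (Num.max 0 (Num.min u t)) w)).
  move=> w u.
  exact: (continuous_comp (@continuous_minr R t u) (cy w (Num.min u t))).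
move=> u; apply: (gfun_filtration_le filF (s := Num.max 0 (Num.min u t))).
- by rewrite le_max lexx.
- by rewrite ge_max t0 ge_min lexx orbT.
- by apply: gy; rewrite le_max lexx.
Qed.

Lemma progressive_cst (c : R -> R) :
  measurable_fun [set: measurableTypeR R] (fun t : measurableTypeR R => c (Num.max 0 t)) ->
  progressive (fun t _ => c t).
Proof.
move=> mc t t0.
have mm : measurable_fun [set: measurableTypeR R] (fun u : measurableTypeR R => (Num.min u t : measurableTypeR R)).
  by apply: measurable_minr => //; exact: measurable_cst.
exact: (measurableT_comp (measurableT_comp mc mm) (@measurable_fst _ _ _ (SA (F t)))).
Qed.

Lemma progressiveD (y z : R -> Om -> R) : progressive y -> progressive z ->
  progressive (fun t w => y t w + z t w).
Proof. by move=> py pz t t0; apply: measurable_funD; [exact: py|exact: pz]. Qed.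

Lemma progressiveM (y z : R -> Om -> R) : progressive y -> progressive z ->
  progressive (fun t w => y t w * z t w).
Proof. by move=> py pz t t0; apply: measurable_funM; [exact: py|exact: pz]. Qed.

Lemma progressive_sum (I : Type) (r : seq I) (y : I -> R -> Om -> R) :
  (forall i, progressive (y i)) -> progressive (fun t w => \sum_(i <- r) y i t w).
Proof. by move=> py t t0; apply: measurable_sum => i; exact: py. Qed.

Lemma progressive_integral (y : R -> Om -> R) t : progressive y -> 0 <= t ->
  gfun (F t) (fun w => \int[lebesgue_measure]_(u in `[0, t]) y u w).
Proof.
move=> py t0.
have := @measurable_Rintegral_fst R _ (SA (F t)) `[0, t]%classic _ (measurable_itv _) (py t t0).
congr (measurable_fun _ _); apply/funext => w.
apply: eq_Rintegral => u; rewrite mem_setE in_itv/= => /andP[u0 ut].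
by rewrite min_l// max_r.
Qed.

Lemma progressive_joint (y : R -> Om -> R) t : progressive y -> 0 <= t ->
  measurable_fun [set: measurableTypeR R * Om] (fun p => y (Num.max 0 (Num.min p.1 t)) p.2).
Proof.
move=> py t0.
pose J (p : measurableTypeR R * Om) : measurableTypeR R * SA (F t) := (p.1, p.2).
have mJ : measurable_fun setT J.
  apply/measurable_fun_pairP; split; first exact: measurable_fst.
  move=> _ B mB; rewrite setTI.
  have mB' : measurable (B : set Om) := SA_measurable (filtration_measurable filF t0) mB.
  rewrite -[X in measurable X]setTI.
  exact: (@measurable_snd _ _ (measurableTypeR R) Om measurableT _ mB').
exact: (measurableT_comp (py t t0) mJ).
Qed.

Lemma progressive_path (y : R -> Om -> R) (t : R) (w : Om) : progressive y -> 0 <= t ->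
  measurable_fun (`[0, t]%classic : set (measurableTypeR R)) (fun u : measurableTypeR R => y u w).
Proof.
move=> py t0; have m := measurableT_comp (progressive_joint py t0) (@pair2_measurable _ _ (measurableTypeR R) Om w).
apply: (eq_measurable_fun (fun u : measurableTypeR R => y (Num.max 0 (Num.min u t)) w)).
  move=> u; rewrite mem_setE in_itv/= => /andP[u0 ut].
  by rewrite min_l// max_r.
exact: measurable_funTS m.
Qed.

(** Paths are continuous relative to [0, +oo[; composing with the retraction [Num.max 0] gives
    functions continuous on R. *)
Lemma continuous_paths_coord n (X : R -> Om -> 'cV[R]_n) w i :
  continuous_paths X -> continuous (fun t : R => X (Num.max 0 t) w i 0).
Proof.
move=> /(_ w) /subspace_continuousP cX t.
have m0 : `[0, +oo[%classic (Num.max 0 t) by rewrite /= in_itv/= andbT le_max lexx.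
have h1 : Num.max 0 u @[u --> t] --> within `[0, +oo[%classic (nbhs (Num.max 0 t)).
  move=> A wA.
  have : nbhs t [set u : R | `[0, +oo[%classic (Num.max 0 u) -> A (Num.max 0 u)].
    exact: @continuous_maxl R 0 t _ wA.
  apply: filterS => u /= h; apply: h.
  by rewrite in_itv/= andbT le_max lexx.
have h2 := cvg_comp _ _ (cX _ m0) (@coord_continuous _ _ _ i 0 (X (Num.max 0 t) w)).
exact: cvg_comp h1 h2.
Qed.

End progressive.

(** * Weighted expectations of convex functions *)

Section riemann_stieltjes.
Context {R : realType}.
Notation mu := (@lebesgue_measure R).

Lemma bounded_integrable (a b : R) (f : R -> R) (B : R) :
  measurable_fun (`[a, b]%classic : set (measurableTypeR R)) f ->
  (forall u, a <= u <= b -> `|f u| <= B) ->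
  mu.-integrable `[a, b] (EFin \o f).
Proof.
move=> mfn hB; apply: measurable_bounded_integrable => //.
  by apply: (@le_lt_trans _ _ (`|b - a|)%:E); rewrite ?ltry//;
    rewrite [X in (X <= _)%E](lebesgue_measure_itv `[a, b])/=; case: ifP => _;
    rewrite -?EFinD lee_fin ?ler_norm.
exists B; split; first exact: num_real.
by move=> x Bx u /=; rewrite in_itv/= => /hB /le_trans; apply; exact: ltW.
Qed.

Lemma Rintegral_increment_le (t a b K : R) (f : R -> R) :
  mu.-integrable `[0, t] (EFin \o f) -> 0 <= a -> a <= b -> b <= t ->
  (forall u, a <= u <= b -> `|f u| <= K) ->
  `|\int[mu]_(u in `[0, b]) f u - \int[mu]_(u in `[0, a]) f u| <= K * (b - a).
Proof.
move=> intf a0 ab bt hK.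
have intS (c e : itv_bound R) : (Interval c e <= `[0, t])%O ->
    mu.-integrable [set` Interval c e] (EFin \o f).
  by move=> h; apply: (integrableS _ _ _ intf) => //; exact: subitvP.
rewrite Rintegral_itvB; last 3 first.
- by apply: intS; rewrite subitvE !bnd_simp/=.
- by rewrite bnd_simp.
- by rewrite bnd_simp.
have intab : mu.-integrable `]a, b] (EFin \o f).
  by apply: intS; rewrite subitvE !bnd_simp/= bt a0.
apply: le_trans (le_normr_Rintegral _ intab) _ => //.
apply: (@le_trans _ _ (\int[mu]_(u in `]a, b]) K)).
  apply: le_Rintegral => //.
  - exact: integrable_norm.
  - apply: (@integrableS _ _ _ mu `[a, b]%classic) => //.
      by apply: subitvP; rewrite subitvE !bnd_simp/=.
    by apply: (@bounded_integrable _ _ (cst K) `|K|) => //; exact: measurable_cst.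
  - by move=> u /=; rewrite in_itv/= => /andP[au ub]; apply: hK; rewrite (ltW au).
rewrite Rintegral_cst// [X in fine X](lebesgue_measure_itv `]a, b])/= lte_fin.
move: ab; rewrite le_eqVlt => /predU1P[->|->]; last by rewrite -EFinB.
by rewrite ltxx subrr.
Qed.

(** On a cell, replacing x(u) by its value at the right end costs the oscillation of x times B times
    the length, and uniform continuity makes the total small. Right ends occur because the weights
    of the grid products are evaluated after each step. *)
Lemma riemann_stieltjes_sum (x c : R -> R) (t B e : R) : 0 < t -> continuous x ->
  measurable_fun (`[0, t]%classic : set (measurableTypeR R)) c ->
  (forall u, 0 <= u <= t -> `|c u| <= B) -> 0 < e ->
  \forall N \near \oo,
    `|\sum_(i < N.+1) x (t * i.+1%:R / N.+1%:R) *
       (\int[mu]_(u in `[0, t * i.+1%:R / N.+1%:R]) c u -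
        \int[mu]_(u in `[0, t * i%:R / N.+1%:R]) c u)
      - \int[mu]_(u in `[0, t]) (x u * c u)| <= e.
Proof.
move=> t0 cx mc hB e0.
have B0 : 0 <= B by apply: le_trans (hB 0 _) => //; rewrite lexx ltW.
have Bt : 0 < (B + 1) * t by rewrite mulr_gt0// ltr_wpDl.
(* [B + 1] keeps the denominator positive when B = 0. *)
pose eta := e / ((B + 1) * t); have eta0 : 0 < eta by rewrite divr_gt0.
have [dl dl0 hdl] := heine 0 t cx eta0.
have [K hK] := continuous_bounded 0 t cx.
have mx : measurable_fun (`[0, t]%classic : set (measurableTypeR R)) x.
  by apply: measurable_funTS; exact: continuous_measurable_funR.
have intc := bounded_integrable mc hB.
have intxc : mu.-integrable `[0, t] (EFin \o (fun u => x u * c u)).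
  apply: (@bounded_integrable _ _ _ (K * B)); first exact: measurable_funM.
  by move=> u ut; rewrite normrM ler_pM// ?hK ?hB.
near=> N.
have N0 : 0 < N.+1%:R :> R by [].
have mesh : t / N.+1%:R <= dl.
  have : N.+1%:R^-1 <= dl / t.
    apply: ltW; near: N.
    by apply: (near_infty_natSinv_lt (PosNum (divr_gt0 dl0 t0))).
  by rewrite ler_pdivlMr// mulrC.
pose T (i : nat) : R := t * i%:R / N.+1%:R.
have T0 : T 0%N = 0 by rewrite /T mulr0 mul0r.
have TN : T N.+1 = t by rewrite /T -mulrA divff ?mulr1// gt_eqF.
have TS i : T i <= T i.+1.
  by rewrite /T ler_pM2r ?invr_gt0// ler_pM2l// ler_nat.
have Tge0 i : 0 <= T i by rewrite /T; pos.
have Tt (i : nat) : (i <= N.+1)%N -> T i <= t.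
  by move=> iN; rewrite -[leRHS]TN /T ler_pM2r ?invr_gt0// ler_pM2l// ler_nat.
have TD i : T i.+1 - T i = t / N.+1%:R.
  by rewrite /T -mulrBl -mulrBr -natrB// subSnn mulr1.
have key (k : nat) : (k <= N.+1)%N ->
  `|\sum_(i < k) x (T i.+1) *
       (\int[mu]_(u in `[0, T i.+1]) c u - \int[mu]_(u in `[0, T i]) c u)
      - \int[mu]_(u in `[0, T k]) (x u * c u)| <= eta * B * T k.
  elim: k => [_|k IH kN].
    by rewrite big_ord0 T0 set_itv1 Rintegral_set1 subrr normr0 mulr0.
  rewrite big_ord_recr/=.
  set S := \sum_(_ < _) _; set C1 := \int[mu]_(u in `[0, T k.+1]) c u.
  set C0 := \int[mu]_(u in `[0, T k]) c u.
  set X1 := \int[mu]_(u in `[0, T k.+1]) (x u * c u).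
  have := IH (ltnW kN); rewrite -/S; set X0 := \int[mu]_(u in `[0, T k]) (x u * c u) => h.
  have -> : S + x (T k.+1) * (C1 - C0) - X1 =
    (S - X0) + (x (T k.+1) * (C1 - C0) - (X1 - X0)) by ring.
  apply: le_trans (ler_normD _ _) _.
  have -> : eta * B * T k.+1 = eta * B * T k + eta * B * (T k.+1 - T k) by ring.
  apply: lerD => //.
  have sub (a : R) : a <= t -> (`[0, a]%classic : set R) `<=` `[0, t]%classic.
    by move=> at_; apply: subitvP; rewrite subitvE !bnd_simp/=.
  have ic (a : R) : a <= t -> mu.-integrable `[0, a] (EFin \o c).
    by move=> at_; apply: (@integrableS _ _ _ mu `[0, t]%classic) => //; exact: sub.
  have ixc (a : R) : a <= t -> mu.-integrable `[0, a] (EFin \o (fun u => x u * c u)).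
    by move=> at_; apply: (@integrableS _ _ _ mu `[0, t]%classic) => //; exact: sub.
  have iZ (a : R) : a <= t -> mu.-integrable `[0, a] (EFin \o (fun u => x (T k.+1) * c u)).
    move=> at_; apply: (@integrableS _ _ _ mu `[0, t]%classic) => //; first exact: sub.
    apply: (@bounded_integrable _ _ _ (`|x (T k.+1)| * B)).
      by apply: measurable_funM => //; exact: measurable_cst.
    by move=> u ut; rewrite normrM ler_wpM2l// hB.
  have lin (a : R) : a <= t -> \int[mu]_(u in `[0, a]) (x (T k.+1) * c u - x u * c u) =
     x (T k.+1) * \int[mu]_(u in `[0, a]) c u - \int[mu]_(u in `[0, a]) (x u * c u).
    by move=> at_; rewrite RintegralB ?RintegralZl ?ic ?ixc ?iZ.
  have -> : x (T k.+1) * (C1 - C0) - (X1 - X0) =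
     \int[mu]_(u in `[0, T k.+1]) (x (T k.+1) * c u - x u * c u) -
     \int[mu]_(u in `[0, T k]) (x (T k.+1) * c u - x u * c u).
    rewrite !lin ?Tt// ?(ltnW kN)//; rewrite /X1 /X0 /C1 /C0; ring.
  apply: (@Rintegral_increment_le t) => //; last 2 first.
  - exact: Tt.
  - move=> u /andP[au ub]; rewrite -mulrBl normrM ler_pM// ?hB//.
    + rewrite distrC; have := hdl (T k.+1) u; rewrite Tge0 Tt//= => /(_ isT); apply.
      rewrite distrC ger0_norm ?subr_ge0//; apply: le_trans mesh; rewrite -(TD k).
      by rewrite lerD2l lerN2.
    + by rewrite (le_trans (Tge0 k))//= (le_trans ub)// Tt.
  apply: (@bounded_integrable _ _ _ (`|x (T k.+1)| * B + K * B)).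
    by apply: measurable_funB; apply: measurable_funM => //; exact: measurable_cst.
  move=> u ut; apply: le_trans (ler_normB _ _) _.
  by rewrite !normrM lerD ?ler_wpM2l ?ler_pM// ?hB// hK.
have := key N.+1 (leqnn _); rewrite TN => /le_trans; apply.
rewrite /eta; have -> : e / ((B + 1) * t) * B * t = e * (B / (B + 1)).
  by field; rewrite !gt_eqF// ltr_wpDl.
apply: ler_piMr; first exact: ltW.
by rewrite ler_pdivrMr ?ltr_wpDl// mul1r lerDl.
Unshelve. all: by end_near. Qed.

End riemann_stieltjes.

(** * From products of tangent weights to an exponential *)

Section exponential_weights.
Context {R : realType} {n : nat}.
Notation mu := (@lebesgue_measure R).

(** Turns a factor 1 - x into an exponential at the cost of a square. After inversion the claim is 1
    <= e^(x + x^2) (1 - x): the quadratic bound of the exponential suffices for x >= 0, the linear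
    one for x < 0. *)
Lemma expR_NBsqr_le (x : R) : `|x| <= 2^-1 -> expR (- x - x ^+ 2) <= 1 - x.
Proof.
move=> hx; have [x1 x2] : - 2^-1 <= x /\ x <= 2^-1 by move: hx; rewrite ler_norml => /andP[].
rewrite -opprD expRN -[leRHS]invrK lef_pV2 ?posrE ?expR_gt0 ?invr_gt0//; last lra.
have x10 : 0 < 1 - x by lra.
rewrite -[leLHS]mul1r ler_pdivrMr//.
case: (leP 0 x) => x0.
  have := expR_ge_quadratic (addr_ge0 x0 (sqr_ge0 x)).
  move: (expR _) => E hE; apply: (@le_trans _ _ ((1 + (x + x ^+ 2) + (x + x ^+ 2) ^+ 2 / 2) * (1 - x))).
    have -> : (1 + (x + x ^+ 2) + (x + x ^+ 2) ^+ 2 / 2) * (1 - x) =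
      1 + x ^+ 2 / 2 * (1 - x - x ^+ 2 - x ^+ 3) by field.
    have x22 : x ^+ 2 <= 4^-1 by rewrite expr2; nra.
    have x33 : x ^+ 3 <= 8^-1.
      by rewrite exprS; have := sqr_ge0 x; nra.
    rewrite lerDl mulr_ge0 ?divr_ge0 ?sqr_ge0//; lra.
  by rewrite ler_wpM2r// ltW.
have := expR_ge1Dx (x + x ^+ 2); move: (expR _) => E hE.
apply: (@le_trans _ _ ((1 + (x + x ^+ 2)) * (1 - x))).
  have -> : (1 + (x + x ^+ 2)) * (1 - x) = 1 + x ^+ 2 * (- x) by ring.
  by rewrite lerDl mulr_ge0 ?sqr_ge0// oppr_ge0 ltW.
by rewrite ler_wpM2r// ltW.
Qed.

(** [q j] stands for the j-th partial derivative of log psi, and [psi_convex] is the tangent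
    inequality of a convex psi at v. *)
Variables (psi : 'cV[R]_n -> R) (q : 'I_n -> 'cV[R]_n -> R).
Hypothesis psi_gt0 : forall v, 0 < psi v.
Hypothesis psi_convex : forall v a : 'cV[R]_n, psi v * (1 - \sum_j q j v * a j 0) <= psi (v - a).

Definition grid (t : R) (N i : nat) : R := t * i%:R / N.+1%:R.

(** By the tangent inequality the i-th factor is at least 1 - x_i, where x_i pairs q at the right
    end with the drift increment. The x_i add up to a Riemann-Stieltjes sum, their squares to
    O(1/N). *)
Lemma prod_weights_ge (y b : R -> 'cV[R]_n) (t B e : R) : 0 < t ->
  (forall j, continuous (fun u : R => q j (y (Num.max 0 u)))) ->
  (forall j, measurable_fun (`[0, t]%classic : set (measurableTypeR R)) (fun u => b u j 0)) ->
  (forall u j, 0 <= u <= t -> `|b u j 0| <= B) -> 0 < e ->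
  \forall N \near \oo,
    expR (- (\sum_j \int[mu]_(u in `[0, t]) (q j (y u) * b u j 0)) - e) <=
    \prod_(i < N.+1) (psi (y (grid t N i.+1) -
       \col_j (\int[mu]_(u in `[0, grid t N i.+1]) b u j 0 -
               \int[mu]_(u in `[0, grid t N i]) b u j 0)) / psi (y (grid t N i.+1))).
Proof.
move=> t0 cq mb hB e0.
have [K hK] : exists K, forall j u, 0 <= u <= t -> `|q j (y u)| <= K.
  have /choice[K hK] j := continuous_bounded 0 t (cq j).
  exists (\sum_j `|K j|) => j u ut; rewrite (bigD1 j)//=.
  have /andP[u0 _] := ut.
  apply: (@le_trans _ _ `|K j|).
    by apply: le_trans (ler_norm _); have := hK j u ut; rewrite max_r.
  by rewrite lerDl; apply: sumr_ge0 => i _; pos.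
have BK (j : 'I_n) : 0 <= B /\ 0 <= K.
  split; first by apply: le_trans (hB 0 j _) => //; rewrite lexx ltW.
  by apply: le_trans (hK j 0 _) => //; rewrite lexx ltW.
pose D := \sum_(j < n) K * B * t.
have D0 : 0 <= D by rewrite /D; apply: sumr_ge0 => j _; have [? ?] := BK j; pos.
(* The n coordinates share e / 2; [n.+1] also covers n = 0. *)
pose e1 := e / 2 / n.+1%:R; have e10 : 0 < e1 by rewrite !divr_gt0.
have rs : \forall N \near \oo, forall j : 'I_n,
    `|\sum_(i < N.+1) q j (y (Num.max 0 (t * i.+1%:R / N.+1%:R))) *
       (\int[mu]_(u in `[0, t * i.+1%:R / N.+1%:R]) b u j 0 -
        \int[mu]_(u in `[0, t * i%:R / N.+1%:R]) b u j 0)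
      - \int[mu]_(u in `[0, t]) (q j (y (Num.max 0 u)) * b u j 0)| <= e1.
  apply: filter_forall => j.
  by apply: (riemann_stieltjes_sum t0 (cq j) (mb j) (B := B)) => // u ut; exact: hB.
have small (c : R) : 0 < c -> \forall N \near \oo, N.+1%:R^-1 <= c.
  by move=> c0; apply: filterS (near_infty_natSinv_lt (PosNum c0)) => k /ltW.
(* 1/(N+1) <= [c1] forces |x_i| <= 1/2, and 1/(N+1) <= [c2] forces the sum of the squares to be at
   most e / 2. *)
pose c1 := (2 * (D + 1))^-1; have c10 : 0 < c1 by rewrite invr_gt0 mulr_gt0// ltr_wpDl.
pose c2 := e / (2 * (D ^+ 2 + 1)).
have D20 : 0 < D ^+ 2 + 1 by rewrite ltr_wpDl// sqr_ge0.
have c20 : 0 < c2 by rewrite divr_gt0// mulr_gt0.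
near=> N.
have N0 : 0 < N.+1%:R :> R by [].
have NV0 : 0 < N.+1%:R^-1 :> R by rewrite invr_gt0.
have N1 : N.+1%:R^-1 <= c1 by near: N; exact: small.
have N2 : N.+1%:R^-1 <= c2 by near: N; exact: small.
have rsN : forall j : 'I_n,
    `|\sum_(i < N.+1) q j (y (Num.max 0 (t * i.+1%:R / N.+1%:R))) *
       (\int[mu]_(u in `[0, t * i.+1%:R / N.+1%:R]) b u j 0 -
        \int[mu]_(u in `[0, t * i%:R / N.+1%:R]) b u j 0)
      - \int[mu]_(u in `[0, t]) (q j (y (Num.max 0 u)) * b u j 0)| <= e1.
  by near: N; exact: rs.
have g0 i : 0 <= grid t N i by rewrite /grid; pos.
have gS i : grid t N i <= grid t N i.+1.
  by rewrite /grid ler_pM2r// ler_pM2l// ler_nat.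
have gt (i : nat) : (i <= N.+1)%N -> grid t N i <= t.
  by move=> iN; rewrite /grid ler_pdivrMr// ler_pM2l// ler_nat.
pose dA i j := \int[mu]_(u in `[0, grid t N i.+1]) b u j 0 -
               \int[mu]_(u in `[0, grid t N i]) b u j 0.
pose x i := \sum_j q j (y (grid t N i.+1)) * dA i j.
have xle (i : 'I_N.+1) : `|x i| <= D / N.+1%:R.
  rewrite /x /D mulr_suml; apply: le_trans (ler_norm_sum _ _ _) _.
  apply: ler_sum => j _; rewrite normrM -!mulrA; apply: ler_pM => //.
    by apply: hK; rewrite g0 gt.
  have intb : mu.-integrable `[0, t] (EFin \o (fun u => b u j 0)).
    by apply: (@bounded_integrable _ _ _ _ B) => // u ut; exact: hB.
  apply: le_trans (Rintegral_increment_le (K := B) intb (g0 i) (gS i) (gt _ _) _) _ => //.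
    move=> u /andP[u1 u2]; apply: hB; rewrite (le_trans (g0 i) u1)/=.
    by apply: le_trans u2 (gt _ _).
  by rewrite /grid -mulrBl -mulrBr -natrB// subSnn mulr1.
have x2 (i : 'I_N.+1) : `|x i| <= 2^-1.
  apply: le_trans (xle i) _; apply: (@le_trans _ _ (D * c1)); first by rewrite ler_wpM2l.
  rewrite /c1 invfM mulrCA ler_piMr// ler_pdivrMr ?ltr_wpDl// mul1r lerDl//.
apply: (@le_trans _ _ (\prod_(i < N.+1) expR (- x i - x i ^+ 2))); last first.
  apply: ler_prod => i _; rewrite expR_ge0/=.
  apply: le_trans (expR_NBsqr_le (x2 i)) _.
  rewrite ler_pdivlMr// mulrC; apply: le_trans (psi_convex _ _).
  rewrite le_eqVlt; apply/orP; left; apply/eqP; congr (_ * (_ - _)).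
  by apply: eq_bigr => j _; rewrite mxE.
rewrite -expR_sum ler_expR sumrB sumrN.
have h1 : \sum_(i < N.+1) x i <= \sum_j \int[mu]_(u in `[0, t]) (q j (y u) * b u j 0) + e / 2.
  rewrite /x exchange_big/=.
  have -> : e / 2 = \sum_(j < n) e1 + e1.
    by rewrite sumr_const card_ord -mulrSr -[RHS]mulr_natr /e1 divfK// pnatr_eq0.
  rewrite addrA -big_split/=; apply: ler_wpDr; first exact: ltW.
  apply: ler_sum => j _; have := rsN j; rewrite ler_norml => /andP[_].
  rewrite lerBlDl => h; apply: le_trans (le_trans h _).
    rewrite le_eqVlt; apply/orP; left; apply/eqP; apply: eq_bigr => i _.
    by rewrite max_r//; exact: g0.
  rewrite lerD2r le_eqVlt; apply/orP; left; apply/eqP; apply: eq_Rintegral => u.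
  by rewrite mem_setE in_itv/= => /andP[u0 _]; rewrite max_r.
have h2 : \sum_(i < N.+1) x i ^+ 2 <= e / 2.
  apply: (@le_trans _ _ (\sum_(i < N.+1) (D / N.+1%:R) ^+ 2)).
    apply: ler_sum => i _; rewrite -[leLHS]real_normK ?num_real// ler_sqr ?nnegrE//.
    by rewrite divr_ge0.
  rewrite sumr_const card_ord -[leLHS]mulr_natr.
  have -> : (D / N.+1%:R) ^+ 2 * N.+1%:R = D ^+ 2 * N.+1%:R^-1 by field; rewrite gt_eqF.
  apply: (@le_trans _ _ (D ^+ 2 * c2)); first by rewrite ler_wpM2l// sqr_ge0.
  have -> : D ^+ 2 * c2 = e / 2 * (D ^+ 2 / (D ^+ 2 + 1)) by rewrite /c2; field; rewrite gt_eqF.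
  apply: ler_piMr; first by rewrite divr_ge0// ltW.
  by rewrite ler_pdivrMr// mul1r lerDl.
have := lerD h1 h2; rewrite -addrA -splitr => h3.
by rewrite -[leLHS]opprD -[leRHS]opprD lerN2.
Unshelve. all: by end_near. Qed.

End exponential_weights.

(** * Hyperbolic sine and cosine *)

Section hyperbolic.
Context {R : realType}.
Implicit Types x y a c la : R.

Definition sh x := (expR x - expR (- x)) / 2.
Definition ch x := (expR x + expR (- x)) / 2.

Lemma ch_ge1 x : 1 <= ch x.
Proof. by rewrite /ch; have := expRD_expRN_ge x; have := sqr_ge0 x; lra. Qed.

Lemma ch_norm x : ch `|x| = ch x.
Proof. by case: (ger0P x) => // _; rewrite /ch opprK addrC. Qed.

Lemma sh_norm x : 0 <= x -> 0 <= sh x.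
Proof.
move=> x0; rewrite /sh divr_ge0// subr_ge0 ler_expR; lra.
Qed.

Lemma sh_norm_mul la y : 0 < la -> sh (la * y) * y = sh (la * `|y|) * `|y|.
Proof.
by move=> la0; case: (ger0P y) => // _; rewrite /sh [la * - y]mulrN opprK; ring.
Qed.

Lemma norm_sh la y : 0 < la -> `|sh (la * y)| = sh (la * `|y|).
Proof.
move=> la0; case: (ger0P y) => y0.
  by rewrite ger0_norm// sh_norm// mulr_ge0// ltW.
have h : 0 <= sh (la * - y) by apply: sh_norm; rewrite mulr_ge0 ?oppr_ge0// ltW.
have -> : sh (la * y) = - sh (la * - y) by rewrite /sh mulrN opprK; ring.
by rewrite normrN ger0_norm.
Qed.

Lemma sh_le x y : x <= y -> sh x <= sh y.
Proof. by move=> xy; rewrite /sh ler_pM2r ?invr_gt0// lerB// ler_expR// lerN2. Qed.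

Lemma ch_le x y : 0 <= x -> x <= y -> ch x <= ch y.
Proof.
move=> x0 xy; rewrite /ch ler_pM2r ?invr_gt0// -subr_ge0.
have -> : expR y + expR (- y) - (expR x + expR (- x)) =
    (expR y - expR x) * (1 - expR (- x) * expR (- y)).
  have ex : expR x * expR (- x) = 1 by rewrite -expRD subrr expR0.
  have ey : expR y * expR (- y) = 1 by rewrite -expRD subrr expR0.
  rewrite mulrBl !mulrBr !mulr1 [expR (- x) * _]mulrC !mulrA ey mul1r.
  by rewrite mulrAC ex mul1r; ring.
apply: mulr_ge0; first by rewrite subr_ge0 ler_expR.
by rewrite subr_ge0 -expRD expR_le1//; lra.
Qed.

(** By monotonicity the larger of a and c, paired with itself, dominates the mixed product. This
    absorbs the off-diagonal entries of the drift matrix. *)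
Lemma sh_cross la a c : 0 < la -> 0 <= a -> 0 <= c ->
  sh (la * a) * c <= sh (la * a) * a + sh (la * c) * c.
Proof.
move=> la0 a0 c0.
have sa : 0 <= sh (la * a) by apply: sh_norm; rewrite mulr_ge0// ltW.
have sc : 0 <= sh (la * c) by apply: sh_norm; rewrite mulr_ge0// ltW.
have [ca|ac] := leP c a.
  apply: (@le_trans _ _ (sh (la * a) * a)); first exact: ler_wpM2l.
  by rewrite lerDl mulr_ge0.
apply: (@le_trans _ _ (sh (la * c) * c)); last by rewrite lerDr mulr_ge0.
by rewrite ler_wpM2r// sh_le// ler_wpM2l ?ltW.
Qed.

(** Recovers the cosine from the sine up to a shift: with x = la a one has ch x - sh x = e^(-x) and
    x e^(-x) <= 1 <= ch x. *)
Lemma ch_sh la a : 0 < la -> 0 <= a -> (a - la^-1) * ch (la * a) <= sh (la * a) * a.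
Proof.
move=> la0 a0; set x := la * a.
have x0 : 0 <= x by rewrite mulr_ge0// ltW.
rewrite -(ler_pM2l la0).
have -> : la * ((a - la^-1) * ch x) = (x - 1) * ch x by rewrite /x; field; rewrite gt_eqF.
have -> : la * (sh x * a) = x * sh x by rewrite /x; ring.
have h1 : x * expR (- x) <= 1.
  rewrite expRN ler_pdivrMr ?expR_gt0// mul1r; have := expR_ge1Dx x; lra.
have h2 := ch_ge1 x.
have -> : sh x = ch x - expR (- x) by rewrite /sh /ch; field.
nra.
Qed.

Lemma ch_sh_cross la a c : 0 < la -> 0 <= a -> 0 <= c ->
  (a - la^-1) * ch (la * c) <= sh (la * a) * a + sh (la * c) * c.
Proof.
move=> la0 a0 c0.
have sa : 0 <= sh (la * a) * a by rewrite mulr_ge0// sh_norm// mulr_ge0// ltW.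
have sc : 0 <= sh (la * c) * c by rewrite mulr_ge0// sh_norm// mulr_ge0// ltW.
have [al|al] := leP a la^-1.
  apply: (@le_trans _ _ 0); last exact: addr_ge0.
  apply: mulr_le0_ge0; first by rewrite subr_le0.
  exact: le_trans (ch_ge1 _).
have [ca|ac] := leP c a.
  apply: (@le_trans _ _ (sh (la * a) * a)); last by rewrite lerDl.
  apply: le_trans (ch_sh la0 a0); rewrite ler_wpM2l ?subr_ge0 ?(ltW al)//.
  by rewrite ch_le ?mulr_ge0 ?(ltW la0)// ler_wpM2l// ltW.
apply: (@le_trans _ _ (sh (la * c) * c)); last by rewrite lerDr.
apply: le_trans (ch_sh la0 c0); rewrite ler_wpM2r ?lerD2r ?(ltW ac)//.
exact: le_trans (ch_ge1 _).
Qed.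

Lemma expR_sub_ge x h : expR x * (1 - h) <= expR (x - h).
Proof. by rewrite expRD ler_pM2l ?expR_gt0//; exact: (expR_ge1Dx (- h)). Qed.

End hyperbolic.

(** * Grid products with a drift-cancelling weight *)

Section weighted_expectation.
Context {R : realType} {n : nat} {d : measure_display} {Om : measurableType d}.
Notation mu := (@lebesgue_measure R).
Variables (P : probability Om R) (F : R -> set (set Om)).
Hypothesis filF : filtration F.
Variables (psi : 'cV[R]_n -> R) (q : 'I_n -> 'cV[R]_n -> R).
Hypothesis psi_gt0 : forall v, 0 < psi v.
Hypothesis psi_convex : forall v a : 'cV[R]_n, psi v * (1 - \sum_j q j v * a j 0) <= psi (v - a).
Hypothesis psi_measurable : forall d' (T : measurableType d') (Z : T -> 'cV[R]_n),
  (forall j, measurable_fun setT (fun w => Z w j 0)) ->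
  measurable_fun setT (fun w => psi (Z w)).
Variables (Y b : R -> Om -> 'cV[R]_n) (K : R -> R).
Hypothesis gY : forall t j, 0 <= t -> gfun (F t) (fun w => Y t w j 0).
Hypothesis gA : forall t j, 0 <= t -> gfun (F t) (fun w => time_integral b t w j 0).
Hypothesis cq : forall w j, continuous (fun u : R => q j (Y (Num.max 0 u) w)).
Hypothesis mb : forall w j (t : R), 0 <= t ->
  measurable_fun (`[0, t]%classic : set (measurableTypeR R)) (fun u => b u w j 0).
Hypothesis hB : forall w t, exists B, forall u j, 0 <= u <= t -> `|b u w j 0| <= B.
(** Growth of psi when Y_s is moved by the noise increment alone; U will carry the weights
    accumulated up to time s. *)
Hypothesis one_step : forall s t, 0 <= s -> s <= t ->
  forall U : Om -> R, gfun (F s) U -> (forall w, 0 <= U w) ->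
  (\int[P]_w (U w * psi (Y s w + ((Y t w - time_integral b t w) -
       (Y s w - time_integral b s w))))%:E <=
   (expR (K t - K s))%:E * \int[P]_w (U w * psi (Y s w))%:E)%E.

(* Along a grid, the weight psi(Y_(i+1) - a_i) / psi(Y_(i+1)), with a_i the drift over the
   i-th step, cancels that step's drift and is close to exp(- sum_j q_j a_i). *)
Lemma weighted_expectation_le (t : R) (g : Om -> R) : 0 < t ->
  measurable_fun setT g -> (forall w, 0 <= g w) ->
  (forall w, g w <= psi (Y t w) *
     expR (- (\sum_j \int[mu]_(u in `[0, t]) (q j (Y u w) * b u w j 0)))) ->
  (\int[P]_w (g w)%:E <= (expR (K t - K 0))%:E * \int[P]_w (psi (Y 0 w))%:E)%E.
Proof.
move=> t0 mg g0 gle.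
pose T := grid t.
have Tge0 N i : 0 <= T N i.
  by rewrite /T /grid; apply: divr_ge0 => //; apply: mulr_ge0 => //; exact: ltW.
have TS N i : T N i <= T N i.+1.
  by rewrite /T /grid ler_pM2r ?invr_gt0// ler_pM2l// ler_nat.
pose r N i w : R := psi (Y (T N i.+1) w -
       \col_j (\int[mu]_(u in `[0, T N i.+1]) b u w j 0 -
               \int[mu]_(u in `[0, T N i]) b u w j 0)) / psi (Y (T N i.+1) w).
have rE N i w : r N i w = psi (Y (T N i) w + ((Y (T N i.+1) w - time_integral b (T N i.+1) w) -
       (Y (T N i) w - time_integral b (T N i) w))) / psi (Y (T N i.+1) w).
  rewrite /r; congr (psi _ / _); apply/matrixP => j l; rewrite !mxE; ring.
have r0 N i w : 0 <= r N i w by rewrite /r divr_ge0// ltW.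
have gr N i : gfun (F (T N i.+1)) (r N i).
  apply: (@measurable_funM _ (SA (F (T N i.+1)))).
    apply: psi_measurable => j; under eq_fun do rewrite !mxE.
    have gA1 := gA j (Tge0 N i.+1).
    have gA0 := gfun_filtration_le filF (Tge0 N i) (TS N i) (gA j (Tge0 N i)).
    apply: (@measurable_funB _ (SA (F (T N i.+1)))); first exact: gY.
    apply: (@measurable_funB _ (SA (F (T N i.+1)))).
      by move: gA1; congr (measurable_fun _ _); apply/funext => w; rewrite mxE.
    by move: gA0; congr (measurable_fun _ _); apply/funext => w; rewrite mxE.
  have gpsi : gfun (F (T N i.+1)) (fun w => psi (Y (T N i.+1) w)).
    by apply: psi_measurable => j; exact: gY.
  under eq_fun do rewrite -powR_inv1 ?(ltW (psi_gt0 _))//.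
  exact: (measurableT_comp (@measurable_powR R (-1)) gpsi).
pose Pi N k w : R := \prod_(i < k) r N i w.
have Pi0 N k w : 0 <= Pi N k w by apply: prodr_ge0.
have gPi N k : gfun (F (T N k)) (Pi N k).
  elim: k => [|k IH].
    rewrite (_ : Pi N 0%N = fun=> 1); first exact: measurable_cst.
    by apply/funext => w; rewrite /Pi big_ord0.
  rewrite (_ : Pi N k.+1 = fun w => Pi N k w * r N k w); last first.
    by apply/funext => w; rewrite /Pi big_ord_recr.
  apply: (@measurable_funM _ (SA (F (T N k.+1)))) => //.
  exact: (gfun_filtration_le filF (Tge0 N k) (TS N k)).
have T0 N : T N 0%N = 0 by rewrite /T /grid mulr0 mul0r.
have TN N : T N N.+1 = t by rewrite /T /grid -mulrA divff ?mulr1// gt_eqF.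
(* Multiplied by psi at the right end, the last weight leaves psi of the left value plus the noise
   increment, so [one_step] applies with U the product of the earlier weights. *)
have main N k : (\int[P]_w (Pi N k w * psi (Y (T N k) w))%:E <=
    (expR (K (T N k) - K 0))%:E * \int[P]_w (psi (Y 0 w))%:E)%E.
  elim: k => [|k IH].
    rewrite T0 subrr expR0 mul1e.
    by under eq_integral do rewrite /Pi big_ord0 mul1r.
  have e1 w : Pi N k.+1 w * psi (Y (T N k.+1) w) = Pi N k w *
      psi (Y (T N k) w + ((Y (T N k.+1) w - time_integral b (T N k.+1) w) -
       (Y (T N k) w - time_integral b (T N k) w))).
    by rewrite /Pi big_ord_recr/= rE -!mulrA mulVf ?mulr1// gt_eqF.
  under eq_integral do rewrite e1.
  apply: le_trans (one_step (Tge0 N k) (TS N k) (gPi N k) (Pi0 N k)) _.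
  apply: le_trans (lee_wpmul2l _ IH) _; first by rewrite lee_fin expR_ge0.
  by rewrite muleA -EFinM -expRD addrA subrK.
have mY0 N : measurable_fun setT (fun w => psi (Y (T N N.+1) w)).
  apply: psi_measurable => j.
  by apply: (gfun_measurable (filtration_measurable filF (Tge0 N N.+1))); exact: gY.
apply: (fatou_EFin_le (fk := fun N w => Pi N N.+1 w * psi (Y (T N N.+1) w))) => //.
- move=> N; apply: measurable_funM => //.
  exact: (gfun_measurable (filtration_measurable filF (Tge0 N N.+1))).
- by move=> N w; rewrite mulr_ge0// ltW.
- move=> w e e0.
  pose a := psi (Y t w) * expR (- (\sum_j \int[mu]_(u in `[0, t]) (q j (Y u w) * b u w j 0))).
  have a0 : 0 < a by rewrite mulr_gt0// expR_gt0.
  have [B hBw] := hB w t.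
  have cqw : forall j, continuous (fun u : R => q j (Y (Num.max 0 u) w)) by move=> j; exact: cq.
  have := @prod_weights_ge _ _ _ _ psi_gt0 psi_convex (fun u => Y u w) (fun u => b u w) t B (e / a) t0 cqw
    (fun j => mb w j (ltW t0)) hBw (divr_gt0 e0 a0).
  apply: filterS => N hN; rewrite TN mulrC.
  apply: le_trans (ler_wpM2l (ltW (psi_gt0 (Y t w))) hN).
  rewrite expRD mulrA -/a; apply: le_trans (lerB (gle w) (lexx e)) _; rewrite -/a.
  have := expR_ge1Dx (- (e / a)); move: (expR _) => E hE.
  have -> : a - e = a * (1 - e / a) by field; rewrite gt_eqF.
  by rewrite ler_wpM2l// ltW.
- by move=> N; have := main N N.+1; rewrite TN.
Qed.

End weighted_expectation.

(** * Covariances of laws *)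

Section finite_sums_of_integrals.
Context {d : measure_display} {T : measurableType d} {R : realType}.
Variables (mu : {measure set T -> \bar R}) (D : set T).
Hypothesis mD : measurable D.

Lemma integrable_scaleR (k : R) (f : T -> R) : mu.-integrable D (EFin \o f) ->
  mu.-integrable D (EFin \o (fun x => k * f x)).
Proof.
move=> fi; rewrite (_ : _ \o _ = (fun x => k%:E * (f x)%:E)%E); last by apply/funext.
exact: (integrableZl mD).
Qed.

Lemma integrable_sumR (I : Type) (s : seq I) (f : I -> T -> R) :
  (forall i, mu.-integrable D (EFin \o f i)) ->
  mu.-integrable D (EFin \o (fun x => \sum_(i <- s) f i x)).
Proof.
move=> fi; rewrite (_ : _ \o _ = (fun x => \sum_(i <- s) (f i x)%:E)%E).
  by apply: integrable_sum => // i _; exact: fi.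
by apply/funext => x; rewrite /= sumEFin.
Qed.

Lemma Rintegral_sum (I : Type) (s : seq I) (f : I -> T -> R) :
  (forall i, mu.-integrable D (EFin \o f i)) ->
  \int[mu]_(x in D) (\sum_(i <- s) f i x) = \sum_(i <- s) \int[mu]_(x in D) f i x.
Proof.
move=> fi; elim: s => [|i s IH].
  by rewrite big_nil; under eq_Rintegral do rewrite big_nil; rewrite /Rintegral integral0.
rewrite big_cons -IH; under eq_Rintegral do rewrite big_cons.
by rewrite RintegralD//; exact: integrable_sumR.
Qed.

End finite_sums_of_integrals.

Section second_moments.
Context {d : measure_display} {Om : measurableType d} {R : realType}.
Variable P : probability Om R.
Implicit Types f g : Om -> R.

Lemma sqr_integrable f : measurable_fun setT f ->
  (\int[P]_w (f w ^+ 2)%:E < +oo)%E -> P.-integrable setT (EFin \o (fun w => f w ^+ 2)).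
Proof.
move=> mfn fin; apply/integrableP; split; first by apply/measurable_EFinP; mf.
apply: le_lt_trans fin; rewrite le_eqVlt; apply/orP; left; apply/eqP.
by apply: eq_integral => w _ /=; rewrite ger0_norm// sqr_ge0.
Qed.

Lemma prod_integrable f g : measurable_fun setT f -> measurable_fun setT g ->
  (\int[P]_w (f w ^+ 2)%:E < +oo)%E -> (\int[P]_w (g w ^+ 2)%:E < +oo)%E ->
  P.-integrable setT (EFin \o (fun w => f w * g w)).
Proof.
move=> mfn mg ff fg; apply/integrableP; split; first by apply/measurable_EFinP; mf.
apply: (@le_lt_trans _ _ (\int[P]_w (f w ^+ 2 + g w ^+ 2)%:E)%E).
  apply: (@integral_EFin_le _ _ _ P (fun w => `|f w * g w|) (fun w => f w ^+ 2 + g w ^+ 2)).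
  - by mf.
  - by mf.
  - by move=> w; exact: normr_ge0.
  - move=> w; rewrite normrM -(real_normK (num_real (f w))) -(real_normK (num_real (g w))).
    by have := sqr_ge0 (`|f w| - `|g w|); have := sqr_ge0 (`|f w|); have := sqr_ge0 (`|g w|); nra.
by rewrite integral_EFinD; try solve [mf | pos]; rewrite lte_add_pinfty.
Qed.

Lemma cst_sqr_fin (c : R) : (\int[P]_w (c ^+ 2)%:E < +oo)%E.
Proof. by rewrite integral_cst//= probability_setT mule1 ltry. Qed.

Lemma cst_integrable (c : R) : P.-integrable setT (EFin \o (fun=> c)).
Proof. exact: finite_measure_integrable_cst. Qed.

Lemma L2_integrable f : measurable_fun setT f ->
  (\int[P]_w (f w ^+ 2)%:E < +oo)%E -> P.-integrable setT (EFin \o f).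
Proof.
move=> mfn ff; have := prod_integrable mfn (measurable_cst (1 : R)) ff (cst_sqr_fin 1).
by congr (integrable _ _ (EFin \o _)); apply/funext => w; rewrite /= mulr1.
Qed.

Lemma L2_shift f (c : R) : measurable_fun setT f ->
  (\int[P]_w (f w ^+ 2)%:E < +oo)%E -> (\int[P]_w ((f w - c) ^+ 2)%:E < +oo)%E.
Proof.
move=> mfn ff; apply: (@le_lt_trans _ _ (\int[P]_w (2 * f w ^+ 2 + 2 * c ^+ 2)%:E)%E).
  apply: integral_EFin_le => //; try by mf.
  - by pos.
  - by move=> w; have := sqr_ge0 (f w + c); nra.
rewrite integral_EFinD; try solve [mf | pos].
rewrite integral_EFinZ; try solve [mf | pos].
rewrite integral_cst//= probability_setT mule1.
by rewrite lte_add_pinfty ?ltry// lte_mul_pinfty.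
Qed.

Lemma Rintegral_cst1 (c : R) : \int[P]_w c = c.
Proof.
have [k kc] : exists k : R, k = c by exists c.
by rewrite -kc /Rintegral integral_cst//= probability_setT mule1.
Qed.

Lemma variance_le f (c : R) : measurable_fun setT f ->
  (\int[P]_w (f w ^+ 2)%:E < +oo)%E ->
  \int[P]_w ((f w - \int[P]_v f v) ^+ 2) <= \int[P]_w ((f w - c) ^+ 2).
Proof.
move=> mfn ff; set m := \int[P]_v f v.
have i1 := L2_integrable mfn ff.
have mfm : measurable_fun setT (fun w => f w - m) by mf.
have i2 : P.-integrable setT (EFin \o (fun w => (f w - m) ^+ 2)).
  by apply: sqr_integrable => //; exact: L2_shift.
have i3 := cst_integrable.
have i4 : P.-integrable setT (EFin \o (fun w => (f w - m))).
  by apply: L2_integrable => //; exact: L2_shift.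
have i5 : P.-integrable setT (EFin \o (fun w => 2 * (m - c) * (f w - m))).
  exact: integrable_scaleR.
have e0 : \int[P]_w (f w - m) = 0.
  by rewrite RintegralB// Rintegral_cst1 subrr.
have -> : \int[P]_w ((f w - c) ^+ 2) =
    \int[P]_w ((f w - m) ^+ 2 + (2 * (m - c) * (f w - m) + (m - c) ^+ 2)).
  by apply: eq_Rintegral => w _; ring.
rewrite RintegralD//; last exact: (integrableD _ i5 (i3 _)).
rewrite RintegralD//.
rewrite RintegralZl// e0 mulr0 add0r Rintegral_cst1 lerDl; exact: sqr_ge0.
Qed.

End second_moments.

Section laws_of_vectors.
Context {d : measure_display} {Om : measurableType d} {R : realType} {n : nat}.
Variables (P : probability Om R) (X : Om -> 'cV[R]_n).

Lemma measurable_coord i : measurable_fun [set: Rn R n] (fun x : Rn R n => (x : 'cV[R]_n) i 0).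
Proof.
move=> _ B mB; rewrite setTI; apply: sub_sigma_algebra.
by exists i, 0, B.
Qed.

Hypothesis mX : measurable_fun [set: Om] (X : Om -> Rn R n).

Lemma measurable_vector_coord i : measurable_fun setT (fun w => X w i 0).
Proof. exact: (measurableT_comp (measurable_coord i) mX). Qed.
Let mXi := measurable_vector_coord.

Lemma integral_law (g : Rn R n -> R) : measurable_fun setT g ->
  (\int[law P X]_x (g x)%:E = \int[P]_w (g (X w))%:E)%E.
Proof.
move=> mg; rewrite /law integralE [RHS]integralE; congr (_ - _)%E.
  rewrite (@ge0_integral_pushforward _ _ _ _ _ _ mX)//; last first.
    by apply: measurable_funepos; mf.
  by apply: eq_integral => w _; rewrite /= !funeposE.
rewrite (@ge0_integral_pushforward _ _ _ _ _ _ mX)//; last first.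
  by apply: measurable_funeneg; mf.
by apply: eq_integral => w _; rewrite /= !funenegE.
Qed.

Lemma mean_law i : mean (law P X) i 0 = \int[P]_w X w i 0.
Proof. by rewrite /mean mxE integral_law//; exact: measurable_coord. Qed.

Lemma Cov_law i j : Cov (law P X) i j =
  \int[P]_w ((X w i 0 - \int[P]_v X v i 0) * (X w j 0 - \int[P]_v X v j 0)).
Proof.
rewrite /Cov mxE -!mean_law; congr fine.
rewrite (@integral_law (fun x => (x i 0 - mean (law P X) i 0) * (x j 0 - mean (law P X) j 0)))//.
by apply: measurable_funM; apply: measurable_funB; (exact: measurable_cst || exact: measurable_coord).
Qed.

Hypothesis L2X : (\int[P]_w (sqnorm (X w))%:E < +oo)%E.

Lemma coord_L2 i : (\int[P]_w (X w i 0 ^+ 2)%:E < +oo)%E.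
Proof.
apply: le_lt_trans L2X; apply: integral_EFin_le => //.
- by mf.
- by apply: measurable_sqnorm => j l; rewrite ord1.
- by pos.
- by move=> w; exact: sqr_le_sqnorm.
Qed.

Let c i w := X w i 0 - \int[P]_v X v i 0.
Let mc i : measurable_fun setT (c i). Proof. by rewrite /c; mf. Qed.
Let c2 i : (\int[P]_w (c i w ^+ 2)%:E < +oo)%E.
Proof. by rewrite /c; apply: L2_shift => //; exact: coord_L2. Qed.

Lemma Cov_psd : psdmx (Cov (law P X)).
Proof.
split.
  by apply/matrixP => i j; rewrite mxE !Cov_law; apply: eq_Rintegral => w _; rewrite mulrC.
move=> x; rewrite !mxE.
have ic i j : P.-integrable setT (EFin \o (fun w => c i w * c j w)) by exact: prod_integrable.
have E : \sum_j (x^T *m Cov (law P X)) 0 j * x j 0 =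
    \int[P]_w (\sum_j \sum_i x j 0 * x i 0 * (c i w * c j w)).
  rewrite Rintegral_sum//; last first.
    by move=> j; apply: integrable_sumR => // i; exact: integrable_scaleR.
  apply: eq_bigr => j _; rewrite Rintegral_sum//; last by move=> i; exact: integrable_scaleR.
  rewrite mxE mulr_suml; apply: eq_bigr => i _.
  rewrite RintegralZl//.
  rewrite Cov_law mxE mulrAC; congr (_ * _); exact: mulrC.
rewrite E /Rintegral; apply: fine_ge0; apply: integral_ge0 => w _; rewrite lee_fin.
suff -> : \sum_j \sum_i x j 0 * x i 0 * (c i w * c j w) = (\sum_j x j 0 * c j w) ^+ 2.
  exact: sqr_ge0.
rewrite expr2 mulr_suml; apply: eq_bigr => j _; rewrite mulr_sumr.
by apply: eq_bigr => i _; ring.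
Qed.

Lemma var_coord_le (a : 'cV[R]_n) i :
  Cov (law P X) i i <= \int[P]_w ((X w i 0 - a i 0) ^+ 2).
Proof. by rewrite Cov_law; apply: variance_le => //; exact: coord_L2. Qed.

Lemma sqnorm_shift (a : 'cV[R]_n) : \int[P]_w sqnorm (X w - a) =
  \sum_i \int[P]_w ((X w i 0 - a i 0) ^+ 2).
Proof.
rewrite -Rintegral_sum//; last first.
  by move=> i; apply: sqr_integrable; [mf|apply: L2_shift => //; exact: coord_L2].
apply: eq_Rintegral => w _; rewrite /sqnorm; apply: eq_bigr => i _.
by rewrite big_ord1 !mxE.
Qed.

Lemma trace_Cov_le (a : 'cV[R]_n) : \tr (Cov (law P X)) <= \int[P]_w sqnorm (X w - a).
Proof. by rewrite sqnorm_shift; apply: ler_sum => i _; exact: var_coord_le. Qed.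

Lemma Cov_diag_ge0 i : 0 <= Cov (law P X) i i.
Proof.
by rewrite Cov_law; apply: fine_ge0; apply: integral_ge0 => w _; rewrite lee_fin -expr2 sqr_ge0.
Qed.

Lemma trace_Cov_ge0 : 0 <= \tr (Cov (law P X)).
Proof. by apply: sumr_ge0 => i _; exact: Cov_diag_ge0. Qed.

(** By 2 |u v| <= u^2 + v^2 an entry is at most the mean of two diagonal entries, hence at most the
    trace; the trace is smallest about the mean, so any centre a is allowed. *)
Lemma Cov_entry_le (a : 'cV[R]_n) i j : `|Cov (law P X) i j| <= \int[P]_w sqnorm (X w - a).
Proof.
apply: le_trans (trace_Cov_le a).
have ic k l : P.-integrable setT (EFin \o (fun w => c k w * c l w)) by exact: prod_integrable.
have half : `|Cov (law P X) i j| <= (Cov (law P X) i i + Cov (law P X) j j) / 2.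
  rewrite !Cov_law; apply: le_trans (le_normr_Rintegral _ (ic i j)) _ => //.
  have -> : (\int[P]_w (c i w * c i w) + \int[P]_w (c j w * c j w)) / 2 =
      \int[P]_w (2^-1 * (c i w * c i w + c j w * c j w)).
    rewrite RintegralZl//; last by apply: (integrableD _ (ic i i) (ic j j)).
    by rewrite RintegralD// mulrC.
  apply: le_Rintegral => //.
  - exact: integrable_norm (ic i j).
  - by apply: integrable_scaleR => //; apply: (integrableD _ (ic i i) (ic j j)).
  - move=> w _ /=; rewrite normrM -!expr2.
    have := sqr_ge0 (`|c i w| - `|c j w|).
    by rewrite -(real_normK (num_real (c i w))) -(real_normK (num_real (c j w))); nra.
apply: le_trans half _.
have le_tr k : Cov (law P X) k k <= \tr (Cov (law P X)).
  rewrite /mxtrace (bigD1 k)//= lerDl; apply: sumr_ge0 => l _; exact: Cov_diag_ge0.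
have := le_tr i; have := le_tr j; lra.
Qed.

End laws_of_vectors.

Section matrix_square_root.
Context {R : realType} {n : nat}.

(** Both outcomes of [xget] are covered: a symmetric root B of A has squared norm tr(B B^T) = tr A,
    and the default 0 obeys the bound since tr A >= 0. *)
Lemma sqnorm_sqrtmx_le (A : 'M[R]_n) : 0 <= \tr A -> sqnorm (sqrtmx A) <= \tr A.
Proof.
move=> trA; rewrite /sqrtmx; case: xgetP => [B _ [[BT _] BA]|_].
  rewrite -BA /sqnorm /mxtrace le_eqVlt; apply/orP; left; apply/eqP.
  apply: eq_bigr => i _; rewrite mxE; apply: eq_bigr => j _.
  by rewrite -[in X in _ * X]BT mxE expr2.
rewrite /sqnorm big1// => i _; apply: big1 => j _; rewrite mxE expr0n//.
Qed.

Lemma sqnorm_eq0 m k (A : 'M[R]_(m, k)) : sqnorm A <= 0 -> A = 0.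
Proof.
move=> A0; apply/matrixP => i j; rewrite mxE.
by apply/eqP; rewrite -sqrf_eq0 eq_le sqr_ge0 andbT (le_trans (sqr_le_sqnorm A i j)).
Qed.

End matrix_square_root.

(** * Ito processes with dissipative drift *)

Section ito_facts.
Context {R : realType} {d : measure_display} {Om : measurableType d}.
Variables (P : probability Om R) (F : R -> set (set Om)).
Hypothesis filF : filtration F.
Context {n : nat}.
Variables (X : R -> Om -> 'cV[R]_n).
Hypothesis aX : adapted F X.
Hypothesis cX : continuous_paths X.
Notation mu := (@lebesgue_measure R).

Lemma adapted_gfun t j : 0 <= t -> gfun (F t) (fun w => X t w j 0).
Proof. by move=> t0; exact: mx_measurable_gfun (aX t0). Qed.

Lemma adapted_measurable t : 0 <= t -> measurable_fun [set: Om] (X t : Om -> Rn R n).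
Proof. by move=> t0 _ B mB; rewrite setTI; apply: (filtration_measurable filF t0); exact: aX. Qed.

Lemma progressive_coord j : progressive F (fun t w => X t w j 0).
Proof.
apply: progressive_continuous => //; last by move=> t; exact: adapted_gfun.
by move=> w; exact: continuous_paths_coord.
Qed.

Lemma joint_coord j :
  measurable_fun [set: measurableTypeR R * Om] (fun p => X (Num.max 0 p.1) p.2 j 0).
Proof.
apply: (@continuous_joint_measurable R _ Om (fun u w => X (Num.max 0 u) w j 0)).
  by move=> w; exact: continuous_paths_coord.
move=> t; apply: measurable_vector_coord; apply: adapted_measurable.
by rewrite le_max lexx.
Qed.

Lemma measurable_mean_law i : measurable_fun [set: measurableTypeR R]
  (fun u : measurableTypeR R => mean (law P (X (Num.max 0 u))) i 0).
Proof.
have E u : mean (law P (X (Num.max 0 u))) i 0 = \int[P]_w X (Num.max 0 u) w i 0.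
  by apply: mean_law; apply: adapted_measurable; rewrite le_max lexx.
under eq_fun do rewrite E.
exact: measurable_Rintegral_snd (joint_coord i).
Qed.

Lemma measurable_Cov_law i j : measurable_fun [set: measurableTypeR R]
  (fun u : measurableTypeR R => Cov (law P (X (Num.max 0 u))) i j).
Proof.
have mX u : measurable_fun [set: Om] (X (Num.max 0 u) : Om -> Rn R n).
  by apply: adapted_measurable; rewrite le_max lexx.
have E u : Cov (law P (X (Num.max 0 u))) i j =
   \int[P]_w ((X (Num.max 0 u) w i 0 - mean (law P (X (Num.max 0 u))) i 0) *
     (X (Num.max 0 u) w j 0 - mean (law P (X (Num.max 0 u))) j 0)).
  by rewrite Cov_law// -!mean_law.
under eq_fun do rewrite E.
apply: (@measurable_Rintegral_snd _ _ _ P (fun p : measurableTypeR R * Om =>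
  (X (Num.max 0 p.1) p.2 i 0 - mean (law P (X (Num.max 0 p.1))) i 0) *
     (X (Num.max 0 p.1) p.2 j 0 - mean (law P (X (Num.max 0 p.1))) j 0))).
have mm k : measurable_fun [set: measurableTypeR R * Om]
    (fun p => mean (law P (X (Num.max 0 p.1))) k 0).
  exact: (measurableT_comp (measurable_mean_law k) (@measurable_fst _ _ _ Om)).
by apply: measurable_funM; apply: measurable_funB; (exact: joint_coord || exact: mm).
Qed.

Lemma progressive_Cov (C : R -> 'M[R]_n) : (forall i j, measurable_fun [set: measurableTypeR R]
  (fun u : measurableTypeR R => C (Num.max 0 u) i j)) -> forall i,
  progressive F (fun u w => (C u *m X u w) i 0).
Proof.
move=> mC i; rewrite (_ : (fun u w => _) = fun u w => \sum_k C u i k * X u w k 0); last first.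
  by apply/funext => u; apply/funext => w; rewrite mxE.
apply: progressive_sum => k; apply: progressiveM; last exact: progressive_coord.
exact: (@progressive_cst _ _ _ F (fun u => C u i k)).
Qed.

Lemma progressive_sqnorm : progressive F (fun u w => sqnorm (X u w)).
Proof.
rewrite (_ : (fun u w => _) = fun u w => \sum_k X u w k 0 * X u w k 0); last first.
  by apply/funext => u; apply/funext => w; apply: eq_bigr => i _; rewrite big_ord1 expr2.
by apply: progressive_sum => k; apply: progressiveM; exact: progressive_coord.
Qed.

Lemma path_bounded w t : exists2 B : R, 0 <= B & forall u j, 0 <= u <= t -> `|X u w j 0| <= B.
Proof.
have /choice[K hK] j := continuous_bounded 0 t (@continuous_paths_coord _ _ _ _ _ w j cX).
exists (\sum_j `|K j|); first by pos.
move=> u j ut; rewrite (bigD1 j)//=.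
have /andP[u0 _] := ut.
apply: (@le_trans _ _ `|K j|).
  by apply: le_trans (ler_norm _); have := hK j u ut; rewrite max_r.
by rewrite lerDl; apply: sumr_ge0 => i _; pos.
Qed.

End ito_facts.

(** * The noise of an Ito process *)

Section noise.
Context {R : realType} {d : measure_display} {Om : measurableType d}.
Variables (P : probability Om R) (F : R -> set (set Om)).
Hypothesis filF : filtration F.
Context {n : nat}.
Variables (W : R -> Om -> 'cV[R]_n) (X b : R -> Om -> 'cV[R]_n) (h : R -> 'M[R]_n).
Hypothesis bW : brownian P F W.
Hypothesis ipX : ito_process P F W X b (fun t _ => h t).
Hypothesis pb : forall j, progressive F (fun u w => b u w j 0).
Hypothesis hM : forall t, exists M, forall u, 0 <= u <= t -> sqnorm (h u) <= M.
Notation mu := (@lebesgue_measure R).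

Lemma time_integral_gfun t j : 0 <= t -> gfun (F t) (fun w => time_integral b t w j 0).
Proof.
move=> t0; have := progressive_integral (pb j) t0.
by congr (measurable_fun _ _); apply/funext => w; rewrite mxE.
Qed.

(** Agrees almost surely, at each time, with X_0 plus the Ito integral; defined from X and its
    drift, it is adapted by construction. *)
Definition noise t w j : R := X t w j 0 - time_integral b t w j 0.

Lemma noise_gfun t j : 0 <= t -> gfun (F t) (fun w => noise t w j).
Proof.
move=> t0; case: ipX => aX _ _ _.
by apply: (@measurable_funB _ (SA (F t))); [exact: adapted_gfun|exact: time_integral_gfun].
Qed.

Lemma noise_subgaussian s t j v : 0 <= s -> s <= t -> 0 <= v ->
  (\int[mu]_(u in `[s, t]) (\sum_l h u j l ^+ 2)%:E <= v%:E)%E ->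
  subgaussian P (F s) (fun w => noise t w j - noise s w j) v.
Proof.
move=> s0 st v0 hv theta A mA; have t0 := le_trans s0 st.
have mA' : measurable (A : set Om) := SA_measurable (filtration_measurable filF s0) mA.
case: (ipX) => aX cX _ [I itoI XI].
have mI r : 0 <= r -> measurable_fun setT (fun w => I r w j 0).
  by move=> r0; exact: (ito_integral_measurable itoI).
have mN r : 0 <= r -> measurable_fun setT (fun w => noise r w j).
  by move=> r0; apply: (gfun_measurable (filtration_measurable filF r0)); exact: noise_gfun.
apply: le_trans (ito_subgaussian filF bW itoI s0 st v0 (hM t) hv theta mA).
have mE (f : Om -> R) : measurable_fun setT f -> 
    measurable_fun [set: Om] (fun w : Om => \1_(A : set Om) w * expR (theta * f w) : R).
  move=> mfn; apply: (@measurable_funM _ Om); first exact: measurable_indic.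
  exact: (measurableT_comp (@measurable_expR R) (measurable_funM (@measurable_cst _ _ Om R setT theta) mfn)).
apply: integral_EFin_ae_le => //.
- by apply: mE; apply: measurable_funB; apply: mN.
- by apply: mE; apply: measurable_funB; apply: mI.
- apply: filterS2 (XI s s0) (XI t t0) => w es et.
  rewrite /noise es et !mxE.
  by rewrite le_eqVlt; apply/orP; left; apply/eqP; congr (_ * expR (_ * _)); ring.
Qed.

End noise.

Section noise_variance.
Context {R : realType} {d : measure_display} {Om : measurableType d}.
Variables (P : probability Om R) (F : R -> set (set Om)).
Hypothesis filF : filtration F.
Context {n : nat}.
Variables (W : R -> Om -> 'cV[R]_n) (X b : R -> Om -> 'cV[R]_n) (h : R -> 'M[R]_n) (g : R -> R).
Hypothesis bW : brownian P F W.
Hypothesis ipX : ito_process P F W X b (fun t _ => h t).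
Hypothesis pb : forall j, progressive F (fun u w => b u w j 0).
Hypothesis mg : measurable_fun [set: measurableTypeR R] (fun u : measurableTypeR R => g (Num.max 0 u)).
Hypothesis gM : forall t, exists M, forall u, 0 <= u <= t -> g u <= M.
Hypothesis hg : forall u, 0 <= u -> sqnorm (h u) <= g u.
Notation mu := (@lebesgue_measure R).

Lemma path_measurable (f : R -> R) (a c : R) : 0 <= a ->
  measurable_fun [set: measurableTypeR R] (fun u : measurableTypeR R => f (Num.max 0 u)) ->
  measurable_fun (`[a, c]%classic : set (measurableTypeR R)) f.
Proof.
move=> a0 mfn; apply: (eq_measurable_fun (fun u : measurableTypeR R => f (Num.max 0 u))).
  move=> u; rewrite mem_setE in_itv/= => /andP[u0 ut].
  by rewrite max_r// (le_trans a0).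
exact: measurable_funTS mfn.
Qed.

Lemma trace_ge0 u : 0 <= u -> 0 <= g u.
Proof. by move=> u0; apply: le_trans (hg u0); exact: sqnorm_ge0. Qed.

Lemma trace_integrable s t : 0 <= s -> mu.-integrable `[s, t] (EFin \o g).
Proof.
move=> s0; have [M hM] := gM t; apply: (@bounded_integrable _ _ _ _ M).
  exact: path_measurable.
move=> u /andP[su ut]; have u0 := le_trans s0 su.
by rewrite ger0_norm ?trace_ge0// hM// u0.
Qed.

Lemma trace_integralB s t : 0 <= s -> s <= t ->
  \int[mu]_(u in `[0, t]) g u - \int[mu]_(u in `[0, s]) g u = \int[mu]_(u in `[s, t]) g u.
Proof.
move=> s0 st.
have ig : mu.-integrable `[0, t] (EFin \o g) by exact: trace_integrable.
rewrite Rintegral_itvB; [|by []|by rewrite bnd_simp|by rewrite bnd_simp].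
rewrite Rintegral_itv_obnd_cbnd//; apply: (@integrableS _ _ _ mu `[0, t]%classic) => //.
by apply: subitvP; rewrite subitvE !bnd_simp/= s0.
Qed.

Lemma noise_bounded t : exists M, forall u, 0 <= u <= t -> sqnorm (h u) <= M.
Proof.
have [M hM] := gM t; exists M => u /andP[u0 ut].
by apply: le_trans (hg u0) _; apply: hM; rewrite u0.
Qed.

(** Each coordinate receives the energy of its own row, so that the variances add up to the trace.
    Using the full trace in every coordinate would cost a factor n in the energy inequality, where
    the linear drift provides only 4. *)
Lemma noise_variance s t : 0 <= s -> s <= t -> exists v : 'I_n -> R,
  [/\ forall j, 0 <= v j,
     forall j, subgaussian P (F s) (fun w => noise X b t w j - noise X b s w j) (v j)
   & \sum_j v j <= \int[mu]_(u in `[0, t]) g u - \int[mu]_(u in `[0, s]) g u].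
Proof.
move=> s0 st; case: (ipX) => _ _ _ [I itoI _].
have mh j l : measurable_fun (`[s, t]%classic : set (measurableTypeR R)) (fun u => h u j l).
  by apply: path_measurable => //; exact: (ito_integrand_measurable itoI).
pose q j u := \sum_l h u j l ^+ 2.
have mq j : measurable_fun (`[s, t]%classic : set (measurableTypeR R)) (q j).
  by apply: measurable_sum => l; exact: measurable_funX.
have q0 j u : 0 <= q j u by rewrite /q; pos.
have [M hM] := gM t.
have iq j : mu.-integrable `[s, t] (EFin \o q j).
  apply: (@bounded_integrable _ _ _ _ M) => // u /andP[su ut]; have u0 := le_trans s0 su.
  rewrite ger0_norm//; apply: le_trans (row_le_sqnorm _ _) _.
  by apply: le_trans (hg u0) _; apply: hM; rewrite u0.
exists (fun j => \int[mu]_(u in `[s, t]) q j u); split.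
- by move=> j; apply: fine_ge0; apply: integral_ge0 => u _; rewrite lee_fin.
- move=> j; apply: (noise_subgaussian filF bW ipX pb noise_bounded) => //.
    by apply: fine_ge0; apply: integral_ge0 => u _; rewrite lee_fin.
  by rewrite /Rintegral fineK//; exact: (integrable_fin_num _ (iq j)).
- rewrite trace_integralB// -Rintegral_sum//; apply: le_Rintegral => //.
  + exact: integrable_sumR.
  + exact: trace_integrable.
  + move=> u /=; rewrite in_itv/= => /andP[su ut]; apply: hg; exact: le_trans su.
Qed.

End noise_variance.
Section tonelli.
Context {R : realType} {d : measure_display} {Om : measurableType d}.
Variable P : probability Om R.
Notation mu := (@lebesgue_measure R).

Lemma tonelli_path (g : R -> Om -> R) (t : R) :
  measurable_fun [set: measurableTypeR R * Om] (fun p => g (Num.max 0 p.1) p.2) ->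
  (forall u w, 0 <= u -> 0 <= g u w) ->
  (forall w, mu.-integrable `[0, t] (EFin \o (fun u => g u w))) ->
  (\int[P]_w (\int[mu]_(u in `[0%R, t]) g u w)%:E =
   \int[mu]_(u in `[0%R, t]) \int[P]_w (g u w)%:E)%E.
Proof.
move=> mg g0 ig; pose D := (`[0, t]%classic : set (measurableTypeR R)).
pose G (p : measurableTypeR R * Om) := (\1_D p.1 * g (Num.max 0 p.1) p.2)%:E.
have mG : measurable_fun setT G.
  apply/measurable_EFinP; apply: measurable_funM => //.
  have mi : measurable_fun [set: measurableTypeR R] (\1_D : measurableTypeR R -> R).
    by apply: measurable_indic; exact: (measurable_itv `[0, t]).
  exact: (measurableT_comp mi (@measurable_fst _ _ _ _)).
have G0 p : (0 <= G p)%E.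
  by rewrite lee_fin mulr_ge0//; apply: g0; rewrite le_max lexx.
transitivity (\int[P]_w \int[mu]_u G (u, w))%E.
  apply: eq_integral => w _; rewrite fineK; last exact: (integrable_fin_num _ (ig w)).
  rewrite integral_mkcond; apply: eq_integral => u _; rewrite patchE /G/= indicE.
  case: ifP => uD; last by rewrite mul0r.
  by rewrite mul1r max_r//; move: uD; rewrite mem_setE in_itv/= => /andP[].
rewrite -(@fubini_tonelli _ _ _ _ _ lebesgue_measure P G mG G0).
rewrite [RHS]integral_mkcond; apply: eq_integral => u _; rewrite patchE /G/= indicE.
case: ifP => uD; last by under eq_integral do rewrite mul0r; rewrite integral0.
apply: eq_integral => w _.
by rewrite mul1r max_r//; move: uD; rewrite mem_setE in_itv/= => /andP[].
Qed.

End tonelli.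

(** * Energy and exponential moments under a dissipative drift *)

Section dissipative.
Context {R : realType} {d : measure_display} {Om : measurableType d}.
Variables (P : probability Om R) (F : R -> set (set Om)).
Hypothesis filF : filtration F.
Context {n : nat}.
Variables (W Y b : R -> Om -> 'cV[R]_n) (h C : R -> 'M[R]_n) (k : R).
Hypothesis bW : brownian P F W.
Hypothesis ipY : ito_process P F W Y b (fun t _ => h t).
Hypothesis L2Y : locally_L2 P Y.
Hypothesis k0 : 0 < k.
Hypothesis bE : forall u w, 0 <= u ->
  b u w = k *: (- 2 *: Y u w - sqnorm (Y u w) *: Y u w - C u *m Y u w).
Hypothesis mC : forall i j, measurable_fun [set: measurableTypeR R]
  (fun u : measurableTypeR R => C (Num.max 0 u) i j).
Hypothesis Cb : forall t, exists c, forall u i j, 0 <= u <= t -> `|C u i j| <= c.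
Hypothesis psdC : forall u (y : 'cV[R]_n), 0 <= u -> 0 <= (y^T *m C u *m y) 0 0.
Notation mu := (@lebesgue_measure R).

Definition second_moment u := \int[P]_w sqnorm (Y u w).
Notation f := second_moment.
Hypothesis hf : forall u, 0 <= u -> sqnorm (h u) <= k * f u.

Let aY : adapted F Y. Proof. by case: ipY. Qed.
Let cY : continuous_paths Y. Proof. by case: ipY. Qed.

Lemma measurable_sqnorm_process u : 0 <= u -> measurable_fun setT (fun w => sqnorm (Y u w)).
Proof.
move=> u0; apply: measurable_sqnorm => i j; rewrite ord1.
by apply: measurable_vector_coord; exact: (adapted_measurable filF aY).
Qed.

Lemma second_momentE u : 0 <= u -> (\int[P]_w (sqnorm (Y u w))%:E = (f u)%:E)%E.
Proof.
move=> u0; rewrite /f /Rintegral fineK// ge0_fin_numE; last first.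
  by apply: integral_ge0 => w _; rewrite lee_fin sqnorm_ge0.
have [M hM] := L2Y u; apply: le_lt_trans (hM u _) (ltry _).
by rewrite u0 lexx.
Qed.

Lemma second_moment_ge0 u : 0 <= f u.
Proof. by apply: fine_ge0; apply: integral_ge0 => w _; rewrite lee_fin sqnorm_ge0. Qed.

Lemma second_moment_bounded t : exists M, forall u, 0 <= u <= t -> f u <= M.
Proof.
have [M hM] := L2Y t; exists M => u ut; have /andP[u0 _] := ut.
by rewrite -lee_fin -second_momentE//; exact: hM.
Qed.

Lemma second_moment_measurable :
  measurable_fun [set: measurableTypeR R] (fun u : measurableTypeR R => f (Num.max 0 u)).
Proof.
apply: (@measurable_Rintegral_snd _ _ _ P (fun p : measurableTypeR R * Om => sqnorm (Y (Num.max 0 p.1) p.2))).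
by apply: measurable_sqnorm => i j; rewrite ord1; exact: (joint_coord filF aY cY).
Qed.

Let bjE u w j : 0 <= u -> b u w j 0 =
  k * (- 2 * Y u w j 0 - sqnorm (Y u w) * Y u w j 0 - (C u *m Y u w) j 0).
Proof. by move=> u0; rewrite bE// !mxE. Qed.

Lemma dissipative_progressive j : progressive F (fun u w => b u w j 0).
Proof.
have p1 : progressive F (fun u w => k * ((- 2 * Y u w j 0 + (- 1) * (sqnorm (Y u w) * Y u w j 0)) + (- 1) * (C u *m Y u w) j 0)).
  have pc c : progressive F (fun _ _ => c : R).
    by apply: (@progressive_cst _ _ _ F (fun=> c)); exact: measurable_cst.
  apply: progressiveM => //; apply: progressiveD; last first.
    by apply: progressiveM => //; exact: progressive_Cov.
  apply: progressiveD; first by apply: progressiveM => //; exact: progressive_coord.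
  apply: progressiveM => //; apply: progressiveM; last exact: progressive_coord.
  exact: progressive_sqnorm.
move=> t t0; have := p1 t t0; congr (measurable_fun _ _); apply/funext => p.
by rewrite bjE ?le_max ?lexx// !mulN1r.
Qed.

Lemma dissipative_bounded w t : exists B, forall u j, 0 <= u <= t -> `|b u w j 0| <= B.
Proof.
have [B B0 hB] := path_bounded cY w t.
have [c hc] := Cb t.
exists (k * (2 * B + (\sum_(i < n) \sum_(j < 1) B ^+ 2) * B + \sum_(i < n) c * B)) => u j ut.
have /andP[u0 _] := ut.
rewrite bjE// normrM (gtr0_norm k0); apply: ler_wpM2l; first exact: ltW.
apply: le_trans (ler_normB _ _) _; apply: lerD.
  apply: le_trans (ler_normB _ _) _; apply: lerD.
    by rewrite normrM normrN [`|2|]ger0_norm// ler_wpM2l// hB.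
  rewrite normrM; apply: ler_pM => //; last exact: hB.
  rewrite ger0_norm ?sqnorm_ge0//; apply: ler_sum => i _; apply: ler_sum => l _.
  by rewrite ord1 -real_normK ?num_real// ler_sqr ?nnegrE// hB.
rewrite mxE; apply: le_trans (ler_norm_sum _ _ _) _; apply: ler_sum => i _.
by rewrite normrM; apply: ler_pM => //; [exact: hc|exact: hB].
Qed.

Lemma dissipative_path_measurable w j t : 0 <= t ->
  measurable_fun (`[0, t]%classic : set (measurableTypeR R)) (fun u => b u w j 0).
Proof. by move=> t0; exact: (progressive_path filF w (dissipative_progressive j) t0). Qed.

Let mkf : measurable_fun [set: measurableTypeR R] (fun u : measurableTypeR R => k * f (Num.max 0 u)).
Proof. by apply: measurable_funM; [exact: measurable_cst|exact: second_moment_measurable]. Qed.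

Let kfM t : exists M, forall u, 0 <= u <= t -> k * f u <= M.
Proof.
have [M hM] := second_moment_bounded t; exists (k * M) => u ut.
by rewrite ler_wpM2l ?(ltW k0)//; exact: hM.
Qed.

Lemma dissipative_variance s t : 0 <= s -> s <= t -> exists v : 'I_n -> R,
  [/\ forall j, 0 <= v j,
     forall j, subgaussian P (F s) (fun w => noise Y b t w j - noise Y b s w j) (v j)
   & \sum_j v j <= \int[mu]_(u in `[0, t]) (k * f u) - \int[mu]_(u in `[0, s]) (k * f u)].
Proof. exact: (noise_variance filF bW ipY dissipative_progressive mkf kfM hf). Qed.

Let psi (al : R) (v : 'cV[R]_n) := 1 + al * sqnorm v.
Let q al j (v : 'cV[R]_n) := 2 * al * v j 0 / psi al v.

Let psi_gt0 al v : 0 <= al -> 0 < psi al v.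
Proof. by move=> al0; rewrite ltr_pwDl// mulr_ge0// sqnorm_ge0. Qed.

Let sqnormE (v : 'cV[R]_n) : sqnorm v = \sum_j v j 0 ^+ 2.
Proof. by apply: eq_bigr => i _; rewrite big_ord1. Qed.

Let psi_convex al (v a : 'cV[R]_n) : 0 < al ->
  psi al v * (1 - \sum_j q al j v * a j 0) <= psi al (v - a).
Proof.
move=> al1; have al0 := ltW al1; rewrite mulrBr mulr1 mulr_sumr.
have -> : \sum_j psi al v * (q al j v * a j 0) = al * \sum_j 2 * v j 0 * a j 0.
  rewrite mulr_sumr; apply: eq_bigr => j _; rewrite /q.
  by field; rewrite gt_eqF// psi_gt0.
rewrite /psi -addrA -mulrBr lerD2l ler_wpM2l// !sqnormE -sumrB.
by apply: ler_sum => j _; rewrite !mxE; have := sqr_ge0 (a j 0); nra.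
Qed.

Let trace_int t := \int[mu]_(u in `[0, t]) (k * f u).

Let trace_int_le s t : 0 <= s -> s <= t -> trace_int s <= trace_int t.
Proof.
move=> s0 st; have [v [v0 _]] := dissipative_variance s0 st.
by move=> /(le_trans (sumr_ge0 _ (fun j _ => v0 j))); rewrite subr_ge0.
Qed.

(** Conditionally, |Y_s|^2 grows by at most the total variance V, and (1 + al V) (1 + al |y|^2) >= 1
    + al |y|^2 + al V puts this additive growth in multiplicative form. *)
Lemma one_step_sqnorm al s t : 0 < al -> 0 <= s -> s <= t ->
  forall U : Om -> R, gfun (F s) U -> (forall w, 0 <= U w) ->
  (\int[P]_w (U w * psi al (Y s w + ((Y t w - time_integral b t w) -
       (Y s w - time_integral b s w))))%:E <=
   (expR (al * trace_int t - al * trace_int s))%:E * \int[P]_w (U w * psi al (Y s w))%:E)%E.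
Proof.
move=> al1 s0 st U gU U0; have al0 := ltW al1; have t0 := le_trans s0 st.
have [v [v0 sg sv]] := dissipative_variance s0 st.
have subF := filtration_measurable filF s0.
have mU := gfun_measurable subF gU.
have gY j : gfun (F s) (fun w => Y s w j 0) by exact: adapted_gfun.
have mY j : measurable_fun [set: Om] (fun w => Y s w j 0) by exact: (gfun_measurable subF (gY j)).
have mN r j : 0 <= r -> measurable_fun setT (fun w => noise Y b r w j).
  move=> r0; apply: (gfun_measurable (filtration_measurable filF r0)).
  exact: (noise_gfun ipY dissipative_progressive).
pose m j w := noise Y b t w j - noise Y b s w j.
have mm j : measurable_fun setT (m j) by apply: measurable_funB; exact: mN.
set I := (\int[P]_w (U w * psi al (Y s w))%:E)%E.
(* Nothing to prove if the right side is infinite; otherwise E[U] and all E[U Y_j^2] are finite, as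
   [subgaussian_sqrD] requires. *)
have [->|Ifin] := eqVneq I +oo%E; first by rewrite gt0_muley ?leey// lte_fin expR_gt0.
have UE w : U w * psi al (Y s w) = U w + al * \sum_j U w * Y s w j 0 ^+ 2.
  by rewrite /psi mulrDr mulr1 sqnormE !mulr_sumr; congr (_ + _); apply: eq_bigr => j _; ring.
have lhsE w : U w * psi al (Y s w + ((Y t w - time_integral b t w) - (Y s w - time_integral b s w))) =
   U w + al * \sum_j U w * (Y s w j 0 + m j w) ^+ 2.
  rewrite /psi mulrDr mulr1 sqnormE !mulr_sumr; congr (_ + _); apply: eq_bigr => j _.
  by rewrite !mxE /m /noise !mxE; ring.
under eq_integral do rewrite lhsE.
have IE : I = (\int[P]_w (U w)%:E + al%:E * \sum_j \int[P]_w (U w * Y s w j 0 ^+ 2)%:E)%E.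
  rewrite /I; under eq_integral do rewrite UE.
  rewrite integral_EFinD; try solve [mf | pos].
  rewrite integral_EFinZ; try solve [mf | pos].
  rewrite integral_EFin_sum//; first by move=> j; mf.
  by move=> j w; pos.
have mUm j : measurable_fun setT (fun w => U w * (Y s w j 0 + m j w) ^+ 2) by mf.
rewrite integral_EFinD; try solve [mf | pos].
rewrite integral_EFinZ; try solve [mf | pos].
rewrite integral_EFin_sum//; last by move=> j w; pos.
have [a a0 aE] : exists2 a : R, 0 <= a & (\int[P]_w (U w)%:E = a%:E)%E.
  have : (0 <= \int[P]_w (U w)%:E)%E by exact: integral_EFin_ge0.
  have : (\int[P]_w (U w)%:E <= I)%E.
    rewrite IE leeDl// mule_ge0 ?lee_fin// sume_ge0// => j _; apply: integral_EFin_ge0 => w; pos.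
  case: (\int[P]_w (U w)%:E)%E => [r _ r0| |//]; first by exists r.
  by rewrite leye_eq => /eqP Ioo; rewrite Ioo eqxx in Ifin.
have bE' j : {c : R | 0 <= c & (\int[P]_w (U w * Y s w j 0 ^+ 2)%:E = c%:E)%E}.
  apply/cid2.
  have h0 : (0 <= \int[P]_w (U w * Y s w j 0 ^+ 2)%:E)%E by apply: integral_EFin_ge0 => w; pos.
  have : (al%:E * \int[P]_w (U w * Y s w j 0 ^+ 2)%:E <= I)%E.
    rewrite IE; apply: (@le_trans _ _ (al%:E * \sum_j \int[P]_w (U w * Y s w j 0 ^+ 2)%:E)%E); last first.
      by rewrite leeDr// aE lee_fin.
    apply: lee_wpmul2l; first by rewrite lee_fin.
    rewrite (bigD1 j)//= leeDl// sume_ge0// => i _; apply: integral_EFin_ge0 => w; pos.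
  case: (\int[P]_w (U w * Y s w j 0 ^+ 2)%:E)%E h0 => [r r0 _| |//]; first by exists r.
  rewrite gt0_muley ?lte_fin//.
  by rewrite leye_eq => _ /eqP Ioo; rewrite Ioo eqxx in Ifin.
pose c j := s2val (bE' j).
have c0 j : 0 <= c j := s2valP (bE' j).
have cE j : (\int[P]_w (U w * Y s w j 0 ^+ 2)%:E = (c j)%:E)%E := s2valP' (bE' j).
rewrite aE; apply: (@le_trans _ _ (a%:E + al%:E * \sum_j (c j + v j * a)%:E)%E).
  rewrite leeD2l// lee_wpmul2l ?lee_fin//; apply: lee_sum => j _.
  exact: (subgaussian_sqrD subF (mm j) (v0 j) (sg j) gU (gY j) U0 aE (cE j)).
rewrite IE aE; under [X in (_ <= _ * (_ + _ * X))%E]eq_bigr do rewrite cE.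
rewrite !sumEFin -!EFinM -!EFinD lee_fin -mulrBr.
rewrite big_split/= -mulr_suml.
set V := \sum_i v i in sv *; set S := \sum_i c i.
have S0 : 0 <= S by apply: sumr_ge0.
have := expR_ge1Dx (al * (trace_int t - trace_int s)).
move: (expR _) => E hE.
have h1 : al * V <= al * (trace_int t - trace_int s) by rewrite ler_wpM2l.
apply: (@le_trans _ _ ((1 + al * V) * (a + al * S))).
  have V0 : 0 <= V by apply: sumr_ge0.
  have : 0 <= al * V * (al * S) by pos.
  nra.
by apply: ler_wpM2r; [pos|lra].
Qed.

(** Lower bound for the time integral of |Y|^2 / (1 + al |Y|^2), from 1 / (1 + z) >= 1 - z. *)
Let bracket t al w := \int[mu]_(u in `[0, t]) (sqnorm (Y u w) + (- al) * (sqnorm (Y u w) * sqnorm (Y u w))).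

Let psi_measurable al d' (T : measurableType d') (Z : T -> 'cV[R]_n) :
  (forall j, measurable_fun setT (fun w => Z w j 0)) ->
  measurable_fun setT (fun w => psi al (Z w)).
Proof.
move=> mZ; apply: measurable_funD; first exact: measurable_cst.
apply: measurable_funM; first exact: measurable_cst.
by apply: measurable_sqnorm => i j; rewrite ord1.
Qed.

Let q_continuous al w j : 0 < al -> continuous (fun u : R => q al j (Y (Num.max 0 u) w)).
Proof.
move=> al0 u; have cYi i := @continuous_paths_coord _ _ _ _ _ w i cY.
apply: cvgM; first by apply: cvgM; [exact: cvg_cst|exact: cYi].
apply: cvgV; first by rewrite gt_eqF// psi_gt0// ltW.
apply: cvgD; first exact: cvg_cst.
apply: cvgM; first exact: cvg_cst.
apply: cvg_sumr => i; apply: cvg_sumr => l; rewrite ord1 expr2.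
by under eq_cvg do rewrite expr2; apply: cvgM; exact: cYi.
Qed.

Let bracket_measurable al t : 0 <= t -> measurable_fun setT (bracket t al).
Proof.
move=> t0; apply: (gfun_measurable (filtration_measurable filF t0)).
have psq := progressive_sqnorm filF aY cY.
apply: (progressive_integral _ t0) => //; apply: progressiveD => //.
apply: progressiveM; last exact: progressiveM.
by apply: (@progressive_cst _ _ _ F (fun=> - al)); exact: measurable_cst.
Qed.

Let sqnorm_path_measurable w t : 0 <= t ->
  measurable_fun (`[0, t]%classic : set (measurableTypeR R)) (fun u => sqnorm (Y u w)).
Proof. exact: (progressive_path filF w (progressive_sqnorm filF aY cY)). Qed.

Let sqnorm_path_bounded w t : exists2 B, 0 <= B & forall u, 0 <= u <= t -> sqnorm (Y u w) <= B.
Proof.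
have [B B0 hB] := path_bounded cY w t; exists (\sum_(i < n) B ^+ 2); first by pos.
move=> u ut; rewrite sqnormE; apply: ler_sum => i _.
by rewrite -real_normK ?num_real// ler_sqr ?nnegrE// hB.
Qed.

(** The exponent E integrates a nonnegative function, as C is positive semidefinite, and dominates 4
    al k times the bracket; then (1 + al |Y_t|^2) (1 + E) >= 1 + al |Y_t|^2 + E. Since the bracket
    may be negative, the maximum with 0 is what makes Fatou's lemma applicable afterwards. *)
Let weight_le al t w : 0 < al -> 0 <= t ->
  1 + al * Num.max 0 (sqnorm (Y t w) + 4 * k * bracket t al w) <=
  psi al (Y t w) * expR (- (\sum_j \int[mu]_(u in `[0, t]) (q al j (Y u w) * b u w j 0))).
Proof.
move=> al1 t0; have al0 := ltW al1.
set E := - _; pose y2 u := sqnorm (Y u w).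
have y20 u : 0 <= y2 u by exact: sqnorm_ge0.
have my2 : measurable_fun (`[0, t]%classic : set (measurableTypeR R)) y2 by exact: sqnorm_path_measurable.
have [B2 B20 hB2] := sqnorm_path_bounded w t.
have [B hB] := dissipative_bounded w t.
have iq j : mu.-integrable `[0, t] (EFin \o (fun u => q al j (Y u w) * b u w j 0)).
  have [Q hQ] := continuous_bounded 0 t (@q_continuous al w j al1).
  apply: (@bounded_integrable _ _ _ _ (Q * B)).
    apply: measurable_funM; last exact: dissipative_path_measurable.
    apply: (@path_measurable _ (fun u => q al j (Y u w))) => //.
    by apply: continuous_measurable_funR; exact: q_continuous.
  move=> u ut; have /andP[u0 _] := ut; rewrite normrM ler_pM// ?hB//.
  by have := hQ u ut; rewrite max_r.
have ey : E = \int[mu]_(u in `[0, t]) (- \sum_j (q al j (Y u w) * b u w j 0)).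
  rewrite /E -Rintegral_sum// -mulN1r -RintegralZl//; last exact: integrable_sumR.
  by apply: eq_Rintegral => u _; rewrite mulN1r.
have lower u : 0 <= u <= t ->
    al * (4 * k * (y2 u + - al * (y2 u * y2 u))) <= - \sum_j (q al j (Y u w) * b u w j 0) /\
    0 <= - \sum_j (q al j (Y u w) * b u w j 0).
  move=> /andP[u0 _].
  have -> : - \sum_j (q al j (Y u w) * b u w j 0) =
    (2 * al * k / psi al (Y u w)) * (2 * y2 u + y2 u * y2 u + ((Y u w)^T *m C u *m Y u w) 0 0).
    have -> : ((Y u w)^T *m C u *m Y u w) 0 0 = \sum_j Y u w j 0 * (C u *m Y u w) j 0.
      by rewrite -mulmxA mxE; apply: eq_bigr => j _; rewrite mxE.
    have -> : 2 * y2 u + y2 u * y2 u = \sum_j (2 * Y u w j 0 ^+ 2 + y2 u * Y u w j 0 ^+ 2).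
      by rewrite big_split/= -!mulr_sumr -sqnormE.
    rewrite -big_split/= mulr_sumr -sumrN; apply: eq_bigr => j _.
    by rewrite bjE// /q -/(y2 u); ring.
  have p0 := psdC (Y u w) u0; have g0 := psi_gt0 (Y u w) al0.
  set S := ((Y u w)^T *m C u *m Y u w) 0 0 in p0 *.
  have yy := y20 u; have ak : 0 <= 2 * al * k by have := ltW k0; pos.
  split; last first.
    by apply: mulr_ge0; [apply: divr_ge0 => //; exact: ltW|pos].
  have -> : al * (4 * k * (y2 u + - al * (y2 u * y2 u))) =
     2 * al * k * (2 * y2 u * (1 - al * y2 u)) by ring.
  rewrite -[leRHS]mulrA; apply: ler_wpM2l => //.
  rewrite [leRHS]mulrC ler_pdivlMr// /psi -/(y2 u).
  have -> : 2 * y2 u * (1 - al * y2 u) * (1 + al * y2 u) = 2 * y2 u - 2 * y2 u * (al * y2 u) ^+ 2 by ring.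
  have : 0 <= 2 * y2 u * (al * y2 u) ^+ 2 by pos.
  have : 0 <= y2 u * y2 u by pos.
  lra.
have iE : mu.-integrable `[0, t] (EFin \o (fun u => - \sum_j (q al j (Y u w) * b u w j 0))).
  have : mu.-integrable `[0, t] (EFin \o (fun u => -1 * \sum_j (q al j (Y u w) * b u w j 0))).
    by apply: integrable_scaleR => //; exact: integrable_sumR.
  by congr (integrable _ _ (EFin \o _)); apply/funext => u; rewrite mulN1r.
have ib : mu.-integrable `[0, t] (EFin \o (fun u => y2 u + - al * (y2 u * y2 u))).
  apply: (@bounded_integrable _ _ _ _ (B2 + al * (B2 * B2))).
    by mf.
  move=> u ut; apply: le_trans (ler_normD _ _) _; rewrite ger0_norm//; apply: lerD; first exact: hB2.
  rewrite normrM normrN (ger0_norm al0) ger0_norm ?mulr_ge0//; apply: ler_wpM2l => //.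
  by apply: ler_pM => //; exact: hB2.
have E0 : 0 <= E.
  rewrite ey; apply: fine_ge0; apply: integral_ge0 => u /=; rewrite in_itv/= => ut.
  by rewrite lee_fin; have [] := lower u ut.
have EG : al * (4 * k * bracket t al w) <= E.
  rewrite ey /bracket !mulrA -RintegralZl//; apply: le_Rintegral => //.
    exact: integrable_scaleR.
  by move=> u /=; rewrite in_itv/= => ut; have [+ _] := lower u ut; rewrite !mulrA.
have := expR_ge1Dx E; move: (expR E) => X hX.
apply: (@le_trans _ _ (psi al (Y t w) * (1 + E))); last by rewrite ler_wpM2l// ltW// psi_gt0.
rewrite /psi -/(y2 t); have yt := y20 t.
have h1 : 0 <= al * y2 t by pos.
have h2 : 0 <= al * y2 t * E by pos.
move: EG; move: (bracket t al w) => G EG.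
by rewrite maxEle; case: ifP => _; nra.
Qed.

Lemma energy_weight al t : 0 < al -> 0 < t ->
  (\int[P]_w (1 + al * Num.max 0 (sqnorm (Y t w) + 4 * k * bracket t al w))%:E <=
   (expR (al * trace_int t))%:E * (1 + al * f 0)%:E)%E.
Proof.
move=> al1 t0; have al0 := ltW al1.
have := @weighted_expectation_le R n _ _ P F filF (psi al) (q al) (fun v => psi_gt0 v al0)
  (fun v a => psi_convex v a al1) (@psi_measurable al) Y b (fun t => al * trace_int t)
  (fun t j => adapted_gfun aY (t := t) j) (fun t j => time_integral_gfun dissipative_progressive (t := t) j)
  (fun w j => @q_continuous al w j al1) (fun w j t => @dissipative_path_measurable w j t)
  dissipative_bounded (fun s t => @one_step_sqnorm al s t al1) t
  (fun w => 1 + al * Num.max 0 (sqnorm (Y t w) + 4 * k * bracket t al w)) t0.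
have -> : (\int[P]_w (psi al (Y 0 w))%:E = (1 + al * f 0)%:E)%E.
  rewrite integral_EFinD; try solve [mf | pos]; last first.
  - by move=> w; apply: mulr_ge0 => //; exact: sqnorm_ge0.
  - by apply: measurable_funM; [exact: measurable_cst|exact: measurable_sqnorm_process].
  rewrite integral_EFinZ//; [|exact: measurable_sqnorm_process|by move=> w; exact: sqnorm_ge0].
  by rewrite integral_cst//= probability_setT mule1 second_momentE.
have -> : trace_int 0 = 0 by rewrite /trace_int set_itv1 Rintegral_set1.
rewrite mulr0 subr0; apply.
- apply: measurable_funD; first exact: measurable_cst.
  apply: measurable_funM; first exact: measurable_cst.
  apply: measurable_maxr; first exact: measurable_cst.
  apply: measurable_funD; first by apply: measurable_sqnorm_process; exact: ltW.
  by apply: measurable_funM; [exact: measurable_cst|apply: bracket_measurable; exact: ltW].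
- by move=> w; apply: addr_ge0 => //; apply: mulr_ge0 => //; rewrite le_max lexx.
- by move=> w; apply: weight_le => //; exact: ltW.
Qed.

(** With J the integral of k f, [energy_weight] reads 1 + al r <= e^(al J) (1 + al f(0)). To first
    order in al this is r <= f(0) + J, and the lower limit of r is at least f(t) + 4 J. The 4 is
    twice the rate 2 of the linear drift, the J comes from the noise. *)
Lemma energy t : 0 <= t -> f t + 3 * \int[mu]_(u in `[0, t]) (k * f u) <= f 0.
Proof.
rewrite le_eqVlt => /predU1P[<-|t0].
  by rewrite set_itv1 Rintegral_set1 mulr0 addr0.
have t0' := ltW t0; rewrite -/(trace_int t).
set J := trace_int t; have J0 : 0 <= J.
  have := trace_int_le (lexx 0) t0'; rewrite {1}/trace_int set_itv1 Rintegral_set1//.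
pose al (N : nat) : R := N.+1%:R^-1.
have al0 N : 0 < al N by rewrite invr_gt0.
have small (c : R) : 0 < c -> \forall N \near \oo, al N <= c.
  by move=> c0; apply: filterS (near_infty_natSinv_lt (PosNum c0)) => N /ltW.
pose fk N w := Num.max 0 (sqnorm (Y t w) + 4 * k * bracket t (al N) w).
pose fl w := sqnorm (Y t w) + 4 * \int[mu]_(u in `[0, t]) (k * sqnorm (Y u w)).
have mYt := measurable_sqnorm_process t0'.
have mfk N : measurable_fun setT (fk N).
  apply: measurable_maxr; first exact: measurable_cst.
  apply: measurable_funD => //.
  by apply: measurable_funM; [exact: measurable_cst|exact: bracket_measurable].
have joint : measurable_fun [set: measurableTypeR R * Om] (fun p => k * sqnorm (Y (Num.max 0 p.1) p.2)).
  apply: measurable_funM; first exact: measurable_cst.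
  by apply: measurable_sqnorm => i j; rewrite ord1; exact: (joint_coord filF aY cY).
have iy w : mu.-integrable `[0, t] (EFin \o (fun u => k * sqnorm (Y u w))).
  have [B B0 hB] := sqnorm_path_bounded w t; apply: integrable_scaleR => //.
  apply: (@bounded_integrable _ _ _ _ B); first exact: sqnorm_path_measurable.
  by move=> u ut; rewrite ger0_norm ?sqnorm_ge0// hB.
have pos_int w : 0 <= \int[mu]_(u in `[0, t]) (k * sqnorm (Y u w)).
  apply: fine_ge0; apply: integral_ge0 => u _.
  by rewrite lee_fin mulr_ge0 ?sqnorm_ge0// ltW.
have mint : measurable_fun setT (fun w => \int[mu]_(u in `[0, t]) (k * sqnorm (Y u w))).
  have := measurable_Rintegral_fst (measurable_itv `[0, t]) joint.
  congr (measurable_fun _ _); apply/funext => w; apply: eq_Rintegral => u.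
  by rewrite mem_setE in_itv/= => /andP[u0 _]; rewrite max_r.
have intE : (\int[P]_w (fl w)%:E = (f t + 4 * J)%:E)%E.
  rewrite integral_EFinD; try solve [mf | pos | by move=> w; exact: sqnorm_ge0].
  rewrite second_momentE// integral_EFinZ// tonelli_path//; last first.
    by move=> u w u0; rewrite mulr_ge0 ?sqnorm_ge0// ltW.
  rewrite [X in (_ + 4%:E * X)%E](_ : _ = J%:E) -?EFinM -?EFinD//.
  rewrite /J /trace_int /Rintegral fineK.
    apply: eq_integral => u; rewrite mem_setE in_itv/= => /andP[u0 _].
    rewrite integral_EFinZ ?second_momentE ?EFinM// ?(ltW k0)//; first exact: measurable_sqnorm_process.
    by move=> w; exact: sqnorm_ge0.
  apply: integrable_fin_num => //.
  exact: (trace_integrable mkf kfM hf).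
suff : (\int[P]_w (fl w)%:E <= (f 0 + J)%:E)%E by rewrite intE lee_fin; lra.
apply: (fatou_EFin (fk := fk)) => //.
- by apply: measurable_funD => //; mf.
- by move=> N w; rewrite le_max lexx.
- by move=> w; rewrite addr_ge0 ?sqnorm_ge0 ?mulr_ge0.
- move=> w e e0; have [B B0 hB] := sqnorm_path_bounded w t.
  pose D := 4 * k * (t * (B * B)); have D0 : 0 <= D by have := ltW k0; rewrite /D; pos.
  apply: filterS (small (e / (D + 1)) _); last by rewrite divr_gt0// ltr_wpDl.
  move=> N hN; rewrite /fk le_max; apply/orP; right.
  have i1 : mu.-integrable `[0, t] (EFin \o (fun u => sqnorm (Y u w))).
    apply: (@bounded_integrable _ _ _ _ B); first exact: sqnorm_path_measurable.
    by move=> u ut; rewrite ger0_norm ?sqnorm_ge0// hB.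
  have i2 : mu.-integrable `[0, t] (EFin \o (fun u => sqnorm (Y u w) * sqnorm (Y u w))).
    apply: (@bounded_integrable _ _ _ _ (B * B)).
      by apply: measurable_funM; exact: sqnorm_path_measurable.
    by move=> u ut; rewrite ger0_norm ?mulr_ge0 ?sqnorm_ge0// ler_pM ?sqnorm_ge0 ?hB.
  have i2' : mu.-integrable `[0, t] (EFin \o (fun u => (- al N) * (sqnorm (Y u w) * sqnorm (Y u w)))).
    exact: integrable_scaleR.
  rewrite /fl /bracket RintegralD// !RintegralZl//.
  have le2 : \int[mu]_(u in `[0, t]) (sqnorm (Y u w) * sqnorm (Y u w)) <= t * (B * B).
    apply: (@le_trans _ _ (\int[mu]_(u in `[0, t]) (B * B))).
      apply: le_Rintegral => //.
        by apply: (@bounded_integrable _ _ _ _ (B * B)) => [|u _]; [exact: measurable_cst|rewrite ger0_norm ?mulr_ge0].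
      by move=> u /=; rewrite in_itv/= => ut; rewrite ler_pM ?sqnorm_ge0 ?hB.
    rewrite Rintegral_cst// [X in fine X](lebesgue_measure_itv `[0, t])/= lte_fin t0 -EFinB/= subr0.
    by rewrite mulrC.
  set I1 := \int[mu]_(_ in _) _; set I2 := \int[mu]_(_ in _) _ in le2 *.
  have : al N * (D + 1) <= e by rewrite -ler_pdivlMr// ltr_wpDl.
  have : al N * (4 * k * I2) <= al N * D by rewrite ler_wpM2l ?(ltW (al0 N))// /D ler_wpM2l// mulr_ge0// ltW.
  have := ltW (al0 N).
  lra.
(* The first bound gives al J <= 1/2, the second al J (f(0) + J) <= e / 2, so the factor 1 - al J
   can be divided out at the price of e. *)
- move=> e e0; have c0 : 0 < Num.min (2^-1 / (J + 1)) (e / (2 * (J * (f 0 + J) + 1))).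
    have f0 := second_moment_ge0 0.
    rewrite lt_min !divr_gt0//=; first by rewrite mulr_gt0// ltr_wpDl// mulr_ge0// addr_ge0.
    by rewrite ltr_wpDl.
  apply: filterS (small _ c0) => N; rewrite le_min => /andP[h1 h2].
  have f0 := second_moment_ge0 0.
  have a0 := al0 N.
  have hx : al N * J <= 2^-1.
    have : al N * (J + 1) <= 2^-1 by rewrite -ler_pdivlMr// ltr_wpDl.
    lra.
  have K0 : 0 <= J * (f 0 + J) by pos.
  have hy : al N * (J * (f 0 + J)) * 2 <= e.
    have : al N * (2 * (J * (f 0 + J) + 1)) <= e.
      by rewrite -ler_pdivlMr// mulr_gt0// ltr_wpDl.
    nra.
  have := energy_weight (al0 N) t0; rewrite -/J.
  under eq_integral do rewrite -/(fk N _).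
  have mfkN : measurable_fun setT (fun w => al N * fk N w) by mf.
  rewrite integral_EFinD; try solve [mf | pos | by move=> w; apply: mulr_ge0; [exact: ltW|rewrite le_max lexx]].
  rewrite integral_EFinZ; [|exact: (mfk N)|exact: ltW|by move=> w; rewrite le_max lexx].
  rewrite integral_cst//= probability_setT mule1.
  have : (0 <= \int[P]_w (fk N w)%:E)%E by apply: integral_EFin_ge0 => w; rewrite le_max lexx.
  case: (\int[P]_w (fk N w)%:E)%E => [r r0| _ |//]; last first.
    by rewrite gt0_muley ?lte_fin// addey// leye_eq.
  rewrite -EFinD -!EFinM lee_fin => hr.
  have hE := expR_le_inv (_ : al N * J < 1); have {}hE := hE ltac:(lra).
  have p1 : 0 < 1 - al N * J by lra.
  have : (1 + al N * r) * (1 - al N * J) <= 1 + al N * f 0.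
    rewrite -ler_pdivlMr// [leRHS]mulrC; apply: le_trans hr _; rewrite ler_wpM2r//.
    by apply: addr_ge0 => //; apply: mulr_ge0 => //; exact: ltW.
  move=> h3; rewrite -EFinD lee_fin.
  have h4 : r * (1 - al N * J) <= f 0 + J.
    rewrite -(ler_pM2l a0); nra.
  have : r * (1 - al N * J) <= (f 0 + J + e) * (1 - al N * J).
    apply: le_trans h4 _; nra.
  by rewrite ler_pM2r.
Qed.

Let psi2 la (v : 'cV[R]_n) := 1 + \sum_j ch (la * v j 0).
Let q2 la j (v : 'cV[R]_n) := la * sh (la * v j 0) / psi2 la v.

Let psi2_gt0 la v : 0 < psi2 la v.
Proof.
by rewrite ltr_pwDl// sumr_ge0// => j _; exact: le_trans (ch_ge1 _).
Qed.

Let psi2_convex la (v a : 'cV[R]_n) :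
  psi2 la v * (1 - \sum_j q2 la j v * a j 0) <= psi2 la (v - a).
Proof.
rewrite mulrBr mulr1 mulr_sumr.
have -> : \sum_j psi2 la v * (q2 la j v * a j 0) = \sum_j la * sh (la * v j 0) * a j 0.
  apply: eq_bigr => j _; rewrite /q2; field; by rewrite gt_eqF// psi2_gt0.
rewrite /psi2 -addrA lerD2l -sumrB; apply: ler_sum => j _; rewrite !mxE /ch /sh.
have := expR_sub_ge (la * v j 0) (la * a j 0).
have := expR_sub_ge (- (la * v j 0)) (- (la * a j 0)).
have -> : la * v j 0 - la * a j 0 = la * (v j 0 - a j 0) by ring.
have -> : - (la * v j 0) - - (la * a j 0) = - (la * (v j 0 - a j 0)) by ring.
move: (expR _) (expR _) (expR _) (expR _) => *; lra.
Qed.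

Let psi2_measurable la d' (T : measurableType d') (Z : T -> 'cV[R]_n) :
  (forall j, measurable_fun setT (fun w => Z w j 0)) ->
  measurable_fun setT (fun w => psi2 la (Z w)).
Proof. by move=> mZ; rewrite /psi2 /ch; mf. Qed.

Let q2_continuous la w j : continuous (fun u : R => q2 la j (Y (Num.max 0 u) w)).
Proof.
move=> u; have cYi i := @continuous_paths_coord _ _ _ _ _ w i cY.
have cE (c : R) i : expR (c * Y (Num.max 0 v) w i 0) @[v --> u] --> expR (c * Y (Num.max 0 u) w i 0).
  apply: (continuous_cvg _ (@continuous_expR R _)).
  by apply: cvgM; [exact: cvg_cst|exact: cYi].
apply: cvgM.
  apply: cvgM; first exact: cvg_cst.
  apply: cvgM; last exact: cvg_cst.
  by apply: cvgB; [exact: cE|under eq_cvg do rewrite -mulNr; rewrite -mulNr; exact: cE].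
apply: cvgV; first by rewrite gt_eqF.
apply: cvgD; first exact: cvg_cst.
apply: cvg_sumr => i; apply: cvgM; last exact: cvg_cst.
by apply: cvgD; [exact: cE|under eq_cvg do rewrite -mulNr; rewrite -mulNr; exact: cE].
Qed.

(** The two halves of each cosine are exponentials with parameters la and -la, whose subgaussian
    bounds depend on la^2 only; every single variance is at most the total one. *)
Lemma one_step_ch la s t : 0 <= s -> s <= t ->
  forall U : Om -> R, gfun (F s) U -> (forall w, 0 <= U w) ->
  (\int[P]_w (U w * psi2 la (Y s w + ((Y t w - time_integral b t w) -
       (Y s w - time_integral b s w))))%:E <=
   (expR (la ^+ 2 / 2 * trace_int t - la ^+ 2 / 2 * trace_int s))%:E *
     \int[P]_w (U w * psi2 la (Y s w))%:E)%E.
Proof.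
move=> s0 st U gU U0; have t0 := le_trans s0 st.
have [v [v0 sg sv]] := dissipative_variance s0 st.
have subF := filtration_measurable filF s0.
have mU := gfun_measurable subF gU.
have gY j : gfun (F s) (fun w => Y s w j 0) by exact: adapted_gfun.
have mY j : measurable_fun [set: Om] (fun w => Y s w j 0) by exact: (gfun_measurable subF (gY j)).
have mN r j : 0 <= r -> measurable_fun setT (fun w => noise Y b r w j).
  move=> r0; apply: (gfun_measurable (filtration_measurable filF r0)).
  exact: (noise_gfun ipY dissipative_progressive).
pose m j w := noise Y b t w j - noise Y b s w j.
have mm j : measurable_fun setT (m j) by apply: measurable_funB; exact: mN.
rewrite -mulrBr; set E := expR _.
have E1 : 1 <= E.
  by rewrite /E -expR0 ler_expR mulr_ge0 ?divr_ge0 ?sqr_ge0// subr_ge0; exact: trace_int_le.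
have vle j : v j <= trace_int t - trace_int s.
  apply: le_trans sv; rewrite (bigD1 j)//= lerDl; exact: sumr_ge0.
have expE (c : R) j : c ^+ 2 = la ^+ 2 ->
    (\int[P]_w (U w * expR (c * Y s w j 0) * expR (c * m j w))%:E <=
     E%:E * \int[P]_w (U w * expR (c * Y s w j 0))%:E)%E.
  move=> cla; have gUe : gfun (F s) (fun w => U w * expR (c * Y s w j 0)).
    apply: (@measurable_funM _ (SA (F s))) => //.
    apply: (measurableT_comp (@measurable_expR R)).
    by apply: (@measurable_funM _ (SA (F s))) => //; exact: measurable_cst.
  apply: le_trans (subgaussian_exp subF (mm j) (sg j) c gUe _) _; first by move=> w; pos.
  apply: lee_wpmul2r; first by apply: integral_EFin_ge0 => w; pos.
  rewrite lee_fin ler_expR cla mulrAC ler_wpM2l// divr_ge0// sqr_ge0//.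
have lhsE w : U w * psi2 la (Y s w + ((Y t w - time_integral b t w) - (Y s w - time_integral b s w))) =
   U w + \sum_j (2^-1 * (U w * expR (la * Y s w j 0) * expR (la * m j w)) +
                 2^-1 * (U w * expR (- la * Y s w j 0) * expR (- la * m j w))).
  rewrite /psi2 mulrDr mulr1 mulr_sumr; congr (_ + _); apply: eq_bigr => j _.
  have -> : (Y s w + (Y t w - time_integral b t w - (Y s w - time_integral b s w))) j 0 = Y s w j 0 + m j w.
    by rewrite !mxE /m /noise !mxE; ring.
  by rewrite /ch -mulNr !mulrDr !expRD; field.
have rhsE w : U w * psi2 la (Y s w) =
   U w + \sum_j (2^-1 * (U w * expR (la * Y s w j 0)) + 2^-1 * (U w * expR (- la * Y s w j 0))).
  rewrite /psi2 mulrDr mulr1 mulr_sumr; congr (_ + _); apply: eq_bigr => j _.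
  by rewrite /ch -mulNr; field.
under eq_integral do rewrite lhsE.
under [X in (_ <= _ * X)%E]eq_integral do rewrite rhsE.
have i20 : 0 <= 2^-1 :> R by [].
rewrite integral_EFinD; try solve [mf | pos].
rewrite integral_EFin_sum; try solve [by move=> j; mf | by move=> j w; pos].
rewrite integral_EFinD; try solve [mf | pos].
rewrite integral_EFin_sum; try solve [by move=> j; mf | by move=> j w; pos].
rewrite ge0_muleDr; last 2 first.
- exact: integral_EFin_ge0.
- by apply: sume_ge0 => j _; apply: integral_EFin_ge0 => w; pos.
apply: leeD.
  by rewrite -[leLHS]mul1e; apply: lee_wpmul2r; [exact: integral_EFin_ge0|rewrite lee_fin].
rewrite ge0_sume_distrr; last by move=> j _; apply: integral_EFin_ge0 => w; pos.
apply: lee_sum => j _.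
have half (f1 f2 : Om -> R) : measurable_fun setT f1 -> measurable_fun setT f2 ->
    (forall w, 0 <= f1 w) -> (forall w, 0 <= f2 w) ->
    (\int[P]_w (2^-1 * f1 w + 2^-1 * f2 w)%:E =
     (2^-1)%:E * \int[P]_w (f1 w)%:E + (2^-1)%:E * \int[P]_w (f2 w)%:E)%E.
  move=> m1 m2 p1 p2; rewrite integral_EFinD; try solve [mf | pos].
  by rewrite integral_EFinZ// integral_EFinZ.
rewrite half; try solve [mf | pos].
rewrite half; try solve [mf | pos].
rewrite [leRHS]ge0_muleDr; last 2 first.
- by apply: mule_ge0; [rewrite lee_fin|apply: integral_EFin_ge0 => w; pos].
- by apply: mule_ge0; [rewrite lee_fin|apply: integral_EFin_ge0 => w; pos].
by apply: leeD; rewrite muleCA; (apply: lee_wpmul2l; first by rewrite lee_fin);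
  apply: expE; rewrite ?sqrrN.
Qed.

(** Everything is measured, pointwise in time, by S_j = sinh(la |y_j|) |y_j|: the drift contributes
    at least the sum of the S_j, while (|y_i| - 1/la) psi is at most a multiple of that sum. *)
Lemma exponential_moment (la t c : R) (i : 'I_n) : 0 < la -> 0 < t ->
  (forall u j l, 0 <= u <= t -> `|C u j l| <= c) -> 2 * n%:R * c <= 1 ->
  (\int[P]_w (expR (la * k / n.+3%:R * \int[mu]_(u in `[0, t]) (`|Y u w i 0| - la^-1)))%:E <=
   (expR (la ^+ 2 / 2 * trace_int t))%:E * \int[P]_w (psi2 la (Y 0 w))%:E)%E.
Proof.
move=> la0 t0 hc nc; have t0' := ltW t0.
have pY : progressive F (fun u w => `|Y u w i 0|).
  move=> r r0; apply: (measurableT_comp (@normr_measurable R setT)).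
  exact: (progressive_coord filF aY cY i r0).
have p1 : progressive F (fun u w => `|Y u w i 0| - la^-1).
  have pc (e : R) : progressive F (fun _ _ => e).
    by apply: (@progressive_cst _ _ _ F (fun=> e)); exact: measurable_cst.
  exact: progressiveD.
have := @weighted_expectation_le R n _ _ P F filF (psi2 la) (q2 la) (psi2_gt0 la)
  (psi2_convex la) (@psi2_measurable la) Y b (fun t => la ^+ 2 / 2 * trace_int t)
  (fun t j => adapted_gfun aY (t := t) j) (fun t j => time_integral_gfun dissipative_progressive (t := t) j)
  (fun w j => @q2_continuous la w j) (fun w j t => @dissipative_path_measurable w j t)
  dissipative_bounded (fun s t => @one_step_ch la s t) t
  (fun w => expR (la * k / n.+3%:R * \int[mu]_(u in `[0, t]) (`|Y u w i 0| - la^-1))) t0.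
have -> : trace_int 0 = 0 by rewrite /trace_int set_itv1 Rintegral_set1.
rewrite mulr0 subr0; apply.
- apply: (measurableT_comp (@measurable_expR R)).
  apply: measurable_funM; first exact: measurable_cst.
  apply: (gfun_measurable (filtration_measurable filF t0')).
  exact: (progressive_integral p1 t0').
- by move=> w; exact: expR_ge0.
move=> w; apply: (@le_trans _ _ (expR (- (\sum_j \int[mu]_(u in `[0, t]) (q2 la j (Y u w) * b u w j 0))))); last first.
  apply: ler_peMl; first exact: expR_ge0.
  by rewrite lerDl sumr_ge0// => j _; exact: le_trans (ch_ge1 _).
rewrite ler_expR.
have [B hB] := dissipative_bounded w t.
have [B1 B10 hB1] := path_bounded cY w t.
have iq j : mu.-integrable `[0, t] (EFin \o (fun u => q2 la j (Y u w) * b u w j 0)).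
  have [Q hQ] := continuous_bounded 0 t (@q2_continuous la w j).
  apply: (@bounded_integrable _ _ _ _ (Q * B)).
    apply: measurable_funM; last exact: dissipative_path_measurable.
    apply: (@path_measurable _ (fun u => q2 la j (Y u w))) => //.
    by apply: continuous_measurable_funR; exact: q2_continuous.
  move=> u ut; have /andP[u0 _] := ut; rewrite normrM ler_pM// ?hB//.
  by have := hQ u ut; rewrite max_r.
have iS : mu.-integrable `[0, t] (EFin \o (fun u => \sum_j (q2 la j (Y u w) * b u w j 0))).
  exact: integrable_sumR.
have iE : mu.-integrable `[0, t] (EFin \o (fun u => - \sum_j (q2 la j (Y u w) * b u w j 0))).
  have : mu.-integrable `[0, t] (EFin \o (fun u => -1 * \sum_j (q2 la j (Y u w) * b u w j 0))).
    exact: integrable_scaleR.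
  by congr (integrable _ _ (EFin \o _)); apply/funext => u; rewrite mulN1r.
have iY : mu.-integrable `[0, t] (EFin \o (fun u => `|Y u w i 0| - la^-1)).
  apply: (@bounded_integrable _ _ _ _ (B1 + la^-1)).
    exact: (progressive_path filF w p1 t0').
  move=> u ut; apply: le_trans (ler_normB _ _) _; rewrite normr_id lerD ?hB1//.
  by rewrite ger0_norm// invr_ge0 ltW.
have -> : - (\sum_j \int[mu]_(u in `[0, t]) (q2 la j (Y u w) * b u w j 0)) =
    \int[mu]_(u in `[0, t]) (- \sum_j (q2 la j (Y u w) * b u w j 0)).
  rewrite -Rintegral_sum// -mulN1r -RintegralZl//.
  by apply: eq_Rintegral => u _; rewrite mulN1r.
rewrite -RintegralZl//; apply: le_Rintegral => //; first exact: integrable_scaleR.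
move=> u /=; rewrite in_itv/= => ut; have /andP[u0 _] := ut.
pose y := Y u w; pose a j := `|y j 0|; pose S j := sh (la * a j) * a j.
have a0 j : 0 <= a j by exact: normr_ge0.
have S0 j : 0 <= S j by rewrite /S mulr_ge0// sh_norm// mulr_ge0// ltW.
have g0 := psi2_gt0 la y.
pose D j := 2 * y j 0 + sqnorm y * y j 0 + (C u *m y) j 0.
have -> : - \sum_j (q2 la j (Y u w) * b u w j 0) = la * k / psi2 la y * \sum_j sh (la * y j 0) * D j.
  rewrite mulr_sumr -sumrN; apply: eq_bigr => j _.
  by rewrite bjE// /q2 /D -/y; ring.
rewrite -!mulrA ler_pM2l// ler_pM2l// mulrC ler_pdivrMr//.
set Sb := \sum_j _ * D j.
have -> : (psi2 la y)^-1 * Sb * n.+3%:R = n.+3%:R * Sb / psi2 la y by ring.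
rewrite ler_pdivlMr// /Sb.
(* Positive semidefiniteness of C gives no sign here, because sinh acts coordinate by coordinate.
   The linear drift contributes 2 sum S, the matrix costs at most 2 n c sum S <= sum S, and the
   cubic term is nonnegative. *)
have h1 : \sum_j S j <= \sum_j sh (la * y j 0) * D j.
  have h2 : \sum_j sh (la * y j 0) * D j >= \sum_j (2 * S j - c * \sum_l (S j + S l)).
    apply: ler_sum => j _; rewrite /D !mulrDr.
    have -> : sh (la * y j 0) * (2 * y j 0) = 2 * S j.
      by rewrite mulrCA sh_norm_mul.
    have p2 : 0 <= sh (la * y j 0) * (sqnorm y * y j 0).
      by rewrite mulrCA sh_norm_mul// mulr_ge0 ?sqnorm_ge0//; exact: S0.
    have p3 : - (c * \sum_l (S j + S l)) <= sh (la * y j 0) * (C u *m y) j 0.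
      suff : `|sh (la * y j 0) * (C u *m y) j 0| <= c * \sum_l (S j + S l).
        by rewrite ler_norml => /andP[].
      rewrite mxE mulr_sumr mulr_sumr; apply: le_trans (ler_norm_sum _ _ _) _.
      apply: ler_sum => l _; rewrite normrM (norm_sh _ la0) normrM mulrCA.
      apply: ler_pM => //.
      - by rewrite mulr_ge0// sh_norm// mulr_ge0// ltW.
      - exact: hc.
      - exact: sh_cross.
    by rewrite -addrA; apply: lerD => //; rewrite -[leLHS]add0r lerD.
  apply: le_trans h2; rewrite sumrB -mulr_sumr -mulr_sumr.
  have -> : \sum_j \sum_l (S j + S l) = 2 * n%:R * \sum_j S j.
    under eq_bigr do rewrite big_split/= sumr_const card_ord.
    rewrite big_split/= sumr_const card_ord sumrMnl -mulr2n -[LHS]mulr_natl -[X in _ * X]mulr_natl.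
    by rewrite mulrA.
  have SS : 0 <= \sum_j S j by apply: sumr_ge0.
  nra.
apply: le_trans (_ : n.+3%:R * \sum_j S j <= _); last first.
  by rewrite ler_wpM2l.
have SS : 0 <= \sum_j S j by apply: sumr_ge0.
have Sle j : S j <= \sum_j S j by rewrite (bigD1 j)//= lerDl sumr_ge0.
have h3 : (a i - la^-1) * psi2 la y <= 2 * S i + \sum_j (S i + S j).
  rewrite /psi2 mulrDr mulr1 mulr_sumr; apply: lerD; last first.
    by apply: ler_sum => j _; rewrite -ch_norm normrM (gtr0_norm la0); exact: ch_sh_cross.
  have [ai|ai] := leP (a i) la^-1.
    by apply: (@le_trans _ _ 0); [rewrite subr_le0|rewrite mulr_ge0].
  apply: (@le_trans _ _ ((a i - la^-1) * ch (la * a i))).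
    by rewrite ler_peMr ?ch_ge1// subr_ge0 ltW.
  apply: le_trans (ch_sh la0 (a0 i)) _; rewrite -/(S i); have := S0 i; lra.
apply: le_trans h3 _.
(* 2 S_i + sum_j (S_i + S_j) = (n + 2) S_i + sum S <= (n + 3) sum S: the origin of the constant n +
   3. *)
rewrite big_split/= sumr_const card_ord -mulr_natl -[n.+3%:R]natr1 -[n.+2%:R]natr1 -[n.+1%:R]natr1.
have := Sle i; have : 0 <= n%:R :> R by []. nra.
Qed.
End dissipative.

(** * The averaged equation *)

Section degenerate_laws.
Context {R : realType} {d : measure_display} {Om : measurableType d} {n : nat}.
Variables (P : probability Om R) (X : Om -> 'cV[R]_n).
Hypothesis mX : measurable_fun [set: Om] (X : Om -> Rn R n).

Lemma measurable_sqnorm_Rn : measurable_fun [set: Rn R n] (fun x : Rn R n => sqnorm (x : 'cV[R]_n)).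
Proof. by apply: measurable_sqnorm => i j; rewrite ord1; exact: measurable_coord. Qed.

Lemma eq_law_integral (nu : probability (Rn R n) R) (g : Rn R n -> R) :
  measurable_fun setT g -> eq_law (law P X) nu ->
  (\int[P]_w (g (X w))%:E = \int[nu]_x (g x)%:E)%E.
Proof.
move=> mg e; rewrite -(integral_law P mX mg).
have := @eq_measure_integral _ _ R [set: Rn R n] nu
  (measure_function_pushforward__canonical__measure_function_Measure P mX) (fun x => (g x)%:E).
by apply=> A mA _; exact: e.
Qed.

Lemma law_dirac0 : {ae P, forall w, X w = 0} -> eq_law (law P X) \d_(0 : Rn R n).
Proof.
move=> X0 A mA; rewrite /law /pushforward diracE.
have mXA : measurable (X @^-1` A) by rewrite -[_ @^-1` _]setTI; exact: mX.
have ae_sub (B : set Om) : measurable B -> {ae P, forall w, ~ B w} -> P B = 0%E.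
  move=> mB [N [mN PN hN]]; apply/eqP; rewrite eq_le measure_ge0 andbT -PN.
  by apply: le_measure; rewrite ?inE// => w Bw; apply: hN => /=; apply.
case: (boolP (_ \in A)) => A0.
  have := ae_sub (~` (X @^-1` A)) (measurableC mXA).
  rewrite probability_setC// => h.
  have {}h : (1 - P (X @^-1` A))%E = 0%E.
    apply: h; apply: filterS X0 => w Xw0 /=; rewrite Xw0; apply; exact: set_mem.
  have fin := fin_num_measure P _ mXA; rewrite -(fineK fin) in h *.
  by move: h; rewrite -EFinB => -[/eqP]; rewrite subr_eq0 => /eqP <-.
apply: ae_sub => //; apply: filterS X0 => w Xw0 /=; rewrite Xw0 => A0'.
by move/negP: A0; apply; exact: mem_set.
Qed.

Lemma sqnorm_integral_eq0 : (\int[P]_w (sqnorm (X w))%:E = 0)%E -> {ae P, forall w, X w = 0}.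
Proof.
move=> I0; have ms : measurable_fun setT (fun w => sqnorm (X w)).
  exact: (measurableT_comp measurable_sqnorm_Rn mX).
have := @ae_eq_integral_abs _ _ _ P setT measurableT (fun w => (sqnorm (X w))%:E) _.
case=> [|+ _]; first by mf.
under eq_integral do rewrite gee0_abs ?lee_fin ?sqnorm_ge0//.
by move=> /(_ I0); apply: filterS => w /= /(_ I) [h]; apply: sqnorm_eq0; rewrite h.
Qed.

End degenerate_laws.

Section constant_processes.
Context {R : realType} {d : measure_display} {Om : measurableType d}.
Variables (P : probability Om R) (F : R -> set (set Om)).
Hypothesis filF : filtration F.
Context {n : nat}.

Lemma adapted_cst (xi : Om -> 'cV[R]_n) : mx_measurable (F 0) xi -> adapted F (fun _ => xi).
Proof. by move=> mxi t t0 A mA; case: filF => _ _ /(_ 0 t (lexx _) t0); apply; exact: mxi. Qed.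

Lemma cst_mx_measurable m k (c : 'M[R]_(m, k)) (t : R) : 0 <= t -> mx_measurable (F t) (fun _ : Om => c).
Proof.
move=> t0 A mA; apply/(filtration_SA filF) => //.
have [Ac|Ac] := pselect (A c).
  by rewrite (_ : _ @^-1` _ = setT)//; apply/seteqP; split.
by rewrite (_ : _ @^-1` _ = set0)//; apply/seteqP; split.
Qed.

Lemma continuous_paths_cst (xi : Om -> 'cV[R]_n) : continuous_paths (fun _ : R => xi).
Proof. by move=> w; apply: continuous_subspaceT => t; exact: cvg_cst. Qed.

Lemma time_integral_eq0 (b : R -> Om -> 'cV[R]_n) t w :
  (forall u, 0 <= u -> b u w = 0) -> time_integral b t w = 0.
Proof.
move=> b0; apply/matrixP => i j; rewrite !mxE.
under eq_Rintegral do [].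
transitivity (\int[lebesgue_measure]_(s in `[0, t]) (0 : R)).
  by apply: eq_Rintegral => s; rewrite mem_setE in_itv/= => /andP[s0 _]; rewrite b0// mxE.
by rewrite /Rintegral integral0.
Qed.

Lemma drift_integrable_eq0 (b : R -> Om -> 'cV[R]_n) :
  (forall u w, 0 <= u -> b u w = 0) -> drift_integrable P b.
Proof.
move=> b0; apply: aeW => w t i t0.
apply: (@eq_integrable _ _ _ _ _ _ (EFin \o (fun=> 0))) => //.
  by move=> u; rewrite mem_setE in_itv/= => /andP[u0 _]; rewrite b0// mxE.
by apply: (@bounded_integrable _ _ _ _ 0) => [|? _]; [exact: measurable_cst|rewrite normr0].
Qed.

Lemma ito_process_cst (W b : R -> Om -> 'cV[R]_n) (h : R -> Om -> 'M[R]_n) (c : 'cV[R]_n) :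
  (forall u w, 0 <= u -> b u w = 0) -> (forall u w, 0 <= u -> h u w = 0) ->
  ito_process P F W (fun _ _ => c) b h.
Proof.
move=> b0 h0; split.
- by move=> t t0; exact: cst_mx_measurable.
- exact: continuous_paths_cst.
- exact: drift_integrable_eq0.
exists (fun _ _ => 0); last first.
  by move=> t t0; apply: aeW => w; rewrite time_integral_eq0 ?addr0// => u; exact: b0.
split.
- move=> i j; apply: (eq_measurable_fun (fun _ : measurableTypeR R * Om => 0 : R)); last exact: measurable_cst.
  by move=> p; rewrite inE/= => p0; rewrite h0// mxE.
- move=> t t0 A mA; apply: (filtration_measurable filF t0).
  by have := @cst_mx_measurable n 1 0 t t0 A mA.
(* Simple processes of size 0, whose integrals are empty sums. *)
exists (fun _ => SimpleProcess 0 (fun=> 0) (fun _ _ => 0)).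
  move=> k; split => //=; last by exists 0 => ? ?; rewrite /sqnorm big1// => i _; rewrite big1// => j _; rewrite mxE expr0n.
  by move=> ?; exact: cst_mx_measurable.
have s0 m k : sqnorm (0 : 'M[R]_(m, k)) = 0.
  by rewrite /sqnorm big1// => i _; rewrite big1// => j _; rewrite mxE expr0n.
move=> k t; split; apply: cvg_near_cst; apply: nearW => N.
  apply: integral0_eq => s /=; rewrite in_itv/= => /andP[s0' _].
  by apply: integral0_eq => w _; rewrite /sp_eval big_ord0 h0// subrr s0.
by apply: integral0_eq => w _; rewrite /sp_integral big_ord0 subrr s0.
Qed.

End constant_processes.

Section frozen_equation.
Context {R : realType} {n : nat}.
Variable mu : set (Rn R n) -> \bar R.
Hypothesis psd_mu : forall y : 'cV[R]_n, 0 <= (y^T *m Cov mu *m y) 0 0.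

Lemma sqrtmx_Cov_le d (Om : measurableType d) (P : probability Om R) (X : Om -> 'cV[R]_n) :
  measurable_fun [set: Om] (X : Om -> Rn R n) -> (\int[P]_w (sqnorm (X w))%:E < +oo)%E ->
  sqnorm (sqrtmx (Cov (law P X))) <= \int[P]_w sqnorm (X w).
Proof.
move=> mX L2X; apply: le_trans (sqnorm_sqrtmx_le _) _; first exact: trace_Cov_ge0.
by have := trace_Cov_le mX L2X 0; under [leRHS]eq_Rintegral do rewrite subr0.
Qed.

Lemma frozen_energy d (Om : measurableType d) (P : probability Om R) (F : R -> set (set Om))
    (B Y : R -> Om -> 'cV[R]_n) (t : R) : frozen_solution P F mu B Y -> 0 <= t ->
  second_moment P Y t + 3 * \int[lebesgue_measure]_(u in `[0, t]) (1 * second_moment P Y u)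
    <= second_moment P Y 0.
Proof.
case=> filF bB L2Y ip t0; apply: (energy filF bB ip L2Y ltr01 (C := fun=> Cov mu)) => //.
- by move=> u w u0; rewrite scale1r.
- move=> T; exists (\sum_i \sum_j `|Cov mu i j|) => u i j _.
  rewrite (bigD1 i)//= (bigD1 j)//= -addrA lerDl addr_ge0 ?sumr_ge0// => l _.
  by apply: sumr_ge0.
- move=> u u0; rewrite mul1r; apply: sqrtmx_Cov_le.
    by case: ip => aY _ _ _; exact: (adapted_measurable filF aY).
  by have [M hM] := L2Y u; apply: le_lt_trans (hM u _) (ltry _); rewrite u0 lexx.
Qed.

Lemma frozen_measurable d (Om : measurableType d) (P : probability Om R) (F : R -> set (set Om))
    (B Y : R -> Om -> 'cV[R]_n) (t : R) : frozen_solution P F mu B Y -> 0 <= t ->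
  measurable_fun [set: Om] (Y t : Om -> Rn R n).
Proof. by case=> filF _ _ [aY _ _ _] t0; exact: (adapted_measurable filF aY t0). Qed.

Lemma frozen_second_momentE d (Om : measurableType d) (P : probability Om R) (F : R -> set (set Om))
    (B Y : R -> Om -> 'cV[R]_n) (t : R) : frozen_solution P F mu B Y -> 0 <= t ->
  (\int[P]_w (sqnorm (Y t w))%:E = (second_moment P Y t)%:E)%E.
Proof. by case=> filF bB L2Y ip t0; exact: second_momentE. Qed.

Let int_dirac : (\int[\d_(0%R : Rn R n)]_x (sqnorm (x : 'cV[R]_n))%:E = 0%:E)%E.
Proof.
rewrite integral_dirac//; last by apply/measurable_EFinP; exact: (@measurable_sqnorm_Rn R n).
by rewrite /sqnorm big1 ?mule0// => i _; rewrite big1// => j _; rewrite mxE expr0n.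
Qed.

Lemma zero_frozen_solution d (Om : measurableType d) (P : probability Om R) (F : R -> set (set Om))
    (B : R -> Om -> 'cV[R]_n) : filtration F -> brownian P F B ->
  frozen_solution P F mu B (fun _ _ => 0).
Proof.
move=> filF bB.
have s0 : sqnorm (0 : 'cV[R]_n) = 0.
  by rewrite /sqnorm big1// => i _; rewrite big1// => j _; rewrite mxE expr0n.
split => //.
  by move=> T; exists 0 => t _; rewrite s0 integral0.
apply: ito_process_cst => //.
  by move=> u w _; rewrite s0 scaler0 scale0r mulmx0 !subr0.
move=> u w u0; apply: sqnorm_eq0.
have m0 : measurable_fun [set: Om] ((fun=> 0) : Om -> Rn R n) by exact: measurable_cst.
apply: le_trans (sqrtmx_Cov_le m0 _) _.
  by under eq_integral do rewrite s0; rewrite integral0.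
by rewrite /Rintegral; under eq_integral do rewrite s0; rewrite integral0.
Qed.

(** The given Brownian motion carries the zero solution, as the existence half of
    [invariant_measure] demands. Any solution started from the Dirac mass has f(0) = 0, and the
    energy inequality keeps it at 0. *)
Lemma dirac0_invariant d (Om : measurableType d) (P : probability Om R) (F : R -> set (set Om))
    (B : R -> Om -> 'cV[R]_n) : filtration F -> brownian P F B ->
  unique_invariant_measure mu (\d_(0 : Rn R n) : probability (Rn R n) R).
Proof.
move=> filF bB; split.
  split.
    exists d, Om, P, F, B, (fun _ _ => 0); split; first exact: zero_frozen_solution.
    by apply: law_dirac0; [exact: measurable_cst|exact: aeW].
  move=> d' Om' P' F' B' Y fs law0 t t0.
  have mY s : 0 <= s -> measurable_fun [set: Om'] (Y s : Om' -> Rn R n) by exact: frozen_measurable fs.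
  apply: (law_dirac0 (mY t t0)); apply: (sqnorm_integral_eq0 (mY t t0)).
  rewrite (frozen_second_momentE fs t0); congr (_%:E); apply/eqP.
  rewrite eq_le second_moment_ge0 andbT.
  have f00 : second_moment P' Y 0 = 0.
    have := eq_law_integral (mY 0 (lexx 0)) measurable_sqnorm_Rn law0.
    by rewrite int_dirac (frozen_second_momentE fs (lexx 0)) => -[].
  have := frozen_energy fs t0; rewrite f00; apply: le_trans; rewrite lerDl mulr_ge0//.
  apply: fine_ge0; apply: integral_ge0 => u _; rewrite lee_fin mul1r; exact: second_moment_ge0.
move=> nu' [[d' [Om' [P' [F' [B' [Y [fs law0]]]]]]] inv] A mA.
have mY s : 0 <= s -> measurable_fun [set: Om'] (Y s : Om' -> Rn R n) by exact: frozen_measurable fs.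
rewrite -law0//; apply: (law_dirac0 (mY 0 (lexx 0)) _ mA).
apply: (sqnorm_integral_eq0 (mY 0 (lexx 0))).
rewrite (frozen_second_momentE fs (lexx 0)).
have fE t : 0 <= t -> second_moment P' Y t = second_moment P' Y 0.
  move=> t0; have := inv _ _ _ _ _ _ fs law0 t t0.
  move/(eq_law_integral (mY t t0) measurable_sqnorm_Rn).
  rewrite -(eq_law_integral (mY 0 (lexx 0)) measurable_sqnorm_Rn law0).
  by rewrite (frozen_second_momentE fs t0) (frozen_second_momentE fs (lexx 0)) => -[].
(* Under an invariant law f is constant, so the energy inequality on [0, 1] reads f + 3 f <= f. *)
have := frozen_energy fs ler01.
have -> : \int[lebesgue_measure]_(u in `[0, 1]) (1 * second_moment P' Y u) = second_moment P' Y 0.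
  transitivity (\int[lebesgue_measure]_(u in `[0, 1]) (second_moment P' Y 0)).
    by apply: eq_Rintegral => u; rewrite mem_setE in_itv/= => /andP[u0 _]; rewrite mul1r fE.
  rewrite Rintegral_cst// [X in fine X](lebesgue_measure_itv `[0, 1])/= lte_fin ltr01.
  by rewrite -EFinB subr0 mulr1.
rewrite (fE 1)// => h; congr (_%:E); apply/eqP; rewrite eq_le second_moment_ge0 andbT; lra.
Qed.

End frozen_equation.

Section averaged_equation.
Context {R : realType} {n : nat} {d : measure_display} {Om : measurableType d}.
Variables (P : probability Om R) (F : R -> set (set Om)) (B : R -> Om -> 'cV[R]_n).
Hypothesis filF : filtration F.
Hypothesis bB : brownian P F B.

Lemma dirac0_mean (nu : probability (Rn R n) R) : eq_law \d_(0 : Rn R n) nu -> mean nu = 0.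
Proof.
move=> e; apply/matrixP => i j; rewrite !mxE.
rewrite -(@eq_measure_integral _ _ _ setT nu \d_(0 : Rn R n)); last by move=> A mA _; exact: e.
rewrite integral_dirac//; first by rewrite mxE mule0.
by apply/measurable_EFinP; exact: measurable_coord.
Qed.

Lemma dirac0_Cov (nu : probability (Rn R n) R) : eq_law \d_(0 : Rn R n) nu -> Cov nu = 0.
Proof.
move=> e; apply/matrixP => i j; rewrite [LHS]mxE [RHS]mxE.
rewrite -(@eq_measure_integral _ _ _ setT nu \d_(0 : Rn R n)); last by move=> A mA _; exact: e.
rewrite dirac0_mean// integral_dirac//; first by rewrite !mxE subr0 mul0r mule0.
apply/measurable_EFinP; apply: measurable_funM; apply: measurable_funB;
  (exact: measurable_coord || exact: measurable_cst).
Qed.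

Lemma law_unique_invariant (X : Om -> 'cV[R]_n) :
  measurable_fun [set: Om] (X : Om -> Rn R n) -> (\int[P]_w (sqnorm (X w))%:E < +oo)%E ->
  unique_invariant_measure (law P X) (\d_(0 : Rn R n) : probability (Rn R n) R).
Proof.
move=> mX L2X; apply: (dirac0_invariant _ filF bB) => y.
by have [_] := Cov_psd mX L2X; apply.
Qed.

Lemma averaged_cst (xi : Om -> 'cV[R]_n) : mx_measurable (F 0) xi ->
  (\int[P]_w (sqnorm (xi w))%:E < +oo)%E -> averaged_solution P F xi (fun _ => xi).
Proof.
move=> mxi L2xi; have a := adapted_cst filF mxi.
have b0 (u : R) (w : Om) : 0 <= u -> - (Cov \d_(0 : Rn R n) *m xi w) + mean \d_(0 : Rn R n) = 0.
  move=> _; rewrite (dirac0_Cov (nu := \d_(0 : Rn R n))) ?(dirac0_mean (nu := \d_(0 : Rn R n)))//.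
  by rewrite mul0mx oppr0 addr0.
split => //.
- exact: continuous_paths_cst.
- move=> T; exists (fine (\int[P]_w (sqnorm (xi w))%:E)) => t _; rewrite fineK// ge0_fin_numE//.
  by apply: integral_ge0 => w _; rewrite lee_fin sqnorm_ge0.
- exact: aeW.
exists (fun=> \d_(0 : Rn R n)); split.
- move=> t t0; apply: law_unique_invariant => //.
  exact: (adapted_measurable filF a (lexx 0)).
- exact: drift_integrable_eq0.
- move=> t t0; apply: aeW => w; rewrite time_integral_eq0 ?addr0// => u; exact: b0.
Qed.

(** Uniqueness of the invariant measure makes [nu t] the Dirac mass at 0, which kills the drift, so
    X_t = xi almost surely at each time. A common null set is found over rational times, and path
    continuity extends the equality to all times. *)
Lemma averaged_unique (xi : Om -> 'cV[R]_n) (X : R -> Om -> 'cV[R]_n) :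
  averaged_solution P F xi X ->
  {ae P, forall w, forall t, 0 <= t -> X t w = xi w}.
Proof.
case=> aX cX L2X X0 [nu [inv _ XE]].
have e t : 0 <= t -> eq_law \d_(0 : Rn R n) (nu t).
  move=> t0; have [_] := inv t t0; apply.
  have [] // := law_unique_invariant (adapted_measurable filF aX t0) _.
  by have [M hM] := L2X t; apply: le_lt_trans (hM t _) (ltry _); rewrite t0 lexx.
have Xt t : 0 <= t -> {ae P, forall w, X t w = xi w}.
  move=> t0; apply: filterS2 (XE t t0) X0 => w -> ->.
  by rewrite time_integral_eq0 ?addr0// => u u0; rewrite dirac0_Cov ?dirac0_mean ?mul0mx ?oppr0 ?addr0//; exact: e.
(* An enumeration of the rationals; integers that code none are sent to 0. *)
pose r (k : nat) : R := odflt 0 (omap ratr (unpickle k : option rat)).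
have : {ae P, forall w, forall k : nat, X (Num.max 0 (r k)) w = xi w}.
  by apply: ae_foralln => k; apply: Xt; rewrite le_max lexx.
apply: filterS => w hw t t0; apply/matrixP => i j; rewrite ord1.
apply/eqP; rewrite -subr_eq0 -normr_le0; apply/ler_addgt0Pr => eps eps0; rewrite add0r.
have [r0 r00 hr] := continuous_dist (@continuous_paths_coord _ _ _ _ _ w i cX t) eps0.
have [q] : exists q : rat, ratr q \in `]t, t + r0[ by apply: rat_in_itvoo; rewrite ltrDl.
rewrite in_itv/= => /andP[q1 q2].
have q0 : 0 <= ratr q :> R := le_trans t0 (ltW q1).
have := hr (ratr q); rewrite (max_r q0) (max_r t0).
have := hw (pickle q); rewrite /r pickleK/= (max_r q0) => ->.
move=> hq; rewrite distrC; apply: hq; rewrite ger0_norm ?subr_ge0 ?(ltW q1)//; lra.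
Qed.

End averaged_equation.

(** * Maximal inequalities *)

Section running_maximum.
Context {R : realType}.
Implicit Type s : nat -> R.

Fixpoint runmax s k : R := if k is j.+1 then Num.max (runmax s j) (s j.+1) else s 0%N.

Lemma runmax_ge s k i : (i <= k)%N -> s i <= runmax s k.
Proof.
elim: k => [|k IH]; first by rewrite leqn0 => /eqP ->.
rewrite leq_eqVlt ltnS => /predU1P[->|/IH h] /=; first by rewrite le_max lexx orbT.
by rewrite le_max h.
Qed.

Lemma runmax_attained s k : exists2 i, (i <= k)%N & runmax s k = s i.
Proof.
elim: k => [|k [i ik IH]]; first by exists 0%N.
rewrite /= maxEle; case: ifP => _; first by exists k.+1.
by exists i => //; exact: leqW.
Qed.

(* Summing by parts, a telescoping square bounds the square of the running
   maximum: this is the pathwise form of Doob's L^2 inequality. *)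
Lemma doob_pathwise s k : (forall i, 0 <= s i) ->
  runmax s k ^+ 2 + 4 * \sum_(i < k) runmax s i * s i.+1 <=
  4 * s k ^+ 2 + 4 * \sum_(i < k) runmax s i * s i.
Proof.
move=> s0.
have key : \sum_(i < k) runmax s i * s i.+1 - \sum_(i < k) runmax s i * s i <=
    runmax s k * s k - runmax s k ^+ 2 / 2.
  elim: k => [|k IH].
    by rewrite !big_ord0 /= subr0; have := sqr_ge0 (s 0%N); lra.
  rewrite !big_ord_recr/=; move: IH.
  move: (\sum_(i < k) _) (\sum_(i < k) _) => A B IH.
  have := sqr_ge0 (runmax s k - s k.+1).
  rewrite maxEle; case: ifP => _; nra.
have := sqr_ge0 (runmax s k - 2 * s k).
move: key; move: (\sum_(i < k) _) (\sum_(i < k) _) => A B; nra.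
Qed.

End running_maximum.

Section path_supremum.
Context {R : realType}.
Implicit Type g : R -> R.

Definition pathmax (T : R) g : R := sup [set `|g t| | t in `[0, T]].

Lemma pathmax_le (T : R) g (c : R) : 0 <= T -> (forall t, 0 <= t <= T -> `|g t| <= c) -> pathmax T g <= c.
Proof.
move=> T0 h; apply: ge_sup; first by exists `|g 0|; exists 0 => //=; rewrite in_itv/= lexx.
by move=> _ [t /=+ <-]; rewrite in_itv/= => /h.
Qed.

Lemma pathmax_ge (T : R) g (t : R) : continuous (fun t : R => g (Num.max 0 t)) -> 0 <= t <= T -> `|g t| <= pathmax T g.
Proof.
move=> cg tT; apply: ub_le_sup; last by exists t => //=; rewrite in_itv.
have [B hB] := continuous_bounded 0 T cg; exists B => _ [u /=+ <-]; rewrite in_itv/= => uT.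
by have := hB u uT; have /andP[u0 _] := uT; rewrite max_r.
Qed.

Lemma pathmax_ge0 (T : R) g : continuous (fun t : R => g (Num.max 0 t)) -> 0 <= T -> 0 <= pathmax T g.
Proof. by move=> cg T0; apply: le_trans (pathmax_ge (t := 0) cg _) => //; rewrite lexx. Qed.

Lemma runmax_pathmax (T : R) g (k : nat) : continuous (fun t : R => g (Num.max 0 t)) -> 0 < T ->
  runmax (fun i => `|g (grid T k i)|) k.+1 <= pathmax T g.
Proof.
move=> cg T0; have [i ik ->] := runmax_attained (fun i => `|g (grid T k i)|) k.+1.
apply: pathmax_ge => //; rewrite /grid !mulr_ge0 ?invr_ge0 ?(ltW T0)//=.
by rewrite ler_pdivrMr// ler_pM2l// ler_nat.
Qed.

Lemma runmax_cvg (T : R) g : continuous (fun t : R => g (Num.max 0 t)) -> 0 < T ->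
  runmax (fun i => `|g (grid T k i)|) k.+1 @[k --> \oo] --> pathmax T g.
Proof.
move=> cg T0; apply/cvgrPdist_le => e e0.
have e2 : 0 < e / 2 by rewrite divr_gt0.
have [dl dl0 hdl] := heine 0 T cg e2.
have dT : 0 < dl / T by rewrite divr_gt0.
near=> k.
have hk : T / k.+1%:R <= dl.
  have : k.+1%:R^-1 <= dl / T.
    by near: k; apply: filterS (near_infty_natSinv_lt (PosNum dT)) => k /ltW.
  by rewrite ler_pdivlMr// mulrC.
rewrite ger0_norm ?subr_ge0 ?runmax_pathmax// lerBlDr.
apply: pathmax_le; first exact: ltW.
move=> t /andP[t0 tT].
pose i := `|Num.floor (k.+1%:R * t / T)|%N.
have x0 : 0 <= k.+1%:R * t / T by rewrite divr_ge0 ?mulr_ge0// ltW.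
have iE : i%:R = (Num.floor (k.+1%:R * t / T))%:~R :> R.
  by rewrite /i natr_absz ger0_norm// floor_ge0.
have i1 : i%:R <= k.+1%:R * t / T by rewrite iE; exact: floor_le.
have i2 : k.+1%:R * t / T < i%:R + 1.
  by rewrite iE -[1]/(1%:~R) -intrD; exact: floorD1_gt.
have g1 : grid T k i <= t.
  rewrite /grid ler_pdivrMr//; move: i1; rewrite ler_pdivlMr// => i1.
  by rewrite mulrC [leRHS]mulrC.
have g2 : t - grid T k i <= dl.
  apply: le_trans hk; rewrite /grid lerBlDr -mulrDl ler_pdivlMr//.
  have -> : T + T * i%:R = T * (i%:R + 1) by ring.
  by move: (ltW i2); rewrite ler_pdivrMr// mulrC [X in _ <= X -> _]mulrC.
have ik : (i <= k.+1)%N.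
  rewrite -(@ler_nat R); apply: le_trans i1 _; rewrite ler_pdivrMr// ler_wpM2l//.
have g0 : 0 <= grid T k i by rewrite /grid !mulr_ge0 ?invr_ge0// ltW.
have := hdl t (grid T k i); rewrite t0 tT distrC ger0_norm ?subr_ge0// => /(_ isT g2).
rewrite (max_r g0) (max_r t0) => h.
have := runmax_ge (fun i => `|g (grid T k i)|) ik.
have := ler_normB (g (grid T k i)) (g (grid T k i) - g t).
rewrite opprB addrC subrK; lra.
Unshelve. all: by end_near. Qed.

Lemma measurable_pathmax {d} {Om : measurableType d} (N : R -> Om -> R) (T : R) : 0 < T ->
  (forall w, continuous (fun t : R => N (Num.max 0 t) w)) ->
  (forall t, 0 <= t -> measurable_fun setT (N t)) ->
  measurable_fun setT (fun w => pathmax T (N ^~ w)).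
Proof.
move=> T0 cN mN.
apply: (@measurable_fun_cvg _ _ _ setT (fun k w => runmax (fun i => `|N (grid T k i) w|) k.+1)) => //.
  move=> k; elim: (k.+1) => [|j IH] /=.
    by apply: (measurableT_comp (@normr_measurable R setT)); apply: mN; rewrite /grid !mulr_ge0 ?invr_ge0// ltW.
  apply: measurable_maxr => //.
  by apply: (measurableT_comp (@normr_measurable R setT)); apply: mN; rewrite /grid !mulr_ge0 ?invr_ge0// ltW.
by move=> w _; exact: runmax_cvg (cN w) T0.
Qed.

End path_supremum.

(** * Doob's inequality for subgaussian noise *)

Section doob.
Context {R : realType} {d : measure_display} {Om : measurableType d}.
Variables (P : probability Om R) (F : R -> set (set Om)).
Hypothesis filF : filtration F.
Variables (N : R -> Om -> R) (T V : R).
Hypothesis T0 : 0 < T.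
Hypothesis gN : forall t, 0 <= t -> gfun (F t) (N t).
Hypothesis cN : forall w, continuous (fun t : R => N (Num.max 0 t) w).
Hypothesis sgN : forall s t, 0 <= s -> s <= t -> t <= T ->
  exists2 v, 0 <= v & subgaussian P (F s) (fun w => N t w - N s w) v.
Hypothesis totN : forall t, 0 <= t -> t <= T -> subgaussian P (F 0) (N t) V.

Let mN t : 0 <= t -> measurable_fun setT (N t).
Proof. by move=> t0; apply: (gfun_measurable (filtration_measurable filF t0)); exact: gN. Qed.

Let exp_moment theta t : 0 <= t -> t <= T ->
  (\int[P]_w (expR (theta * N t w))%:E <= (expR (theta ^+ 2 * V / 2))%:E)%E.
Proof.
move=> t0 tT.
have := subgaussian_exp (filtration_measurable filF (lexx 0)) (mN t0) (totN t0 tT) theta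
  (@measurable_cst _ _ (SA (F 0)) R setT 1) (fun=> ler01).
under eq_integral do rewrite /cst/= mul1r.
by under [X in (_ <= _ * X)%E -> _]eq_integral do rewrite /cst/=; rewrite integral_cst//= probability_setT !mule1.
Qed.

(** For s_i = exp(theta N / 2) at the grid points, [subgaussian_exp_ge] gives E[M_i s_i] <=
    E[M_i s_(i+1)]; inserted in [doob_pathwise], the two sums cancel and 4 E[s_last^2] remains. Half
    of theta appears because the inequality squares. *)
Lemma doob_grid theta k : (\int[P]_w
   (runmax (fun i => expR (theta / 2 * N (grid T k i) w)) k.+1 ^+ 2)%:E <=
   (4 * expR (theta ^+ 2 * V / 2))%:E)%E.
Proof.
pose G := grid T k.
have G0 i : 0 <= G i by rewrite /G /grid !mulr_ge0 ?invr_ge0// ltW.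
have GS i : G i <= G i.+1 by rewrite /G /grid ler_pM2r ?invr_gt0// ler_pM2l// ler_nat.
have GT (i : nat) : (i <= k.+1)%N -> G i <= T.
  by move=> ik; rewrite /G /grid ler_pdivrMr// ler_pM2l// ler_nat.
pose s i w := expR (theta / 2 * N (G i) w).
pose M i w := runmax (s ^~ w) i.
have s0 i w : 0 <= s i w by exact: expR_ge0.
have s2 i w : s i w ^+ 2 = expR (theta * N (G i) w).
  by rewrite /s -expRM_natl; congr expR; field.
have gs i : gfun (F (G i)) (s i).
  apply: (measurableT_comp (@measurable_expR R)).
  by apply: (@measurable_funM _ (SA (F (G i)))); [exact: measurable_cst|exact: gN].
have gM i : gfun (F (G i)) (M i).
  elim: i => [|i IH]; first exact: gs.
  apply: (@measurable_maxr _ (SA (F (G i.+1)))); last exact: gs.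
  exact: (gfun_filtration_le filF (G0 i) (GS i)).
have ms i : measurable_fun [set: Om] (s i).
  exact: (gfun_measurable (filtration_measurable filF (G0 i)) (gs i)).
have mM i : measurable_fun [set: Om] (M i).
  exact: (gfun_measurable (filtration_measurable filF (G0 i)) (gM i)).
have M0 i w : 0 <= M i w by apply: le_trans (s0 0%N w) _; exact: (@runmax_ge R (s^~ w)).
(* The sums can be cancelled because they are finite: M_i s_i <= M_i^2, which is at most the sum of
   the s_j^2. *)
have fin (i : nat) : (i <= k.+1)%N ->
    {a : R | 0 <= a & (\int[P]_w (M i w * s i w)%:E = a%:E)%E}.
  move=> ik; apply/cid2.
  have h0 : (0 <= \int[P]_w (M i w * s i w)%:E)%E by apply: integral_EFin_ge0 => w; pos.
  have : (\int[P]_w (M i w * s i w)%:E <= \sum_(j < i.+1) \int[P]_w (s j w ^+ 2)%:E)%E.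
    rewrite -integral_EFin_sum; [|by move=> j; mf|by pos].
    apply: integral_EFin_le; try solve [mf | pos].
    move=> w; apply: (@le_trans _ _ (M i w ^+ 2)).
      by rewrite expr2 ler_wpM2l//; exact: (@runmax_ge R (s^~ w)).
    have [j ji e] := runmax_attained (s^~ w) i.
    rewrite /M e (bigD1 (Ordinal (ji : (j < i.+1)%N)))//= lerDl; pos.
  have : (\sum_(j < i.+1) \int[P]_w (s j w ^+ 2)%:E <= \sum_(j < i.+1) (expR (theta ^+ 2 * V / 2))%:E)%E.
    apply: lee_sum => j _; under eq_integral do rewrite s2.
    by apply: exp_moment => //; apply: GT; apply: leq_trans ik; rewrite -ltnS.
  move=> /[swap] /le_trans/[apply]; rewrite sumEFin.
  case: (\int[P]_w (M i w * s i w)%:E)%E h0 => [r r0 _| |//]; first by exists r.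
  by rewrite leye_eq.
have mono i : (i < k.+1)%N ->
   (\int[P]_w (M i w * s i w)%:E <= \int[P]_w (M i w * s i.+1 w)%:E)%E.
  move=> ik; have [a a0 aE] := fin i (ltnW ik).
  have [v v0 sg] := sgN (G0 i) (GS i) (GT i.+1 ik).
  have mm : measurable_fun setT (fun w => N (G i.+1) w - N (G i) w).
    by apply: measurable_funB; exact: mN.
  have gU : gfun (F (G i)) (fun w => M i w * s i w) by apply: (@measurable_funM _ (SA (F (G i)))).
  have := subgaussian_exp_ge (filtration_measurable filF (G0 i)) mm v0 sg (theta / 2) gU
     (fun w => mulr_ge0 (M0 i w) (s0 i w)) aE.
  rewrite aE; under eq_integral do rewrite -mulrA.
  suff e w : s i w * expR (theta / 2 * (N (G i.+1) w - N (G i) w)) = s i.+1 w.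
    by under eq_integral do rewrite e.
  by rewrite /s -expRD; congr expR; ring.
have pw w := @doob_pathwise R (s^~ w) k.+1 (s0 ^~ w).
pose A : R := \sum_(i < k.+1) s2val (fin i (ltnW (ltn_ord i))).
have AE : (\sum_(i < k.+1) \int[P]_w (M i w * s i w)%:E = A%:E)%E.
  rewrite -sumEFin; apply: eq_bigr => i _; exact: (s2valP' (fin i (ltnW (ltn_ord i)))).
have mMs i j : measurable_fun setT (fun w => M i w * s j w) by mf.
have Ms0 i j w : 0 <= M i w * s j w by pos.
have h1 : (\int[P]_w (M k.+1 w ^+ 2)%:E + 4%:E * A%:E <=
    (4 * expR (theta ^+ 2 * V / 2))%:E + 4%:E * A%:E)%E.
  apply: (@le_trans _ _ (\int[P]_w (M k.+1 w ^+ 2 + 4 * \sum_(i < k.+1) M i w * s i.+1 w)%:E)%E).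
    rewrite integral_EFinD; try solve [mf | pos].
    rewrite leeD2l// integral_EFinZ; try solve [mf | pos].
    rewrite lee_wpmul2l// ?lee_fin// integral_EFin_sum; try solve [by move=> ?; mf | by move=> ? ?; pos].
    by rewrite -AE; apply: lee_sum => i _; exact: mono.
  apply: (@le_trans _ _ (\int[P]_w (4 * s k.+1 w ^+ 2 + 4 * \sum_(i < k.+1) M i w * s i w)%:E)%E).
    by apply: integral_EFin_le; try solve [mf | pos].
  rewrite integral_EFinD; try solve [mf | pos].
  rewrite integral_EFinZ; try solve [mf | pos].
  rewrite integral_EFinZ; try solve [mf | pos].
  rewrite integral_EFin_sum; try solve [by move=> ?; mf | by move=> ? ?; pos].
  rewrite AE leeD2r// EFinM lee_wpmul2l// ?lee_fin//.
  under eq_integral do rewrite s2.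
  by apply: exp_moment => //; exact: GT.
by rewrite -(leeD2rE _ _ (_ : (4%:E * A%:E)%E \is a fin_num)).
Qed.

(** At a grid point where |N| is largest, exp(theta |N|) is one of the exponentials with parameters
    theta and -theta; each of the two contributes Doob's factor 4. *)
Lemma exp_pathmax (theta : R) : 0 <= theta ->
  (\int[P]_w (expR (theta * pathmax T (N ^~ w)))%:E <=
   (8 * expR (theta ^+ 2 * V / 2))%:E)%E.
Proof.
move=> th0; pose fk k w := expR (theta * runmax (fun i => `|N (grid T k i) w|) k.+1).
have g0 k i : 0 <= grid T k i by rewrite /grid !mulr_ge0 ?invr_ge0// ltW.
have mrun (c : R) k j : measurable_fun setT (fun w => runmax (fun i => expR (c * N (grid T k i) w)) j).
  have me i : measurable_fun setT (fun w => expR (c * N (grid T k i) w)).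
    by apply: (measurableT_comp (@measurable_expR R)); apply: measurable_funM => //; exact: mN.
  by elim: j => [|j IH] /=; [exact: me|apply: measurable_maxr].
have mfk k : measurable_fun setT (fk k).
  apply: (measurableT_comp (@measurable_expR R)); apply: measurable_funM => //.
  elim: (k.+1) => [|j IH] /=; last apply: measurable_maxr => //;
    by apply: (measurableT_comp (@normr_measurable R setT)); exact: mN.
apply: (fatou_EFin_le (fk := fk)) => //.
- apply: (measurableT_comp (@measurable_expR R)); apply: measurable_funM => //.
  exact: measurable_pathmax.
- by move=> k w; exact: expR_ge0.
- move=> w e e0.
  have : expR (theta * runmax (fun i => `|N (grid T k i) w|) k.+1) @[k --> \oo] -->
      expR (theta * pathmax T (N ^~ w)).
    apply: (continuous_cvg _ (@continuous_expR R _)).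
    by apply: cvgMr; apply: runmax_cvg => //; exact: cN.
  by move=> /cvgrPdist_le/(_ e e0); apply: filterS => k; rewrite ler_norml => /andP[_]; rewrite /fk; lra.
move=> k.
pose Mp w := runmax (fun i => expR (theta / 2 * N (grid T k i) w)) k.+1.
pose Mm w := runmax (fun i => expR (- theta / 2 * N (grid T k i) w)) k.+1.
apply: (@le_trans _ _ (\int[P]_w (Mp w ^+ 2 + Mm w ^+ 2)%:E)%E).
  apply: integral_EFin_le => //.
  - by apply: measurable_funD; apply: measurable_funX; exact: mrun.
  - by move=> w; exact: expR_ge0.
  move=> w; rewrite /fk.
  have [i ik ->] := runmax_attained (fun i => `|N (grid T k i) w|) k.+1.
  have pw (c : R) : (expR (c * N (grid T k i) w)) <= runmax (fun i => expR (c * N (grid T k i) w)) k.+1.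
    exact: (runmax_ge (fun i => expR (c * N (grid T k i) w)) ik).
  have sq (c : R) : expR (2 * c * N (grid T k i) w) <= runmax (fun i => expR (c * N (grid T k i) w)) k.+1 ^+ 2.
    have -> : expR (2 * c * N (grid T k i) w) = expR (c * N (grid T k i) w) ^+ 2.
      by rewrite -expRM_natl; congr expR; ring.
    by rewrite ler_sqr ?nnegrE ?expR_ge0//; apply: le_trans (pw c); exact: expR_ge0.
  have sp := sq (theta / 2); have sm := sq (- theta / 2).
  rewrite -/(Mp w) -/(Mm w) in sp sm.
  have M2p : 0 <= Mp w ^+ 2 by exact: sqr_ge0.
  have M2m : 0 <= Mm w ^+ 2 by exact: sqr_ge0.
  case: (ger0P (N (grid T k i) w)) => _.
    apply: le_trans (le_trans _ sp) _; last by rewrite lerDl.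
    by rewrite le_eqVlt; apply/orP; left; apply/eqP; congr expR; field.
  apply: le_trans (le_trans _ sm) _; last by rewrite lerDr.
  by rewrite le_eqVlt; apply/orP; left; apply/eqP; congr expR; field.
rewrite integral_EFinD; try solve [mf | pos | by apply: measurable_funX; exact: mrun].
have -> : 8 * expR (theta ^+ 2 * V / 2) = 4 * expR (theta ^+ 2 * V / 2) + 4 * expR ((- theta) ^+ 2 * V / 2).
  by rewrite sqrrN; ring.
by rewrite EFinD; apply: leeD; exact: doob_grid.
Qed.

Lemma pathmax_sqr : 0 < V -> (\int[P]_w (pathmax T (N ^~ w) ^+ 2)%:E <= (32 * V)%:E)%E.
Proof.
(* For this theta, theta^2 V = 1. Hence p^2 <= 2 V e^(theta p), and 2 V times 8 e^(1/2) is at most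
   32 V since e^(1/2) <= 2. *)
move=> V0; pose theta := (Num.sqrt V)^-1.
have sV : 0 < Num.sqrt V by rewrite sqrtr_gt0.
have th0 : 0 <= theta by rewrite invr_ge0 ltW.
have th2 : theta ^+ 2 * V = 1 by rewrite exprVn sqr_sqrtr ?(ltW V0)// mulVf// gt_eqF.
have mp : measurable_fun setT (fun w => pathmax T (N ^~ w)) by exact: measurable_pathmax.
have h := exp_pathmax th0; rewrite th2 in h.
apply: (@le_trans _ _ (\int[P]_w (2 * V * expR (theta * pathmax T (N ^~ w)))%:E)%E).
  apply: integral_EFin_le; try solve [mf | pos].
  move=> w; have p0 : 0 <= pathmax T (N ^~ w) by apply: pathmax_ge0 => //; exact: ltW.
  have := expR_ge_quadratic (mulr_ge0 th0 p0).
  set E := expR _; set p := pathmax _ _ in p0 *; move=> hE.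
  have h1 : 0 <= theta * p by exact: mulr_ge0.
  have : (theta * p) ^+ 2 <= 2 * E by lra.
  rewrite exprMn => h2.
  have -> : p ^+ 2 = V * (theta ^+ 2 * p ^+ 2) by rewrite mulrA [V * _]mulrC th2 mul1r.
  have -> : 2 * V * E = V * (2 * E) by ring.
  by rewrite ler_wpM2l// ltW.
have V2 : 0 <= 2 * V by have := ltW V0; pos.
rewrite integral_EFinZ; try solve [mf | pos].
apply: le_trans (lee_wpmul2l _ h) _; first by rewrite lee_fin.
rewrite -EFinM lee_fin.
have := @expR_le_inv R (1 / 2) ltac:(lra); have -> : (1 - 1 / 2 : R)^-1 = 2 by field.
move: (expR _) => E hE; nra.
Qed.

Lemma pathmax_tail (theta c : R) : 0 <= theta ->
  (P [set w | (c < pathmax T (N ^~ w))%R] <= (8 * expR (theta ^+ 2 * V / 2 - theta * c))%:E)%E.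
Proof.
move=> th0.
have mp : measurable_fun setT (fun w => pathmax T (N ^~ w)) by exact: measurable_pathmax.
pose A := [set w | c < pathmax T (N ^~ w)].
have mA : measurable A.
  rewrite (_ : A = (fun w => pathmax T (N ^~ w)) @^-1` `]c, +oo[%classic).
    by rewrite -[_ @^-1` _]setTI; exact: mp.
  by apply/seteqP; split => w /=; rewrite in_itv/= andbT.
rewrite -/A -[A]setIT -integral_indic//.
apply: (@le_trans _ _ (\int[P]_w (expR (- theta * c) * expR (theta * pathmax T (N ^~ w)))%:E)%E).
  apply: integral_EFin_le; try solve [mf | pos].
  move=> w; rewrite indicE -expRD; case: (boolP (_ \in _)) => [|_]; last exact: expR_ge0.
  rewrite inE /A/= => cw; rewrite -[leLHS]expR0 ler_expR mulNr addrC subr_ge0.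
  by rewrite ler_wpM2l// ltW.
rewrite integral_EFinZ; try solve [mf | pos].
apply: le_trans (lee_wpmul2l _ (exp_pathmax th0)) _; first by rewrite lee_fin expR_ge0.
by rewrite -EFinM lee_fin expRD mulNr; move: (expR _) (expR _) => a e; lra.
Qed.

End doob.

(** * Cauchy-Schwarz, Gronwall and bounds for time integrals *)

Section elementary_bounds.
Context {R : realType}.
Notation mu := (@lebesgue_measure R).

Lemma sqr_sum_le (I : finType) (a : I -> R) : (\sum_i a i) ^+ 2 <= #|I|%:R * \sum_i a i ^+ 2.
Proof.
have -> : (\sum_i a i) ^+ 2 = \sum_i \sum_j a i * a j.
  by rewrite expr2 mulr_suml; apply: eq_bigr => i _; rewrite mulr_sumr.
apply: (@le_trans _ _ (\sum_i \sum_j (a i ^+ 2 + a j ^+ 2) / 2)).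
  by apply: ler_sum => i _; apply: ler_sum => j _; have := sqr_ge0 (a i - a j); nra.
under eq_bigr do rewrite -mulr_suml big_split/= sumr_const.
rewrite -mulr_suml big_split/= sumr_const sumrMnl (_ : #|xpredT| = #|I|)//.
rewrite mulr_natl; set x := _ *+ _; have -> // : (x + x) / 2 = x by lra.
Qed.

Lemma sqnorm_mulmx_le n (C : 'M[R]_n) (x : 'cV[R]_n) (c : R) : (forall i j, `|C i j| <= c) ->
  sqnorm (C *m x) <= n%:R ^+ 2 * c ^+ 2 * sqnorm x.
Proof.
move=> hc; have sE (v : 'cV[R]_n) : sqnorm v = \sum_j v j 0 ^+ 2 by apply: eq_bigr => i _; rewrite big_ord1.
rewrite !sE; apply: (@le_trans _ _ (\sum_(j < n) n%:R * c ^+ 2 * \sum_j x j 0 ^+ 2)).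
  apply: ler_sum => i _; rewrite mxE; apply: le_trans (sqr_sum_le _) _.
  rewrite card_ord -mulrA ler_wpM2l// mulr_sumr; apply: ler_sum => j _.
  rewrite exprMn ler_wpM2r ?sqr_ge0// -[leLHS]real_normK ?num_real// ler_sqr ?nnegrE//.
  by apply: le_trans (hc i j).
rewrite sumr_const card_ord -[leLHS]mulr_natl le_eqVlt; apply/orP; left; apply/eqP; ring.
Qed.

(** Cauchy-Schwarz, from the nonnegative integral of (f - m)^2 with m the mean value of f. *)
Lemma sqr_Rintegral_le (t : R) (f : R -> R) : 0 <= t ->
  mu.-integrable `[0, t] (EFin \o f) -> mu.-integrable `[0, t] (EFin \o (fun u => f u ^+ 2)) ->
  (\int[mu]_(u in `[0, t]) f u) ^+ 2 <= t * \int[mu]_(u in `[0, t]) (f u ^+ 2).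
Proof.
rewrite le_eqVlt => /predU1P[<- _ _|t0 i1 i2].
  by rewrite set_itv1 !Rintegral_set1 expr0n mul0r.
set A := \int[mu]_(u in _) f u; pose m := A / t.
have ic (c : R) : mu.-integrable `[0, t] (EFin \o (fun=> c)).
  by apply: (@bounded_integrable _ _ _ _ `|c|) => //; exact: measurable_cst.
have ifm : mu.-integrable `[0, t] (EFin \o (fun u => 2 * m * f u)) by exact: integrable_scaleR.
have i3 : mu.-integrable `[0, t] (EFin \o (fun u => f u ^+ 2 - 2 * m * f u)).
  exact: (integrableB _ i2 ifm).
have : 0 <= \int[mu]_(u in `[0, t]) (f u ^+ 2 - 2 * m * f u + m ^+ 2).
  apply: fine_ge0; apply: integral_ge0 => u _; rewrite lee_fin.
  by move: (f u) => x; have := sqr_ge0 (x - m); nra.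
rewrite RintegralD//.
rewrite RintegralB// RintegralZl// Rintegral_cst// [X in fine X](lebesgue_measure_itv `[0, t])/= lte_fin t0.
rewrite -EFinB/= subr0 -/A.
set Q := \int[mu]_(u in _) _.
have -> : Q - 2 * m * A + m ^+ 2 * t = (t * Q - A ^+ 2) / t by rewrite /m; field; rewrite gt_eqF.
by rewrite pmulr_lge0 ?invr_gt0// subr_ge0.
Qed.

Lemma Rintegral_le_itv (t T : R) (p : R -> R) : 0 <= t -> t <= T ->
  (forall u, 0 <= u -> 0 <= p u) -> mu.-integrable `[0, T] (EFin \o p) ->
  \int[mu]_(u in `[0, t]) p u <= \int[mu]_(u in `[0, T]) p u.
Proof.
move=> t0 tT p0 ip; rewrite -subr_ge0.
rewrite Rintegral_itvB; [|by []|by rewrite bnd_simp|by rewrite bnd_simp].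
apply: fine_ge0; apply: integral_ge0 => u /=; rewrite in_itv/= lee_fin => /andP[tu _].
by apply: p0; apply: le_trans t0 (ltW tu).
Qed.

Lemma Rintegral_le_cst (t M : R) (p : R -> R) : 0 <= t -> mu.-integrable `[0, t] (EFin \o p) ->
  (forall u, 0 <= u <= t -> p u <= M) -> \int[mu]_(u in `[0, t]) p u <= t * M.
Proof.
rewrite le_eqVlt => /predU1P[<- _ _|t0 ip h]; first by rewrite set_itv1 Rintegral_set1 mul0r.
apply: (@le_trans _ _ (\int[mu]_(u in `[0, t]) M)).
  apply: le_Rintegral => //.
  by apply: (@bounded_integrable _ _ _ _ `|M|) => [|u _ //]; exact: measurable_cst.
rewrite Rintegral_cst// [X in fine X](lebesgue_measure_itv `[0, t])/= lte_fin t0.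
by rewrite -EFinB/= subr0 mulrC.
Qed.

Lemma Rintegral_exp_le (B t : R) : 0 < B -> 0 < t ->
  \int[mu]_(u in `[0, t]) expR (B * u) <= expR (B * t) / B.
Proof.
move=> B0 t0.
pose G u : R := expR (B * u) / B.
have cE0 : continuous (fun u : R => expR (B * u)).
  move=> u; apply: (continuous_cvg _ (@continuous_expR R _)).
  by apply: cvgM; [exact: cvg_cst|exact: cvg_id].
have cE (c : R) : continuous (fun u : R => expR (B * u) * c).
  by move=> u; apply: cvgM; [exact: cE0|exact: cvg_cst].
have dG (u : R) : is_derive u (1 : R) G (expR (B * u)).
  have h1 : is_derive u (1 : R) (fun u : R => B * u) B.
    by apply: is_derive_eq; rewrite /GRing.scale/= mulr1.
  have h2 : is_derive u (1 : R) (fun u : R => expR (B * u)) (expR (B * u) * B).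
    by apply: is_derive1_comp.
  have -> : G = fun u : R => B^-1 *: expR (B * u) by apply/funext => v; rewrite /G mulrC.
  by apply: is_derive_eq; rewrite /GRing.scale/= mulrCA mulVf ?mulr1// gt_eqF.
have := @continuous_FTC2 R (fun u => expR (B * u)) G 0 t t0.
rewrite /Rintegral => -> //.
- by rewrite -EFinB/= /G mulr0 expR0 lerBlDr lerDl divr_ge0// ltW.
- by apply: continuous_subspaceT => u; exact: cE0.
- split.
  + by move=> u _; have [] := dG u.
  + by have := cE B^-1 0; move=> /cvg_at_right_filter.
  + by have := cE B^-1 t; move=> /cvg_at_left_filter.
- by move=> u _; rewrite derive1E; have := dG u => h; exact: derive_val.
Qed.

(** In the weighted norm S = sup g(u) e^(-2 B u) the integral operator, with its factor B, has norm
    at most 1/2, whence S <= A + S / 2. The a priori bound M makes S finite. The argument suits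
    second moments, which are bounded and measurable in time. *)
Lemma gronwall (T A B M : R) (g : R -> R) : 0 <= A -> 0 < B ->
  (forall s t : R, 0 <= s -> mu.-integrable `[s, t] (EFin \o g)) ->
  (forall u, 0 <= u <= T -> 0 <= g u <= M) ->
  (forall t, 0 <= t <= T -> g t <= A + B * \int[mu]_(u in `[0, t]) g u) ->
  forall t, 0 <= t <= T -> g t <= 2 * A * expR (2 * B * T).
Proof.
move=> A0 B0 ig gM hg t tT; have T0 : 0 <= T by case/andP: tT => /le_trans; apply.
pose E : set R := [set g u * expR (- (2 * B * u)) | u in `[0, T]].
have g0 u : 0 <= u <= T -> 0 <= g u by move=> /gM/andP[].
have ubE : has_ubound E.
  exists M => _ [u /=+ <-]; rewrite in_itv/= => uT; have /andP[p0 pM] := gM u uT.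
  apply: le_trans pM; apply: ler_piMr => //.
  rewrite expR_le1// oppr_le0 !mulr_ge0// ?(ltW B0)//; by case/andP: uT.
pose S := sup E.
have gS u : 0 <= u <= T -> g u <= S * expR (2 * B * u).
  move=> uT; rewrite -ler_pdivrMr ?expR_gt0// -expRN.
  by apply: ub_le_sup => //; exists u => //=; rewrite in_itv.
have S0 : 0 <= S.
  have h := gS 0; rewrite lexx T0 mulr0 expR0 mulr1 in h.
  by apply: le_trans (g0 0 _) (h isT); rewrite lexx T0.
have key u : 0 <= u <= T -> g u * expR (- (2 * B * u)) <= A + S / 2.
  move=> uT; have /andP[u0 uT'] := uT.
  have ep : 0 < expR (2 * B * u) by exact: expR_gt0.
  rewrite expRN ler_pdivrMr//.
  apply: le_trans (hg u uT) _.
  have : \int[mu]_(v in `[0, u]) g v <= S * expR (2 * B * u) / (2 * B).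
    move: u0; rewrite le_eqVlt => /predU1P[<-|u0].
      by rewrite set_itv1 Rintegral_set1 !mulr_ge0 ?expR_ge0 ?invr_ge0 ?mulr_ge0// ltW.
    have me : measurable_fun (`[0, u]%classic : set (measurableTypeR R)) (fun v => expR (2 * B * v)).
      apply: measurable_funTS; apply: (measurableT_comp (@measurable_expR R)).
      by apply: measurable_funM => //; exact: measurable_id.
    have ie : mu.-integrable `[0, u] (EFin \o (fun v => expR (2 * B * v))).
      apply: (@bounded_integrable _ _ _ _ (expR (2 * B * u))) => // v /andP[v0 vu].
      by rewrite ger0_norm ?expR_ge0// ler_expR ler_wpM2l// mulr_ge0// ltW.
    apply: (@le_trans _ _ (\int[mu]_(v in `[0, u]) (S * expR (2 * B * v)))).
      apply: le_Rintegral => //; [exact: ig|exact: integrable_scaleR|].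
      move=> v /=; rewrite in_itv/= => /andP[v0 vu]; apply: gS.
      by rewrite v0 (le_trans vu).
    rewrite RintegralZl// -mulrA ler_wpM2l//; apply: Rintegral_exp_le => //; exact: mulr_gt0.
  move=> /(ler_wpM2l (ltW B0)).
  have -> : B * (S * expR (2 * B * u) / (2 * B)) = S / 2 * expR (2 * B * u).
    by field; rewrite gt_eqF.
  have e1 : 1 <= expR (2 * B * u) by rewrite -expR0 ler_expR !mulr_ge0// ltW.
  have := ler_wpM2l A0 e1; nra.
have SA2 : S <= A + S / 2.
  apply: ge_sup; first by exists (g 0 * expR (- (2 * B * 0))); exists 0 => //=; rewrite in_itv/= lexx.
  by move=> _ [u /=+ <-]; rewrite in_itv/= => /key.
apply: le_trans (gS t tT) _; apply: ler_pM => //; first lra.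
by have /andP[_ tT'] := tT; rewrite ler_expR ler_wpM2l// mulr_ge0// ltW.
Qed.

End elementary_bounds.

(** * The slow-fast system *)

Section slow_fast.
Context {R : realType} {d : measure_display} {Om : measurableType d}.
Variables (P : probability Om R) (F : R -> set (set Om)).
Hypothesis filF : filtration F.
Context {n : nat}.
Variables (W1 W2 : R -> Om -> 'cV[R]_n).
Hypotheses (bW1 : brownian P F W1) (bW2 : brownian P F W2).
Variables (eps delta : R) (xi zeta : Om -> 'cV[R]_n) (X Y : R -> Om -> 'cV[R]_n).
Hypotheses (eps01 : 0 < eps < 1) (delta01 : 0 < delta < 1).
Hypothesis sol : slow_fast_solution P F W1 W2 eps delta xi zeta X Y.
Notation mu := (@lebesgue_measure R).
Notation CX t := (Cov (law P (X t))).
Notation CY t := (Cov (law P (Y t))).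
Notation f := (second_moment P Y).
Notation g := (second_moment P X).

Let bX t w := - (CY t *m X t w) + Y t w.
Let bY t w := delta^-1 *: (- 2 *: Y t w - sqnorm (Y t w) *: Y t w - CX t *m Y t w).
Let hX t := Num.sqrt eps *: (sqrtmx (CX t) + sqrtmx (CY t)).
Let hY t := (Num.sqrt delta)^-1 *: sqrtmx (CY t).
Let eps0 : 0 < eps. Proof. by case/andP: eps01. Qed.
Let delta0 : 0 < delta. Proof. by case/andP: delta01. Qed.
Let dV0 : 0 < delta^-1. Proof. by rewrite invr_gt0. Qed.
Let L2X : locally_L2 P X. Proof. by case: sol => -[]. Qed.
Let L2Y : locally_L2 P Y. Proof. by case: sol => -[]. Qed.
Let ipX : ito_process P F W1 X bX (fun t _ => hX t). Proof. by case: sol. Qed.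
Let ipY : ito_process P F W2 Y bY (fun t _ => hY t). Proof. by case: sol. Qed.
Let aX : adapted F X. Proof. by case: ipX. Qed.
Let aY : adapted F Y. Proof. by case: ipY. Qed.
Let cX : continuous_paths X. Proof. by case: ipX. Qed.
Let cY : continuous_paths Y. Proof. by case: ipY. Qed.
Let mX t : 0 <= t -> measurable_fun [set: Om] (X t : Om -> Rn R n).
Proof. exact: (adapted_measurable filF aX). Qed.
Let mY t : 0 <= t -> measurable_fun [set: Om] (Y t : Om -> Rn R n).
Proof. exact: (adapted_measurable filF aY). Qed.
Let finX t : 0 <= t -> (\int[P]_w (sqnorm (X t w))%:E < +oo)%E.
Proof. by move=> t0; have [M hM] := L2X t; apply: le_lt_trans (hM t _) (ltry _); rewrite t0 lexx. Qed.
Let finY t : 0 <= t -> (\int[P]_w (sqnorm (Y t w))%:E < +oo)%E.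
Proof. by move=> t0; have [M hM] := L2Y t; apply: le_lt_trans (hM t _) (ltry _); rewrite t0 lexx. Qed.
Let g_ge0 u : 0 <= g u. Proof. exact: second_moment_ge0. Qed.
Let f_ge0 u : 0 <= f u. Proof. exact: second_moment_ge0. Qed.
Let mf' : measurable_fun [set: measurableTypeR R] (fun u : measurableTypeR R => f (Num.max 0 u)).
Proof. exact: (second_moment_measurable filF ipY). Qed.

Lemma CX_entry u i j : 0 <= u -> `|CX u i j| <= g u.
Proof.
move=> u0; have := Cov_entry_le (mX u0) (finX u0) 0 i j.
by under eq_Rintegral do rewrite subr0.
Qed.

Lemma CY_entry u i j : 0 <= u -> `|CY u i j| <= f u.
Proof.
move=> u0; have := Cov_entry_le (mY u0) (finY u0) 0 i j.
by under eq_Rintegral do rewrite subr0.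
Qed.

Let mCX := measurable_Cov_law P filF aX cX.
Let mCY := measurable_Cov_law P filF aY cY.
Let CXb t : exists c, forall u i j, 0 <= u <= t -> `|CX u i j| <= c.
Proof.
have [M hM] := second_moment_bounded L2X t; exists M => u i j ut; have /andP[u0 _] := ut.
exact: le_trans (CX_entry i j u0) (hM u ut).
Qed.
Let psdCX u (y : 'cV[R]_n) : 0 <= u -> 0 <= (y^T *m CX u *m y) 0 0.
Proof. by move=> u0; have [_] := Cov_psd (mX u0) (finX u0); apply. Qed.
Let bYE u w : 0 <= u -> bY u w = delta^-1 *: (- 2 *: Y u w - sqnorm (Y u w) *: Y u w - CX u *m Y u w).
Proof. by []. Qed.
Let hYf u : 0 <= u -> sqnorm (hY u) <= delta^-1 * f u.
Proof.
move=> u0; rewrite sqnormZ exprVn sqr_sqrtr ?(ltW delta0)//.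
by rewrite ler_wpM2l ?(ltW dV0)//; exact: sqrtmx_Cov_le (mY u0) (finY u0).
Qed.

Let fM t : exists M, forall u, 0 <= u <= t -> f u <= M. Proof. exact: second_moment_bounded. Qed.

Lemma bounded_path_integrable (q : R -> R) s t :
  measurable_fun [set: measurableTypeR R] (fun u : measurableTypeR R => q (Num.max 0 u)) ->
  (forall u, 0 <= u -> 0 <= q u) -> (exists M, forall u, 0 <= u <= t -> q u <= M) -> 0 <= s ->
  mu.-integrable `[s, t] (EFin \o q).
Proof.
move=> mq q0 [M hM] s0; apply: (@bounded_integrable _ _ _ _ M); first exact: path_measurable.
move=> u /andP[su ut]; have u0 := le_trans s0 su.
by rewrite ger0_norm ?q0// hM// u0.
Qed.

Let intf s t : 0 <= s -> mu.-integrable `[s, t] (EFin \o f).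
Proof. exact: bounded_path_integrable. Qed.

Let int_ge0 (q : R -> R) t : (forall u, 0 <= u -> 0 <= q u) -> 0 <= \int[mu]_(u in `[0, t]) q u.
Proof.
move=> q0; apply: fine_ge0; apply: integral_ge0 => u /=; rewrite in_itv/= => /andP[u0 _].
by rewrite lee_fin q0.
Qed.

Lemma fast_energy t : 0 <= t -> f t + 3 * (delta^-1 * \int[mu]_(u in `[0, t]) f u) <= f 0.
Proof.
move=> t0; rewrite -RintegralZl//; last exact: intf.
exact: (energy filF bW2 ipY L2Y dV0 bYE mCX CXb psdCX hYf t0).
Qed.

Lemma fast_moment_le t : 0 <= t -> f t <= f 0.
Proof.
move=> t0; apply: le_trans (fast_energy t0); rewrite lerDl mulr_ge0// mulr_ge0 ?(ltW dV0)//.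
exact: int_ge0.
Qed.

Lemma fast_moment_integral t : 0 <= t -> \int[mu]_(u in `[0, t]) f u <= delta * f 0.
Proof.
move=> t0; have := fast_energy t0; have := f_ge0 t.
have I0 : 0 <= delta^-1 * \int[mu]_(u in `[0, t]) f u by rewrite mulr_ge0 ?(ltW dV0)// int_ge0.
move=> h1 h2; rewrite mulrC -ler_pdivrMr// mulrC; lra.
Qed.

Lemma fast_exponential_moment (la t c : R) (i : 'I_n) : 0 < la -> 0 < t ->
  (forall u j l, 0 <= u <= t -> `|CX u j l| <= c) -> 2 * n%:R * c <= 1 ->
  (\int[P]_w (expR (la * delta^-1 / n.+3%:R * \int[mu]_(u in `[0, t]) (`|Y u w i 0| - la^-1)))%:E <=
   (expR (la ^+ 2 / 2 * f 0))%:E * \int[P]_w (1 + \sum_j ch (la * Y 0 w j 0))%:E)%E.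
Proof.
move=> la0 t0 hc nc.
apply: le_trans (exponential_moment filF bW2 ipY L2Y dV0 bYE mCX CXb hYf i la0 t0 hc nc) _.
apply: lee_wpmul2r.
  by apply: integral_EFin_ge0 => w; rewrite addr_ge0// sumr_ge0// => j _; exact: le_trans (ch_ge1 _).
rewrite lee_fin ler_expR ler_wpM2l ?divr_ge0 ?sqr_ge0// RintegralZl//; last exact: intf.
by rewrite mulrC ler_pdivrMr// mulrC; exact: fast_moment_integral (ltW t0).
Qed.

(* [q] bounds the trace of Cov(X_u); taking it small is what makes the noise of
   order eps^2 when the initial value is deterministic. *)
Variable q : R -> R.
Hypothesis mq : measurable_fun [set: measurableTypeR R] (fun u : measurableTypeR R => q (Num.max 0 u)).
Hypothesis qM : forall t, exists M, forall u, 0 <= u <= t -> q u <= M.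
Hypothesis qX : forall u, 0 <= u -> \tr (CX u) <= q u.

(** Dominates the squared norm of the noise coefficient of X; the factors 2 come from the square of
    a sum of two roots. *)
Let G u := eps * (2 * q u + 2 * f u).

Let mG : measurable_fun [set: measurableTypeR R] (fun u : measurableTypeR R => G (Num.max 0 u)).
Proof.
apply: measurable_funM; first exact: measurable_cst.
by apply: measurable_funD; apply: measurable_funM => //; exact: measurable_cst.
Qed.

Let GM t : exists M, forall u, 0 <= u <= t -> G u <= M.
Proof.
have [M1 h1] := fM t; have [M2 h2] := qM t; exists (eps * (2 * M2 + 2 * M1)) => u ut.
by rewrite ler_wpM2l ?(ltW eps0)// lerD// ler_wpM2l// ?h1 ?h2.
Qed.

Let hXG u : 0 <= u -> sqnorm (hX u) <= G u.
Proof.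
move=> u0; rewrite sqnormZ sqr_sqrtr ?(ltW eps0)// ler_wpM2l ?(ltW eps0)//.
apply: le_trans (sqnormD_le _ _) _; apply: lerD; rewrite ler_wpM2l//.
  by apply: le_trans (qX u0); apply: sqnorm_sqrtmx_le; exact: trace_Cov_ge0 (mX u0).
exact: sqrtmx_Cov_le (mY u0) (finY u0).
Qed.

Lemma slow_progressive j : progressive F (fun u w => bX u w j 0).
Proof.
have p1 : progressive F (fun u w => -1 * (CY u *m X u w) j 0 + Y u w j 0).
  apply: progressiveD; last exact: (progressive_coord filF aY cY).
  apply: progressiveM; last exact: (progressive_Cov filF aX cX mCY).
  by apply: (@progressive_cst _ _ _ F (fun=> -1)); exact: measurable_cst.
move=> t t0; have := p1 t t0; congr (measurable_fun _ _); apply/funext => p.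
by rewrite /bX !mxE mulN1r.
Qed.

Lemma slow_drift_bounded w t : exists B, forall u j, 0 <= u <= t -> `|bX u w j 0| <= B.
Proof.
have [B B0 hB] := path_bounded cX w t; have [B' B0' hB'] := path_bounded cY w t.
have [M hM] := fM t.
exists (\sum_(k < n) M * B + B') => u j ut; have /andP[u0 _] := ut.
rewrite /bX !mxE; apply: le_trans (ler_normD _ _) _; apply: lerD; last exact: hB'.
rewrite normrN; apply: le_trans (ler_norm_sum _ _ _) _; apply: ler_sum => k _.
rewrite normrM; apply: ler_pM => //; last exact: hB.
by apply: le_trans (CY_entry _ _ u0) _; exact: hM.
Qed.

Lemma slow_drift_integrable w j t : 0 <= t -> mu.-integrable `[0, t] (EFin \o (fun u => bX u w j 0)).
Proof.
move=> t0; have [B hB] := slow_drift_bounded w t; apply: (@bounded_integrable _ _ _ _ B) => [|u ut].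
  exact: (progressive_path filF w (slow_progressive j) t0).
exact: hB.
Qed.

Definition slow_noise j t w := noise X bX t w j - noise X bX 0 w j.

Let bX0 w j : time_integral bX 0 w j 0 = 0.
Proof. by rewrite mxE set_itv1 Rintegral_set1. Qed.

Lemma slow_noiseE j t w : slow_noise j t w = X t w j 0 - X 0 w j 0 - \int[mu]_(u in `[0, t]) bX u w j 0.
Proof. by rewrite /slow_noise /noise bX0 subr0 mxE; ring. Qed.

Lemma slow_noise_gfun j t : 0 <= t -> gfun (F t) (slow_noise j t).
Proof.
move=> t0; apply: (@measurable_funB _ (SA (F t))).
  exact: (noise_gfun ipX slow_progressive).
apply: (gfun_filtration_le filF (lexx 0) t0).
exact: (noise_gfun ipX slow_progressive).
Qed.

(** Continuity is inherited from the paths of X and from the time integral of a locally bounded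
    drift, which is locally Lipschitz; the Ito integral itself is determined only up to a null set
    at each time. *)
Lemma slow_noise_continuous j w : continuous (fun t : R => slow_noise j (Num.max 0 t) w).
Proof.
have e : (fun t : R => slow_noise j (Num.max 0 t) w) = fun t : R => X (Num.max 0 t) w j 0 - X 0 w j 0 - \int[mu]_(u in `[0, Num.max 0 t]) bX u w j 0.
  by apply/funext => t; rewrite slow_noiseE.
rewrite e => t; apply: cvgB.
  by apply: cvgB; [exact: continuous_paths_coord|exact: cvg_cst].
have [B hB] := slow_drift_bounded w (Num.max 0 t + 1).
have m0 (s : R) : 0 <= Num.max 0 s by rewrite le_max lexx.
have ib := slow_drift_integrable w j (_ : 0 <= Num.max 0 t + 1).
have {}ib := ib (addr_ge0 (m0 t) ler01).
have B0 : 0 <= `|B| by [].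
have lip (s r : R) : 0 <= s -> s <= r -> r <= Num.max 0 t + 1 ->
    `|\int[mu]_(u in `[0, r]) bX u w j 0 - \int[mu]_(u in `[0, s]) bX u w j 0| <= `|B| * (r - s).
  move=> s0 sr rt; apply: (Rintegral_increment_le (t := Num.max 0 t + 1)) => //.
  move=> u /andP[su ur]; apply: le_trans (hB u j _) (ler_norm B).
  by rewrite (le_trans s0 su) (le_trans ur rt).
apply/cvgrPdist_le => e1 e10; near=> s.
have st : `|Num.max 0 t - Num.max 0 s| <= 1.
  by near: s; apply: (@cvgr_dist_le _ _ _ _ _ _ _ (@continuous_maxl R 0 t)).
have se : `|Num.max 0 t - Num.max 0 s| <= e1 / (`|B| + 1).
  near: s; apply: (@cvgr_dist_le _ _ _ _ _ _ _ (@continuous_maxl R 0 t)).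
  by rewrite divr_gt0// ltr_wpDl.
apply: (@le_trans _ _ (`|B| * `|Num.max 0 t - Num.max 0 s|)); last first.
  apply: le_trans (ler_wpM2l B0 se) _.
  rewrite mulrCA; apply: ler_piMr; first exact: ltW.
  by rewrite ler_pdivrMr ?ltr_wpDl// mul1r lerDl.
have [ts|ts] := leP (Num.max 0 s) (Num.max 0 t).
  by rewrite [X in _ * X]ger0_norm ?subr_ge0//; apply: lip => //; rewrite lerDl.
rewrite distrC [X in _ * X]distrC [X in _ * X]ger0_norm ?subr_ge0 ?(ltW ts)//.
apply: lip => //; first exact: ltW.
by move: st; rewrite distrC ger0_norm ?subr_ge0 ?(ltW ts)// lerBlDl.
Unshelve. all: by end_near. Qed.

Variables (T V : R).
Hypothesis T0 : 0 < T.
Hypothesis GV : \int[mu]_(u in `[0, T]) G u <= V.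

Let G_ge0 u : 0 <= u -> 0 <= G u.
Proof. by move=> u0; apply: le_trans (hXG u0); exact: sqnorm_ge0. Qed.

Lemma slow_noise_increment j s t : 0 <= s -> s <= t -> t <= T ->
  exists2 v, 0 <= v & subgaussian P (F s) (fun w => slow_noise j t w - slow_noise j s w) v.
Proof.
move=> s0 st tT; have [v [v0 sg _]] := noise_variance filF bW1 ipX slow_progressive mG GM hXG s0 st.
exists (v j) => //; have -> // : (fun w => slow_noise j t w - slow_noise j s w) =
  (fun w => noise X bX t w j - noise X bX s w j).
by apply/funext => w; rewrite /slow_noise; ring.
Qed.

Lemma slow_noise_total t : 0 <= t -> exists v : 'I_n -> R,
  [/\ forall j, 0 <= v j, forall j, subgaussian P (F 0) (slow_noise j t) (v j) &
      \sum_j v j <= \int[mu]_(u in `[0, t]) G u].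
Proof.
move=> t0; have [v [v0 sg sv]] := noise_variance filF bW1 ipX slow_progressive mG GM hXG (lexx 0) t0.
by exists v; split => //; move: sv; rewrite set_itv1 Rintegral_set1 subr0.
Qed.

Lemma subgaussian_mono (GG : set (set Om)) (m : Om -> R) v v' : GG `<=` measurable -> v <= v' ->
  subgaussian P GG m v -> subgaussian P GG m v'.
Proof.
move=> subG vv sg theta A mA; apply: le_trans (sg theta A mA) _.
apply: lee_wpmul2r => //; rewrite lee_fin ler_expR ler_pM2r// ler_wpM2l//; exact: sqr_ge0.
Qed.

Lemma slow_noise_subgaussian j t : 0 <= t -> t <= T -> subgaussian P (F 0) (slow_noise j t) V.
Proof.
move=> t0 tT; have [v [v0 sg sv]] := slow_noise_total t0.
apply: subgaussian_mono (sg j); first exact: (filtration_measurable filF (lexx 0)).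
apply: le_trans GV; apply: (@le_trans _ _ (\int[mu]_(u in `[0, t]) G u)).
  by apply: le_trans sv; rewrite (bigD1 j)//= lerDl sumr_ge0.
rewrite -subr_ge0 (trace_integralB mG GM hXG)//; apply: fine_ge0; apply: integral_ge0 => u /=.
by rewrite in_itv/= lee_fin => /andP[tu _]; apply: G_ge0; exact: le_trans tu.
Qed.

Lemma slow_noise_sqr j : 0 < V ->
  (\int[P]_w (pathmax T (slow_noise j ^~ w) ^+ 2)%:E <= (32 * V)%:E)%E.
Proof.
move=> V0; apply: (pathmax_sqr filF) => //.
- by move=> t; exact: slow_noise_gfun.
- exact: slow_noise_continuous.
- exact: slow_noise_increment.
- exact: slow_noise_subgaussian.
Qed.

Lemma slow_noise_tail j (theta c : R) : 0 <= theta ->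
  (P [set w | (c < pathmax T (slow_noise j ^~ w))%R] <= (8 * expR (theta ^+ 2 * V / 2 - theta * c))%:E)%E.
Proof.
move=> th0; apply: (pathmax_tail filF) => //.
- by move=> t; exact: slow_noise_gfun.
- exact: slow_noise_continuous.
- exact: slow_noise_increment.
- exact: slow_noise_subgaussian.
Qed.

End slow_fast.

(** * Moments of the slow component, uniformly in eps and delta *)

Section slow_estimates.
Context {R : realType} {d : measure_display} {Om : measurableType d}.
Variables (P : probability Om R) (F : R -> set (set Om)).
Hypothesis filF : filtration F.
Context {n : nat}.
Variables (W1 W2 : R -> Om -> 'cV[R]_n).
Hypotheses (bW1 : brownian P F W1) (bW2 : brownian P F W2).
Variables (eps delta : R) (xi zeta : Om -> 'cV[R]_n) (X Y : R -> Om -> 'cV[R]_n).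
Hypotheses (eps01 : 0 < eps < 1) (delta01 : 0 < delta < 1).
Hypothesis sol : slow_fast_solution P F W1 W2 eps delta xi zeta X Y.
Notation mu := (@lebesgue_measure R).
Notation CX t := (Cov (law P (X t))).
Notation CY t := (Cov (law P (Y t))).
Notation f := (second_moment P Y).
Notation g := (second_moment P X).
Let bX t w := - (CY t *m X t w) + Y t w.
Let eps0 : 0 < eps. Proof. by case/andP: eps01. Qed.
Let delta0 : 0 < delta. Proof. by case/andP: delta01. Qed.
Let L2X : locally_L2 P X. Proof. by case: sol => -[]. Qed.
Let L2Y : locally_L2 P Y. Proof. by case: sol => -[]. Qed.
Let aX : adapted F X. Proof. by case: sol => _ _ []. Qed.
Let aY : adapted F Y. Proof. by case: sol => _ _ _ []. Qed.
Let cX : continuous_paths X. Proof. by case: sol => _ _ []. Qed.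
Let cY : continuous_paths Y. Proof. by case: sol => _ _ _ []. Qed.
Let mX t : 0 <= t -> measurable_fun [set: Om] (X t : Om -> Rn R n).
Proof. exact: (adapted_measurable filF aX). Qed.
Let mY t : 0 <= t -> measurable_fun [set: Om] (Y t : Om -> Rn R n).
Proof. exact: (adapted_measurable filF aY). Qed.
Let finX t : 0 <= t -> (\int[P]_w (sqnorm (X t w))%:E < +oo)%E.
Proof. by move=> t0; have [M hM] := L2X t; apply: le_lt_trans (hM t _) (ltry _); rewrite t0 lexx. Qed.
Let g_ge0 u : 0 <= g u. Proof. exact: second_moment_ge0. Qed.
Let f_ge0 u : 0 <= f u. Proof. exact: second_moment_ge0. Qed.
Let sE (v : 'cV[R]_n) : sqnorm v = \sum_j v j 0 ^+ 2.
Proof. by apply: eq_bigr => i _; rewrite big_ord1. Qed.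
Let gE u : 0 <= u -> (\int[P]_w (sqnorm (X u w))%:E = (g u)%:E)%E.
Proof. by case: sol => _ _ ip _; exact: (second_momentE L2X). Qed.
Let fE u : 0 <= u -> (\int[P]_w (sqnorm (Y u w))%:E = (f u)%:E)%E.
Proof. by case: sol => _ _ _ ip; exact: (second_momentE L2Y). Qed.
Let mg : measurable_fun [set: measurableTypeR R] (fun u : measurableTypeR R => g (Num.max 0 u)).
Proof. by case: sol => _ _ ip _; exact: (second_moment_measurable filF ip). Qed.
Let mf' : measurable_fun [set: measurableTypeR R] (fun u : measurableTypeR R => f (Num.max 0 u)).
Proof. by case: sol => _ _ _ ip; exact: (second_moment_measurable filF ip). Qed.
Let fM t : exists M, forall u, 0 <= u <= t -> f u <= M. Proof. exact: second_moment_bounded. Qed.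
Let gM t : exists M, forall u, 0 <= u <= t -> g u <= M. Proof. exact: second_moment_bounded. Qed.
Let intf s t : 0 <= s -> mu.-integrable `[s, t] (EFin \o f).
Proof. exact: bounded_path_integrable. Qed.
Let intg s t : 0 <= s -> mu.-integrable `[s, t] (EFin \o g).
Proof. exact: bounded_path_integrable. Qed.
Let mbX j : measurable_fun [set: measurableTypeR R * Om] (fun p => bX (Num.max 0 p.1) p.2 j 0).
Proof.
rewrite (_ : (fun p => _) = fun p : measurableTypeR R * Om =>
  - (\sum_k CY (Num.max 0 p.1) j k * X (Num.max 0 p.1) p.2 k 0) + Y (Num.max 0 p.1) p.2 j 0); last first.
  by apply/funext => p; rewrite /bX !mxE.
have mc k : measurable_fun [set: measurableTypeR R * Om] (fun p => CY (Num.max 0 p.1) j k).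
  exact: (measurableT_comp (measurable_Cov_law P filF aY cY j k) (@measurable_fst _ _ _ Om)).
apply: measurable_funD; last exact: (joint_coord filF aY cY).
apply: measurable_funN; apply: measurable_sum => k.
by apply: measurable_funM; [exact: mc|exact: (joint_coord filF aX cX)].
Qed.
Let mbs : measurable_fun [set: measurableTypeR R * Om] (fun p => sqnorm (bX (Num.max 0 p.1) p.2)).
Proof. by apply: measurable_sqnorm => i j; rewrite ord1; exact: mbX. Qed.

(** The entries of Cov(Y_u) are at most f(u), so the matrix acts with squared norm at most n^2
    f(u)^2. *)
Lemma slow_drift_moment u : 0 <= u ->
  (\int[P]_w (sqnorm (bX u w))%:E <= (2 * n%:R ^+ 2 * f u ^+ 2 * g u + 2 * f u)%:E)%E.
Proof.
move=> u0; have ms : measurable_fun setT (fun w => sqnorm (bX u w)).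
  have := measurableT_comp mbs (@pair1_measurable _ _ (measurableTypeR R) Om u).
  by congr (measurable_fun _ _); apply/funext => w /=; rewrite max_r.
have mxx : measurable_fun setT (fun w => sqnorm (X u w)).
  by apply: measurable_sqnorm => i j; rewrite ord1; exact: (measurable_vector_coord (mX u0)).
have myy : measurable_fun setT (fun w => sqnorm (Y u w)).
  by apply: measurable_sqnorm => i j; rewrite ord1; exact: (measurable_vector_coord (mY u0)).
have c0 : 0 <= 2 * n%:R ^+ 2 * f u ^+ 2 by have := f_ge0 u; pos.
have x0 w : 0 <= sqnorm (X u w) by exact: sqnorm_ge0.
have y0 w : 0 <= sqnorm (Y u w) by exact: sqnorm_ge0.
apply: (@le_trans _ _ (\int[P]_w (2 * n%:R ^+ 2 * f u ^+ 2 * sqnorm (X u w) + 2 * sqnorm (Y u w))%:E)%E).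
  apply: integral_EFin_le; try solve [mf | by move=> w; exact: sqnorm_ge0].
  move=> w; apply: le_trans (sqnormD_le _ _) _; rewrite sqnormN lerD2r.
  have -> : 2 * n%:R ^+ 2 * f u ^+ 2 * sqnorm (X u w) = 2 * (n%:R ^+ 2 * f u ^+ 2 * sqnorm (X u w)) by ring.
  by rewrite ler_wpM2l//; apply: sqnorm_mulmx_le => i j; exact: (CY_entry filF sol).
rewrite integral_EFinD; try solve [mf | pos].
rewrite integral_EFinZ; try solve [mf | pos].
rewrite integral_EFinZ; try solve [mf | pos].
by rewrite gE// fE// -!EFinM -EFinD.
Qed.

Let sb_integrable w t : 0 <= t -> mu.-integrable `[0, t] (EFin \o (fun u => sqnorm (bX u w))).
Proof.
move=> t0; have [B hB] := slow_drift_bounded filF sol w t.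
apply: (@bounded_integrable _ _ _ _ (\sum_(i < n) B ^+ 2)).
  apply: measurable_sqnorm => i j; rewrite ord1.
  exact: (progressive_path filF w (slow_progressive filF sol i) t0).
move=> u ut; rewrite ger0_norm ?sqnorm_ge0// sE; apply: ler_sum => i _.
rewrite -[leLHS]real_normK ?num_real//.
have hb := hB u i ut; rewrite ler_sqr ?nnegrE//; exact: le_trans hb.
Qed.

Lemma slow_drift_integral t : 0 <= t ->
  (\int[P]_w (\int[mu]_(u in `[0%R, t]) sqnorm (bX u w))%:E <=
   (\int[mu]_(u in `[0%R, t]) (2 * n%:R ^+ 2 * f u ^+ 2 * g u + 2 * f u))%:E)%E.
Proof.
move=> t0; rewrite tonelli_path//; last 2 first.
- by move=> u w _; exact: sqnorm_ge0.
- by move=> w; exact: sb_integrable.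
have [M hM] := fM t; have [M' hM'] := gM t.
have m2 : measurable_fun (`[0, t]%classic : set (measurableTypeR R)) (fun u => 2 * n%:R ^+ 2 * f u ^+ 2 * g u + 2 * f u).
  apply: path_measurable => //; apply: measurable_funD; last by apply: measurable_funM => //; exact: measurable_cst.
  apply: measurable_funM => //; apply: measurable_funM; first exact: measurable_cst.
  exact: measurable_funX.
have pos2 u : 0 <= 2 * n%:R ^+ 2 * f u ^+ 2 * g u + 2 * f u.
  by have := f_ge0 u; have := g_ge0 u; move=> ? ?; pos.
rewrite /Rintegral fineK; last first.
  apply: integrable_fin_num => //.
  apply: (@bounded_integrable _ _ _ _ (2 * n%:R ^+ 2 * M ^+ 2 * M' + 2 * M)) => //.
  move=> u ut; rewrite ger0_norm//; have h1 := hM u ut; have h2 := hM' u ut.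
  have fu := f_ge0 u; have gu := g_ge0 u; have M0 := le_trans fu h1.
  apply: lerD; last by rewrite ler_wpM2l.
  apply: ler_pM => //; first by pos.
  by rewrite ler_wpM2l// ler_sqr ?nnegrE.
apply: ge0_le_integral => //.
- by move=> u _; apply: integral_EFin_ge0 => w; exact: sqnorm_ge0.
- have := @measurable_fun_fubini_tonelli_F _ _ _ _ _ P (fun p : measurableTypeR R * Om => (sqnorm (bX (Num.max 0 p.1) p.2))%:E).
  move=> /(_ (ltac:(apply/measurable_EFinP; exact: mbs))) /(_ (fun p => ltac:(by rewrite lee_fin sqnorm_ge0))).
  set H := fubini_F _ _ => mH; apply: (eq_measurable_fun H); last exact: measurable_funTS mH.
  by move=> u; rewrite mem_setE in_itv/= => /andP[u0 _]; rewrite /H /fubini_F/= max_r.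
- by apply/measurable_EFinP.
- by move=> u /=; rewrite in_itv/= => /andP[u0 _]; exact: slow_drift_moment.
Qed.

Let f0 := f 0.
Let g0 := g 0.
Let ff0 u : 0 <= u -> f u <= f0. Proof. exact: (fast_moment_le filF bW2 delta01 sol). Qed.
Let intf_le t : 0 <= t -> \int[mu]_(u in `[0, t]) f u <= delta * f0.
Proof. exact: (fast_moment_integral filF bW2 delta01 sol). Qed.

Let trg u : 0 <= u -> \tr (CX u) <= g u.
Proof.
move=> u0; have := trace_Cov_le (mX u0) (finX u0) 0.
by under [leRHS]eq_Rintegral do rewrite subr0.
Qed.

Let int_ge0 (q : R -> R) t : (forall u, 0 <= u -> 0 <= q u) -> 0 <= \int[mu]_(u in `[0, t]) q u.
Proof.
move=> q0; apply: fine_ge0; apply: integral_ge0 => u /=; rewrite in_itv/= => /andP[u0 _].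
by rewrite lee_fin q0.
Qed.

(** Used twice: with p = g to feed Gronwall's lemma, then with p = f, once g is bounded, to gain the
    order delta. *)
Let drift_int_le (c t : R) (p : R -> R) : 0 <= t -> 0 <= c -> mu.-integrable `[0, t] (EFin \o p) ->
  (forall u, 0 <= u <= t -> 2 * n%:R ^+ 2 * f u ^+ 2 * g u <= c * p u) ->
  \int[mu]_(u in `[0, t]) (2 * n%:R ^+ 2 * f u ^+ 2 * g u + 2 * f u) <=
  c * \int[mu]_(u in `[0, t]) p u + 2 * \int[mu]_(u in `[0, t]) f u.
Proof.
move=> t0 c0 ip h.
have i1 : mu.-integrable `[0, t] (EFin \o (fun u => c * p u)) by exact: integrable_scaleR.
have i2 : mu.-integrable `[0, t] (EFin \o (fun u => 2 * f u)).
  by apply: integrable_scaleR => //; exact: intf.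
have i12 : mu.-integrable `[0, t] (EFin \o (fun u => c * p u + 2 * f u)).
  exact: (integrableD _ i1 i2).
rewrite -!RintegralZl//; last exact: intf.
rewrite -RintegralD//; apply: le_Rintegral => //; last first.
  by move=> u /=; rewrite in_itv/= => ut; rewrite lerD2r; exact: h.
have m2 : measurable_fun (`[0, t]%classic : set (measurableTypeR R)) (fun u => 2 * n%:R ^+ 2 * f u ^+ 2 * g u + 2 * f u).
  apply: path_measurable => //; apply: measurable_funD; last by apply: measurable_funM => //; exact: measurable_cst.
  apply: measurable_funM => //; apply: measurable_funM; first exact: measurable_cst.
  exact: measurable_funX.
apply: (le_integrable _ _ _ i12) => //; first exact/measurable_EFinP.
move=> u /=; rewrite in_itv/= => ut; rewrite lee_fin.
have fu := f_ge0 u; have gu := g_ge0 u; have l0 : 0 <= 2 * n%:R ^+ 2 * f u ^+ 2 * g u by pos.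
have hu := h u ut.
have q0 : 0 <= c * p u by exact: le_trans hu.
have f2 : 0 <= 2 * f u by pos.
by rewrite ger0_norm ?addr_ge0// ger0_norm ?addr_ge0// lerD2r.
Qed.

(** The square of a sum of three terms, X_0, drift and noise, costs a factor 3. Bounding eps and
    delta by 1 leaves constants that depend only on n, T and the initial second moments. *)
Lemma slow_gronwall (T t : R) : 0 <= t <= T ->
  g t <= (3 * g0 + (6 * T + 6) * f0) +
         (6 * T * n%:R ^+ 2 * f0 ^+ 2 + 6) * \int[mu]_(u in `[0, t]) g u.
Proof.
move=> /andP[t0 tT].
have [v [v0 sg sv]] := slow_noise_total filF bW1 eps01 sol mg gM trg t0.
pose N j w := slow_noise P X Y j t w.
have mN j : measurable_fun setT (N j).
  by apply: (gfun_measurable (filtration_measurable filF t0)); exact: (slow_noise_gfun filF sol).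
have mx r : 0 <= r -> measurable_fun setT (fun w => sqnorm (X r w)).
  by move=> r0; apply: measurable_sqnorm => i j; rewrite ord1; exact: (measurable_vector_coord (mX r0)).
have mI : measurable_fun setT (fun w => \int[mu]_(u in `[0, t]) sqnorm (bX u w)).
  have := measurable_Rintegral_fst (measurable_itv `[0, t]) mbs.
  congr (measurable_fun _ _); apply/funext => w; apply: eq_Rintegral => u.
  by rewrite mem_setE in_itv/= => /andP[u0 _]; rewrite max_r.
have I0 w : 0 <= \int[mu]_(u in `[0, t]) sqnorm (bX u w).
  by apply: int_ge0 => u _; exact: sqnorm_ge0.
have x0 w : 0 <= sqnorm (X 0 w) by exact: sqnorm_ge0.
have pw w : sqnorm (X t w) <= 3 * sqnorm (X 0 w) +
    (3 * t * \int[mu]_(u in `[0, t]) sqnorm (bX u w) + 3 * \sum_j N j w ^+ 2).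
  have jj j : X t w j 0 ^+ 2 <= 3 * X 0 w j 0 ^+ 2 +
     (3 * t * \int[mu]_(u in `[0, t]) (bX u w j 0 ^+ 2) + 3 * N j w ^+ 2).
    have ib := slow_drift_integrable filF sol w j t0.
    have ib2 : mu.-integrable `[0, t] (EFin \o (fun u => bX u w j 0 ^+ 2)).
      have [B hB] := slow_drift_bounded filF sol w t.
      apply: (@bounded_integrable _ _ _ _ (B ^+ 2)).
        by apply: measurable_funX; exact: (progressive_path filF w (slow_progressive filF sol j) t0).
      move=> u ut; have hb := hB u j ut.
      by rewrite normrX ler_sqr ?nnegrE//; exact: le_trans hb.
    have := sqr_Rintegral_le t0 ib ib2.
    rewrite /N slow_noiseE -/(bX _ _).
    set A := \int[mu]_(u in _) _; set B := \int[mu]_(u in _) _ => hAB.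
    move: (X t w j 0) (X 0 w j 0) => x y; set z := x - y - A.
    have -> : x = y + A + z by rewrite /z; ring.
    have := sqr_ge0 (y - A); have := sqr_ge0 (y - z); have := sqr_ge0 (A - z).
    nra.
  have sI : \int[mu]_(u in `[0, t]) sqnorm (bX u w) = \sum_j \int[mu]_(u in `[0, t]) (bX u w j 0 ^+ 2).
    rewrite -Rintegral_sum//; last first.
      move=> j; have [B hB] := slow_drift_bounded filF sol w t.
      apply: (@bounded_integrable _ _ _ _ (B ^+ 2)).
        by apply: measurable_funX; exact: (progressive_path filF w (slow_progressive filF sol j) t0).
      move=> u ut; have hb := hB u j ut.
      by rewrite normrX ler_sqr ?nnegrE//; exact: le_trans hb.
    by apply: eq_Rintegral => u _; rewrite sE.
  rewrite !sE sI !mulr_sumr -!big_split/=; apply: ler_sum => j _; exact: jj.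
have EN j : (\int[P]_w (N j w ^+ 2)%:E <= (v j)%:E)%E.
  have := subgaussian_sqr (filtration_measurable filF (lexx 0)) (mN j) (v0 j) (sg j)
    (@measurable_cst _ _ (SA (F 0)) R setT 1) (fun=> ler01) (a := 1).
  have e1 : (\int[P]_w (cst (1 : R) w)%:E = 1%:E)%E.
    by under eq_integral do rewrite /cst/=; rewrite integral_cst//= probability_setT mule1.
  move=> /(_ e1).
  by under eq_integral do rewrite mul1r; rewrite mulr1.
have D := drift_int_le t0 (_ : 0 <= 2 * n%:R ^+ 2 * f0 ^+ 2) (intg t (lexx 0)) _.
have {}D := D ltac:(by have := f_ge0 0; pos).
have {}D : \int[mu]_(u in `[0, t]) (2 * n%:R ^+ 2 * f u ^+ 2 * g u + 2 * f u) <=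
  2 * n%:R ^+ 2 * f0 ^+ 2 * \int[mu]_(u in `[0, t]) g u + 2 * \int[mu]_(u in `[0, t]) f u.
  apply: D => u /andP[u0 _]; rewrite ler_wpM2r// ler_wpM2l ?mulr_ge0//.
  by rewrite ler_sqr ?nnegrE ?ff0//; exact: f_ge0.
have If : \int[mu]_(u in `[0, t]) f u <= f0.
  apply: le_trans (intf_le t0) _; apply: ler_piMl; first exact: f_ge0.
  by case/andP: delta01 => _ /ltW.
have SV : \sum_j v j <= 2 * \int[mu]_(u in `[0, t]) g u + 2 * f0.
  apply: le_trans sv _.
  have i1 : mu.-integrable `[0, t] (EFin \o (fun u => 2 * g u)) by apply: integrable_scaleR => //; exact: intg.
  have i2 : mu.-integrable `[0, t] (EFin \o (fun u => 2 * f u)) by apply: integrable_scaleR => //; exact: intf.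
  have i3 : mu.-integrable `[0, t] (EFin \o (fun u => 2 * g u + 2 * f u)) by exact: (integrableD _ i1 i2).
  rewrite RintegralZl// RintegralD// !RintegralZl//; [|exact: intf|exact: intg].
  have Ig0 : 0 <= \int[mu]_(u in `[0, t]) g u by exact: int_ge0.
  have If0 : 0 <= \int[mu]_(u in `[0, t]) f u by exact: int_ge0.
  apply: (@le_trans _ _ (2 * \int[mu]_(u in `[0, t]) g u + 2 * \int[mu]_(u in `[0, t]) f u)).
    move: Ig0 If0; move: (\int[mu]_(u in _) g u) (\int[mu]_(u in _) f u) => a c a0 c0.
    by apply: ler_piMl; [rewrite addr_ge0// mulr_ge0|case/andP: eps01 => _ /ltW].
  by rewrite lerD2l ler_wpM2l.
have : (\int[P]_w (sqnorm (X t w))%:E <= (3 * g0)%:E + ((3 * t)%:E * (\int[mu]_(u in `[0, t]) (2 * n%:R ^+ 2 * f u ^+ 2 * g u + 2 * f u))%:E + 3%:E * (\sum_j v j)%:E))%E.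
  have t3 : 0 <= 3 * t by pos.
  apply: (@le_trans _ _ (\int[P]_w (3 * sqnorm (X 0 w) +
    (3 * t * \int[mu]_(u in `[0, t]) sqnorm (bX u w) + 3 * \sum_j N j w ^+ 2))%:E)%E).
    apply: integral_EFin_le => //; try by mf.
    + exact: mx.
    + apply: measurable_funD; last by mf.
      by apply: measurable_funM; [exact: measurable_cst|exact: mx].
    + by move=> w; exact: sqnorm_ge0.
  have m0 := mx 0 (lexx 0).
  rewrite integral_EFinD; try solve [mf | pos].
  rewrite integral_EFinZ; try solve [mf | pos].
  rewrite integral_EFinD; try solve [mf | pos].
  rewrite integral_EFinZ; try solve [mf | pos].
  rewrite integral_EFinZ; try solve [mf | pos].
  rewrite gE// -EFinM leeD2l//; apply: leeD; apply: lee_wpmul2l; rewrite ?lee_fin//.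
    exact: slow_drift_integral.
  rewrite integral_EFin_sum; try solve [by move=> ?; mf | by move=> ? ?; pos].
  by rewrite -sumEFin; apply: lee_sum => j _.
rewrite (gE t0) -EFinM -EFinM -EFinD lee_fin => h.
apply: (le_trans h).
have Ig0 : 0 <= \int[mu]_(u in `[0, t]) g u by exact: int_ge0.
have If0 : 0 <= \int[mu]_(u in `[0, t]) f u by exact: int_ge0.
move: D If SV Ig0 If0.
set I := \int[mu]_(u in _) _; set J := \int[mu]_(u in _) g u; set K := \int[mu]_(u in _) f u.
set Sv := \sum_j _ => D If SV Ig0 If0.
have ff := f_ge0 0; rewrite -/f0 in ff.
have Il : I <= 2 * n%:R ^+ 2 * f0 ^+ 2 * J + 2 * f0 by lra.
have R0 : 0 <= 2 * n%:R ^+ 2 * f0 ^+ 2 * J + 2 * f0 by pos.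
have : 3 * t * I <= 3 * T * (2 * n%:R ^+ 2 * f0 ^+ 2 * J + 2 * f0).
  apply: (@le_trans _ _ (3 * t * (2 * n%:R ^+ 2 * f0 ^+ 2 * J + 2 * f0))).
    by apply: ler_wpM2l => //; pos.
  by apply: ler_wpM2r => //; rewrite ler_wpM2l.
have -> : 3 * T * (2 * n%:R ^+ 2 * f0 ^+ 2 * J + 2 * f0) = 6 * T * n%:R ^+ 2 * f0 ^+ 2 * J + 6 * T * f0 by ring.
rewrite !mulrDl; lra.
Qed.

(** Gronwall's bound 2 A e^(2 B T) with the constants of [slow_gronwall]. *)
Definition moment_bound (T f0 g0 : R) : R :=
  2 * (3 * g0 + (6 * T + 6) * f0) * expR (2 * (6 * T * n%:R ^+ 2 * f0 ^+ 2 + 6) * T).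

(** The first summand is 2 T times the integrated drift energy per unit of delta; the second is 2 n
    times the 32 V of [slow_noise_sqr] per unit of eps. *)
Definition sup_moment_bound (T f0 g0 : R) : R :=
  2 * T * ((2 * n%:R ^+ 2 * f0 * moment_bound T f0 g0 + 2) * f0) +
  64 * n%:R * (T * (2 * moment_bound T f0 g0 + 2 * f0) + 1).

Variable T : R.
Hypothesis T0 : 0 < T.
Let T0' : 0 <= T := ltW T0.
Let H := moment_bound T f0 g0.

Let H_ge0 : 0 <= H.
Proof.
have := f_ge0 0; have := g_ge0 0; rewrite -/f0 -/g0 => ? ?.
by rewrite /H /moment_bound; pos.
Qed.

Lemma slow_moment_le t : 0 <= t <= T -> g t <= H.
Proof.
have ff := f_ge0 0; have gg := g_ge0 0; rewrite -/f0 -/g0 in ff gg.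
have [M hM] := gM T.
apply: (@gronwall R T (3 * g0 + (6 * T + 6) * f0) (6 * T * n%:R ^+ 2 * f0 ^+ 2 + 6) M) => //.
- by pos.
- by rewrite ltr_wpDl//; pos.
- by move=> u uT; rewrite g_ge0 hM.
- by move=> t'; exact: slow_gronwall.
Qed.

Let int_abs_integrable w j : mu.-integrable `[0, T] (EFin \o (fun u => `|bX u w j 0|)).
Proof. exact: (integrable_norm (slow_drift_integrable filF sol w j T0')). Qed.

Let sqr_integrable w j : mu.-integrable `[0, T] (EFin \o (fun u => bX u w j 0 ^+ 2)).
Proof.
have [B hB] := slow_drift_bounded filF sol w T.
apply: (@bounded_integrable _ _ _ _ (B ^+ 2)).
  by apply: measurable_funX; exact: (progressive_path filF w (slow_progressive filF sol j) T0').
move=> u ut; have hb := hB u j ut.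
by rewrite normrX ler_sqr ?nnegrE//; exact: le_trans hb.
Qed.

Let increment_continuous w j : continuous (fun t : R => X (Num.max 0 t) w j 0 - X 0 w j 0).
Proof. by move=> t; apply: cvgB; [exact: continuous_paths_coord|exact: cvg_cst]. Qed.

Lemma slow_pathmax_le w j :
  pathmax T (fun t => X t w j 0 - X 0 w j 0) <=
  \int[mu]_(u in `[0, T]) `|bX u w j 0| + pathmax T (slow_noise P X Y j ^~ w).
Proof.
apply: pathmax_le => // t /andP[t0 tT].
have -> : X t w j 0 - X 0 w j 0 = \int[mu]_(u in `[0, t]) bX u w j 0 + slow_noise P X Y j t w.
  by rewrite slow_noiseE; ring.
apply: le_trans (ler_normD _ _) _; apply: lerD.
  have ib := slow_drift_integrable filF sol w j t0.
  apply: le_trans (le_normr_Rintegral _ ib) _ => //.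
  by apply: Rintegral_le_itv => //; exact: (int_abs_integrable w j).
by apply: (@pathmax_ge R T (slow_noise P X Y j ^~ w) t);
  [exact: (slow_noise_continuous filF sol)|rewrite t0 tT].
Qed.

Let pm j w := pathmax T (fun t => X t w j 0 - X 0 w j 0).

Let mpm j : measurable_fun setT (pm j).
Proof.
apply: (@measurable_pathmax R _ _ (fun t w => X t w j 0 - X 0 w j 0)) => //.
by move=> t t0; apply: measurable_funB; apply: measurable_vector_coord; exact: mX.
Qed.

Lemma slow_sup_moment :
  (\int[P]_w (\sum_j pathmax T (fun t => (X t w j 0 - X 0 w j 0)%R) ^+ 2)%:E <=
   (sup_moment_bound T f0 g0 * (eps + delta))%:E)%E.
Proof.
have ff := f_ge0 0; have gg := g_ge0 0; rewrite -/f0 -/g0 in ff gg.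
(* The added 1 makes V positive, as [slow_noise_sqr] asks. *)
pose V := eps * (T * (2 * H + 2 * f0) + 1).
have V0 : 0 < V by rewrite mulr_gt0// ltr_wpDl//; pos.
have i2g : mu.-integrable `[0, T] (EFin \o (fun u => 2 * g u)) by apply: integrable_scaleR => //; exact: intg.
have i2f : mu.-integrable `[0, T] (EFin \o (fun u => 2 * f u)) by apply: integrable_scaleR => //; exact: intf.
have iG : mu.-integrable `[0, T] (EFin \o (fun u => 2 * g u + 2 * f u)) by exact: (integrableD _ i2g i2f).
have GV : \int[mu]_(u in `[0, T]) (eps * (2 * g u + 2 * f u)) <= V.
  rewrite RintegralZl// /V ler_wpM2l ?(ltW eps0)//.
  apply: (@le_trans _ _ (T * (2 * H + 2 * f0))); last by rewrite lerDl.
  apply: Rintegral_le_cst => // u uT; have /andP[u0 _] := uT.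
  by rewrite lerD// ler_wpM2l// ?ff0//; exact: slow_moment_le.
pose N j w := pathmax T (slow_noise P X Y j ^~ w).
have mN j : measurable_fun setT (N j).
  apply: measurable_pathmax => //; first exact: (slow_noise_continuous filF sol).
  move=> t t0; apply: (gfun_measurable (filtration_measurable filF t0)).
  exact: (slow_noise_gfun filF sol).
have EN j : (\int[P]_w (N j w ^+ 2)%:E <= (32 * V)%:E)%E.
  exact: (slow_noise_sqr filF bW1 eps01 sol mg gM trg T0 GV).
pose I w := \int[mu]_(u in `[0, T]) sqnorm (bX u w).
have mI : measurable_fun setT I.
  have := measurable_Rintegral_fst (measurable_itv `[0, T]) mbs.
  congr (measurable_fun _ _); apply/funext => w; apply: eq_Rintegral => u.
  by rewrite mem_setE in_itv/= => /andP[u0 _]; rewrite max_r.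
have I0 w : 0 <= I w by apply: int_ge0 => u _; exact: sqnorm_ge0.
have sI w : I w = \sum_j \int[mu]_(u in `[0, T]) (bX u w j 0 ^+ 2).
  by rewrite -Rintegral_sum//; apply: eq_Rintegral => u _; rewrite sE.
have T20 : 0 <= 2 * T by pos.
apply: (@le_trans _ _ (\int[P]_w (2 * T * I w + 2 * \sum_j N j w ^+ 2)%:E)%E).
  apply: integral_EFin_le; try solve [mf | pos].
  move=> w; rewrite sI !mulr_sumr -big_split/=; apply: ler_sum => j _.
  have h := slow_pathmax_le w j; rewrite -/(N j w) in h.
  have N0 : 0 <= N j w by apply: pathmax_ge0 => //; exact: (slow_noise_continuous filF sol).
  have p0 : 0 <= pathmax T (fun t => X t w j 0 - X 0 w j 0).
    exact: (@pathmax_ge0 R T (fun t => X t w j 0 - X 0 w j 0)).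
  have A0 : 0 <= \int[mu]_(u in `[0, T]) `|bX u w j 0| by apply: int_ge0.
  have hc := sqr_Rintegral_le T0' (int_abs_integrable w j) _.
  have {}hc : (\int[mu]_(u in `[0, T]) `|bX u w j 0|) ^+ 2 <= T * \int[mu]_(u in `[0, T]) (bX u w j 0 ^+ 2).
    have e : (fun u => bX u w j 0 ^+ 2) = (fun u => `|bX u w j 0| ^+ 2).
      by apply/funext => u; rewrite real_normK ?num_real.
    by have := sqr_integrable w j; rewrite e => /hc.
  move: h hc A0 p0 N0; move: (pathmax _ _) (N j w) => p q.
  move: (\int[mu]_(u in _) `|_|) (\int[mu]_(u in _) (_ ^+ 2)) => A Q h hc A0 p0 N0.
  apply: (@le_trans _ _ ((A + q) ^+ 2)); first by rewrite ler_sqr ?nnegrE ?addr_ge0.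
  by have := sqr_ge0 (A - q); nra.
rewrite integral_EFinD; try solve [mf | pos].
rewrite integral_EFinZ; try solve [mf | pos].
rewrite integral_EFinZ; try solve [mf | pos].
rewrite integral_EFin_sum; try solve [by move=> ?; mf | by move=> ? ?; pos].
have D := slow_drift_integral T0'.
(* Of f^2 one factor is bounded by f(0) and the other is kept: its time integral is at most delta
   f(0), the source of the order delta. *)
have hd : \int[mu]_(u in `[0, T]) (2 * n%:R ^+ 2 * f u ^+ 2 * g u + 2 * f u) <=
    (2 * n%:R ^+ 2 * f0 * H + 2) * (delta * f0).
  have cc : 0 <= 2 * n%:R ^+ 2 * f0 * H by pos.
  apply: (@le_trans _ _ (2 * n%:R ^+ 2 * f0 * H * \int[mu]_(u in `[0, T]) f u + 2 * \int[mu]_(u in `[0, T]) f u)).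
    apply: drift_int_le => //; first exact: intf.
    move=> u uT; have /andP[u0 _] := uT.
    have fu := f_ge0 u; have gu := slow_moment_le uT; have fu0 := ff0 u0.
    have -> : 2 * n%:R ^+ 2 * f u ^+ 2 * g u = 2 * n%:R ^+ 2 * f u * (f u * g u) by ring.
    have -> : 2 * n%:R ^+ 2 * f0 * H * f u = 2 * n%:R ^+ 2 * f u * (f0 * H) by ring.
    by apply: ler_wpM2l; [pos|apply: ler_pM].
  rewrite -mulrDl; apply: ler_wpM2l; [by pos|exact: intf_le].
apply: (@le_trans _ _ ((2 * T)%:E * ((2 * n%:R ^+ 2 * f0 * H + 2) * (delta * f0))%:E + 2%:E * \sum_(j < n) (32 * V)%:E)%E).
  apply: leeD; apply: lee_wpmul2l; rewrite ?lee_fin//.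
    by apply: le_trans D _; rewrite lee_fin.
  by apply: lee_sum => j _; exact: EN.
rewrite sumEFin -!EFinM -EFinD lee_fin sumr_const card_ord -mulr_natl.
rewrite /sup_moment_bound -/H /V.
have a0 : 0 <= 2 * T * ((2 * n%:R ^+ 2 * f0 * H + 2) * f0) by pos.
have b0 : 0 <= 64 * n%:R * (T * (2 * H + 2 * f0) + 1) by pos.
have := mulr_ge0 a0 (ltW eps0); have := mulr_ge0 b0 (ltW delta0).
lra.
Qed.

End slow_estimates.

(** * Tail bounds for deterministic initial values *)

Section deterministic_start.
Context {R : realType} {d : measure_display} {Om : measurableType d}.
Variables (P : probability Om R) (F : R -> set (set Om)).
Hypothesis filF : filtration F.
Context {n : nat}.
Variables (W1 W2 : R -> Om -> 'cV[R]_n).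
Hypotheses (bW1 : brownian P F W1) (bW2 : brownian P F W2).
Variables (eps delta : R) (x y : 'cV[R]_n) (X Y : R -> Om -> 'cV[R]_n).
Hypotheses (eps01 : 0 < eps < 1) (delta01 : 0 < delta < 1).
Hypothesis sol : slow_fast_solution P F W1 W2 eps delta (cst x) (cst y) X Y.
Variable T : R.
Hypothesis T0 : 0 < T.
Notation mu := (@lebesgue_measure R).
Notation CX t := (Cov (law P (X t))).
Notation f := (second_moment P Y).
Notation g := (second_moment P X).
Let T0' : 0 <= T := ltW T0.
Let eps0 : 0 < eps. Proof. by case/andP: eps01. Qed.
Let delta0 : 0 < delta. Proof. by case/andP: delta01. Qed.
Let L2X : locally_L2 P X. Proof. by case: sol => -[]. Qed.
Let L2Y : locally_L2 P Y. Proof. by case: sol => -[]. Qed.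
Let X0 : {ae P, forall w, X 0 w = x}. Proof. by case: sol => _ []. Qed.
Let Y0 : {ae P, forall w, Y 0 w = y}. Proof. by case: sol => _ []. Qed.
Let aX : adapted F X. Proof. by case: sol => _ _ []. Qed.
Let aY : adapted F Y. Proof. by case: sol => _ _ _ []. Qed.
Let cX : continuous_paths X. Proof. by case: sol => _ _ []. Qed.
Let cY : continuous_paths Y. Proof. by case: sol => _ _ _ []. Qed.
Let mX t : 0 <= t -> measurable_fun [set: Om] (X t : Om -> Rn R n).
Proof. exact: (adapted_measurable filF aX). Qed.
Let mY t : 0 <= t -> measurable_fun [set: Om] (Y t : Om -> Rn R n).
Proof. exact: (adapted_measurable filF aY). Qed.
Let finX t : 0 <= t -> (\int[P]_w (sqnorm (X t w))%:E < +oo)%E.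
Proof. by move=> t0; have [M hM] := L2X t; apply: le_lt_trans (hM t _) (ltry _); rewrite t0 lexx. Qed.
Let sE (v : 'cV[R]_n) : sqnorm v = \sum_j v j 0 ^+ 2.
Proof. by apply: eq_bigr => i _; rewrite big_ord1. Qed.

Lemma second_moment_ae (Z : R -> Om -> 'cV[R]_n) (z : Om -> 'cV[R]_n) :
  measurable_fun [set: Om] (Z 0 : Om -> Rn R n) -> measurable_fun [set: Om] (z : Om -> Rn R n) ->
  {ae P, forall w, Z 0 w = z w} -> second_moment P Z 0 = \int[P]_w sqnorm (z w).
Proof.
move=> mZ mz Zz; congr fine; apply: ae_eq_integral => //.
- by apply/measurable_EFinP; exact: (measurableT_comp (@measurable_sqnorm_Rn R n) mZ).
- by apply/measurable_EFinP; exact: (measurableT_comp (@measurable_sqnorm_Rn R n) mz).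
- by apply: filterS Zz => w -> _.
Qed.

Let f0E : f 0 = sqnorm y.
Proof. by rewrite (second_moment_ae (mY (lexx 0)) (measurable_cst _) Y0); exact: (Rintegral_cst1 P (sqnorm y)). Qed.
Let g0E : g 0 = sqnorm x.
Proof. by rewrite (second_moment_ae (mX (lexx 0)) (measurable_cst _) X0); exact: (Rintegral_cst1 P (sqnorm x)). Qed.

Let K := @sup_moment_bound R n T (sqnorm y) (sqnorm x).
Let pm j w := pathmax T (fun t => X t w j 0 - X 0 w j 0).

Let increment_continuous w j : continuous (fun t : R => X (Num.max 0 t) w j 0 - X 0 w j 0).
Proof. by move=> t; apply: cvgB; [exact: continuous_paths_coord|exact: cvg_cst]. Qed.

Let mpm j : measurable_fun setT (pm j).
Proof.
apply: (@measurable_pathmax R _ _ (fun t w => X t w j 0 - X 0 w j 0)) => //.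
by move=> t t0; apply: measurable_funB; apply: measurable_vector_coord; exact: mX.
Qed.

Let pm0 j w : 0 <= pm j w.
Proof. exact: (@pathmax_ge0 R T (fun t => X t w j 0 - X 0 w j 0)). Qed.

Lemma slow_deviation_moment u : 0 <= u <= T -> \int[P]_w sqnorm (X u w - x) <= K * (eps + delta).
Proof.
move=> uT; have /andP[u0 _] := uT.
have ms : measurable_fun setT (fun w => sqnorm (X u w - x)).
  apply: measurable_sqnorm => i j; rewrite ord1; under eq_fun do rewrite !mxE.
  by apply: measurable_funB => //; apply: measurable_vector_coord; exact: mX.
have h : (\int[P]_w (sqnorm (X u w - x))%:E <= (K * (eps + delta))%:E)%E.
  have := slow_sup_moment filF bW1 bW2 eps01 delta01 sol T0; rewrite f0E g0E -/K; apply: le_trans.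
  apply: integral_EFin_ae_le => //.
  - by apply: measurable_sum => j; apply: measurable_funX; exact: mpm.
  - by move=> w; exact: sqnorm_ge0.
  - by pos.
  - apply: filterS X0 => w Xw; rewrite sE; apply: ler_sum => j _; rewrite !mxE -Xw.
    rewrite -[leLHS]real_normK ?num_real// ler_sqr ?nnegrE//; last exact: pm0.
    exact: (@pathmax_ge R T (fun t => X t w j 0 - X 0 w j 0)).
rewrite -lee_fin /Rintegral fineK// ge0_fin_numE; last by apply: integral_EFin_ge0 => w; exact: sqnorm_ge0.
exact: le_lt_trans h (ltry _).
Qed.

Let q u := \tr (CX u).
Let mq : measurable_fun [set: measurableTypeR R] (fun u : measurableTypeR R => q (Num.max 0 u)).
Proof. by apply: measurable_sum => i; exact: (measurable_Cov_law P filF aX cX). Qed.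
Let qM t : exists M, forall u, 0 <= u <= t -> q u <= M.
Proof.
have [M hM] := second_moment_bounded L2X t; exists M => u ut; have /andP[u0 _] := ut.
apply: le_trans (hM u ut); have := trace_Cov_le (mX u0) (finX u0) 0.
by under [leRHS]eq_Rintegral do rewrite subr0.
Qed.
Let q0 u : 0 <= u -> 0 <= q u.
Proof. by move=> u0; exact: trace_Cov_ge0 (mX u0). Qed.

(** Bound on the total variance of the noise. It is O(eps (eps + delta)) because Cov(X_u) is
    controlled by the deviation of X_u from x, not by the second moment of X_u. *)
Let V := eps * (2 * (T * (K * (eps + delta))) + 2 * (delta * sqnorm y)).

Let mf' : measurable_fun [set: measurableTypeR R] (fun u : measurableTypeR R => f (Num.max 0 u)).
Proof. by case: sol => _ _ _ ip; exact: (second_moment_measurable filF ip). Qed.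
Let intf : mu.-integrable `[0, T] (EFin \o f).
Proof. by apply: bounded_path_integrable => // [u _|]; [exact: second_moment_ge0|exact: second_moment_bounded]. Qed.
Let intf_le : \int[mu]_(u in `[0, T]) f u <= delta * sqnorm y.
Proof. by rewrite -f0E; exact: (fast_moment_integral filF bW2 delta01 sol). Qed.

Let GV : \int[mu]_(u in `[0, T]) (eps * (2 * q u + 2 * f u)) <= V.
Proof.
have iq : mu.-integrable `[0, T] (EFin \o q) by exact: bounded_path_integrable.
have i2q : mu.-integrable `[0, T] (EFin \o (fun u => 2 * q u)) by exact: integrable_scaleR.
have i2f : mu.-integrable `[0, T] (EFin \o (fun u => 2 * f u)) by exact: integrable_scaleR.
have iG : mu.-integrable `[0, T] (EFin \o (fun u => 2 * q u + 2 * f u)) by exact: (integrableD _ i2q i2f).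
rewrite RintegralZl// /V ler_wpM2l ?(ltW eps0)// RintegralD// !RintegralZl//.
apply: lerD; rewrite ler_wpM2l//; apply: Rintegral_le_cst => // u uT; have /andP[u0 _] := uT.
exact: le_trans (trace_Cov_le (mX u0) (finX u0) x) (slow_deviation_moment uT).
Qed.

Let iY w j : mu.-integrable `[0, T] (EFin \o (fun u => `|Y u w j 0|)).
Proof.
have [B B0 hB] := path_bounded cY w T; apply: (@bounded_integrable _ _ _ _ B) => [|u ut].
  apply: (measurableT_comp (@normr_measurable R setT)).
  exact: (progressive_path filF w (progressive_coord filF aY cY j) T0').
by rewrite normr_id hB.
Qed.

Lemma fast_integral_measurable j : measurable_fun setT (fun w => \int[mu]_(u in `[0, T]) `|Y u w j 0|).
Proof.
have pY : progressive F (fun u w => `|Y u w j 0|).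
  move=> r r0; apply: (measurableT_comp (@normr_measurable R setT)).
  exact: (progressive_coord filF aY cY j r0).
exact: (gfun_measurable (filtration_measurable filF T0') (progressive_integral pY T0')).
Qed.

Let mA j (a : R) : measurable [set w | a < \int[mu]_(u in `[0, T]) `|Y u w j 0| ].
Proof.
rewrite (_ : [set w | _] = (fun w => \int[mu]_(u in `[0, T]) `|Y u w j 0|) @^-1` `]a, +oo[%classic).
  by rewrite -[_ @^-1` _]setTI; exact: fast_integral_measurable.
by apply/seteqP; split => w /=; rewrite in_itv/= andbT.
Qed.

Definition fast_tail_cst (a : R) : R :=
  expR ((2 * T / a) ^+ 2 / 2 * sqnorm y) * (1 + \sum_j ch (2 * T / a * y j 0)).

(** Markov's inequality for the exponential moment with la = 2 T / a. Subtracting 1 / la over [0, T]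
    uses up a / 2; the remaining a / 2, times la / ((n + 3) delta), is the exponent T / ((n + 3)
    delta), free of a. *)
Lemma fast_tail j (a : R) : 0 < a -> 2 * n%:R * (K * (eps + delta)) <= 1 ->
  (P [set w | (a < \int[mu]_(u in `[0%R, T]) `|Y u w j 0|)%R] <=
   (expR (- (T / n.+3%:R / delta)) * fast_tail_cst a)%:E)%E.
Proof.
move=> a0 nK; pose la := 2 * T / a; have la0 : 0 < la by rewrite divr_gt0// mulr_gt0.
have hc u i l : 0 <= u <= T -> `|CX u i l| <= K * (eps + delta).
  move=> uT; have /andP[u0 _] := uT.
  exact: le_trans (Cov_entry_le (mX u0) (finX u0) x i l) (slow_deviation_moment uT).
have := fast_exponential_moment filF bW2 delta01 sol j la0 T0 hc nK.
rewrite f0E.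
have -> : (\int[P]_w (1 + \sum_j0 ch (la * Y 0 w j0 0))%:E = (1 + \sum_j0 ch (la * y j0 0))%:E)%E.
  transitivity (\int[P]_w (1 + \sum_j0 ch (la * y j0 0))%:E)%E.
    apply: ae_eq_integral => //.
    - have mYj i := measurable_vector_coord (mY (lexx 0)) i.
      by rewrite /ch; mf.
    - by apply: filterS Y0 => w -> _.
  by rewrite integral_cst//= probability_setT mule1.
set k := la * delta^-1 / n.+3%:R; rewrite -EFinM -/la => hE.
have k0 : 0 <= k by rewrite /k !mulr_ge0 ?invr_ge0// ltW.
pose E w := expR (k * \int[mu]_(u in `[0, T]) (`|Y u w j 0| - la^-1)).
have IE w : \int[mu]_(u in `[0, T]) (`|Y u w j 0| - la^-1) = \int[mu]_(u in `[0, T]) `|Y u w j 0| - a / 2.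
  rewrite RintegralB//; last first.
    by apply: (@bounded_integrable _ _ _ _ `|la^-1|) => [|u _ //]; exact: measurable_cst.
  rewrite Rintegral_cst// [X in fine X](lebesgue_measure_itv `[0, T])/= lte_fin T0.
  by rewrite -EFinB/= subr0 /la; congr (_ - _); field; rewrite !gt_eqF.
have mI := fast_integral_measurable j.
have mE : measurable_fun setT E.
  rewrite (_ : E = fun w => expR (k * (\int[mu]_(u in `[0, T]) `|Y u w j 0| - a / 2))); last first.
    by apply/funext => w; rewrite /E IE.
  apply: (measurableT_comp (@measurable_expR R)); apply: measurable_funM; first exact: measurable_cst.
  by apply: measurable_funB => //; exact: measurable_cst.
rewrite -[X in P X]setIT -integral_indic//.
apply: (@le_trans _ _ (\int[P]_w (expR (- (T / n.+3%:R / delta)) * E w)%:E)%E).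
  apply: integral_EFin_le; try solve [mf | pos].
  move=> w; rewrite indicE /E -expRD IE; case: (boolP (_ \in _)) => [|_]; last exact: expR_ge0.
  rewrite inE/= => aw; rewrite -[leLHS]expR0 ler_expR.
  have -> : T / n.+3%:R / delta = k * (a / 2).
    by rewrite /k /la; field; rewrite !gt_eqF.
  by rewrite addrC subr_ge0 ler_wpM2l//; lra.
rewrite integral_EFinZ; try solve [mf | pos].
by rewrite EFinM lee_wpmul2l// lee_fin expR_ge0.
Qed.

(** If no fast integral and no noise maximum exceeds a, the summed deviation S satisfies S <= n
    ((|x|_1 + S) delta |y|^2 + 2 a), where S reappears through the drift -Cov(Y) X. The smallness
    conditions give S <= a + S / 2 + 2 n a, that is S <= 2 a + 4 n a <= c. *)
Lemma slow_tail (a c theta : R) : 0 < a -> 0 <= theta ->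
  2 * n%:R * (K * (eps + delta)) <= 1 ->
  n%:R * (delta * sqnorm y) <= 2^-1 ->
  n%:R * (delta * sqnorm y) * (\sum_k `|x k 0|) <= a ->
  2 * a + 4 * (n%:R * a) <= c ->
  (P [set w | (c < \sum_j pathmax T (fun t => X t w j 0 - X 0 w j 0))%R] <=
   (n%:R * (expR (- (T / n.+3%:R / delta)) * fast_tail_cst a +
            8 * expR (theta ^+ 2 * V / 2 - theta * a)))%:E)%E.
Proof.
move=> a0 th0 nK nd ndx hac.
pose S w := \sum_j pm j w.
have mS : measurable_fun setT S by apply: measurable_sum => j; exact: mpm.
have mSc : measurable [set w | c < S w].
  rewrite (_ : [set w | _] = S @^-1` `]c, +oo[%classic).
    by rewrite -[_ @^-1` _]setTI; exact: mS.
  by apply/seteqP; split => w /=; rewrite in_itv/= andbT.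
pose N j w := pathmax T (slow_noise P X Y j ^~ w).
have mN j : measurable_fun setT (N j).
  apply: measurable_pathmax => //; first exact: (slow_noise_continuous filF sol).
  move=> t t0; apply: (gfun_measurable (filtration_measurable filF t0)).
  exact: (slow_noise_gfun filF sol).
pose A j := [set w | a < \int[mu]_(u in `[0, T]) `|Y u w j 0| ].
pose B j := [set w | a < N j w].
have mB j : measurable (B j).
  rewrite (_ : B j = N j @^-1` `]a, +oo[%classic).
    by rewrite -[_ @^-1` _]setTI; exact: mN.
  by apply/seteqP; split => w /=; rewrite in_itv/= andbT.
have mAj j : measurable (A j) by exact: mA.
rewrite -[X in P X]setIT -integral_indic//.
have mi (D : set Om) : measurable D -> measurable_fun setT (\1_D : Om -> R) by move=> mD; exact: measurable_indic.
have mi' (D : set Om) : measurable D -> measurable_fun setT (fun w => \1_D w : R) by move=> mD; exact: measurable_indic.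
apply: (@le_trans _ _ (\int[P]_w (\sum_j (\1_(A j) w + \1_(B j) w))%:E)%E).
  apply: integral_EFin_ae_le.
  - exact: mi.
  - by apply: measurable_sum => j; apply: measurable_funD; exact: mi'.
  - by pos.
  - by pos.
  apply: filterS X0 => w Xw; rewrite {1}indicE; case: (boolP (_ \in _)) => [|_]; last by pos.
  rewrite inE/= => cS.
  have [[j hj]|hn] := pselect (exists j, A j w \/ B j w).
    rewrite (bigD1 j)//=; apply: ler_wpDr; first by pos.
    case: hj => hj.
      by rewrite [\1_(A j) w]indicE mem_set//= lerDl; pos.
    by rewrite [\1_(B j) w]indicE mem_set//= lerDr; pos.
  exfalso.
  have hA j : \int[mu]_(u in `[0, T]) `|Y u w j 0| <= a.
    by rewrite leNgt; apply/negP => h; apply: hn; exists j; left.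
  have hB j : N j w <= a by rewrite leNgt; apply/negP => h; apply: hn; exists j; right.
  have Xle u k : 0 <= u <= T -> `|X u w k 0| <= `|x k 0| + pm k w.
    move=> uT; rewrite -[X u w k 0](subrK (X 0 w k 0)) addrC; apply: le_trans (ler_normD _ _) _.
    rewrite Xw lerD2l -Xw; exact: (@pathmax_ge R T (fun t => X t w k 0 - X 0 w k 0)).
  pose L := \sum_k (`|x k 0| + pm k w).
  have L0 : 0 <= L by rewrite /L; pos.
  have pmj j : pm j w <= L * (delta * sqnorm y) + a + a.
    apply: le_trans (slow_pathmax_le filF sol T0 w j) _; apply: lerD; last exact: hB.
    apply: (@le_trans _ _ (\int[mu]_(u in `[0, T]) (L * f u + `|Y u w j 0|))).
      apply: le_Rintegral => //.
      - exact: (integrable_norm (slow_drift_integrable filF sol w j T0')).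
      - apply: (integrableD _ (integrable_scaleR _ L intf) (iY w j)) => //.
      move=> u /=; rewrite in_itv/= => uT; have /andP[u0 _] := uT.
      rewrite !mxE; apply: le_trans (ler_normD _ _) _; rewrite lerD2r normrN.
      apply: le_trans (ler_norm_sum _ _ _) _; rewrite /L mulr_suml; apply: ler_sum => k _.
      rewrite normrM mulrC; apply: ler_pM => //; first exact: Xle.
      exact: (CY_entry filF sol).
    rewrite RintegralD//; last exact: integrable_scaleR.
    by rewrite RintegralZl//; apply: lerD; [apply: ler_wpM2l|exact: hA].
  have : S w <= n%:R * (L * (delta * sqnorm y) + a + a).
    by rewrite mulr_natl -[X in _ *+ X]card_ord -sumr_const; apply: ler_sum => j _; exact: pmj.
  have LE : L = \sum_k `|x k 0| + S w by rewrite /L big_split.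
  have S0 : 0 <= S w by rewrite /S; pos.
  rewrite LE; move: cS nd ndx S0; rewrite -/(S w).
  set D := delta * sqnorm y; move: (\sum_k `|x k 0|) (S w) => x1 s cS nd ndx S0.
  have : n%:R * D * s <= 2^-1 * s by apply: ler_wpM2r.
  have -> : n%:R * ((x1 + s) * D + a + a) = n%:R * D * x1 + n%:R * D * s + 2 * (n%:R * a) by ring.
  lra.
rewrite integral_EFin_sum; [|by move=> j; apply: measurable_funD; exact: mi'|by pos].
rewrite mulr_natl -[X in _ *+ X]card_ord -sumr_const -sumEFin; apply: lee_sum => j _.
rewrite integral_EFinD; [|exact: mi'|exact: mi'|by pos|by pos].
rewrite EFinD; apply: leeD.
  by rewrite integral_indic// setIT; exact: fast_tail.
rewrite integral_indic// setIT.
exact: (slow_noise_tail filF bW1 eps01 sol mq qM (fun u _ => lexx (q u)) T0 GV j a th0).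
Qed.

End deterministic_start.

Section superexponential.
Context {R : realType} {d : measure_display} {Om : measurableType d}.
Variables (P : probability Om R) (F : R -> set (set Om)).
Hypothesis filF : filtration F.
Context {n : nat}.
Variables (W1 W2 : R -> Om -> 'cV[R]_n).
Hypotheses (bW1 : brownian P F W1) (bW2 : brownian P F W2).
Variables (delta : R -> R) (x y : 'cV[R]_n) (X Y : R -> R -> Om -> 'cV[R]_n).
Hypothesis delta01 : forall eps, 0 < eps < 1 -> 0 < delta eps < 1.
Hypothesis delta_o : delta eps / eps @[eps --> 0^'+] --> 0.
Hypothesis sol : forall eps, 0 < eps < 1 ->
  slow_fast_solution P F W1 W2 eps (delta eps) (cst x) (cst y) (X eps) (Y eps).
Variable T : R.
Hypothesis T0 : 0 < T.

Lemma near0_small (B r : R) : 0 <= B -> 0 < r -> \forall eps \near 0^'+, B * eps <= r.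
Proof.
move=> B0 r0; near=> eps.
have e0 : 0 <= eps by near: eps; apply: filterS (nbhs_right_gt 0) => e /ltW.
have : eps <= r / (B + 1).
  by near: eps; apply: nbhs_right_le; rewrite divr_gt0// ltr_wpDl.
by rewrite ler_pdivlMr ?ltr_wpDl// mulrC; nra.
Unshelve. all: by end_near. Qed.

Lemma slow_superexponential (c M : R) : 0 < c -> \forall eps \near 0^'+,
  (P [set w | (c < \sum_j pathmax T (fun t => X eps t w j 0 - X eps 0 w j 0))%R] <=
   (expR (- (M / eps)))%:E)%E.
Proof.
(* The added 1 leaves a factor e^(-1/eps), which absorbs the constant [B] since [B] <= 1/eps <=
   e^(1/eps) for small eps. *)
move=> c0; pose M1 := `|M| + 1; have M10 : 0 < M1 by rewrite ltr_wpDl.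
pose K := @sup_moment_bound R n T (sqnorm y) (sqnorm x).
have y0 : 0 <= sqnorm y by exact: sqnorm_ge0.
have x0 : 0 <= sqnorm x by exact: sqnorm_ge0.
have T0' := ltW T0.
have K0 : 0 <= K by rewrite /K /sup_moment_bound /moment_bound; pos.
pose a := c / (2 + 4 * n%:R); have a0 : 0 < a by rewrite divr_gt0// ltr_pwDl// mulr_ge0.
have ac : 2 * a + 4 * (n%:R * a) <= c.
  have -> : 2 * a + 4 * (n%:R * a) = a * (2 + 4 * n%:R) by ring.
  by rewrite divfK// gt_eqF// ltr_pwDl// mulr_ge0.
pose C2 := 4 * T * K + 2 * sqnorm y; have C20 : 0 <= C2 by rewrite /C2; pos.
(* With theta = L / eps the linear term theta a is M1 / eps, while the variance bound C2 eps^2 keeps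
   the quadratic term below the constant L^2 C2 / 2. *)
pose L := M1 / a; have L0 : 0 <= L by rewrite divr_ge0// ltW.
pose C1 := @fast_tail_cst R n y T a.
have C10 : 0 <= C1.
  rewrite /C1 /fast_tail_cst mulr_ge0 ?expR_ge0// addr_ge0// sumr_ge0// => j _.
  exact: le_trans (ch_ge1 _).
pose B := n%:R * (C1 + 8 * expR (L ^+ 2 * C2 / 2)).
have B0 : 0 <= B by rewrite /B mulr_ge0// addr_ge0// mulr_ge0// expR_ge0.
(* delta / eps <= 1 lets delta be replaced by eps; the second bound makes the exponent T / ((n + 3)
   delta) at least M1 / eps. *)
pose rho := Num.min 1 (T / n.+3%:R / M1).
have rho0 : 0 < rho by rewrite lt_min ltr01/= !divr_gt0.
pose x1 := \sum_k `|x k 0|; have x10 : 0 <= x1 by rewrite /x1; pos.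
near=> eps.
have e0 : 0 < eps by near: eps; exact: nbhs_right_gt.
have e1 : eps < 1 by near: eps; exact: nbhs_right_lt.
have e01 : 0 < eps < 1 by rewrite e0 e1.
have dr : delta eps / eps <= rho.
  near: eps; move/cvgrPdist_le : delta_o => /(_ rho rho0); apply: filterS => e.
  by rewrite sub0r normrN; exact: le_trans (ler_norm _).
have /andP[d0 d1] := delta01 e01.
rewrite ler_pdivrMr// in dr.
have de : delta eps <= eps.
  by apply: le_trans dr _; apply: ler_piMl; [exact: ltW|rewrite ge_min lexx].
have dM : M1 / eps <= T / n.+3%:R / delta eps.
  rewrite ler_pdivlMr// mulrAC ler_pdivrMr//.
  have : delta eps * M1 <= T / n.+3%:R * eps.
    apply: (@le_trans _ _ (rho * eps * M1)); first by rewrite ler_wpM2r// ltW.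
    rewrite mulrAC ler_wpM2r ?(ltW e0)// -ler_pdivlMr// ge_min lexx orbT//.
  by rewrite mulrC.
have h1 : 4 * n%:R * K * eps <= 1 by near: eps; apply: near0_small => //; pos.
have h2 : n%:R * sqnorm y * eps <= 2^-1 by near: eps; apply: near0_small => //; pos.
have h3 : n%:R * sqnorm y * x1 * eps <= a by near: eps; apply: near0_small => //; pos.
have h4 : B * eps <= 1 by near: eps; apply: near0_small => //; pos.
have := slow_tail filF bW1 bW2 e01 (delta01 e01) (sol e01) T0 (theta := L / eps) a0.
move=> /(_ c); rewrite -/K -/x1 -/C1 => H; apply: le_trans (H _ _ _ _ _) _ => //.
- by rewrite divr_ge0// ltW.
- apply: le_trans h1; have : n%:R * K * delta eps <= n%:R * K * eps by apply: ler_wpM2l => //; pos.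
  lra.
- apply: le_trans h2; have : n%:R * sqnorm y * delta eps <= n%:R * sqnorm y * eps by apply: ler_wpM2l => //; pos.
  lra.
- apply: le_trans h3; have : n%:R * sqnorm y * x1 * delta eps <= n%:R * sqnorm y * x1 * eps by apply: ler_wpM2l => //; pos.
  lra.
rewrite lee_fin.
have me : expR (- (M1 / eps)) * B <= expR (- (M / eps)).
  apply: (@le_trans _ _ (expR (- (`|M| / eps)) * (expR (- eps^-1) * B))).
    by rewrite mulrA -expRD /M1 mulrDl mul1r opprD.
  apply: (@le_trans _ _ (expR (- (`|M| / eps)))).
    apply: ler_piMr; first exact: expR_ge0.
    rewrite expRN mulrC ler_pdivrMr ?expR_gt0// mul1r.
    have := expR_ge1Dx eps^-1; move: h4; rewrite -ler_pdivlMr// div1r; lra.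
  by rewrite ler_expR lerN2 ler_pM2r ?invr_gt0// ler_norm.
apply: le_trans me; rewrite /B [expR (- (M1 / eps)) * _]mulrCA ler_wpM2l// [leRHS]mulrDr; apply: lerD.
  by rewrite ler_wpM2r// ler_expR lerN2.
rewrite [leRHS]mulrCA ler_wpM2l// -expRD ler_expR.
have -> : L / eps * a = M1 / eps by rewrite /L; field; rewrite !gt_eqF.
rewrite addrC lerD2l ler_pM2r ?invr_gt0//.
have -> : (L / eps) ^+ 2 = L ^+ 2 / eps ^+ 2 by rewrite expr_div_n.
rewrite -mulrA ler_wpM2l ?sqr_ge0// mulrC ler_pdivrMr ?exprn_gt0//.
have -> : C2 * eps ^+ 2 = eps * (2 * (T * (K * (eps + eps))) + 2 * (eps * sqnorm y)) by rewrite /C2; ring.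
apply: ler_wpM2l; first exact: ltW.
by apply: lerD; repeat (apply: ler_wpM2l => //); [rewrite lerD2l|apply: ler_wpM2r].
Unshelve. all: by end_near. Qed.

End superexponential.

(** * Large deviations *)

Section countable_sets.
Context {d : measure_display} {Om : measurableType d} {C : countType}.
Variable A : C -> set Om.
Hypothesis mA : forall c, measurable (A c).

Lemma measurable_exists_countable : measurable [set w | exists c, A c w].
Proof.
rewrite (_ : [set w | _] = \bigcup_(c in [set: C]) A c); last first.
  by apply/seteqP; split => w; [case=> c h; exists c|case=> c _ h; exists c].
by apply: countable_bigcupT_measurable => //; exact: countableP.
Qed.

End countable_sets.

Lemma measurable_forall_countable {d : measure_display} {Om : measurableType d} {C : countType}
    (A : C -> set Om) : (forall c, measurable (A c)) -> measurable [set w | forall c, A c w].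
Proof.
move=> mA; rewrite (_ : [set w | _] = ~` [set w | exists c, (~` A c) w]); last first.
  apply/seteqP; split => w /= h; first by case=> c; apply.
  by move=> c; apply: contrapT => hc; apply: h; exists c.
by apply: measurableC; apply: measurable_exists_countable => c; exact: measurableC.
Qed.

(** * Balls of the path space *)

Section path_topology.
Import ArrowAsUniformType.
Context {R : realType} {n : nat} {T : R}.
Implicit Types (G : set (path_space n T)) (phi psi : path_space n T).

Definition path_ball phi (r : R) : set (path_space n T) :=
  [set psi | forall t i, `|path_at phi t i 0 - path_at psi t i 0| < r].

Lemma path_open_ball G phi : open G -> G phi -> exists2 r : R, 0 < r & path_ball phi r `<=` G.
Proof.
move=> [B oB <-] /= Bphi.
have : nbhs (phi : arrow_uniform_type (set_type `[0, T]) 'cV[R]_n) B by exact: open_nbhs_nbhs.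
rewrite -nbhs_ballE => -[r /= r0 h]; exists r => // psi hpsi; apply: h => t.
by split => // i j; rewrite ord1; exact: hpsi.
Qed.

Lemma path_nbhs_ball phi (r : R) : 0 < r -> nbhs phi (path_ball phi r).
Proof.
move=> r0.
have h : nbhs (phi : arrow_uniform_type (set_type `[0, T]) 'cV[R]_n) (ball (phi : arrow_uniform_type (set_type `[0, T]) 'cV[R]_n) r) by exact: nbhsx_ballx.
have := @initial_continuous _ _ (id : continuousType (set_type `[0, T]) 'cV[R]_n -> (set_type `[0, T] -> 'cV[R]_n)) phi _ h.
rewrite nbhs_filterE => h'; apply: (@filterS _ (nbhs phi) _ _ _ _ h') => psi /= hpsi t i.
by have [_ /(_ i 0)] := hpsi t.
Qed.

Definition cst_path (x : 'cV[R]_n) : path_space n T :=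
  (cst x : continuousType (set_type `[0, T]) 'cV[R]_n).

Lemma cst_pathE x t : path_at (cst_path x) t = x.
Proof. by []. Qed.

Lemma path_eqP phi psi : (forall t, path_at phi t = path_at psi t) -> phi = psi.
Proof. by move=> h; apply/continuousEP => t; exact: h. Qed.

End path_topology.

(** * Measurability of events on path space *)

Section path_measurability.
Context {R : realType} {n : nat} {T : R} {d : measure_display} {Om : measurableType d}.
Hypothesis T0 : 0 < T.
Variables (X : R -> Om -> 'cV[R]_n) (Z : Om -> path_space n T).
Hypothesis cX : forall w i, continuous (fun t : R => X (Num.max 0 t) w i 0).
Hypothesis mX : forall t i, 0 <= t -> measurable_fun setT (fun w => X t w i 0).
Hypothesis ZE : forall w t, path_at (Z w) t = X (\val t) w.

(* Paths staying, on each cell of a grid, within a small distance of a rational value: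
   countably many such sets, whose preimages are seen to be measurable at rational times,
   generate all open sets by unions. *)
Let box_index := {N : nat & (nat * {ffun 'I_N.+1 * 'I_n -> rat})%type}.

Let box (c : box_index) : set (path_space n T) := [set psi | forall (i : 'I_(tag c).+1) j (t : set_type `[0, T]),
  grid T (tag c) i <= \val t <= grid T (tag c) i.+1 ->
  `|path_at psi t j 0 - ratr ((tagged c).2 (i, j))| <= (tagged c).1.+1%:R^-1].

Lemma continuous_rat_le (p : R -> R) (q r : R) : continuous p ->
  (forall s : rat, `|p (ratr s) - q| <= r) -> forall s, `|p s - q| <= r.
Proof.
move=> cp h s; apply/ler_addgt0Pr => e e0.
have [dl dl0 hdl] := continuous_dist (cp s) e0.
have [u] : exists u : rat, ratr u \in `]s, s + dl[ by apply: rat_in_itvoo; rewrite ltrDl.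
rewrite in_itv/= => /andP[u1 u2].
have us : `|ratr u - s| < dl by rewrite ger0_norm ?subr_ge0 ?(ltW u1)//; lra.
have -> : p s - q = (p (ratr u) - q) - (p (ratr u) - p s) by ring.
by apply: le_trans (ler_normB _ _) _; apply: lerD; [exact: h|exact: hdl].
Qed.

Let grid_in N (i : 'I_N.+1) : 0 <= grid T N i /\ grid T N i <= grid T N i.+1 /\ grid T N i.+1 <= T.
Proof.
split; first by rewrite /grid !mulr_ge0 ?invr_ge0// ltW.
split; first by rewrite /grid ler_pM2r ?invr_gt0// ler_pM2l// ler_nat.
by rewrite /grid ler_pdivrMr// ler_pM2l// ler_nat.
Qed.

(** Clamping time to a cell lets the cell be tested by all real times and hence, by continuity, by
    the rational ones, even if its end points are irrational. *)
Let box_measurable c : measurable [set w | box c (Z w)].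
Proof.
case: c => N [m q]; pose cl (i : 'I_N.+1) (s : R) := Num.max (grid T N i) (Num.min s (grid T N i.+1)).
have cl_in (i : 'I_N.+1) s : grid T N i <= cl i s <= grid T N i.+1.
  have [_ [h _]] := grid_in i.
  by rewrite /cl le_max lexx/= ge_max h ge_min lexx orbT.
have cl0 (i : 'I_N.+1) s : 0 <= cl i s.
  have [h _] := grid_in i; by have /andP[h' _] := cl_in i s; exact: le_trans h'.
have clT (i : 'I_N.+1) s : `[0, T]%classic (cl i s).
  rewrite /= in_itv/= cl0/=; have [_ [_ h]] := grid_in i.
  by have /andP[_ h'] := cl_in i s; exact: le_trans h' h.
rewrite (_ : [set w | _] = [set w | forall z : 'I_N.+1 * 'I_n * rat,
    [set w | `|X (cl z.1.1 (ratr z.2)) w z.1.2 0 - ratr (q z.1)| <= m.+1%:R^-1] w]); last first.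
  apply/seteqP; split => w /=.
    move=> h [[i j] s] /=.
    by have := h i j (exist _ (cl i (ratr s)) (mem_set (clT i _))) (cl_in i _); rewrite ZE.
  move=> h i j t tg; rewrite ZE.
  pose p s := X (Num.max 0 (cl i s)) w j 0.
  have cp : continuous p.
    move=> s; have h1 := continuous_comp (@continuous_minr R (grid T N i.+1) s)
       (@continuous_maxl R (grid T N i) (Num.min s (grid T N i.+1))).
    exact: (continuous_comp h1 (@cX w j (cl i s))).
  have := @continuous_rat_le p (ratr (q (i, j))) m.+1%:R^-1 cp _ (\val t).
  rewrite /p (max_r (cl0 _ _)); have /andP[t1 t2] := tg.
  rewrite /cl (min_l t2) (max_r t1); apply => s.
  by have := h (i, j, s); rewrite /= (max_r (cl0 _ _)).
apply: measurable_forall_countable => -[[i j] s] /=.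
have mc : measurable_fun setT (fun w => `|X (cl i (ratr s)) w j 0 - ratr (q (i, j))|).
  apply: (measurableT_comp (@normr_measurable R setT)).
  by apply: measurable_funB; [exact: mX|exact: measurable_cst].
rewrite [X in measurable X](_ : _ = (fun w => `|X (cl i (ratr s)) w j 0 - ratr (q (i, j))|) @^-1` `]-oo, m.+1%:R^-1]%classic).
  by rewrite -[_ @^-1` _]setTI; exact: mc.
by apply/seteqP; split => w /=; rewrite in_itv.
Qed.

Lemma path_preimage_open (G : set (path_space n T)) : open G -> measurable (Z @^-1` G).
Proof.
move=> oG.
rewrite (_ : Z @^-1` G = [set w | exists c : box_index, [set w | box c `<=` G /\ box c (Z w)] w]); last first.
  apply/seteqP; split => w /=; last by case=> c [sub]; exact: sub.
  (* Given a ball of radius r inside G, the box is built from a grid on whose cells the path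
     oscillates by at most rho / 2 and from rational values within rho / 2; as 2 rho < r, the box
     stays in the ball. *)
  move=> Gw; have [r r0 hr] := path_open_ball oG Gw.
  have r2 : 0 < r / 2 by rewrite divr_gt0.
  have [m hm] : exists m : nat, m.+1%:R^-1 < r / 2.
    by have [m _ hm] := near_infty_natSinv_lt (PosNum r2); exists m; exact: (hm m (leqnn m)).
  pose rho : R := m.+1%:R^-1; have rho0 : 0 < rho by rewrite invr_gt0.
  have rho2 : 0 < rho / 2 by rewrite divr_gt0.
  have : \forall N \near \oo, forall j : 'I_n, forall s u : R, 0 <= s <= T -> `|u - s| <= T / N.+1%:R ->
     `|X (Num.max 0 u) w j 0 - X (Num.max 0 s) w j 0| <= rho / 2.
    apply: filter_forall => j; have [dl dl0 hdl] := heine 0 T (@cX w j) rho2.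
    have dT : 0 < dl / T by rewrite divr_gt0.
    apply: filterS (near_infty_natSinv_lt (PosNum dT)) => N /ltW /= hN s u sT us.
    by apply: hdl => //; apply: le_trans us _; move: hN; rewrite ler_pdivlMr// mulrC.
  case=> N _ /(_ N (leqnn N)) hN.
  have /choice[q hq] : forall z : 'I_N.+1 * 'I_n, exists q : rat, `|X (grid T N z.1) w z.2 0 - ratr q| <= rho / 2.
    move=> z; set x := X _ _ _ _.
    have [q] : exists q : rat, ratr q \in `]x - rho / 2, x + rho / 2[ by apply: rat_in_itvoo; lra.
    rewrite in_itv/= => /andP[q1 q2]; exists q; rewrite ler_norml; lra.
  exists (existT _ N (m, [ffun z => q z])); have bw : box (existT _ N (m, [ffun z => q z])) (Z w).
    move=> i j t /= /andP[t1 t2]; rewrite ZE ffunE.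
    have [g0 [gg gT]] := grid_in i.
    have t0 : 0 <= \val t := le_trans g0 t1.
    have tT : \val t <= T := le_trans t2 gT.
    have := hN j (grid T N i) (\val t); rewrite g0 (le_trans gg gT) => /(_ isT).
    rewrite ger0_norm ?subr_ge0// (max_r t0) (max_r g0).
    have gd : grid T N i.+1 - grid T N i = T / N.+1%:R.
      by rewrite /grid -mulrBl -mulrBr -natrB// subSnn mulr1.
    rewrite -gd lerD2r => /(_ t2) h1; have := hq (i, j) => /= h2.
    have -> : X (\val t) w j 0 - ratr (q (i, j)) =
      (X (\val t) w j 0 - X (grid T N i) w j 0) + (X (grid T N i) w j 0 - ratr (q (i, j))) by ring.
    by apply: le_trans (ler_normD _ _) _; rewrite -/rho; lra.
  split => // psi bpsi; apply: hr => t j.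
  have /andP[t0 tT] : 0 <= \val t <= T by have := set_valP t; rewrite /= in_itv.
  have [i hi] : exists i : 'I_N.+1, grid T N i <= \val t <= grid T N i.+1.
    have N0 : 0 < N.+1%:R :> R by [].
    have x0 : 0 <= N.+1%:R * \val t / T by rewrite divr_ge0 ?mulr_ge0// ltW.
    have ge k : (grid T N k <= \val t) = (k%:R <= N.+1%:R * \val t / T).
      by rewrite /grid ler_pdivrMr// ler_pdivlMr// mulrC [X in _ = (_ <= X)]mulrC.
    have le k : (\val t <= grid T N k) = (N.+1%:R * \val t / T <= k%:R).
      by rewrite /grid ler_pdivlMr// ler_pdivrMr// [X in X = _]/= [\val t * _]mulrC [T * _]mulrC.
    have [k kN h] : exists2 k : nat, (k <= N)%N & k%:R <= N.+1%:R * \val t / T <= k.+1%:R.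
      pose k := `|Num.floor (N.+1%:R * \val t / T)|%N.
      have kE : k%:R = (Num.floor (N.+1%:R * \val t / T))%:~R :> R.
        by rewrite /k natr_absz ger0_norm// floor_ge0.
      have k1 : k%:R <= N.+1%:R * \val t / T by rewrite kE; exact: floor_le.
      have k2 : N.+1%:R * \val t / T < k%:R + 1.
        by rewrite kE -[1]/(1%:~R) -intrD; exact: floorD1_gt.
      have xN : N.+1%:R * \val t / T <= N.+1%:R by rewrite ler_pdivrMr// ler_wpM2l.
      (* At t = T the floor is N + 1; the last cell, closed on the right, takes its place. *)
      have [kN|Nk] := leqP k N; first by exists k => //; rewrite k1/= -[k.+1%:R]natr1; exact: ltW k2.
      exists N => //; rewrite xN andbT; apply: le_trans k1; rewrite ler_nat; exact: ltnW.
    exists (Ordinal (kN : (k < N.+1)%N)); by rewrite ge le.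
  have h1 := bw i j t hi; have h2 := bpsi i j t hi; move: h1 h2 => /=.
  set a := path_at (Z w) t j 0; set b := path_at psi t j 0; set e := ratr _ => h1 h2.
  have -> : a - b = (a - e) - (b - e) by ring.
  apply: le_lt_trans (ler_normB _ _) _; apply: (le_lt_trans (lerD h1 h2)).
  by rewrite [ltRHS]splitr; exact: ltrD.
apply: measurable_exists_countable => c.
have [sub|nsub] := pselect (box c `<=` G).
  rewrite (_ : [set w | _] = [set w | box c (Z w)]); first exact: box_measurable.
  by apply/seteqP; split => w /=; [case|].
rewrite (_ : [set w | _] = set0); first exact: measurable0.
by apply/seteqP; split => w //= [].
Qed.

Lemma path_preimage_closed (K : set (path_space n T)) : closed K -> measurable (Z @^-1` K).
Proof.
move=> cK; rewrite -[K]setCK -[X in measurable X]setCK.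
by apply: measurableC; rewrite preimage_setC setCK; apply: path_preimage_open; exact: closed_openC.
Qed.

End path_measurability.

(** * The large deviation bounds *)

Section large_deviations.
Context {R : realType} {d : measure_display} {Om : measurableType d}.
Variables (P : probability Om R) (F : R -> set (set Om)).
Hypothesis filF : filtration F.
Context {n : nat}.
Variables (W1 W2 : R -> Om -> 'cV[R]_n).
Hypotheses (bW1 : brownian P F W1) (bW2 : brownian P F W2).
Variables (delta : R -> R) (x y : 'cV[R]_n) (X Y : R -> R -> Om -> 'cV[R]_n).
Hypothesis delta01 : forall eps, 0 < eps < 1 -> 0 < delta eps < 1.
Hypothesis delta_o : delta eps / eps @[eps --> 0^'+] --> 0.
Hypothesis sol : forall eps, 0 < eps < 1 ->
  slow_fast_solution P F W1 W2 eps (delta eps) (cst x) (cst y) (X eps) (Y eps).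
Variable T : R.
Hypothesis T0 : 0 < T.
Variable Z : R -> Om -> path_space n T.
Hypothesis ZE : forall eps w t, 0 < eps < 1 -> path_at (Z eps w) t = X eps (\val t) w.

Lemma probability_ae_le (A B : set Om) : measurable A -> measurable B ->
  {ae P, forall w, A w -> B w} -> (P A <= P B)%E.
Proof.
move=> mA mB h; rewrite -[A]setIT -[B]setIT -!integral_indic//.
apply: integral_EFin_ae_le.
- exact: measurable_indic.
- exact: measurable_indic.
- by pos.
- by pos.
- apply: filterS h => w hw; rewrite !indicE; case: (boolP (w \in A)) => //; rewrite inE => /hw hB.
  by rewrite mem_set.
Qed.

Lemma limf_esup_le (f : R -> \bar R) (l : \bar R) :
  (\forall e \near 0^'+, (f e <= l)%E) -> (limf_esup f 0^'+ <= l)%E.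
Proof.
move=> h; rewrite limf_esupE; apply: (@le_trans _ _ (ereal_sup (f @` [set e | (f e <= l)%E]))).
  by apply: ereal_inf_lbound; exists [set e | (f e <= l)%E].
by apply: ge_ereal_sup => _ [e /= he <-].
Qed.

Lemma limf_einf_ge (f : R -> \bar R) (l : \bar R) :
  (\forall e \near 0^'+, (l <= f e)%E) -> (l <= limf_einf f 0^'+)%E.
Proof.
move=> h; rewrite limf_einfE; apply: (@le_trans _ _ (ereal_inf (f @` [set e | (l <= f e)%E]))).
  by apply: le_ereal_inf_tmp => _ [e /= he <-].
by apply: ereal_sup_ubound; exists [set e | (l <= f e)%E].
Qed.

Let near01 : \forall eps \near (0 : R)^'+, 0 < eps < 1.
Proof.
near=> eps; apply/andP; split; first by near: eps; exact: nbhs_right_gt.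
by near: eps; exact: nbhs_right_lt.
Unshelve. all: by end_near. Qed.

Let cX eps : 0 < eps < 1 -> continuous_paths (X eps).
Proof. by move=> /sol [_ _ [_ h _ _] _]. Qed.

Let mX eps t i : 0 < eps < 1 -> 0 <= t -> measurable_fun setT (fun w => X eps t w i 0).
Proof.
move=> /sol [_ _ [h _ _ _] _] t0.
by apply: measurable_vector_coord; exact: (adapted_measurable filF h).
Qed.

Lemma path_closed_measurable eps (K : set (path_space n T)) : 0 < eps < 1 -> closed K ->
  measurable (Z eps @^-1` K).
Proof.
move=> e01; apply: (path_preimage_closed T0 (X := X eps)).
- by move=> w i; apply: continuous_paths_coord; exact: cX.
- by move=> t i t0; exact: mX.
- by move=> w t; exact: ZE.
Qed.

(** Leaving the ball yields a deviation of at least r, whereas the tail event asks for a strict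
    excess; hence the level r / 2. *)
Lemma path_escape (K : set (path_space n T)) (r M : R) : closed K -> 0 < r ->
  (forall psi, path_ball (cst_path x) r psi -> ~ K psi) ->
  \forall eps \near 0^'+, (P (Z eps @^-1` K) <= (expR (- (M / eps)))%:E)%E.
Proof.
move=> cK r0 hK; have r2 : 0 < r / 2 by rewrite divr_gt0.
have := slow_superexponential filF bW1 bW2 delta01 delta_o sol T0 M r2.
apply: filterS2 near01 => eps e01; apply: le_trans.
have incr w i : continuous (fun t : R => X eps (Num.max 0 t) w i 0 - X eps 0 w i 0).
  by move=> t; apply: cvgB; [apply: continuous_paths_coord; exact: cX|exact: cvg_cst].
pose S w := \sum_j pathmax T (fun t => X eps t w j 0 - X eps 0 w j 0).
have mS : measurable_fun setT S.
  apply: measurable_sum => j.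
  apply: (@measurable_pathmax R _ _ (fun t w => X eps t w j 0 - X eps 0 w j 0)) => //.
  by move=> t t0; apply: measurable_funB; exact: mX.
have [_ [X0 _] _ _] := sol e01.
apply: probability_ae_le; first exact: path_closed_measurable.
  rewrite (_ : [set w | _] = S @^-1` `]r / 2, +oo[%classic).
    by rewrite -[_ @^-1` _]setTI; exact: mS.
  by apply/seteqP; split => w /=; rewrite in_itv/= andbT.
apply: filterS X0 => w Xw /= Kw.
have [[t [i hti]]|hn] := pselect (exists (t : set_type `[0, T]) (i : 'I_n), r <= `|x i 0 - X eps (\val t) w i 0|); last first.
  exfalso; apply: (hK _ _ Kw) => t i; rewrite cst_pathE ZE// ltNge; apply/negP => h.
  by apply: hn; exists t, i.
have tT : 0 <= \val t <= T by have := set_valP t; rewrite /= in_itv.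
have p0 j : 0 <= pathmax T (fun t => X eps t w j 0 - X eps 0 w j 0).
  by apply: (@pathmax_ge0 R T (fun t => X eps t w j 0 - X eps 0 w j 0)); [exact: incr|exact: ltW].
apply: (@lt_le_trans _ _ r); first by rewrite ltr_pdivrMr// ltr_pMr// ltr1n.
apply: le_trans hti _; rewrite distrC -[x]Xw (bigD1 i)//=; apply: ler_wpDr.
  by apply: sumr_ge0.
by apply: (@pathmax_ge R T (fun t => X eps t w i 0 - X eps 0 w i 0)); [exact: incr|].
Qed.

Let rate (psi : path_space n T) : \bar R := if `[< psi = cst_path x >] then 0%E else +oo%E.

Let rate_cst : rate (cst_path x) = 0%E.
Proof. by rewrite /rate asboolT. Qed.

Let rate_ge0 psi : (0 <= rate psi)%E.
Proof. by rewrite /rate; case: ifP => _; rewrite ?leey. Qed.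

Let rate_inf0 (G : set (path_space n T)) : G (cst_path x) -> ereal_inf (rate @` G) = 0%E.
Proof.
move=> Gx; apply/eqP; rewrite eq_le; apply/andP; split.
  by rewrite -rate_cst; apply: ereal_inf_lbound; exists (cst_path x).
by apply: le_ereal_inf_tmp => _ [psi _ <-].
Qed.

Let rate_infy (G : set (path_space n T)) : ~ G (cst_path x) -> ereal_inf (rate @` G) = +oo%E.
Proof.
move=> nG; apply/eqP; rewrite -leye_eq; apply: le_ereal_inf_tmp => _ [psi Gpsi <-].
by rewrite /rate asboolF// => e; apply: nG; rewrite -e.
Qed.

Let rate_lsc : lower_semicontinuous rate.
Proof.
move=> psi a; have [->|ne] := pselect (psi = cst_path x).
  rewrite rate_cst => a0; exists setT; first exact: filterT.
  by move=> phi _; apply: lt_le_trans a0 _.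
move=> _; have [t [i hti]] : exists t i, 0 < `|path_at psi t i 0 - x i 0|.
  apply: contrapT => h; apply: ne; apply: path_eqP => t; rewrite cst_pathE; apply/matrixP => i j.
  rewrite ord1; apply/eqP; rewrite -subr_eq0 -normr_le0 leNgt; apply/negP => hl.
  by apply: h; exists t, i.
exists (path_ball psi `|path_at psi t i 0 - x i 0|); first exact: path_nbhs_ball.
move=> phi /(_ t i) hphi; rewrite /rate asboolF ?ltry// => e.
by move: hphi; rewrite e cst_pathE ltxx.
Qed.

Lemma slow_LDP : LDP P Z.
Proof.
exists rate; split => //.
(* If G misses the constant path, the infimum is +oo and the bound is trivial. Otherwise G has
   probability at least 1/2 for small eps, so eps ln P is at least -eps ln 2, which tends to 0. *)
- move=> G oG; have [Gx|nGx] := pselect (G (cst_path x)); last by rewrite rate_infy// leNye.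
  rewrite rate_inf0// oppe0; apply/lee_addgt0Pr => eta eta0; rewrite -leeBlDr// sub0e -EFinN.
  apply: limf_einf_ge.
  have [r r0 hr] := path_open_ball oG Gx.
  have cG : closed (~` G) by exact: open_closedC.
  have esc := @path_escape (~` G) r 1 cG r0 (fun psi h => fun nG => nG (hr psi h)).
  have ln2 : 0 <= - ln (2^-1 : R) by rewrite lnV ?posrE// opprK ln_ge0// ler1n.
  have sm := @near0_small R (- ln 2^-1) eta ln2 eta0.
  have sm2 := @near0_small R 1 2^-1 ler01 (_ : 0 < 2^-1).
  have {}sm2 := sm2 ltac:(by []).
  near=> e.
  have e01 : 0 < e < 1 by near: e; exact: near01.
  have /andP[e0 e1] := e01.
  have h1 : (P (Z e @^-1` ~` G) <= (expR (- (1 / e)))%:E)%E by near: e; exact: esc.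
  have h2 : - ln 2^-1 * e <= eta by near: e; exact: sm.
  have h3 : 1 * e <= 2^-1 by near: e; exact: sm2.
  have mC := path_closed_measurable e01 cG.
  have PG : P (Z e @^-1` G) = (1 - P (Z e @^-1` ~` G))%E.
    by rewrite -probability_setC// -preimage_setC setCK.
  have fin := fin_num_measure P _ mC.
  rewrite PG; move: h1; rewrite -(fineK fin); move: (fine _) => p.
  rewrite lee_fin -EFinB => h1.
  have hp : p <= 2^-1.
    apply: le_trans h1 _; apply: le_trans h3; rewrite !mul1r expRN.
    rewrite -[leRHS]invrK lef_pV2 ?posrE ?expR_gt0 ?invr_gt0//.
    by have := expR_ge1Dx e^-1; lra.
  have p1 : 0 < 1 - p by lra.
  rewrite lne_EFin// -EFinM lee_fin.
  have : ln 2^-1 <= ln (1 - p) by rewrite ler_ln ?posrE//; lra.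
  move=> hl; apply: (@le_trans _ _ (e * ln 2^-1)); first lra.
  by rewrite ler_wpM2l// ltW.
- move=> K cK; have [Kx|nKx] := pselect (K (cst_path x)).
    rewrite rate_inf0// oppe0; apply: limf_esup_le; apply: filterS near01 => e e01.
    have /andP[e0 _] := e01; apply: mule_ge0_le0; first by rewrite lee_fin ltW.
    by rewrite lne_le0; apply: probability_le1; exact: path_closed_measurable.
  rewrite rate_infy//=.
  (* The superexponential bound holds for every M, which forces the upper limit to be -oo.
     Probability 0 is a separate case, [lne] being -oo there. *)
  have bnd (M : R) : (limf_esup (fun e : R => e%:E * lne (P (Z e @^-1` K))) 0^'+ <= (- M)%:E)%E.
    apply: limf_esup_le.
    have [r r0 hr] := path_open_ball (closed_openC cK) nKx.
    have esc := @path_escape K r M cK r0 hr.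
    apply: filterS2 near01 esc => e e01; have /andP[e0 _] := e01.
    have fin := fin_num_measure P _ (path_closed_measurable e01 cK).
    have P0 : (0 <= P (Z e @^-1` K))%E by exact: measure_ge0.
    move: P0 fin; case: (P (Z e @^-1` K)) => // p + _.
    rewrite !lee_fin le_eqVlt => /predU1P[<- _|p0 hp].
      by rewrite le0_lneNy// gt0_muleNy ?leNye// lte_fin.
    rewrite lne_EFin// -EFinM lee_fin.
    have : ln p <= - (M / e) by rewrite -ler_expR lnK ?posrE.
    move=> hl; apply: (@le_trans _ _ (e * - (M / e))); first by rewrite ler_wpM2l// ltW.
    by rewrite mulrN mulrCA divff ?mulr1// gt_eqF.
  case: (limf_esup _ _) bnd => [l| |] // bnd; last by have := bnd 0; rewrite leye_eq.
  exfalso; have := bnd (1 - l); rewrite lee_fin; lra.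
Unshelve. all: by end_near. Qed.

End large_deviations.

(** * Strong convergence *)

Section strong_convergence.
Context {R : realType} {d : measure_display} {Om : measurableType d}.
Variables (P : probability Om R) (F : R -> set (set Om)).
Context {n : nat}.

(** Reduces to s^2 <= 1 + s^p for s >= 0, by comparing s with 1. *)
Lemma Lp_vector_sqnorm (p : R) (xi : Om -> 'cV[R]_n) : 2 <= p ->
  measurable_fun [set: Om] (xi : Om -> Rn R n) -> Lp_vector P p xi ->
  (\int[P]_w (sqnorm (xi w))%:E < +oo)%E.
Proof.
move=> p2 mxi; rewrite /Lp_vector => Lp.
have ms : measurable_fun setT (fun w => sqnorm (xi w)).
  exact: (measurableT_comp (@measurable_sqnorm_Rn R n) mxi).
have mp : measurable_fun setT (fun w => Num.sqrt (sqnorm (xi w)) `^ p).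
  apply: (measurableT_comp (@measurable_powR R p)).
  exact: (measurableT_comp (continuous_measurable_fun (@sqrt_continuous R)) ms).
apply: (@le_lt_trans _ _ (\int[P]_w (1 + Num.sqrt (sqnorm (xi w)) `^ p)%:E)%E).
  apply: integral_EFin_le => //.
  - by apply: measurable_funD => //; exact: measurable_cst.
  - by move=> w; exact: sqnorm_ge0.
  move=> w; have s0 : 0 <= Num.sqrt (sqnorm (xi w)) := sqrtr_ge0 _.
  rewrite -[leLHS](sqr_sqrtr (sqnorm_ge0 _)); move: (Num.sqrt _) s0 => s s0.
  have [s1|/ltW s1] := lerP s 1.
    by apply: ler_wpDr; [exact: powR_ge0|rewrite expr_le1].
  by apply: ler_wpDl => //; rewrite -powR_mulrn//; exact: ler_powR.
rewrite integral_EFinD; [|exact: measurable_cst|exact: mp|by []|by move=> w; exact: powR_ge0].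
by rewrite integral_cst//= probability_setT mul1e lte_add_pinfty// ltry.
Qed.

Hypothesis filF : filtration F.
Variables (W1 W2 : R -> Om -> 'cV[R]_n).
Hypotheses (bW1 : brownian P F W1) (bW2 : brownian P F W2).
Variables (eps delta : R) (xi zeta : Om -> 'cV[R]_n) (X Y : R -> Om -> 'cV[R]_n).
Hypotheses (eps01 : 0 < eps < 1) (delta01 : 0 < delta < 1).
Hypotheses (mxi : mx_measurable (F 0) xi) (mzeta : mx_measurable (F 0) zeta).
Hypothesis sol : slow_fast_solution P F W1 W2 eps delta xi zeta X Y.
Variable T : R.
Hypothesis T0 : 0 < T.

(** Replaces a supremum over uncountably many times by [pathmax], which is a limit of grid maxima
    and so measurable in the sample point. *)
Lemma ereal_sup_pathmax (g : R -> R) : continuous (fun t : R => g (Num.max 0 t)) ->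
  (forall t, 0 <= g t) -> ereal_sup [set (g t)%:E | t in `[0, T]] = (pathmax T g)%:E.
Proof.
move=> cg g0; have T0' := ltW T0; apply/eqP; rewrite eq_le.
have le : (ereal_sup [set (g t)%:E | t in `[0%R, T]] <= (pathmax T g)%:E)%E.
  apply: ge_ereal_sup => _ [t /=+ <-]; rewrite in_itv/= => tT.
  by rewrite lee_fin -[g t]ger0_norm//; exact: pathmax_ge.
rewrite le/=.
have : forall t, 0 <= t <= T -> ((g t)%:E <= ereal_sup [set (g t)%:E | t in `[0%R, T]])%E.
  by move=> t tT; apply: ereal_sup_ubound; exists t => //=; rewrite in_itv.
case: (ereal_sup _) le => [s _ h|_ _|_ h]; last 2 first.
- exact: leey.
- by have := h 0; rewrite lexx T0' => /(_ isT); rewrite leeNy_eq.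
rewrite lee_fin; apply: pathmax_le => // t tT; rewrite ger0_norm// -lee_fin; exact: h.
Qed.

Let mX t : 0 <= t -> measurable_fun [set: Om] (X t : Om -> Rn R n).
Proof. by case: sol => _ _ [aX _ _ _] _; exact: (adapted_measurable filF aX). Qed.
Let mxi' : measurable_fun [set: Om] (xi : Om -> Rn R n).
Proof. exact: (adapted_measurable filF (adapted_cst filF mxi) (lexx 0)). Qed.
Let mzeta' : measurable_fun [set: Om] (zeta : Om -> Rn R n).
Proof. exact: (adapted_measurable filF (adapted_cst filF mzeta) (lexx 0)). Qed.

Lemma slow_strong_error :
  (\int[P]_w ereal_sup [set (sqnorm (X t w - xi w)%R)%:E | t in `[0%R, T]] <=
   (@sup_moment_bound R n T (\int[P]_w sqnorm (zeta w))%R (\int[P]_w sqnorm (xi w))%R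
      * (eps + delta `^ 3^-1))%:E)%E.
Proof.
have [_ [X0 Y0] [aX cX _ _] [aY _ _ _]] := sol.
have T0' := ltW T0; have /andP[d0 d1] := delta01.
have cXi w i := @continuous_paths_coord _ _ _ _ _ w i cX.
have sE (v : 'cV[R]_n) : sqnorm v = \sum_j v j 0 ^+ 2.
  by apply: eq_bigr => i _; rewrite big_ord1.
have csq w : continuous (fun t : R => sqnorm (X (Num.max 0 t) w - xi w)).
  rewrite (_ : (fun t : R => _) = (fun t : R => \sum_j (X (Num.max 0 t) w j 0 - xi w j 0) ^+ 2)).
    move=> t; apply: cvg_sumr => j.
    have h : (X (Num.max 0 u) w j 0 - xi w j 0) @[u --> t] --> X (Num.max 0 t) w j 0 - xi w j 0.
      by apply: cvgB; [exact: cXi|exact: cvg_cst].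
    by rewrite expr2; under eq_fun do rewrite expr2; exact: cvgM.
  by apply/funext => t; rewrite sE; apply: eq_bigr => j _; rewrite !mxE.
under eq_integral do rewrite (ereal_sup_pathmax (csq _) (fun t => sqnorm_ge0 _)).
have mpm j : measurable_fun setT (fun w => pathmax T (fun t => X t w j 0 - X 0 w j 0)).
  apply: (@measurable_pathmax R _ _ (fun t w => X t w j 0 - X 0 w j 0)) => //.
    by move=> w t; apply: cvgB; [exact: cXi|exact: cvg_cst].
  by move=> t t0; apply: measurable_funB; apply: measurable_vector_coord; exact: mX.
have cinc w j : continuous (fun t : R => X (Num.max 0 t) w j 0 - X 0 w j 0).
  by move=> t; apply: cvgB; [exact: cXi|exact: cvg_cst].
have K0 : 0 <= @sup_moment_bound R n T (\int[P]_w sqnorm (zeta w)) (\int[P]_w sqnorm (xi w)).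
  have m0 (v : Om -> 'cV[R]_n) : 0 <= \int[P]_w sqnorm (v w).
    by apply: Rintegral_ge0 => w _; exact: sqnorm_ge0.
  have mb0 : 0 <= @moment_bound R n T (\int[P]_w sqnorm (zeta w)) (\int[P]_w sqnorm (xi w)).
    by have := m0 zeta; have := m0 xi; rewrite /moment_bound => x0 z0; pos.
  by rewrite /sup_moment_bound; have z0 := m0 zeta; pos.
apply: (@le_trans _ _ (\int[P]_w (\sum_j pathmax T (fun t => (X t w j 0 - X 0 w j 0)%R) ^+ 2)%:E)%E).
  apply: integral_EFin_ae_le.
  - apply: (@measurable_pathmax R _ _ (fun t w => sqnorm (X t w - xi w))) => //.
    move=> t t0; apply: measurable_sqnorm => i j; rewrite ord1; under eq_fun do rewrite !mxE.
    by apply: measurable_funB; apply: measurable_vector_coord => //; exact: mX.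
  - by apply: measurable_sum => j; apply: measurable_funX; exact: mpm.
  - by move=> w; apply: (@pathmax_ge0 R T (fun t => sqnorm (X t w - xi w))).
  - by pos.
  - apply: filterS X0 => w Xw; apply: pathmax_le => // t tT.
    rewrite ger0_norm ?sqnorm_ge0// sE; apply: ler_sum => j _; rewrite !mxE -Xw.
    rewrite -[leLHS]real_normK ?num_real// ler_sqr ?nnegrE//.
      exact: (@pathmax_ge R T (fun t => X t w j 0 - X 0 w j 0)).
    exact: (@pathmax_ge0 R T (fun t => X t w j 0 - X 0 w j 0)).
apply: le_trans (slow_sup_moment filF bW1 bW2 eps01 delta01 sol T0) _.
rewrite (second_moment_ae (mX (lexx 0)) mxi' X0).
rewrite (second_moment_ae (adapted_measurable filF aY (lexx 0)) mzeta' Y0).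
rewrite lee_fin ler_wpM2l// lerD2l -[leLHS]powRr1 ?(ltW d0)//.
by apply: ger_powR; rewrite ?d0 ?(ltW d1)// invf_le1// ler1n.
Qed.

End strong_convergence.

Theorem theorem3p3 (R : realType) (n : nat) :
  exists2 kappa : R, 2 <= kappa &
  forall (d : measure_display) (Om : measurableType d) (P : probability Om R)
    (F : R -> set (set Om)) (W1 W2 : R -> Om -> 'cV[R]_n),
  filtration F -> brownian P F W1 -> brownian P F W2 ->
  independent_processes P W1 W2 ->
  (forall (xi zeta : Om -> 'cV[R]_n) (p : R),
     kappa < p ->
     mx_measurable (F 0) xi -> mx_measurable (F 0) zeta ->
     Lp_vector P p xi -> Lp_vector P p zeta ->
     exists Xbar : R -> Om -> 'cV[R]_n,
       [/\ averaged_solution P F xi Xbar,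
           forall X' : R -> Om -> 'cV[R]_n, averaged_solution P F xi X' ->
             {ae P, forall w, forall t, 0 <= t -> X' t w = Xbar t w}
         & forall T : R, 0 < T ->
           exists C : R, forall eps delta : R,
             0 < eps < 1 -> 0 < delta < 1 ->
             forall X Y : R -> Om -> 'cV[R]_n,
             slow_fast_solution P F W1 W2 eps delta xi zeta X Y ->
             (\int[P]_w ereal_sup
                [set (sqnorm (X t w - Xbar t w)%R)%:E | t in `[0%R, T]]
              <= (C * (eps + delta `^ (3%:R^-1)))%:E)%E]) /\
  (forall delta : R -> R,
     (forall eps, 0 < eps < 1 -> 0 < delta eps < 1) ->
     delta eps / eps @[eps --> 0^'+] --> 0 ->
     forall (x y : 'cV[R]_n) (X Y : R -> R -> Om -> 'cV[R]_n),
     (forall eps, 0 < eps < 1 ->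
        slow_fast_solution P F W1 W2 eps (delta eps) (cst x) (cst y)
          (X eps) (Y eps)) ->
     forall T : R, 0 < T ->
     forall Xpath : R -> Om -> path_space n T,
       (forall eps w t, 0 < eps < 1 ->
          path_at (Xpath eps w) t = X eps (\val t) w) ->
       LDP P Xpath).
Proof.
exists 2 => // d Om P F W1 W2 filF bW1 bW2 _; split.
  move=> xi zeta p p2 mxi mzeta Lxi _; exists (fun=> xi); split.
  - apply: (averaged_cst filF bW1 mxi); apply: (Lp_vector_sqnorm (ltW p2) _ Lxi).
    by exact: (adapted_measurable filF (adapted_cst filF mxi) (lexx 0)).
  - by move=> X'; exact: (averaged_unique filF bW1).
  - move=> T T0; exists (@sup_moment_bound R n T (\int[P]_w sqnorm (zeta w)) (\int[P]_w sqnorm (xi w))).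
    by move=> eps delta e01 d01 X Y sol; exact: (slow_strong_error filF bW1 bW2 e01 d01 mxi mzeta sol T0).
move=> delta d01 dlo x y X Y sol T T0 Z ZE.
exact: (slow_LDP filF bW1 bW2 d01 dlo sol T0 ZE).
Qed.
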